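(* Let $(\mathcal{P},\mathcal{N})$ be a Beurling generalized number system whose integer-counting function satisfies $N_{\mathcal{P}}(x)=Ax+O(x^{1/2})$ for some constant $A>0$. Then $\mathrm{LH}(\mathcal{P},\mathrm{Li}(x))$ holds if and only if the Riemann hypothesis holds for $(\mathcal{P},\mathcal{N})$.
   Context: A Beurling generalized number system $(\mathcal{P},\mathcal{N})$ consists of a sequence of generalized primes $\mathcal{P}=(p_j)_{j\ge1}$ of real numbers with $1<p_1\le p_2\le\cdots$, $p_j\to\infty$ (repetitions allowed), and the sequence $\mathcal{N}=(n_j)_{j\ge1}$ of generalized integers consisting of $1$ and all finite products of generalized primes (counted with multiplicity according to the distinct representations as products $p_{j_1}\cdots p_{j_k}$ with $j_1\le\dots\le j_k$), arranged in non-decreasing order. $N_{\mathcal{P}}(x)=\#\{j:n_j\le x\}$, and $\psi_{\mathcal{P}}(x)=\sum_{p_j^{\nu}\le x,\ \nu\ge1}\log p_j$ is the Chebyshev function. The Riemann hypothesis for $(\mathcal{P},\mathcal{N})$ means $\psi_{\mathcal{P}}(x)=x+O_\varepsilon(x^{1/2+\varepsilon})$ for every $\varepsilon>0$. $\mathrm{Li}(x)=\int_1^x\frac{1-u^{-1}}{\log u}\,\mathrm{d}u$. For a sequence $\mathcal{S}=(s_j)_{j\ge1}$ of positive reals and a differentiable $M$, $\mathrm{LH}(\mathcal{S},M(x))$ means: for every $\varepsilon>0$ and $B>0$, $$\sum_{s_j\le x}s_j^{-\mathrm{i} t}=\int_{s_1}^x u^{-\mathrm{i} t}M'(u)\,\mathrm{d}u+O_{\varepsilon,B}\bigl(M(x)^{1/2}|t|^{\varepsilon}\bigr)$$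 uniformly for real $t$ and $s_1\le x\le |t|^B$ (sums counting repeated values with multiplicity). *)

(* Defs.v *)
From Stdlib Require Import Reals List Sorted.
From Coquelicot Require Import Coquelicot.
Open Scope R_scope.

(** Stdlib reals with Coquelicot; sequences are indexed from [0], so the
    mathematical [p_1] is [gprime P 0]. *)

Definition index_prod (p : nat -> R) (l : list nat) : R :=
  fold_right (fun j r => p j * r) 1 l.

(** A representation [p_{j_1} ... p_{j_k}] with [j_1 <= ... <= j_k] is a sorted
    list of indices; the empty list represents the generalized integer [1].
    [gint_enum] says that [gint] lists the values of all representations, each
    representation being used exactly once. *)
Record beurling_system := {
  gprime : nat -> R;
  gprime_gt1 : 1 < gprime 0;
  gprime_nondecr : forall j : nat, gprime j <= gprime (S j);
  gprime_infty : is_lim_seq gprime p_infty;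
  gint : nat -> R;
  gint_nondecr : forall j : nat, gint j <= gint (S j);
  gint_enum : exists rep : nat -> list nat,
    (forall j : nat, Sorted le (rep j)) /\
    (forall i j : nat, rep i = rep j -> i = j) /\
    (forall l : list nat, Sorted le l -> exists j : nat, rep j = l) /\
    (forall j : nat, gint j = index_prod gprime (rep j))
}.

(** The sum of [c j] over the [j] with [s j <= x].  For sequences [s] tending to
    infinity only finitely many terms of the series are nonzero. *)
Definition sum_le (s : nat -> R) (c : nat -> R) (x : R) : R :=
  Series (fun j => if Rle_dec (s j) x then c j else 0).

Definition Csum_le (s : nat -> R) (c : nat -> C) (x : R) : C :=
  (sum_le s (fun j => Re (c j)) x, sum_le s (fun j => Im (c j)) x).

Definition N_count (P : beurling_system) (x : R) : R :=
  sum_le (gint P) (fun _ => 1) x.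

(** The inner sum runs over the exponents [nu = k + 1 >= 1]; it vanishes as soon
    as [gprime P j > x], so the outer series is a finite sum as well. *)
Definition psi (P : beurling_system) (x : R) : R :=
  Series (fun j =>
    sum_le (fun k => gprime P j ^ S k) (fun _ => ln (gprime P j)) x).

(** [f(x) = O(g(x))] as [x -> +oo]. *)
Definition bigO_infty (f g : R -> R) : Prop :=
  exists K : R,
    Rbar_locally p_infty (fun x => Rabs (f x) <= K * Rabs (g x)).

Definition riemann_hypothesis (P : beurling_system) : Prop :=
  forall eps : R, 0 < eps ->
    bigO_infty (fun x => psi P x - x) (fun x => Rpower x (1 / 2 + eps)).

(** The integrand has a removable singularity at [u = 1], where its value does
    not affect the integral. *)
Definition Li (x : R) : R := RInt (fun u => (1 - / u) / ln u) 1 x.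

(** [u^(-it)] for [u > 0]. *)
Definition pow_mit (u t : R) : C := (cos (t * ln u), - sin (t * ln u)).

(** [LH(s, M(x))].  No [x] satisfies [0 < s_1 <= x <= |0|^B], so the value [t = 0]
    is excluded; this is made explicit because [Rpower 0 B] is [1]. *)
Definition LH (s : nat -> R) (M : R -> R) : Prop :=
  forall eps B : R, 0 < eps -> 0 < B ->
  exists K : R, forall t x : R,
    t <> 0 -> s 0%nat <= x <= Rpower (Rabs t) B ->
    Cmod (Csum_le s (fun j => pow_mit (s j) t) x
          - RInt (V := C_R_CompleteNormedModule)
              (fun u => (pow_mit u t * RtoC (Derive M u))%C) (s 0%nat) x)%C
    <= K * (sqrt (M x) * Rpower (Rabs t) eps).

(* Main.v *)
Require Import Defs.
From Stdlib Require Import Reals.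
From Coquelicot Require Import Coquelicot.
From Stdlib Require Import ZArith List Sorted Permutation Lra Lia.
From Stdlib Require Import ConstructiveEpsilon ClassicalEpsilon.
Open Scope R_scope.

(** In the variable [v = log x] put [E v = N(e^v) - A e^v] and
    [Q v = psi(e^v) - (e^v - 1 - v)].

    LH => RH.  Apply LH at height [t = x^delta] and undo the twist by partial
    summation, adding the phases [0] and [PI/2] so that [cos^2 + sin^2 = 1]; this
    loses only [t^2] and gives the Chebyshev function of the primes, and the
    higher prime powers are negligible.

    RH => LH.  The Dirichlet identity [log * 1 = Lambda * 1] on the generalized
    integers says, for the Laplace transforms, that [Z = A + (s - 1) L(E)] and
    [D = s L(Q)] satisfy [Z' = - D Z] for real [s > 1].  Both transforms are
    analytic in [Re s > 1/2], so this persists there, and [exp] of a primitive of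
    [D] ties [D] to [Z].  Since [Z] is polynomially bounded and bounded below far
    to the right, Borel-Caratheodory gives [D(sigma + iT) << log T].  A finite
    trigonometric (Fejer) kernel then transfers this bound to the twisted sums
    [sum_(q <= e^V) Lambda(q) cos(t log q + phi) - int_0^V cos(t v + phi) (e^v - 1) dv],
    which are [<< e^((1/2 + eps) V) log^2 t] for [V <= B log t].  Dropping the prime
    powers and removing the weight [log p] by partial summation yields LH. *)

(** The twist is what blocks a direct passage from RH to LH: partial summation from
    [psi(x) = x + O(x^(1/2+eps))] costs a full factor [|t|]. The bound [D << log T] removes it: RH
    makes [D] analytic right of 1/2, and the count of integers keeps the growth of [Z] linear in the
    height. The density [e^v - 1] does two jobs. Divided by [v] it is exactly the density of [Li] in
    the variable [v]; and its primitive [e^v - 1 - v] has transform [1/(s-1) - 1/s - 1/s^2], which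
    makes [D] exactly [- Z'/Z] for [Z = (s-1) zeta(s)/s], with no pole left. No logarithm of [Z] is
    formed: along a ray [Z' = - D Z] keeps [|Z|^2 exp(-2 Re F)] constant when [F' = - D]. The kernel
    is a finite sum of cosines, so smoothing at scale [W] meets [D] only at the heights [t +- j/W],
    with coefficients of size [1/j]: one [log t] comes from [D], the other from this harmonic sum.
    The window of smoothing is at most [1/(t e^V)], and the positivity of the weights in [psi] lets
    it be undone at bounded cost. *)

(** * Finite sums over lists *)

Fixpoint lsum {T : Type} (f : T -> R) (l : list T) : R :=
  match l with nil => 0 | a :: l' => f a + lsum f l' end.

Lemma lsum_app {T} (f : T -> R) l1 l2 : lsum f (l1 ++ l2) = lsum f l1 + lsum f l2.
Proof. induction l1; simpl; [ring | rewrite IHl1; ring]. Qed.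

Lemma lsum_map {S T} (g : S -> T) (f : T -> R) l :
  lsum f (map g l) = lsum (fun x => f (g x)) l.
Proof. induction l; simpl; [reflexivity | now rewrite IHl]. Qed.

Lemma lsum_ext {T} (f g : T -> R) l :
  (forall x, In x l -> f x = g x) -> lsum f l = lsum g l.
Proof.
  induction l; intros H; simpl; [reflexivity|].
  rewrite H, IHl; [reflexivity | intros x Hx; apply H; now right | now left].
Qed.

Lemma lsum_plus {T} (f g : T -> R) l :
  lsum (fun x => f x + g x) l = lsum f l + lsum g l.
Proof. induction l; simpl; [ring | rewrite IHl; ring]. Qed.

Lemma lsum_scal {T} (c : R) (f : T -> R) l :
  lsum (fun x => c * f x) l = c * lsum f l.
Proof. induction l; simpl; [ring | rewrite IHl; ring]. Qed.

Lemma lsum_le {T} (f g : T -> R) l :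
  (forall x, In x l -> f x <= g x) -> lsum f l <= lsum g l.
Proof.
  induction l; intros H; simpl; [lra|].
  assert (f a <= g a) by (apply H; now left).
  assert (lsum f l <= lsum g l) by (apply IHl; intros; apply H; now right).
  lra.
Qed.

Lemma lsum_0 {T} (f : T -> R) l : (forall x, In x l -> f x = 0) -> lsum f l = 0.
Proof.
  induction l; intros H; simpl; [reflexivity|].
  rewrite H, IHl; [ring | intros x Hx; apply H; now right | now left].
Qed.

Lemma lsum_nonneg {T} (f : T -> R) l : (forall x, In x l -> 0 <= f x) -> 0 <= lsum f l.
Proof.
  intros H. rewrite <- (lsum_0 (fun _ : T => 0) l) by reflexivity. now apply lsum_le.
Qed.

Lemma lsum_abs {T} (f : T -> R) l : Rabs (lsum f l) <= lsum (fun x => Rabs (f x)) l.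
Proof.
  induction l; simpl; [rewrite Rabs_R0; lra|].
  eapply Rle_trans; [apply Rabs_triang|]. lra.
Qed.

Lemma lsum_perm {T} (f : T -> R) l1 l2 : Permutation l1 l2 -> lsum f l1 = lsum f l2.
Proof. induction 1; simpl; lra. Qed.

Lemma lsum_flat_map {S T} (g : S -> list T) (f : T -> R) l :
  lsum f (flat_map g l) = lsum (fun x => lsum f (g x)) l.
Proof. induction l; simpl; [reflexivity | now rewrite lsum_app, IHl]. Qed.

Lemma lsum_swap {S T} (f : S -> T -> R) l1 l2 :
  lsum (fun x => lsum (f x) l2) l1 = lsum (fun y => lsum (fun x => f x y) l1) l2.
Proof.
  induction l1; simpl.
  - symmetry. now apply lsum_0.
  - rewrite IHl1, <- lsum_plus. reflexivity.
Qed.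

Lemma lsum_filter {T} (f : T -> R) (b : T -> bool) l :
  lsum f (filter b l) = lsum (fun x => if b x then f x else 0) l.
Proof. induction l; simpl; [reflexivity|]. destruct (b a); simpl; rewrite IHl; ring. Qed.

Lemma lsum_seq_S (f : nat -> R) n : lsum f (seq 0 (S n)) = lsum f (seq 0 n) + f n.
Proof. rewrite seq_S, lsum_app. simpl. ring. Qed.

Lemma lsum_sum_n (f : nat -> R) n : lsum f (seq 0 (S n)) = sum_n f n.
Proof.
  induction n.
  - rewrite sum_O. simpl. ring.
  - rewrite lsum_seq_S, IHn, sum_Sn. reflexivity.
Qed.

(** The bridge from the [Series] in the counting functions to list sums: the partial sums are
    constant from [n] on. *)
Lemma Series_finite (a : nat -> R) (n : nat) :
  (forall j, (n <= j)%nat -> a j = 0) -> Series a = lsum a (seq 0 n).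
Proof.
  intros H. apply is_series_unique.
  assert (E : forall m, (n <= m)%nat -> lsum a (seq 0 m) = lsum a (seq 0 n)).
  { induction 1; [reflexivity|]. rewrite lsum_seq_S, IHle, H by assumption. ring. }
  change (is_lim_seq (sum_n a) (lsum a (seq 0 n))).
  apply is_lim_seq_ext_loc with (fun _ => lsum a (seq 0 n)); [|apply is_lim_seq_const].
  exists n. intros m Hm. rewrite <- lsum_sum_n. symmetry. apply E. lia.
Qed.

(** * Step functions and Abel summation *)

(** Atoms are pairs (weight, location). *)
Definition step (L : list (R * R)) (v : R) : R :=
  lsum (fun a => if Rle_dec (snd a) v then fst a else 0) L.

Definition reweigh (k : R -> R) (L : list (R * R)) : list (R * R) :=
  map (fun a => (fst a * k (snd a), snd a)) L.

Lemma step_reweigh k L v :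
  step (reweigh k L) v = lsum (fun a => if Rle_dec (snd a) v then fst a * k (snd a) else 0) L.
Proof. unfold step, reweigh. now rewrite lsum_map. Qed.

Lemma reweigh_comp k1 k2 L v :
  step (reweigh k1 (reweigh k2 L)) v = step (reweigh (fun x => k2 x * k1 x) L) v.
Proof.
  rewrite !step_reweigh. unfold reweigh. rewrite lsum_map. apply lsum_ext.
  intros a _; simpl. destruct (Rle_dec (snd a) v); ring.
Qed.

Lemma reweigh_loc k L a : (forall p, In p L -> a <= snd p) ->
  forall p, In p (reweigh k L) -> a <= snd p.
Proof.
  intros H p Hp. unfold reweigh in Hp. apply in_map_iff in Hp.
  destruct Hp as (q & <- & Hq). simpl. now apply H.
Qed.

Lemma is_RInt_zero (f : R -> R) (a b : R) :
  a <= b -> (forall x, a < x < b -> f x = 0) -> is_RInt f a b 0.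
Proof.
  intros Hab H. apply is_RInt_ext with (fun _ => 0).
  - intros x. rewrite Rmin_left, Rmax_right by lra. intros Hx. symmetry. now apply H.
  - pose proof (is_RInt_const (V := R_NormedModule) a b 0) as HC.
    unfold scal in HC; simpl in HC; unfold mult in HC; simpl in HC.
    now rewrite Rmult_0_r in HC.
Qed.

(** The indicator cuts the integral down to [[l, W]], where the fundamental theorem of calculus
    applies. *)
Lemma abel_atom (k k' : R -> R) (a W c l : R) :
  a <= l -> l <= W ->
  (forall v, a <= v <= W -> is_derive k v (k' v)) ->
  (forall v, a <= v <= W -> continuous k' v) ->
  is_RInt (fun v => k' v * (if Rle_dec l v then c else 0)) a W (c * (k W - k l)).
Proof.
  intros Hal HlW Hk Hc.
  replace (c * (k W - k l)) with (plus 0 (c * (k W - k l))) by (unfold plus; simpl; ring).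
  apply (is_RInt_Chasles (V := R_NormedModule) _ a l W 0 (c * (k W - k l))).
  - apply is_RInt_zero; [lra|]. intros x Hx.
    destruct (Rle_dec l x); [lra|]. ring.
  - apply is_RInt_ext with (fun x => scal c (k' x)).
    + intros x. rewrite Rmin_left, Rmax_right by lra. intros Hx.
      destruct (Rle_dec l x); [|lra]. unfold scal; simpl; unfold mult; simpl; ring.
    + apply (is_RInt_scal (V := R_NormedModule) k' l W c (k W - k l)).
      apply (is_RInt_derive (V := R_CompleteNormedModule) k k');
        intros x; rewrite Rmin_left, Rmax_right by lra; intros Hx; [apply Hk | apply Hc]; lra.
Qed.

(** Linearity in the atoms reduces this to [abel_atom]. Abel summation thus needs neither an
    ordering of the atoms nor a Stieltjes integral. *)
Lemma abel_step (k k' : R -> R) (L : list (R * R)) (a W : R) :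
  a <= W -> (forall p, In p L -> a <= snd p) ->
  (forall v, a <= v <= W -> is_derive k v (k' v)) ->
  (forall v, a <= v <= W -> continuous k' v) ->
  is_RInt (fun v => k' v * step L v) a W (k W * step L W - step (reweigh k L) W).
Proof.
  intros HaW HL Hk Hc. induction L as [|[c l] L IH].
  - unfold step; simpl.
    replace (k W * 0 - 0) with 0 by ring. apply is_RInt_zero; [lra|]. intros; ring.
  - assert (IH' : is_RInt (fun v => k' v * step L v) a W (k W * step L W - step (reweigh k L) W)).
    { apply IH. intros p Hp. apply HL. now right. }
    assert (Hl : a <= l) by (apply (HL (c, l)); now left).
    assert (H1 : is_RInt (fun v => k' v * (if Rle_dec l v then c else 0)) a W
             (if Rle_dec l W then c * (k W - k l) else 0)).
    { destruct (Rle_dec l W).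
      - now apply abel_atom.
      - apply is_RInt_zero; [lra|]. intros x Hx. destruct (Rle_dec l x); [lra|]. ring. }
    pose proof (is_RInt_plus _ _ _ _ _ _ H1 IH') as H2.
    unfold plus in H2; simpl in H2.
    replace (k W * step ((c, l) :: L) W - step (reweigh k ((c, l) :: L)) W)
      with ((if Rle_dec l W then c * (k W - k l) else 0)
            + (k W * step L W - step (reweigh k L) W))
      by (unfold step; simpl; destruct (Rle_dec l W); ring).
    apply is_RInt_ext with (2 := H2).
    intros x _. unfold step; simpl. ring.
Qed.

(** Distribution function of the signed measure "atoms minus density b" on [a, v]. *)
Definition cum (L : list (R * R)) (b : R -> R) (a v : R) : R := step L v - RInt b a v.

Lemma ex_RInt_cont_from (o a W : R) (b : R -> R) : o < a -> a <= W ->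
  (forall v, o < v -> continuous b v) -> ex_RInt b a W.
Proof.
  intros Ho HaW Hb. apply (ex_RInt_continuous (V := R_CompleteNormedModule)).
  intros z. rewrite Rmin_left, Rmax_right by lra. intros Hz. apply Hb; lra.
Qed.

Lemma is_derive_primitive (o a v : R) (b : R -> R) : o < a -> o < v ->
  (forall v, o < v -> continuous b v) -> is_derive (fun x => RInt b a x) v (b v).
Proof.
  intros Ho Hv Hb.
  apply is_derive_RInt with (a := a).
  - assert (Hp : 0 < v - o) by lra.
    exists (mkposreal _ Hp). intros y Hy.
    unfold ball in Hy; simpl in Hy; unfold AbsRing_ball, abs, minus, plus, opp in Hy; simpl in Hy.
    apply Rabs_lt_between in Hy.
    apply (RInt_correct (V := R_CompleteNormedModule)).
    apply (ex_RInt_continuous (V := R_CompleteNormedModule)).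
    intros z Hz. apply Hb. apply Rlt_le_trans with (Rmin a y); [|lra].
    apply Rmin_glb_lt; lra.
  - now apply Hb.
Qed.

(** Integration by parts against the signed measure behind [cum]. The point [o] leaves room to the
    left of [a], so that primitives have two-sided derivatives at [a]; taking [o = 0] admits kernels
    and densities singular at 0. *)
Lemma abel_cum (k k' b : R -> R) (L : list (R * R)) (o a W : R) :
  o < a -> a <= W -> (forall p, In p L -> a <= snd p) ->
  (forall v, o < v -> is_derive k v (k' v)) ->
  (forall v, o < v -> continuous k' v) ->
  (forall v, o < v -> continuous b v) ->
  is_RInt (fun v => k' v * cum L b a v) a W
    (k W * cum L b a W - cum (reweigh k L) (fun v => k v * b v) a W).
Proof.
  intros Ho HaW HL Hk Hc Hb.
  assert (H1 : is_RInt (fun v => k' v * step L v) a W (k W * step L W - step (reweigh k L) W)).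
  { apply abel_step; auto; intros v Hv; [apply Hk | apply Hc]; lra. }
  assert (Hck : forall v, o < v -> continuous k v).
  { intros v Hv. apply (ex_derive_continuous (V := R_NormedModule)). eexists. now apply Hk. }
  assert (HkI : is_RInt (fun v => k' v * RInt b a v + k v * b v) a W (k W * RInt b a W - k a * RInt b a a)).
  { apply (is_RInt_derive (V := R_CompleteNormedModule) (fun v => k v * RInt b a v)).
    - intros x. rewrite Rmin_left, Rmax_right by lra. intros Hx.
      apply (is_derive_mult (K := R_AbsRing) k (fun v => RInt b a v) x (k' x) (b x)).
      + apply Hk; lra.
      + apply is_derive_primitive with o; auto; lra.
      + intros; simpl; apply Rmult_comm.
    - intros x. rewrite Rmin_left, Rmax_right by lra. intros Hx.
      apply (continuous_plus (V := R_NormedModule)).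
      + apply (continuous_mult (K := R_AbsRing)); [apply Hc; lra|].
        apply (ex_derive_continuous (V := R_NormedModule)). eexists.
        apply is_derive_primitive with o; auto; lra.
      + apply (continuous_mult (K := R_AbsRing)); [apply Hck | apply Hb]; lra. }
  rewrite RInt_point in HkI.
  assert (H2 : is_RInt (fun v => k v * b v) a W (RInt (fun v => k v * b v) a W)).
  { apply (RInt_correct (V := R_CompleteNormedModule)).
    apply ex_RInt_cont_from with o; auto. intros v Hv.
    apply (continuous_mult (K := R_AbsRing)); auto. }
  pose proof (is_RInt_minus _ _ _ _ _ _ HkI H2) as H3.
  pose proof (is_RInt_minus _ _ _ _ _ _ H1 H3) as H4.
  unfold minus, plus, opp in H4; simpl in H4.
  unfold cum.
  replace (k W * (step L W - RInt b a W) - (step (reweigh k L) W - RInt (fun v => k v * b v) a W))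
    with (k W * step L W - step (reweigh k L) W +
       - (k W * RInt b a W - k a * zero + - RInt (fun v : R => k v * b v) a W))
    by (unfold zero; simpl; ring).
  apply is_RInt_ext with (2 := H4).
  intros x _. simpl. ring.
Qed.

Lemma cum_abel (k k' b : R -> R) (L : list (R * R)) (o a W : R) :
  o < a -> a <= W -> (forall p, In p L -> a <= snd p) ->
  (forall v, o < v -> is_derive k v (k' v)) ->
  (forall v, o < v -> continuous k' v) ->
  (forall v, o < v -> continuous b v) ->
  cum (reweigh k L) (fun v => k v * b v) a W
  = k W * cum L b a W - RInt (fun v => k' v * cum L b a v) a W.
Proof.
  intros. pose proof (abel_cum k k' b L o a W) as HA.
  rewrite (is_RInt_unique _ _ _ _ (HA H H0 H1 H2 H3 H4)). ring.
Qed.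

(** Integrability is a by-product of Abel summation with a primitive of [k] as the weight. *)
Lemma ex_RInt_step (k : R -> R) (L : list (R * R)) (a W : R) :
  a <= W -> (forall p, In p L -> a <= snd p) -> (forall v, continuous k v) ->
  ex_RInt (fun v => k v * step L v) a W.
Proof.
  intros HaW HL Hk.
  eexists. apply (abel_step (fun x => RInt k a x) k); auto.
  intros v Hv. apply is_derive_primitive with (a - 1); auto; lra.
Qed.

Lemma step_mono (L : list (R * R)) v w :
  (forall p, In p L -> 0 <= fst p) -> v <= w -> step L v <= step L w.
Proof.
  intros HL Hvw. apply lsum_le. intros p Hp. specialize (HL p Hp).
  destruct (Rle_dec (snd p) v), (Rle_dec (snd p) w); lra.
Qed.

Lemma step_nonneg (L : list (R * R)) v :
  (forall p, In p L -> 0 <= fst p) -> 0 <= step L v.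
Proof.
  intros HL. apply lsum_nonneg. intros p Hp. specialize (HL p Hp).
  destruct (Rle_dec (snd p) v); lra.
Qed.

(** Positive weights let the untwisted sum dominate the twisted one on any interval. This later
    controls the twisted sums on very short intervals. *)
Lemma step_var (k : R -> R) (L : list (R * R)) v w :
  (forall p, In p L -> 0 <= fst p) -> (forall x, Rabs (k x) <= 1) -> v <= w ->
  Rabs (step (reweigh k L) w - step (reweigh k L) v) <= step L w - step L v.
Proof.
  intros HL Hk Hvw. rewrite !step_reweigh. unfold step.
  induction L as [|p L IH]; simpl.
  - rewrite Rminus_0_r, Rabs_R0. lra.
  - assert (IH' := IH (fun q Hq => HL q (or_intror Hq))). clear IH.
    assert (Hp := HL p (or_introl eq_refl)).
    match type of IH' with Rabs (?x - ?y) <= ?z - ?t => set (s1 := x) in *; set (s2 := y) in *; set (s3 := z) in *; set (s4 := t) in * end.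
    specialize (Hk (snd p)).
    assert (Rabs (fst p * k (snd p)) <= fst p).
    { rewrite Rabs_mult, (Rabs_pos_eq _ Hp). nra. }
    destruct (Rle_dec (snd p) w), (Rle_dec (snd p) v); try lra.
    + replace (fst p * k (snd p) + s1 - (fst p * k (snd p) + s2)) with (s1 - s2) by ring. lra.
    + replace (fst p * k (snd p) + s1 - (0 + s2)) with (fst p * k (snd p) + (s1 - s2)) by ring.
      eapply Rle_trans; [apply Rabs_triang|]. lra.
    + replace (0 + s1 - (0 + s2)) with (s1 - s2) by ring. lra.
Qed.

(** * The atoms of primes, prime powers and integers *)

Definition lam (P : beurling_system) (j : nat) : R := ln (gprime P j).

Lemma gprime_mono P i j : (i <= j)%nat -> gprime P i <= gprime P j.
Proof. induction 1; [lra|]. pose proof (gprime_nondecr P m). lra. Qed.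

Lemma gint_mono P i j : (i <= j)%nat -> gint P i <= gint P j.
Proof. induction 1; [lra|]. pose proof (gint_nondecr P m). lra. Qed.

Lemma gprime_gt1_all P j : 1 < gprime P j.
Proof. pose proof (gprime_mono P 0 j ltac:(lia)). pose proof (gprime_gt1 P). lra. Qed.

Lemma lam0_pos P : 0 < lam P 0.
Proof. unfold lam. rewrite <- ln_1. apply ln_increasing; [lra|apply gprime_gt1]. Qed.

Lemma ln_le' x y : 0 < x -> x <= y -> ln x <= ln y.
Proof. intros Hx [H | ->]; [left; now apply ln_increasing | lra]. Qed.

Lemma lam_ge P j : lam P 0 <= lam P j.
Proof.
  apply ln_le'; [pose proof (gprime_gt1 P); lra | apply gprime_mono; lia].
Qed.

Lemma lam_pos P j : 0 < lam P j.
Proof. pose proof (lam_ge P j). pose proof (lam0_pos P). lra. Qed.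

Lemma exp_lam P j : exp (lam P j) = gprime P j.
Proof. apply exp_ln. pose proof (gprime_gt1_all P j). lra. Qed.

Lemma gprime_large P X : exists J, forall j, (J <= j)%nat -> X < gprime P j.
Proof.
  pose proof (gprime_infty P) as H. apply is_lim_seq_spec in H.
  destruct (H X) as [J HJ]. exists J. exact HJ.
Qed.

(** A truncation index: up to [e^W] the first [J] primes are all that matter, so the infinite system
    becomes a finite list of atoms. *)
Definition pcover (P : beurling_system) (W : R) (J : nat) : Prop :=
  forall j, (J <= j)%nat -> W < lam P j.

Lemma pcover_ex P W : exists J, pcover P W J.
Proof.
  destruct (gprime_large P (exp W)) as [J HJ]. exists J. intros j Hj.
  rewrite <- (ln_exp W). apply ln_increasing; [apply exp_pos|]. now apply HJ.
Qed.

Lemma pcover_le P W W' J : pcover P W J -> W' <= W -> pcover P W' J.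
Proof. intros H HW j Hj. specialize (H j Hj). lra. Qed.

Lemma exp_le x y : x <= y -> exp x <= exp y.
Proof. intros [H | ->]; [left; now apply exp_increasing | lra]. Qed.

Lemma dec_exp_ln {T} (x y : R) (a b : T) : 0 < x ->
  (if Rle_dec x (exp y) then a else b) = (if Rle_dec (ln x) y then a else b).
Proof.
  intros Hx.
  destruct (Rle_dec x (exp y)) as [h|h], (Rle_dec (ln x) y) as [h'|h']; try reflexivity.
  - apply ln_le' in h; [|assumption]. rewrite ln_exp in h. contradiction.
  - apply exp_le in h'. rewrite exp_ln in h' by assumption. contradiction.
Qed.

Lemma dec_ln_ln {T} (x y : R) (a b : T) : 0 < x -> 0 < y ->
  (if Rle_dec x y then a else b) = (if Rle_dec (ln x) (ln y) then a else b).
Proof. intros Hx Hy. rewrite <- dec_exp_ln by assumption. now rewrite exp_ln. Qed.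

Definition atoms_pi (P : beurling_system) (J : nat) : list (R * R) :=
  map (fun j => (1, lam P j)) (seq 0 J).
Definition atoms_theta (P : beurling_system) (J : nat) : list (R * R) :=
  map (fun j => (lam P j, lam P j)) (seq 0 J).
(** The index [k] stands for the exponent [k + 1], and [K] caps the exponents. *)
Definition atoms_psi (P : beurling_system) (J K : nat) : list (R * R) :=
  flat_map (fun j => map (fun k => (lam P j, INR (S k) * lam P j)) (seq 0 K)) (seq 0 J).
Definition atoms_N (P : beurling_system) (m : nat) : list (R * R) :=
  map (fun j => (1, ln (gint P j))) (seq 0 m).

Lemma atoms_pi_loc P J p : In p (atoms_pi P J) -> lam P 0 <= snd p.
Proof.
  unfold atoms_pi. intros H. apply in_map_iff in H. destruct H as (j & <- & _).
  apply lam_ge.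
Qed.

Lemma atoms_theta_loc P J p : In p (atoms_theta P J) -> lam P 0 <= snd p.
Proof.
  unfold atoms_theta. intros H. apply in_map_iff in H. destruct H as (j & <- & _).
  apply lam_ge.
Qed.

Lemma atoms_theta_wt P J p : In p (atoms_theta P J) -> 0 <= fst p.
Proof.
  unfold atoms_theta. intros H. apply in_map_iff in H. destruct H as (j & <- & _).
  apply Rlt_le, lam_pos.
Qed.

Lemma atoms_psi_loc P J K p : In p (atoms_psi P J K) -> lam P 0 <= snd p.
Proof.
  unfold atoms_psi. intros H. apply in_flat_map in H. destruct H as (j & _ & H).
  apply in_map_iff in H. destruct H as (k & <- & _). cbn [snd].
  pose proof (lam_ge P j). pose proof (lam0_pos P). pose proof (pos_INR k).
  rewrite S_INR. nra.
Qed.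

Lemma atoms_psi_wt P J K p : In p (atoms_psi P J K) -> 0 <= fst p.
Proof.
  unfold atoms_psi. intros H. apply in_flat_map in H. destruct H as (j & _ & H).
  apply in_map_iff in H. destruct H as (k & <- & _). apply Rlt_le, lam_pos.
Qed.

Lemma atoms_theta_pi P J v :
  step (atoms_theta P J) v = step (reweigh (fun x => x) (atoms_pi P J)) v.
Proof.
  rewrite step_reweigh. unfold step, atoms_theta, atoms_pi. rewrite !lsum_map.
  apply lsum_ext. intros j _. cbn [fst snd]. destruct (Rle_dec _ _); ring.
Qed.

Lemma pow_exp_lam P j k : gprime P j ^ k = exp (INR k * lam P j).
Proof.
  rewrite <- (exp_lam P j). induction k.
  - simpl. now rewrite Rmult_0_l, exp_0.
  - rewrite <- tech_pow_Rmult, IHk, <- exp_plus. f_equal. rewrite S_INR. ring.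
Qed.

(** Both cuts are exact: primes from index [J] on exceed [e^W], and a power with exponent above [K]
    has logarithm at least [(K + 1) log p_1 > W]. *)
Lemma psi_atoms P W J K v : pcover P W J -> W < INR (S K) * lam P 0 -> v <= W ->
  psi P (exp v) = step (atoms_psi P J K) v.
Proof.
  intros HJ HK Hv. unfold psi.
  assert (E : forall j, sum_le (fun k => gprime P j ^ S k) (fun _ => ln (gprime P j)) (exp v)
     = lsum (fun k => if Rle_dec (INR (S k) * lam P j) v then lam P j else 0) (seq 0 K)).
  { intros j. unfold sum_le.
    rewrite (Series_finite _ K).
    - apply lsum_ext. intros k _. rewrite pow_exp_lam, dec_exp_ln by apply exp_pos.
      now rewrite ln_exp.
    - intros k Hk. rewrite pow_exp_lam, dec_exp_ln by apply exp_pos. rewrite ln_exp.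
      destruct (Rle_dec _ _) as [h|h]; [|reflexivity]. exfalso.
      assert (INR (S K) <= INR (S k)) by (apply le_INR; lia).
      pose proof (lam_ge P j). pose proof (lam0_pos P). pose proof (pos_INR (S K)). nra. }
  rewrite (Series_finite _ J).
  - unfold step, atoms_psi. rewrite lsum_flat_map. apply lsum_ext. intros j _.
    now rewrite E, lsum_map.
  - intros j Hj. rewrite E. apply lsum_0. intros k _.
    destruct (Rle_dec _ _) as [h|h]; [|reflexivity]. exfalso.
    specialize (HJ j Hj). rewrite S_INR in h.
    pose proof (pos_INR k). pose proof (lam_pos P j). nra.
Qed.

Lemma kcover_ex P W : exists K, W < INR (S K) * lam P 0.
Proof.
  destruct (INR_unbounded (W / lam P 0)) as [K HK]. exists K.
  pose proof (lam0_pos P) as h. rewrite S_INR.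
  apply Rmult_lt_compat_r with (r := lam P 0) in HK; [|assumption].
  unfold Rdiv in HK. rewrite Rmult_assoc, Rinv_l in HK by lra. lra.
Qed.

Lemma N_atoms P W m v : (forall j, (m <= j)%nat -> exp W < gint P j) ->
  (forall j, 0 < gint P j) -> v <= W ->
  N_count P (exp v) = step (atoms_N P m) v.
Proof.
  intros Hm Hpos Hv. unfold N_count, sum_le. rewrite (Series_finite _ m).
  - unfold step, atoms_N. rewrite lsum_map. apply lsum_ext. intros j _. cbn [fst snd].
    now rewrite dec_exp_ln.
  - intros j Hj. specialize (Hm j Hj). apply exp_le in Hv.
    destruct (Rle_dec _ _); [lra|reflexivity].
Qed.

Lemma prime_sum_atoms P J x (h : R -> R) : 0 < x ->  pcover P (ln x) J ->
  sum_le (gprime P) (fun j => h (lam P j)) x = step (reweigh h (atoms_pi P J)) (ln x).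
Proof.
  intros Hx HJ. rewrite step_reweigh. unfold sum_le, atoms_pi. rewrite lsum_map.
  rewrite (Series_finite _ J).
  - apply lsum_ext. intros j _. cbn [fst snd].
    rewrite dec_ln_ln by (pose proof (gprime_gt1_all P j); lra).
    fold (lam P j). destruct (Rle_dec _ _); ring.
  - intros j Hj. specialize (HJ j Hj).
    rewrite dec_ln_ln by (pose proof (gprime_gt1_all P j); lra).
    fold (lam P j). destruct (Rle_dec _ _); [lra|reflexivity].
Qed.

(** * The logarithmic integral *)

(** The entire function [(e^v - 1)/v]. As a power series it is continuous at 0, which removes the
    singularity of the integrand of [Li] at [u = 1]. *)
Definition phi1 (v : R) : R := PSeries (PS_decr_1 (fun n => / INR (fact n))) v.

Lemma phi1_eq v : v * phi1 v = exp v - 1.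
Proof.
  unfold phi1.
  assert (H : PSeries (fun n => / INR (fact n)) v = exp v)
    by (apply is_pseries_unique, is_exp_Reals).
  rewrite PSeries_decr_1 in H by (eexists; apply is_exp_Reals).
  simpl in H. lra.
Qed.

Lemma phi1_continuous v : continuous phi1 v.
Proof.
  apply continuity_pt_filterlim. apply PSeries_continuity.
  rewrite CV_radius_decr_1.
  replace (CV_radius (fun n => / INR (fact n))) with p_infty; [exact I|].
  symmetry. apply CV_radius_infinite_DAlembert.
  - intros n. apply Rinv_neq_0_compat, INR_fact_neq_0.
  - apply is_lim_seq_ext with (fun n => / INR (S n)).
    + intros n. rewrite fact_simpl, mult_INR.
      assert (INR (fact n) <> 0) by apply INR_fact_neq_0.
      assert (0 < INR (S n)) by (apply lt_0_INR; lia).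
      replace (/ (INR (S n) * INR (fact n)) / / INR (fact n)) with (/ INR (S n)) by (field; lra).
      symmetry. apply Rabs_pos_eq. left. now apply Rinv_0_lt_compat.
    + replace (Finite 0) with (Rbar_inv p_infty) by reflexivity.
      apply is_lim_seq_inv; [|easy].
      apply -> is_lim_seq_incr_1. apply is_lim_seq_INR.
Qed.

Definition lidens (u : R) : R := (1 - / u) / ln u.

Lemma lidens_phi1 u : 1 < u -> lidens u = phi1 (ln u) / u.
Proof.
  intros Hu. unfold lidens. assert (0 < ln u) by (rewrite <- ln_1; apply ln_increasing; lra).
  pose proof (phi1_eq (ln u)) as H1. rewrite exp_ln in H1 by lra.
  replace (phi1 (ln u)) with ((u - 1) / ln u).
  - field; lra.
  - apply Rmult_eq_reg_l with (ln u); [|lra]. rewrite H1. field. lra.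
Qed.

Lemma continuous_phi1_ln u : 0 < u -> continuous (fun u => phi1 (ln u) / u) u.
Proof.
  intros Hu. unfold Rdiv.
  apply (continuous_mult (K := R_AbsRing)).
  - apply continuous_comp; [|apply phi1_continuous].
    apply continuity_pt_filterlim, derivable_continuous_pt. eexists; now apply derivable_pt_lim_ln.
  - apply continuity_pt_filterlim. apply continuity_pt_inv; [|lra]. apply continuity_pt_id.
Qed.

Lemma is_RInt_Li x : 1 <= x -> is_RInt lidens 1 x (RInt (fun u => phi1 (ln u) / u) 1 x).
Proof.
  intros Hx. apply is_RInt_ext with (fun u => phi1 (ln u) / u).
  - intros u. rewrite Rmin_left, Rmax_right by lra. intros Hu. symmetry. apply lidens_phi1; lra.
  - apply (RInt_correct (V := R_CompleteNormedModule)).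
    apply ex_RInt_cont_from with 0; try lra. intros; now apply continuous_phi1_ln.
Qed.

Lemma Li_phi1 x : 1 <= x -> Li x = RInt (fun u => phi1 (ln u) / u) 1 x.
Proof. intros Hx. apply is_RInt_unique. now apply is_RInt_Li. Qed.

Lemma Derive_Li u : 1 < u -> Derive Li u = lidens u.
Proof.
  intros Hu. apply is_derive_unique.
  apply is_derive_ext_loc with (fun x => RInt (fun u => phi1 (ln u) / u) 1 x).
  - assert (Hp : 0 < u - 1) by lra. exists (mkposreal _ Hp). intros y Hy.
    unfold ball in Hy; simpl in Hy; unfold AbsRing_ball, abs, minus, plus, opp in Hy; simpl in Hy.
    apply Rabs_lt_between in Hy. symmetry. apply Li_phi1. lra.
  - rewrite lidens_phi1 by assumption.
    apply (is_derive_primitive 0 1 u (fun u => phi1 (ln u) / u)); try lra.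
    intros; now apply continuous_phi1_ln.
Qed.

Lemma ln_le_sub1 u : 0 < u -> ln u <= u - 1.
Proof.
  intros Hu. pose proof (exp_ineq1_le (ln u)) as H. rewrite exp_ln in H by assumption. lra.
Qed.

(** The integrand is at most 1 because [ln (1/u) <= 1/u - 1]. Through this [sqrt (Li x)] in LH
    becomes the exponent 1/2 of RH. *)
Lemma Li_le x : 1 <= x -> Li x <= x - 1.
Proof.
  intros Hx. unfold Li.
  replace (x - 1) with (RInt (fun _ => 1) 1 x).
  - apply RInt_le; [lra | eexists; now apply is_RInt_Li | apply ex_RInt_const |].
    intros u Hu. change ((1 - / u) / ln u <= 1).
    assert (0 < ln u) by (rewrite <- ln_1; apply ln_increasing; lra).
    apply Rmult_le_reg_r with (ln u); [assumption|].
    unfold Rdiv. rewrite Rmult_assoc, Rinv_l by lra.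
    assert (0 < / u) by (apply Rinv_0_lt_compat; lra).
    pose proof (ln_le_sub1 (/ u) H0). rewrite ln_Rinv in H1 by lra. lra.
  - rewrite RInt_const. unfold scal; simpl; unfold mult; simpl. ring.
Qed.

(** Replacing [ln u] by the larger [ln x] in the denominator leaves an integrand with an explicit
    primitive. *)
Lemma Li_ge x : 1 < x -> (x - 1 - ln x) / ln x <= Li x.
Proof.
  intros Hx.
  assert (H0 : 0 < ln x) by (rewrite <- ln_1; apply ln_increasing; lra).
  assert (HI : is_RInt (fun u => (1 - / u) / ln x) 1 x ((x - ln x) / ln x - (1 - ln 1) / ln x)).
  { apply (is_RInt_derive (V := R_CompleteNormedModule) (fun u => (u - ln u) / ln x)).
    - intros u. rewrite Rmin_left, Rmax_right by lra. intros Hu.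
      auto_derive; [lra|]. field. lra.
    - intros u. rewrite Rmin_left, Rmax_right by lra. intros Hu.
      apply (ex_derive_continuous (V := R_NormedModule)). auto_derive. lra. }
  replace ((x - 1 - ln x) / ln x) with ((x - ln x) / ln x - (1 - ln 1) / ln x)
    by (rewrite ln_1; field; lra).
  rewrite <- (is_RInt_unique _ _ _ _ HI). unfold Li.
  apply RInt_le; [lra | eexists; exact HI | eexists; apply is_RInt_Li; lra |].
  intros u Hu. unfold Rdiv. apply Rmult_le_compat_l.
  - assert (/ u <= / 1) by (apply Rinv_le_contravar; lra). lra.
  - apply Rinv_le_contravar.
    + rewrite <- ln_1; apply ln_increasing; lra.
    + apply ln_le'; lra.
Qed.

(** * LH in logarithmic variables *)

Definition cost (t phi v : R) : R := cos (t * v + phi).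
(** The density of [Li] after [u = e^v], that is [Li'(e^v) e^v]. *)
Definition beta (v : R) : R := (exp v - 1) / v.

Lemma cost_continuous t phi v : continuous (cost t phi) v.
Proof.
  apply (ex_derive_continuous (V := R_NormedModule)). unfold cost. auto_derive. exact I.
Qed.

Lemma beta_continuous v : 0 < v -> continuous beta v.
Proof.
  intros. apply (ex_derive_continuous (V := R_NormedModule)). unfold beta. auto_derive. lra.
Qed.

Definition primeE P J t phi v : R :=
  cum (reweigh (cost t phi) (atoms_pi P J)) (fun x => cost t phi x * beta x) (lam P 0) v.

Lemma LH_change P t phi x : gprime P 0 <= x ->
  is_RInt (fun u => cost t phi (ln u) * Derive Li u) (gprime P 0) x
    (RInt (fun v => cost t phi v * beta v) (lam P 0) (ln x)).
Proof.
  intros Hx. pose proof (gprime_gt1 P) as Hp.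
  assert (Hc : forall v, 0 < v -> continuous (fun v => cost t phi v * beta v) v).
  { intros v Hv. apply (continuous_mult (K := R_AbsRing)); [apply cost_continuous|].
    now apply beta_continuous. }
  assert (H : is_RInt (fun u => scal (/ u) (cost t phi (ln u) * beta (ln u))) (gprime P 0) x
     (RInt (fun v => cost t phi v * beta v) (ln (gprime P 0)) (ln x))).
  { apply (is_RInt_comp (V := R_CompleteNormedModule) (fun v => cost t phi v * beta v) ln).
    - intros u. rewrite Rmin_left, Rmax_right by lra. intros Hu. apply Hc.
      rewrite <- ln_1; apply ln_increasing; lra.
    - intros u. rewrite Rmin_left, Rmax_right by lra. intros Hu. split.
      + auto_derive; [lra|]. field. lra.
      + apply (ex_derive_continuous (V := R_NormedModule)). auto_derive. lra. }
  apply is_RInt_ext with (2 := H).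
  intros u. rewrite Rmin_left, Rmax_right by lra. intros Hu.
  assert (0 < ln u) by (rewrite <- ln_1; apply ln_increasing; lra).
  rewrite Derive_Li by lra. unfold scal; simpl; unfold mult; simpl. unfold beta, lidens.
  rewrite exp_ln by lra. field. lra.
Qed.

(** The phase [PI / 2] turns the cosine into [- sin], the imaginary part of [u^(-it)]; so two real
    errors carry the complex one. *)
Lemma LH_form P t x J : gprime P 0 <= x -> pcover P (ln x) J ->
  (Csum_le (gprime P) (fun j => pow_mit (gprime P j) t) x
   - RInt (V := C_R_CompleteNormedModule)
       (fun u => (pow_mit u t * RtoC (Derive Li u))%C) (gprime P 0) x)%C
  = (primeE P J t 0 (ln x), primeE P J t (PI / 2) (ln x)).
Proof.
  intros Hx HJ. pose proof (gprime_gt1 P) as Hp.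
  assert (E : RInt (V := C_R_CompleteNormedModule)
       (fun u => (pow_mit u t * RtoC (Derive Li u))%C) (gprime P 0) x
     = (RInt (fun v => cost t 0 v * beta v) (lam P 0) (ln x),
        RInt (fun v => cost t (PI / 2) v * beta v) (lam P 0) (ln x))).
  { apply (is_RInt_unique (V := C_R_CompleteNormedModule)).
    apply is_RInt_fct_extend_pair.
    - apply is_RInt_ext with (2 := LH_change P t 0 x Hx).
      intros u _. unfold cost. simpl. rewrite Rplus_0_r. ring.
    - apply is_RInt_ext with (2 := LH_change P t (PI / 2) x Hx).
      intros u _. unfold cost. simpl. rewrite <- Ropp_mult_distr_l, cos_plus, cos_PI2, sin_PI2. ring. }
  rewrite E. unfold Csum_le, Cminus, Cplus, Copp. cbn [fst snd].
  unfold primeE, cum. f_equal.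
  - rewrite <- prime_sum_atoms by (assumption || lra). unfold Rminus. f_equal.
    unfold sum_le. apply Series_ext. intros j. destruct (Rle_dec _ _); [|reflexivity].
    unfold cost, pow_mit; simpl. fold (lam P j). now rewrite Rplus_0_r.
  - rewrite <- prime_sum_atoms by (assumption || lra). unfold Rminus. f_equal.
    unfold sum_le. apply Series_ext. intros j. destruct (Rle_dec _ _); [|reflexivity].
    unfold cost, pow_mit; simpl. fold (lam P j). rewrite cos_plus, cos_PI2, sin_PI2. ring.
Qed.

Lemma lin_le_exp a v : 0 < a -> v <= / a * exp (a * v).
Proof.
  intros Ha. apply Rmult_le_reg_l with a; [assumption|].
  rewrite <- Rmult_assoc, Rinv_r, Rmult_1_l by lra.
  pose proof (exp_ineq1_le (a * v)). lra.
Qed.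

Lemma one_le_exp x : 0 <= x -> 1 <= exp x.
Proof. intros H. rewrite <- exp_0. now apply exp_le. Qed.

(** Written as a difference of exponentials so that one statement serves growing ([a > 0]) and
    decaying ([a < 0]) integrands. *)
Lemma RInt_exp_bound (f : R -> R) (C a v w : R) : a <> 0 -> v <= w ->
  ex_RInt f v w -> (forall x, v <= x <= w -> Rabs (f x) <= C * exp (a * x)) ->
  Rabs (RInt f v w) <= C / a * (exp (a * w) - exp (a * v)).
Proof.
  intros Ha Hvw Hf Hb.
  assert (HI : is_RInt (fun x => C * exp (a * x)) v w (C / a * exp (a * w) - C / a * exp (a * v))).
  { apply (is_RInt_derive (V := R_CompleteNormedModule) (fun x => C / a * exp (a * x))).
    - intros x _. auto_derive; [exact I|]. field. lra.
    - intros x _. apply (ex_derive_continuous (V := R_NormedModule)). auto_derive. exact I. }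
  rewrite Rmult_minus_distr_l.
  apply (norm_RInt_le (V := R_NormedModule) f (fun x => C * exp (a * x)) v w); auto.
  apply (RInt_correct (V := R_CompleteNormedModule)). exact Hf.
Qed.

(** RH in the variable [v], asked for all [v >= 0] instead of large [v], so that it can be
    integrated from 0. *)
Definition RHv (P : beurling_system) : Prop :=
  forall eps, 0 < eps -> exists C, forall v, 0 <= v ->
    Rabs (psi P (exp v) - exp v) <= C * exp ((1 / 2 + eps) * v).

Lemma psi_mono_exp P v w : v <= w -> psi P (exp v) <= psi P (exp w).
Proof.
  intros H. destruct (pcover_ex P w) as [J HJ]. destruct (kcover_ex P w) as [K HK].
  rewrite !(psi_atoms P w J K) by (assumption || lra).
  apply step_mono; [apply atoms_psi_wt | assumption].
Qed.

Lemma psi_nonneg_exp P v : 0 <= psi P (exp v).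
Proof.
  destruct (pcover_ex P v) as [J HJ]. destruct (kcover_ex P v) as [K HK].
  rewrite (psi_atoms P v J K) by (assumption || lra).
  apply step_nonneg; apply atoms_psi_wt.
Qed.

Lemma RHv_to_RH P : RHv P -> riemann_hypothesis P.
Proof.
  intros H eps Heps. destruct (H eps Heps) as [C HC].
  exists C. exists 1. intros x Hx.
  assert (Hx0 : 0 < x) by lra.
  assert (0 < ln x) by (rewrite <- ln_1; apply ln_increasing; lra).
  specialize (HC (ln x) ltac:(lra)). rewrite exp_ln in HC by assumption.
  unfold Rpower. rewrite (Rabs_pos_eq (exp _)) by (left; apply exp_pos). exact HC.
Qed.

(** Beyond the threshold the hypothesis applies; on the compact range before it the local bound
    [C0 W] suffices, since [exp (a * v) >= 1]. *)
Lemma bigO_uniform (f : R -> R) (C0 : R -> R) :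
  (forall W, 0 <= W -> forall v, 0 <= v <= W -> Rabs (f (exp v)) <= C0 W) ->
  forall a, 0 <= a -> bigO_infty f (fun x => Rpower x a) ->
  exists C, 0 <= C /\ forall v, 0 <= v -> Rabs (f (exp v)) <= C * exp (a * v).
Proof.
  intros Hb a Ha [K [M HM]].
  set (W := ln (Rmax M 1 + 1)).
  assert (HW : 0 <= W).
  { unfold W. rewrite <- ln_1. apply ln_le'; [lra|]. pose proof (Rmax_r M 1). lra. }
  exists (Rmax K 0 + Rabs (C0 W)). split.
  { pose proof (Rmax_r K 0). pose proof (Rabs_pos (C0 W)). lra. }
  intros v Hv.
  assert (1 <= exp (a * v)) by (apply one_le_exp; nra).
  pose proof (Rmax_r K 0). pose proof (Rmax_l K 0). pose proof (Rabs_pos (C0 W)).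
  destruct (Rle_lt_dec v W) as [h|h].
  - specialize (Hb W HW v (conj Hv h)). pose proof (Rle_abs (C0 W)). nra.
  - assert (HMv : M < exp v).
    { apply exp_increasing in h. unfold W in h.
      rewrite exp_ln in h by (pose proof (Rmax_r M 1); lra). pose proof (Rmax_l M 1). lra. }
    specialize (HM _ HMv). unfold Rpower in HM. rewrite ln_exp in HM.
    rewrite (Rabs_pos_eq (exp _)) in HM by (left; apply exp_pos). nra.
Qed.

Lemma RH_to_RHv P : riemann_hypothesis P -> RHv P.
Proof.
  intros H eps Heps.
  destruct (bigO_uniform (fun x => psi P x - x) (fun W => psi P (exp W) + exp W)) with (a := 1 / 2 + eps)
    as [C [_ HC]]; try lra.
  - intros W HW v Hv.
    pose proof (psi_mono_exp P v W ltac:(lra)). pose proof (psi_nonneg_exp P v).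
    pose proof (exp_le v W ltac:(lra)). pose proof (exp_pos v).
    apply Rabs_le. lra.
  - now apply H.
  - exists C. exact HC.
Qed.

(** * From LH to the Riemann hypothesis *)

Lemma theta_small P J v : v < lam P 0 -> step (atoms_theta P J) v = 0.
Proof.
  intros Hv. apply lsum_0. intros p Hp. apply atoms_theta_loc in Hp.
  destruct (Rle_dec _ _); [lra|reflexivity].
Qed.

(** The classical [psi(x) = theta(x) + theta(x^(1/2)) + ...], truncated at exponent [K], read in
    [v = log x]. *)
Lemma psi_theta_sum P J K v :
  step (atoms_psi P J K) v = lsum (fun k => step (atoms_theta P J) (v / INR (S k))) (seq 0 K).
Proof.
  unfold step, atoms_psi, atoms_theta. rewrite lsum_flat_map.
  rewrite (lsum_ext _ (fun j => lsum (fun k => if Rle_dec (INR (S k) * lam P j) v then lam P j else 0) (seq 0 K)))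
    by (intros j _; now rewrite lsum_map).
  rewrite lsum_swap. apply lsum_ext. intros k _. rewrite lsum_map. apply lsum_ext.
  intros j _. cbn [fst snd].
  assert (Hk : 0 < INR (S k)) by (apply lt_0_INR; lia).
  destruct (Rle_dec (INR (S k) * lam P j) v) as [h|h],
           (Rle_dec (lam P j) (v / INR (S k))) as [h'|h']; try reflexivity; exfalso.
  - apply h'. apply Rmult_le_reg_l with (INR (S k)); [assumption|].
    unfold Rdiv. rewrite (Rmult_comm v), <- Rmult_assoc, Rinv_r, Rmult_1_l; lra.
  - apply h. apply Rmult_le_compat_l with (r := INR (S k)) in h'; [|lra].
    unfold Rdiv in h'. rewrite (Rmult_comm v), <- Rmult_assoc, Rinv_r, Rmult_1_l in h'; lra.
Qed.

Lemma lsum_const {T} (c : R) (l : list T) : lsum (fun _ => c) l = INR (length l) * c.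
Proof.
  induction l; simpl lsum.
  - simpl; ring.
  - rewrite IHl. cbn [length]. rewrite S_INR. ring.
Qed.

(** At most [v / log p_1] powers can occur, and each one beyond the first is [theta] at a point not
    above [v / 2]. *)
Lemma psi_theta_bound P C v J : 0 <= v -> 0 <= C -> pcover P v J ->
  (forall w, 0 <= w <= v -> step (atoms_theta P J) w <= C * exp w) ->
  0 <= psi P (exp v) - step (atoms_theta P J) v <= v / lam P 0 * C * exp (v / 2).
Proof.
  intros Hv HC HJ Hb. pose proof (lam0_pos P) as Hl.
  destruct (nfloor_ex (v / lam P 0)) as [K [HK1 HK2]].
  { apply Rmult_le_pos; [assumption|]. left. now apply Rinv_0_lt_compat. }
  assert (HK : v < INR (S K) * lam P 0).
  { rewrite S_INR. apply Rmult_lt_compat_r with (r := lam P 0) in HK2; [|assumption].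
    unfold Rdiv in HK2. rewrite Rmult_assoc, Rinv_l in HK2; lra. }
  rewrite (psi_atoms P v J K) by (assumption || lra). rewrite psi_theta_sum.
  assert (Hdiv : forall k, 0 <= v / INR (S k) <= v).
  { intros k. assert (1 <= INR (S k)) by (rewrite S_INR; pose proof (pos_INR k); lra).
    assert (0 < / INR (S k) <= 1).
    { split; [apply Rinv_0_lt_compat; lra|]. rewrite <- Rinv_1. apply Rinv_le_contravar; lra. }
    unfold Rdiv. nra. }
  destruct K as [|K].
  - simpl lsum. rewrite theta_small by (simpl in HK; lra).
    assert (0 <= v / lam P 0 * C * exp (v / 2)); [|lra].
    simpl in HK1. pose proof (exp_pos (v/2)). apply Rmult_le_pos; [apply Rmult_le_pos|]; lra.
  - change (seq 0 (S K)) with (0%nat :: seq 1 K). cbn [lsum].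
    replace (v / INR 1) with v by (simpl; field).
    assert (Hs : 0 <= lsum (fun k => step (atoms_theta P J) (v / INR (S k))) (seq 1 K)
              <= lsum (fun _ => C * exp (v / 2)) (seq 1 K)).
    { split.
      - apply lsum_nonneg. intros k _. apply step_nonneg, atoms_theta_wt.
      - apply lsum_le. intros k Hk. apply in_seq in Hk.
        eapply Rle_trans; [apply Hb, Hdiv|].
        apply Rmult_le_compat_l; [assumption|]. apply exp_le.
        unfold Rdiv. apply Rmult_le_compat_l; [assumption|].
        apply Rinv_le_contravar; [lra|]. replace 2 with (INR 2) by (simpl; lra). apply le_INR. lia. }
    rewrite lsum_const, length_seq in Hs.
    rewrite S_INR in HK1. pose proof (exp_pos (v / 2)).
    assert (INR K * (C * exp (v / 2)) <= v / lam P 0 * (C * exp (v / 2))).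
    { apply Rmult_le_compat_r; [apply Rmult_le_pos; lra|lra]. }
    lra.
Qed.

(** Partial summation at height [t = exp (eps v / 4)], so that the factor [t^2 v] lost is
    harmless; the phases [0] and [PI / 2] recombine through [cos^2 + sin^2 = 1]. *)
Lemma theta_of_LH P : LH (gprime P) Li ->
  forall eps, 0 < eps -> exists C, forall v J, 0 <= v -> pcover P v J ->
    Rabs (step (atoms_theta P J) v - exp v) <= C * exp ((1 / 2 + eps) * v).
Proof.
  intros HLH eps Heps. pose proof (lam0_pos P) as Hl. pose proof (gprime_gt1 P) as Hp.
  (* With [t = exp (eps v / 4)] the range [x <= t^(4/eps)] is exactly [x <= e^v]. The crude exponent
     1 for [|t|] is affordable because [t] is a small power of [e^v]. *)
  destruct (HLH 1 (4 / eps)) as [K HK]; [lra | apply Rdiv_lt_0_compat; lra |].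
  set (K' := Rmax K 0). assert (HK'0 : 0 <= K') by apply Rmax_r.
  set (a := eps / 4). assert (Ha : 0 < a) by (unfold a; lra).
  set (C1 := 2 * K' * (2 + 3 * / (2 * a))).
  set (C2 := exp (lam P 0) + 1 + lam P 0 + / (1 / 2)).
  assert (H2a : 0 < / (2 * a)) by (apply Rinv_0_lt_compat; lra).
  assert (HC1 : 0 <= C1) by (unfold C1; nra).
  assert (HC2 : exp (lam P 0) <= C2) by (unfold C2; lra).
  pose proof (exp_pos (lam P 0)) as He0.
  exists (C1 + C2). intros v J Hv HJ.
  assert (Hexp : 1 <= exp ((1 / 2 + eps) * v)) by (apply one_le_exp; nra).
  destruct (Rlt_le_dec v (lam P 0)) as [h|h].
  { rewrite theta_small by assumption. apply exp_increasing in h.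
    rewrite Rminus_0_l, Rabs_Ropp, Rabs_pos_eq by (left; apply exp_pos). nra. }
  set (t := exp (a * v)).
  assert (Ht : 1 <= t) by (apply one_le_exp; nra).
  assert (HE : forall phi, phi = 0 \/ phi = PI / 2 -> forall w, lam P 0 <= w <= v ->
     Rabs (primeE P J t phi w) <= K' * t * exp (/ 2 * w)).
  { intros phi Hphi w Hw.
    assert (Hx : gprime P 0 <= exp w) by (rewrite <- exp_lam; apply exp_le; lra).
    assert (Hx2 : exp w <= Rpower (Rabs t) (4 / eps)).
    { rewrite Rabs_pos_eq by lra. unfold Rpower, t. rewrite ln_exp. apply exp_le.
      replace (4 / eps * (a * v)) with v by (unfold a; field; lra). lra. }
    specialize (HK t (exp w) ltac:(lra) (conj Hx Hx2)).
    rewrite (LH_form P t (exp w) J Hx) in HK by (rewrite ln_exp; apply pcover_le with v; [assumption|lra]).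
    rewrite ln_exp, Rabs_pos_eq, Rpower_1 in HK by lra.
    assert (HLi : sqrt (Li (exp w)) <= exp (/ 2 * w)).
    { replace (exp (/ 2 * w)) with (sqrt (exp w)).
      - apply sqrt_le_1_alt. pose proof (Li_le (exp w)).
        pose proof (one_le_exp w). lra.
      - apply sqrt_lem_1; try (left; apply exp_pos). rewrite <- exp_plus. f_equal. field. }
    assert (Hm : Rmax (Rabs (primeE P J t 0 w)) (Rabs (primeE P J t (PI / 2) w))
                 <= K' * t * exp (/ 2 * w)).
    { eapply Rle_trans; [apply (Rmax_Cmod (primeE P J t 0 w, primeE P J t (PI / 2) w))|].
      eapply Rle_trans; [exact HK|].
      assert (0 <= sqrt (Li (exp w)) * t) by (pose proof (sqrt_pos (Li (exp w))); nra).
      apply Rle_trans with (K' * (sqrt (Li (exp w)) * t)).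
      - apply Rmult_le_compat_r; [assumption|apply Rmax_l].
      - rewrite Rmult_assoc, (Rmult_comm t). apply Rmult_le_compat_l; [assumption|].
        apply Rmult_le_compat_r; lra. }
    destruct Hphi as [-> | ->]; [pose proof (Rmax_l (Rabs (primeE P J t 0 w)) (Rabs (primeE P J t (PI / 2) w)))
      | pose proof (Rmax_r (Rabs (primeE P J t 0 w)) (Rabs (primeE P J t (PI / 2) w)))]; lra. }
  (* Weighting the twisted sum once more by [x cos(t x + phi)] squares its phase. The derivative of
     this weight costs [t x], the second factor [t] in the bound. *)
  assert (HF : forall phi, phi = 0 \/ phi = PI / 2 ->
    Rabs (cum (reweigh (fun x => x * cost t phi x) (reweigh (cost t phi) (atoms_pi P J)))
        (fun x => x * cost t phi x * (cost t phi x * beta x)) (lam P 0) v)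
     <= K' * t * t * (2 + 3 * v) * exp (/ 2 * v)).
  { intros phi Hphi.
    set (k' := fun x => cost t phi x - t * x * sin (t * x + phi)).
    assert (Hder : forall x, 0 < x -> is_derive (fun x => x * cost t phi x) x (k' x)).
    { intros x _. unfold k', cost. auto_derive; [exact I|]. ring. }
    assert (Hk'c : forall x, 0 < x -> continuous k' x).
    { intros x _. apply (ex_derive_continuous (V := R_NormedModule)).
      unfold k', cost. auto_derive. exact I. }
    assert (Hbc : forall x, 0 < x -> continuous (fun x => cost t phi x * beta x) x).
    { intros x Hx. apply (continuous_mult (K := R_AbsRing)); [apply cost_continuous|].
      now apply beta_continuous. }
    pose proof (abel_cum (fun x => x * cost t phi x) k' (fun x => cost t phi x * beta x)
      (reweigh (cost t phi) (atoms_pi P J)) 0 (lam P 0) v Hl h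
      (reweigh_loc _ _ _ (atoms_pi_loc P J)) Hder Hk'c Hbc) as HA.
    rewrite (cum_abel (fun x => x * cost t phi x) k' (fun x => cost t phi x * beta x) _ 0); auto;
      [|apply reweigh_loc, atoms_pi_loc].
    fold (primeE P J t phi v).
    assert (H1 : Rabs (v * cost t phi v * primeE P J t phi v) <= v * (K' * t * exp (/ 2 * v))).
    { rewrite !Rabs_mult, (Rabs_pos_eq v) by lra.
      assert (Rabs (cost t phi v) <= 1) by (apply Rabs_le, COS_bound).
      specialize (HE phi Hphi v ltac:(lra)). pose proof (Rabs_pos (cost t phi v)).
      pose proof (Rabs_pos (primeE P J t phi v)).
      rewrite Rmult_assoc. apply Rmult_le_compat_l; [lra|]. nra. }
    assert (H2 : Rabs (RInt (fun x => k' x * primeE P J t phi x) (lam P 0) v)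
        <= (1 + t * v) * (K' * t) / (/ 2) * (exp (/ 2 * v) - exp (/ 2 * lam P 0))).
    { apply RInt_exp_bound; [lra | assumption | eexists; exact HA |].
      intros x Hx. rewrite Rabs_mult, Rmult_assoc.
      apply Rmult_le_compat; try apply Rabs_pos.
      - unfold k'. eapply Rle_trans; [apply Rabs_triang|]. rewrite Rabs_Ropp, !Rabs_mult.
        rewrite (Rabs_pos_eq t), (Rabs_pos_eq x) by lra.
        assert (Rabs (cost t phi x) <= 1) by (apply Rabs_le, COS_bound).
        assert (Rabs (sin (t * x + phi)) <= 1) by (apply Rabs_le, SIN_bound).
        pose proof (Rabs_pos (sin (t * x + phi))).
        assert (t * x * Rabs (sin (t * x + phi)) <= t * v * 1).
        { apply Rmult_le_compat; try nra. }
        lra.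
      - apply HE; auto. }
    unfold Rminus at 1. eapply Rle_trans; [apply Rabs_triang|]. rewrite Rabs_Ropp.
    unfold primeE in H2 |- *.
    eapply Rle_trans; [apply Rplus_le_compat; [exact H1 | exact H2]|].
    pose proof (exp_pos (/ 2 * v)) as E1. pose proof (exp_pos (/ 2 * lam P 0)) as E2.
    assert (Hkt : 0 <= K' * t) by nra.
    replace ((1 + t * v) * (K' * t) / / 2) with (2 * (1 + t * v) * (K' * t)) by field.
    set (e := exp (/ 2 * v)) in *. set (e2 := exp (/ 2 * lam P 0)) in *.
    assert (0 <= 2 * (1 + t * v) * (K' * t)) by (apply Rmult_le_pos; nra).
    apply Rle_trans with (K' * t * e * (v + 2 * (1 + t * v))); [nra|].
    replace (K' * t * t * (2 + 3 * v) * e) with (K' * t * e * (t * (2 + 3 * v))) by ring.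
    apply Rmult_le_compat_l; [nra|]. nra. }
  (* The two squared phases add up to 1: the atoms get weight [log p], and the density becomes
     [x beta(x) = e^x - 1], whose primitive is [e^x - x]. *)
  assert (Hid : step (atoms_theta P J) v - (exp v - v - (exp (lam P 0) - lam P 0))
    = cum (reweigh (fun x => x * cost t 0 x) (reweigh (cost t 0) (atoms_pi P J)))
        (fun x => x * cost t 0 x * (cost t 0 x * beta x)) (lam P 0) v
    + cum (reweigh (fun x => x * cost t (PI/2) x) (reweigh (cost t (PI/2)) (atoms_pi P J)))
        (fun x => x * cost t (PI/2) x * (cost t (PI/2) x * beta x)) (lam P 0) v).
  { unfold cum. rewrite !reweigh_comp.
    assert (Hsq : forall x, cost t 0 x * cost t 0 x + cost t (PI/2) x * cost t (PI/2) x = 1).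
    { intros x. unfold cost. rewrite Rplus_0_r, cos_plus, cos_PI2, sin_PI2.
      pose proof (sin2_cos2 (t * x)) as H. unfold Rsqr in H. lra. }
    set (f0 := fun x => x * cost t 0 x * (cost t 0 x * beta x)).
    set (f1 := fun x => x * cost t (PI/2) x * (cost t (PI/2) x * beta x)).
    assert (Hex : forall phi, ex_RInt (fun x => x * cost t phi x * (cost t phi x * beta x)) (lam P 0) v).
    { intros phi. apply ex_RInt_cont_from with 0; auto. intros x Hx.
      apply (continuous_mult (K := R_AbsRing)); apply (continuous_mult (K := R_AbsRing));
       try apply cost_continuous; [apply continuous_id | now apply beta_continuous]. }
    assert (HI : RInt f0 (lam P 0) v + RInt f1 (lam P 0) v = exp v - v - (exp (lam P 0) - lam P 0)).
    { rewrite <- (RInt_plus (V := R_CompleteNormedModule)) by apply Hex.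
      apply is_RInt_unique.
      apply is_RInt_ext with (fun x => exp x - 1).
      - intros x. rewrite Rmin_left, Rmax_right by lra. intros Hx.
        unfold plus; simpl. unfold f0, f1.
        replace (x * cost t 0 x * (cost t 0 x * beta x) + x * cost t (PI / 2) x * (cost t (PI / 2) x * beta x))
          with (x * beta x * (cost t 0 x * cost t 0 x + cost t (PI/2) x * cost t (PI/2) x)) by ring.
        rewrite Hsq. unfold beta. field. lra.
      - apply (is_RInt_derive (V := R_CompleteNormedModule) (fun x => exp x - x)).
        + intros x _. auto_derive; [exact I|]. ring.
        + intros x _. apply (ex_derive_continuous (V := R_NormedModule)). auto_derive. exact I. }
    assert (HS : step (atoms_theta P J) v =
       step (reweigh (fun x => cost t 0 x * (x * cost t 0 x)) (atoms_pi P J)) v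
       + step (reweigh (fun x => cost t (PI/2) x * (x * cost t (PI/2) x)) (atoms_pi P J)) v).
    { rewrite atoms_theta_pi, !step_reweigh, <- lsum_plus. apply lsum_ext. intros p _.
      destruct (Rle_dec _ _); [|ring].
      rewrite <- Rmult_plus_distr_l. f_equal.
      transitivity (snd p * (cost t 0 (snd p) * cost t 0 (snd p) + cost t (PI/2) (snd p) * cost t (PI/2) (snd p)));
        [rewrite Hsq; ring | ring]. }
    rewrite HS, <- HI. ring. }
  pose proof (HF 0 (or_introl eq_refl)) as HF0. pose proof (HF (PI/2) (or_intror eq_refl)) as HF1.
  assert (Hmain : Rabs (step (atoms_theta P J) v - (exp v - v - (exp (lam P 0) - lam P 0)))
     <= 2 * K' * t * t * (2 + 3 * v) * exp (/ 2 * v)).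
  { rewrite Hid. eapply Rle_trans; [apply Rabs_triang|]. lra. }
  replace (step (atoms_theta P J) v - exp v) with
    (step (atoms_theta P J) v - (exp v - v - (exp (lam P 0) - lam P 0)) - (v + (exp (lam P 0) - lam P 0))) by ring.
  unfold Rminus at 1. eapply Rle_trans; [apply Rabs_triang|]. rewrite Rabs_Ropp.
  rewrite Rmult_plus_distr_r. apply Rplus_le_compat.
  - eapply Rle_trans; [exact Hmain|].
    (* The exponent [eps = 4 a] is spent as [2 a] on [t^2] and [2 a] on the factor linear in [v]. *)
    unfold C1. replace ((1 / 2 + eps) * v) with (a * v + a * v + (2 * a) * v + / 2 * v) by (unfold a; field).
    rewrite !exp_plus. fold t.
    pose proof (lin_le_exp (2 * a) v ltac:(lra)) as Hv1.
    pose proof (one_le_exp (2 * a * v) ltac:(nra)) as Hv2.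
    set (e := exp (/ 2 * v)). assert (0 < e) by apply exp_pos.
    set (e2 := exp (2 * a * v)) in *.
    replace (2 * K' * t * t * (2 + 3 * v) * e) with (2 * K' * t * t * e * (2 + 3 * v)) by ring.
    replace (2 * K' * (2 + 3 * / (2 * a)) * (t * t * e2 * e)) with
      (2 * K' * t * t * e * ((2 + 3 * / (2 * a)) * e2)) by ring.
    apply Rmult_le_compat_l; [|nra].
    repeat apply Rmult_le_pos; lra.
  - assert (Hge : lam P 0 <= exp (lam P 0)) by (pose proof (exp_ineq1_le (lam P 0)); lra).
    rewrite Rabs_pos_eq by lra.
    pose proof (lin_le_exp (1 / 2) v ltac:(lra)) as Hv1.
    assert (exp (1 / 2 * v) <= exp ((1 / 2 + eps) * v)) by (apply exp_le; nra).
    assert (0 < / (1/2)) by (apply Rinv_0_lt_compat; lra).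
    unfold C2. nra.
Qed.

Lemma RH_of_LH P : LH (gprime P) Li -> riemann_hypothesis P.
Proof.
  intros HLH. apply RHv_to_RH. intros eps Heps.
  (* The exponent [eps = 1/2] gives the Chebyshev bound [theta << e^v], used to discard the higher
     prime powers. *)
  destruct (theta_of_LH P HLH (1/2) ltac:(lra)) as [C0 HC0].
  destruct (theta_of_LH P HLH eps Heps) as [C1 HC1].
  set (C := Rmax C0 0 + 1). assert (HC : 0 <= C) by (unfold C; pose proof (Rmax_r C0 0); lra).
  pose proof (lam0_pos P) as Hl.
  assert (Hil : 0 < / lam P 0) by now apply Rinv_0_lt_compat.
  assert (Hie : 0 < / eps) by now apply Rinv_0_lt_compat.
  exists (C1 + / lam P 0 * C * / eps). intros v Hv.
  destruct (pcover_ex P v) as [J HJ].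
  assert (Hth : forall w, 0 <= w <= v -> step (atoms_theta P J) w <= C * exp w).
  { intros w Hw. assert (HJw : pcover P w J) by (apply pcover_le with v; [assumption|lra]).
    specialize (HC0 w J ltac:(lra) HJw). replace ((1 / 2 + 1 / 2) * w) with w in HC0 by field.
    apply Rabs_le_between in HC0. pose proof (exp_pos w).
    pose proof (Rmax_l C0 0). unfold C. nra. }
  pose proof (psi_theta_bound P C v J Hv HC HJ Hth) as Hd.
  specialize (HC1 v J Hv HJ).
  replace (psi P (exp v) - exp v) with
    ((psi P (exp v) - step (atoms_theta P J) v) + (step (atoms_theta P J) v - exp v)) by ring.
  eapply Rle_trans; [apply Rabs_triang|]. rewrite (Rabs_pos_eq (psi P (exp v) - _)) by lra.
  assert (v / lam P 0 * C * exp (v / 2) <= / lam P 0 * C * / eps * exp ((1 / 2 + eps) * v)).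
  { replace ((1 / 2 + eps) * v) with (v / 2 + eps * v) by field. rewrite exp_plus.
    pose proof (lin_le_exp eps v Heps) as Hv1. pose proof (exp_pos (v / 2)).
    replace (v / lam P 0 * C * exp (v / 2)) with (/ lam P 0 * C * exp (v / 2) * v) by (field; lra).
    replace (/ lam P 0 * C * / eps * (exp (v / 2) * exp (eps * v)))
      with (/ lam P 0 * C * exp (v / 2) * (/ eps * exp (eps * v))) by ring.
    apply Rmult_le_compat_l; [|assumption]. repeat apply Rmult_le_pos; lra. }
  lra.
Qed.

(** * The Dirichlet convolution identity *)

Fixpoint ins (p : nat) (l : list nat) : list nat :=
  match l with
  | nil => p :: nil
  | q :: l' => if Nat.leb p q then p :: l else q :: ins p l'
  end.

Lemma ins_perm p l : Permutation (p :: l) (ins p l).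
Proof.
  induction l as [|q l IH]; simpl; [reflexivity|].
  destruct (Nat.leb p q); [reflexivity|].
  rewrite perm_swap. now apply perm_skip.
Qed.

Lemma ins_sorted p l : Sorted le l -> Sorted le (ins p l).
Proof.
  induction l as [|q l IH]; simpl; intros H; [repeat constructor|].
  destruct (Nat.leb p q) eqn:E.
  - apply Nat.leb_le in E. constructor; [assumption|]. now constructor.
  - apply Nat.leb_gt in E. inversion H as [|? ? H1 H2]; subst.
    constructor; [now apply IH|].
    destruct l as [|r l]; simpl; [constructor; lia|].
    inversion H2; subst. destruct (Nat.leb p r); constructor; lia.
Qed.

(** Sorted lists are canonical forms of multisets: equality of representations may be checked up to
    permutation. *)
Lemma sorted_perm_eq l1 l2 : Sorted le l1 -> Sorted le l2 -> Permutation l1 l2 -> l1 = l2.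
Proof.
  intros H1 H2. apply Sorted_StronglySorted in H1; [|intros x y z; lia].
  apply Sorted_StronglySorted in H2; [|intros x y z; lia].
  revert l2 H2. induction H1 as [|a l1 H1 IH Ha]; intros l2 H2 HP.
  - apply Permutation_nil in HP. now subst.
  - destruct H2 as [|b l2 H2 Hb].
    + apply Permutation_sym, Permutation_nil in HP. discriminate.
    + assert (a = b).
      { rewrite Forall_forall in Ha, Hb.
        assert (Hin1 : In a (b :: l2)) by (rewrite <- HP; now left).
        assert (Hin2 : In b (a :: l1)) by (rewrite HP; now left).
        destruct Hin1 as [|Hin1]; [now subst|]. destruct Hin2 as [|Hin2]; [now subst|].
        specialize (Ha _ Hin2). specialize (Hb _ Hin1). lia. }
      subst b. apply Permutation_cons_inv in HP. f_equal. now apply IH.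
Qed.

Lemma sorted_remove l1 (p : nat) l2 : Sorted le (l1 ++ p :: l2) -> Sorted le (l1 ++ l2).
Proof.
  intros H. apply Sorted_StronglySorted in H; [|intros x y z; lia].
  apply StronglySorted_Sorted. induction l1 as [|a l1 IH]; simpl in *.
  - now inversion H.
  - inversion H as [|? ? H1 H2]; subst. constructor; [now apply IH|].
    rewrite Forall_forall in *. intros x Hx. apply H2. apply in_app_iff in Hx.
    apply in_app_iff. simpl. tauto.
Qed.

Lemma index_prod_perm p l l' : Permutation l l' -> index_prod p l = index_prod p l'.
Proof. induction 1; simpl; try congruence. ring. Qed.

Definition is_rep (P : beurling_system) (rep : nat -> list nat) : Prop :=
  (forall j : nat, Sorted le (rep j)) /\
  (forall i j : nat, rep i = rep j -> i = j) /\
  (forall l : list nat, Sorted le l -> exists j : nat, rep j = l) /\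
  (forall j : nat, gint P j = index_prod (gprime P) (rep j)).

Definition nu (P : beurling_system) (j : nat) : R := ln (gint P j).

Lemma index_prod_ge1 P l : 1 <= index_prod (gprime P) l.
Proof.
  induction l; simpl; [lra|]. pose proof (gprime_gt1_all P a). nra.
Qed.

Lemma gint_ge1 P j : 1 <= gint P j.
Proof. destruct (gint_enum P) as (rep & _ & _ & _ & H). rewrite H. apply index_prod_ge1. Qed.

Lemma nu_nonneg P j : 0 <= nu P j.
Proof. unfold nu. rewrite <- ln_1. apply ln_le'; [lra|apply gint_ge1]. Qed.

Definition ncover (P : beurling_system) (W : R) (m : nat) : Prop :=
  forall j, (m <= j)%nat -> W < nu P j.

Definition cnt (p : nat) (l : list nat) : R := INR (count_occ Nat.eq_dec l p).

(** Unique factorization in logarithmic form, [log n = sum_p v_p(n) log p], for a representation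
    rather than for its value, since different representations may have equal values. *)
Lemma ln_index_prod P l J : (forall q, In q l -> (q < J)%nat) ->
  ln (index_prod (gprime P) l) = lsum (fun p => cnt p l * lam P p) (seq 0 J).
Proof.
  induction l as [|a l IH]; intros H.
  - simpl. rewrite ln_1. symmetry. apply lsum_0. intros p _. unfold cnt. simpl. ring.
  - simpl index_prod. pose proof (index_prod_ge1 P l). pose proof (gprime_gt1_all P a).
    rewrite ln_mult by lra. rewrite IH by (intros; apply H; now right).
    rewrite (lsum_ext (fun p => cnt p (a :: l) * lam P p)
       (fun p => (if Nat.eq_dec a p then lam P p else 0) + cnt p l * lam P p)).
    + rewrite lsum_plus. f_equal.
      assert (Ha : (a < J)%nat) by (apply H; now left). clear - Ha.
      induction J; [lia|]. rewrite lsum_seq_S. destruct (Nat.eq_dec a J) as [->|h].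
      * rewrite lsum_0; [unfold lam; ring|]. intros x Hx. apply in_seq in Hx.
        destruct (Nat.eq_dec J x); [lia|reflexivity].
      * rewrite <- IHJ by lia. ring.
    + intros p _. unfold cnt. simpl. destruct (Nat.eq_dec a p); [|ring].
      rewrite S_INR. ring.
Qed.

Section Reindex.
Variables (P : beurling_system) (rep : nat -> list nat).
Hypothesis Hrep : is_rep P rep.

Lemma nu_ge_lam j p : In p (rep j) -> lam P p <= nu P j.
Proof.
  destruct Hrep as (_ & _ & _ & Hv). intros Hp. unfold lam, nu. rewrite Hv.
  apply ln_le'; [pose proof (gprime_gt1_all P p); lra|].
  induction (rep j) as [|a l IH]; [easy|]. simpl.
  pose proof (index_prod_ge1 P l). pose proof (gprime_gt1_all P a). pose proof (gprime_gt1_all P p).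
  destruct Hp as [->|Hp]; [nra|]. specialize (IH Hp). nra.
Qed.

(** Multiplication by the prime [p], transported to indices. A search finds the index, since
    equality of lists is decidable and surjectivity makes the search stop. *)
Lemma tau_ex (p : nat) : { tau : nat -> nat | forall i, rep (tau i) = ins p (rep i) }.
Proof.
  assert (H : forall i, { j | rep j = ins p (rep i) }).
  { intros i. apply constructive_indefinite_ground_description_nat.
    - intros j. apply list_eq_dec, Nat.eq_dec.
    - destruct Hrep as (Hs & _ & Hsur & _). apply Hsur, ins_sorted, Hs. }
  exists (fun i => proj1_sig (H i)). intros i. apply (proj2_sig (H i)).
Qed.

Lemma nu_tau p tau i : (forall i, rep (tau i) = ins p (rep i)) -> nu P (tau i) = lam P p + nu P i.
Proof.
  intros Ht. destruct Hrep as (_ & _ & _ & Hv). unfold nu, lam. rewrite !Hv, Ht.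
  rewrite <- (index_prod_perm _ _ _ (ins_perm p (rep i))). simpl.
  pose proof (index_prod_ge1 P (rep i)). pose proof (gprime_gt1_all P p).
  now rewrite ln_mult by lra.
Qed.

Lemma cnt_tau p tau i : (forall i, rep (tau i) = ins p (rep i)) ->
  cnt p (rep (tau i)) = cnt p (rep i) + 1.
Proof.
  intros Ht. unfold cnt. rewrite Ht.
  rewrite <- (proj1 (Permutation_count_occ Nat.eq_dec _ _) (ins_perm p (rep i))).
  simpl. destruct (Nat.eq_dec p p); [|easy]. now rewrite S_INR.
Qed.

(** Inserting the prime [p] is a bijection from all representations onto those
    that contain [p]. *)
Lemma reindex p tau (F : nat -> R) w m : (forall i, rep (tau i) = ins p (rep i)) ->
  ncover P w m -> (forall j, ~ In p (rep j) -> F j = 0) ->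
  lsum (fun j => if Rle_dec (nu P j) w then F j else 0) (seq 0 m)
  = lsum (fun i => if Rle_dec (nu P i) (w - lam P p) then F (tau i) else 0) (seq 0 m).
Proof.
  intros Ht Hm HF. destruct Hrep as (Hs & Hinj & Hsur & Hv).
  set (b1 := fun j => if in_dec Nat.eq_dec p (rep j) then
      (if Rle_dec (nu P j) w then true else false) else false).
  set (b2 := fun i => if Rle_dec (nu P i) (w - lam P p) then true else false).
  transitivity (lsum F (filter b1 (seq 0 m))).
  { rewrite lsum_filter. apply lsum_ext. intros j _. unfold b1.
    destruct (in_dec Nat.eq_dec p (rep j)) as [h|h].
    - now destruct (Rle_dec (nu P j) w).
    - rewrite HF by assumption. now destruct (Rle_dec (nu P j) w). }
  transitivity (lsum F (map tau (filter b2 (seq 0 m)))).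
  2:{ rewrite lsum_map, lsum_filter. apply lsum_ext. intros i _. unfold b2.
      now destruct (Rle_dec (nu P i) (w - lam P p)). }
  apply lsum_perm. apply NoDup_Permutation.
  - apply NoDup_filter, seq_NoDup.
  - apply FinFun.Injective_map_NoDup; [|apply NoDup_filter, seq_NoDup].
    intros i j Hij. apply Hinj.
    assert (HP : Permutation (p :: rep i) (p :: rep j)).
    { rewrite (ins_perm p (rep i)), (ins_perm p (rep j)), <- !Ht. now rewrite Hij. }
    apply Permutation_cons_inv in HP. now apply sorted_perm_eq.
  - intros j. rewrite filter_In, in_map_iff. split.
    + intros [Hj Hb]. unfold b1 in Hb.
      destruct (in_dec Nat.eq_dec p (rep j)) as [h|h]; [|discriminate].
      destruct (Rle_dec (nu P j) w) as [hw|hw]; [|discriminate].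
      destruct (in_split _ _ h) as (l1 & l2 & El).
      assert (Hl : Sorted le (l1 ++ l2)) by (apply sorted_remove with p; rewrite <- El; apply Hs).
      destruct (Hsur _ Hl) as [i Hi].
      assert (Hti : tau i = j).
      { apply Hinj. apply sorted_perm_eq; [apply Hs | apply Hs |].
        rewrite Ht, El, Hi. rewrite <- (ins_perm p (l1 ++ l2)). apply Permutation_middle. }
      exists i. split; [assumption|]. apply filter_In.
      assert (Hnu : nu P j = lam P p + nu P i) by (rewrite <- Hti; now apply nu_tau).
      split.
      * apply in_seq. split; [lia|]. destruct (le_lt_dec m i) as [hm|hm]; [|lia].
        specialize (Hm i hm). pose proof (lam_pos P p). lra.
      * unfold b2. destruct (Rle_dec _ _); [reflexivity|lra].
    + intros (i & Hti & Hi). apply filter_In in Hi. destruct Hi as [Hi Hb].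
      unfold b2 in Hb. destruct (Rle_dec (nu P i) (w - lam P p)) as [hw|hw]; [|discriminate].
      assert (Hnu : nu P j = lam P p + nu P i) by (rewrite <- Hti; now apply nu_tau).
      split.
      * apply in_seq. split; [lia|]. destruct (le_lt_dec m j) as [hm|hm]; [|lia].
        specialize (Hm j hm). lra.
      * unfold b1. destruct (in_dec Nat.eq_dec p (rep j)) as [h|h].
        -- destruct (Rle_dec _ _); [reflexivity|lra].
        -- exfalso. apply h. rewrite <- Hti, Ht, <- (ins_perm p (rep i)). now left.
Qed.

Definition expk (s v : R) : R := exp (- s * v).

Definition zetaW (s : R) (m : nat) (w : R) : R := step (reweigh (expk s) (atoms_N P m)) w.

Lemma zetaW_eq s m w :
  zetaW s m w = lsum (fun j => if Rle_dec (nu P j) w then expk s (nu P j) else 0) (seq 0 m).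
Proof.
  unfold zetaW. rewrite step_reweigh. unfold atoms_N. rewrite lsum_map.
  apply lsum_ext. intros j _. cbn [fst snd]. fold (nu P j). destruct (Rle_dec _ _); ring.
Qed.

(** The truncated Dirichlet series with coefficients [v_p(n)]. *)
Definition multW (s : R) (m p : nat) (w : R) : R :=
  lsum (fun j => if Rle_dec (nu P j) w then cnt p (rep j) * expk s (nu P j) else 0) (seq 0 m).

Lemma ncover_le W W' m : ncover P W m -> W' <= W -> ncover P W' m.
Proof. intros H h j Hj. specialize (H j Hj). lra. Qed.

(** Each [n] divisible by [p] is written [p n'], and [v_p(p n') = v_p(n') + 1] splits the sum into
    the two terms on the right. *)
Lemma multW_step s m p w : ncover P w m ->
  multW s m p w = expk s (lam P p) * (zetaW s m (w - lam P p) + multW s m p (w - lam P p)).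
Proof.
  intros Hm. destruct (tau_ex p) as [tau Ht]. unfold multW at 1.
  rewrite (reindex p tau (fun j => cnt p (rep j) * expk s (nu P j)) w m Ht Hm).
  - rewrite zetaW_eq. unfold multW. rewrite <- lsum_plus, <- lsum_scal.
    apply lsum_ext. intros i _. destruct (Rle_dec _ _); [|ring].
    rewrite (cnt_tau p tau i Ht), (nu_tau p tau i Ht).
    unfold expk. rewrite Rmult_plus_distr_l, exp_plus. ring.
  - intros j Hj. unfold cnt.
    rewrite (proj1 (count_occ_not_In Nat.eq_dec (rep j) p) Hj). simpl. ring.
Qed.

Lemma multW_small s m p w : w < lam P p -> multW s m p w = 0.
Proof.
  intros Hw. apply lsum_0. intros j _. destruct (Rle_dec _ _) as [h|h]; [|reflexivity].
  unfold cnt. destruct (in_dec Nat.eq_dec p (rep j)) as [hi|hi].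
  - apply nu_ge_lam in hi. lra.
  - rewrite (proj1 (count_occ_not_In Nat.eq_dec (rep j) p) hi). simpl. ring.
Qed.

(** Peeling off factors [p] one at a time produces the sum over the powers of [p]. The last term
    vanishes once [K log p] is close enough to [w], by [multW_small]. *)
Lemma multW_iter s m p w K : ncover P w m ->
  multW s m p w = lsum (fun k => expk s (INR (S k) * lam P p) * zetaW s m (w - INR (S k) * lam P p)) (seq 0 K)
     + expk s (INR K * lam P p) * multW s m p (w - INR K * lam P p).
Proof.
  intros Hm. induction K.
  - simpl lsum. simpl INR. unfold expk. rewrite !Rmult_0_l, Rmult_0_r, exp_0, Rminus_0_r. ring.
  - rewrite lsum_seq_S, IHK. rewrite (multW_step s m p (w - INR K * lam P p)).
    2:{ apply ncover_le with w; [assumption|]. pose proof (pos_INR K). pose proof (lam_pos P p). nra. }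
    replace (w - INR K * lam P p - lam P p) with (w - INR (S K) * lam P p) by (rewrite S_INR; ring).
    replace (expk s (INR (S K) * lam P p)) with (expk s (INR K * lam P p) * expk s (lam P p)); [ring|].
    unfold expk. rewrite <- exp_plus. f_equal. rewrite S_INR. ring.
Qed.

(** The identity [log * 1 = Lambda * 1] in truncated form: expand [log n] over primes, exchange the
    sums and insert [multW_iter] for each prime. *)
Lemma logW_eq s m J K w : ncover P w m -> pcover P w J -> w < INR (S K) * lam P 0 ->
  step (reweigh (fun v => v * expk s v) (atoms_N P m)) w
  = lsum (fun a => fst a * (expk s (snd a) * zetaW s m (w - snd a))) (atoms_psi P J K).
Proof.
  intros Hm HJ HK. rewrite step_reweigh. unfold atoms_N. rewrite lsum_map.
  transitivity (lsum (fun p => lam P p * multW s m p w) (seq 0 J)).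
  - unfold multW. rewrite (lsum_ext (fun p => lam P p * _)
      (fun p => lsum (fun j => lam P p * (if Rle_dec (nu P j) w then cnt p (rep j) * expk s (nu P j) else 0)) (seq 0 m)))
      by (intros p _; now rewrite lsum_scal).
    rewrite lsum_swap. apply lsum_ext. intros j _. cbn [fst snd]. fold (nu P j).
    destruct (Rle_dec (nu P j) w) as [h|h].
    + rewrite Rmult_1_l. unfold nu at 1. destruct Hrep as (_ & _ & _ & Hv). rewrite Hv.
      rewrite (ln_index_prod P (rep j) J).
      * rewrite Rmult_comm, <- lsum_scal. apply lsum_ext. intros p _. ring.
      * intros q Hq. apply nu_ge_lam in Hq. destruct (le_lt_dec J q) as [hJ|hJ]; [|assumption].
        specialize (HJ q hJ). lra.
    + symmetry. apply lsum_0. intros; ring.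
  - unfold atoms_psi. rewrite lsum_flat_map. apply lsum_ext. intros p _.
    rewrite lsum_map. rewrite (multW_iter s m p w K Hm).
    rewrite (multW_small s m p (w - INR K * lam P p)).
    + rewrite Rmult_0_r, Rplus_0_r, <- lsum_scal. apply lsum_ext. intros k _. reflexivity.
    + rewrite S_INR in HK. pose proof (lam_ge P p). pose proof (pos_INR K). nra.
Qed.
End Reindex.

Lemma step_neg L w : (forall p, In p L -> 0 <= snd p) -> w < 0 -> step L w = 0.
Proof.
  intros HL Hw. apply lsum_0. intros p Hp. specialize (HL p Hp).
  destruct (Rle_dec _ _); [lra|reflexivity].
Qed.

Lemma expk_derive s v : is_derive (expk s) v (- s * expk s v).
Proof. unfold expk. auto_derive; [exact I|ring]. Qed.

Lemma expk_continuous s v : continuous (expk s) v.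
Proof. apply (ex_derive_continuous (V := R_NormedModule)). eexists. apply expk_derive. Qed.

Lemma expk_pos s v : 0 < expk s v.
Proof. apply exp_pos. Qed.

Lemma reweigh_nonneg k L : (forall p, In p L -> 0 <= fst p) -> (forall v, 0 <= k v) ->
  forall p, In p (reweigh k L) -> 0 <= fst p.
Proof.
  intros HL Hk p Hp. apply in_map_iff in Hp. destruct Hp as (q & <- & Hq). simpl.
  apply Rmult_le_pos; auto.
Qed.

(** Partial summation turns [step L v <= C e^v] into the integral of [a C e^((1-a)v)], which
    converges for [a > 1]; hence a bound independent of [W]. *)
Lemma dirichlet_bound L C a W : 1 < a -> 0 <= W -> 0 <= C ->
  (forall p, In p L -> 0 <= snd p) -> (forall p, In p L -> 0 <= fst p) ->
  (forall v, 0 <= v <= W -> step L v <= C * exp v) ->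
  0 <= step (reweigh (expk a) L) W <= C * (1 + a / (a - 1)).
Proof.
  intros Ha HW HC Hloc Hwt Hb. split.
  { apply step_nonneg. apply reweigh_nonneg; auto. intros; left; apply expk_pos. }
  assert (HA : is_RInt (fun v => - a * expk a v * step L v) 0 W
     (expk a W * step L W - step (reweigh (expk a) L) W)).
  { apply (abel_step (expk a) (fun v => - a * expk a v)); auto.
    - intros; apply expk_derive.
    - intros v _. apply (continuous_mult (K := R_AbsRing)); [apply continuous_const|apply expk_continuous]. }
  pose proof (RInt_exp_bound (fun v => - a * expk a v * step L v) (a * C) (1 - a) 0 W
     ltac:(lra) HW ltac:(eexists; exact HA)) as H.
  rewrite (is_RInt_unique _ _ _ _ HA) in H.
  assert (Hx : forall v, 0 <= v <= W -> expk a v * step L v <= C * exp ((1 - a) * v)).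
  { intros v Hv. replace ((1 - a) * v) with (v + - a * v) by ring. rewrite exp_plus. fold (expk a v).
    specialize (Hb v Hv). pose proof (expk_pos a v). nra. }
  assert (Hs0 : forall v, 0 <= step L v) by (intros; now apply step_nonneg).
  assert (H1 : Rabs (expk a W * step L W - step (reweigh (expk a) L) W) <= a * C / (1 - a) * (exp ((1 - a) * W) - exp ((1 - a) * 0))).
  { apply H. intros v Hv. specialize (Hx v Hv).
    assert (0 <= expk a v * step L v) by (apply Rmult_le_pos; [left; apply expk_pos | apply Hs0]).
    rewrite Rmult_assoc, Rabs_mult, Rabs_Ropp, (Rabs_pos_eq a), (Rabs_pos_eq (_ * _)) by lra.
    rewrite Rmult_assoc. apply Rmult_le_compat_l; lra. }
  rewrite Rmult_0_r, exp_0 in H1. specialize (Hx W ltac:(lra)).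
  assert (HaW : (1 - a) * W <= 0 * W) by (apply Rmult_le_compat_r; lra). rewrite Rmult_0_l in HaW.
  assert (HeW : exp ((1 - a) * W) <= exp 0) by (apply exp_le; exact HaW). rewrite exp_0 in HeW.
  pose proof (exp_pos ((1 - a) * W)).
  assert (a * C / (1 - a) * (exp ((1 - a) * W) - 1) <= C * (a / (a - 1))).
  { replace (a * C / (1 - a) * (exp ((1 - a) * W) - 1)) with (C * (a / (a - 1)) * (1 - exp ((1 - a) * W))) by (field; lra).
    assert (0 <= C * (a / (a - 1))) by (apply Rmult_le_pos; [assumption|]; apply Rdiv_le_0_compat; lra).
    set (q := C * (a / (a - 1))) in *. clearbody q. clear - H0 H2.
    set (e := exp ((1 - a) * W)) in *. clearbody e. nra. }
  assert (C * exp ((1 - a) * W) <= C * 1) by (apply Rmult_le_compat_l; assumption).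
  rewrite Rmult_plus_distr_l.
  apply Rabs_le_between in H1. unfold Rminus in *. lra.
Qed.

Lemma atoms_N_loc P m p : In p (atoms_N P m) -> 0 <= snd p.
Proof. intros H. apply in_map_iff in H. destruct H as (j & <- & _). apply nu_nonneg. Qed.

Lemma atoms_N_wt P m p : In p (atoms_N P m) -> 0 <= fst p.
Proof. intros H. apply in_map_iff in H. destruct H as (j & <- & _). simpl. lra. Qed.

Lemma atoms_psi_loc0 P J K p : In p (atoms_psi P J K) -> 0 <= snd p.
Proof. intros H. apply atoms_psi_loc in H. pose proof (lam0_pos P). lra. Qed.

(** Rankin's trick: the terms with product beyond [e^w] lose a factor [e^(-eta w)]. *)
Lemma log_derivative_truncated P s CN Cp : 1 < s -> 0 <= CN -> 0 <= Cp ->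
  exists C, forall w m J K, 0 <= w -> ncover P w m -> pcover P w J -> w < INR (S K) * lam P 0 ->
  (forall v, 0 <= v <= w -> step (atoms_N P m) v <= CN * exp v) ->
  (forall v, 0 <= v <= w -> step (atoms_psi P J K) v <= Cp * exp v) ->
  Rabs (step (reweigh (expk s) (atoms_psi P J K)) w * step (reweigh (expk s) (atoms_N P m)) w
     - step (reweigh (fun v => v * expk s v) (atoms_N P m)) w) <= C * exp (- ((s - 1) / 2) * w).
Proof.
  intros Hs HCN HCp. set (eta := (s - 1) / 2). assert (Heta : 0 < eta) by (unfold eta; lra).
  (* The exponent [a = (s + 1)/2] still exceeds 1, so both series converge at [a]; the remaining
     [eta] pays for the truncation. *)
  set (a := s - eta). assert (Ha : 1 < a) by (unfold a, eta; lra).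
  exists (Cp * (1 + a / (a - 1)) * (CN * (1 + a / (a - 1)))).
  intros w m J K Hw Hm HJ HK HbN Hbp.
  destruct (gint_enum P) as [rep Hrep].
  rewrite (logW_eq P rep Hrep s m J K w Hm HJ HK).
  fold (zetaW P s m w).
  pose proof (dirichlet_bound (atoms_N P m) CN a w Ha Hw HCN (atoms_N_loc P m) (atoms_N_wt P m) HbN) as HN.
  pose proof (dirichlet_bound (atoms_psi P J K) Cp a w Ha Hw HCp (atoms_psi_loc0 P J K) (atoms_psi_wt P J K) Hbp) as HP.
  set (ZN := step (reweigh (expk a) (atoms_N P m)) w) in *.
  set (B := 1 + a / (a - 1)) in *.
  (* A missing term has [log n > w - l], where [n^(-s) = n^(-eta) n^(-a)] is at most
     [e^(-eta (w - l)) n^(-a)]. *)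
  assert (Hdiff : forall l, 0 <= l <= w ->
     0 <= zetaW P s m w - zetaW P s m (w - l) <= expk eta w * exp (eta * l) * ZN).
  { intros l Hl. split.
    - assert (zetaW P s m (w - l) <= zetaW P s m w); [|lra].
      apply step_mono; [|lra]. apply reweigh_nonneg; [apply atoms_N_wt | intros; left; apply expk_pos].
    - unfold ZN. unfold zetaW. rewrite !step_reweigh.
      apply Rle_trans with (lsum (fun p => if Rle_dec (snd p) w then expk eta w * exp (eta * l) * (fst p * expk a (snd p)) else 0) (atoms_N P m)
        + lsum (fun p => if Rle_dec (snd p) (w - l) then fst p * expk s (snd p) else 0) (atoms_N P m)
        - lsum (fun p => if Rle_dec (snd p) (w - l) then fst p * expk s (snd p) else 0) (atoms_N P m)).
      + unfold Rminus. apply Rplus_le_compat_r. rewrite <- lsum_plus. apply lsum_le.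
        intros p Hp. apply atoms_N_wt in Hp.
        assert (0 <= fst p * expk s (snd p)) by (apply Rmult_le_pos; [assumption|left; apply expk_pos]).
        assert (0 <= expk eta w * exp (eta * l) * (fst p * expk a (snd p))).
        { apply Rmult_le_pos; apply Rmult_le_pos; auto; left; apply exp_pos. }
        destruct (Rle_dec (snd p) w), (Rle_dec (snd p) (w + - l)); try lra.
        rewrite Rplus_0_r.
        replace (expk eta w * exp (eta * l) * (fst p * expk a (snd p)))
          with (fst p * (expk eta w * exp (eta * l) * expk a (snd p))) by ring.
        apply Rmult_le_compat_l; [assumption|]. unfold expk. rewrite <- !exp_plus.
        apply exp_le. unfold a. nra.
      + unfold Rminus. rewrite Rplus_assoc, Rplus_opp_r, Rplus_0_r.
        rewrite <- lsum_scal. apply lsum_le. intros p _. destruct (Rle_dec _ _); lra. }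
  rewrite (step_reweigh (expk s) (atoms_psi P J K)).
  rewrite Rmult_comm, <- lsum_scal.
  match goal with |- Rabs (?x - ?y) <= _ =>
    replace (x - y) with (lsum (fun p => if Rle_dec (snd p) w then fst p * (expk s (snd p) * (zetaW P s m w - zetaW P s m (w - snd p))) else 0) (atoms_psi P J K)) end.
  2:{ match goal with |- ?z = ?x - ?y => assert (E : x = z + y); [|lra] end.
      rewrite <- lsum_plus. apply lsum_ext. intros p Hp.
      destruct (Rle_dec (snd p) w); [ring|].
      assert (Hz : zetaW P s m (w - snd p) = 0).
      { apply step_neg; [|lra]. apply reweigh_loc, atoms_N_loc. }
      rewrite Hz. ring. }
  eapply Rle_trans; [apply lsum_abs|].
  apply Rle_trans with (expk eta w * ZN * step (reweigh (expk a) (atoms_psi P J K)) w).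
  - rewrite step_reweigh, <- lsum_scal. apply lsum_le. intros p Hp.
    pose proof (atoms_psi_wt _ _ _ _ Hp) as Hp1. pose proof (atoms_psi_loc0 _ _ _ _ Hp) as Hp2.
    destruct (Rle_dec (snd p) w) as [h|h]; [|rewrite Rabs_R0; lra].
    specialize (Hdiff (snd p) (conj Hp2 h)).
    pose proof (expk_pos s (snd p)).
    rewrite Rabs_pos_eq by (repeat apply Rmult_le_pos; lra).
    apply Rle_trans with (fst p * (expk s (snd p) * (expk eta w * exp (eta * snd p) * ZN))).
    + apply Rmult_le_compat_l; [assumption|]. apply Rmult_le_compat_l; lra.
    + right. replace (expk a (snd p)) with (expk s (snd p) * exp (eta * snd p)).
      * ring.
      * unfold expk. rewrite <- exp_plus. f_equal. unfold a. ring.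
  - change (exp (- eta * w)) with (expk eta w).
    assert (0 <= B).
    { unfold B. assert (0 <= a / (a - 1)) by (apply Rdiv_le_0_compat; lra). lra. }
    pose proof (expk_pos eta w).
    replace (Cp * B * (CN * B) * expk eta w) with (expk eta w * (CN * B) * (Cp * B)) by ring.
    apply Rmult_le_compat; try lra; [apply Rmult_le_pos; lra|].
    apply Rmult_le_compat_l; lra.
Qed.

(** * Complex series, handled through real and imaginary parts *)

Lemma im_le_Cmod (c : C) : Rabs (Im c) <= Cmod c.
Proof. eapply Rle_trans; [apply Rmax_r | apply (Rmax_Cmod c)]. Qed.

Lemma Cmod_le_abs (c : C) : Cmod c <= Rabs (Re c) + Rabs (Im c).
Proof.
  replace c with (RtoC (Re c) + Ci * RtoC (Im c))%C.
  - eapply Rle_trans; [apply Cmod_triangle|].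
    rewrite Cmod_mult, Cmod_Ci, !Cmod_R. destruct c; unfold Re, Im, RtoC, Ci, Cplus, Cmult; simpl.
    rewrite Rmult_1_l. right. f_equal; f_equal; ring.
  - destruct c. unfold Re, Im, RtoC, Ci, Cplus, Cmult; simpl. f_equal; ring.
Qed.

Lemma C_ext (a b : C) : Re a = Re b -> Im a = Im b -> a = b.
Proof. destruct a, b; simpl; intros; congruence. Qed.

Fixpoint csum (u : nat -> C) (n : nat) : C :=
  match n with O => RtoC 0 | S n => (csum u n + u n)%C end.

Lemma csum_Re u n : Re (csum u n) = lsum (fun k => Re (u k)) (seq 0 n).
Proof. induction n; [reflexivity|]. rewrite lsum_seq_S, <- IHn. reflexivity. Qed.
Lemma csum_Im u n : Im (csum u n) = lsum (fun k => Im (u k)) (seq 0 n).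
Proof. induction n; [reflexivity|]. rewrite lsum_seq_S, <- IHn. reflexivity. Qed.

Lemma csum_ext u w n : (forall k, (k < n)%nat -> u k = w k) -> csum u n = csum w n.
Proof.
  induction n; intros H; [reflexivity|]. simpl. rewrite IHn, H by (intros; try apply H; lia).
  reflexivity.
Qed.

Lemma csum_scal c u n : csum (fun k => c * u k)%C n = (c * csum u n)%C.
Proof. induction n; simpl; [ring|]. rewrite IHn. ring. Qed.

Definition Cser (u : nat -> C) : C := (Series (fun n => Re (u n)), Series (fun n => Im (u n))).
Definition cabs (u : nat -> C) : Prop := ex_series (fun n => Cmod (u n)).

Lemma cabs_re u : cabs u -> ex_series (fun n => Rabs (Re (u n))).
Proof.
  intros H. apply (ex_series_le (V := R_CompleteNormedModule)) with (2 := H).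
  intros n. change (Rabs (Rabs (Re (u n))) <= Cmod (u n)). rewrite Rabs_Rabsolu. apply re_le_Cmod.
Qed.
Lemma cabs_im u : cabs u -> ex_series (fun n => Rabs (Im (u n))).
Proof.
  intros H. apply (ex_series_le (V := R_CompleteNormedModule)) with (2 := H).
  intros n. change (Rabs (Rabs (Im (u n))) <= Cmod (u n)). rewrite Rabs_Rabsolu. apply im_le_Cmod.
Qed.

Lemma Cser_ext u w : (forall n, u n = w n) -> Cser u = Cser w.
Proof. intros H. unfold Cser. f_equal; apply Series_ext; intros n; now rewrite H. Qed.

Lemma cabs_le u (b : nat -> R) : (forall n, Cmod (u n) <= b n) -> ex_series b -> cabs u.
Proof.
  intros H Hb. apply (ex_series_le (V := R_CompleteNormedModule)) with (2 := Hb).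
  intros n. change (Rabs (Cmod (u n)) <= b n). rewrite Rabs_pos_eq by apply Cmod_ge_0. apply H.
Qed.

Lemma Cser_plus u w : cabs u -> cabs w -> Cser (fun n => u n + w n)%C = (Cser u + Cser w)%C.
Proof.
  intros Hu Hw. unfold Cser, Cplus. simpl. f_equal.
  - apply Series_plus; apply ex_series_Rabs, cabs_re; assumption.
  - apply Series_plus; apply ex_series_Rabs, cabs_im; assumption.
Qed.

Lemma Cser_scal c u : cabs u -> Cser (fun n => c * u n)%C = (c * Cser u)%C.
Proof.
  intros Hu. assert (H1 := ex_series_Rabs _ (cabs_re u Hu)). assert (H2 := ex_series_Rabs _ (cabs_im u Hu)).
  apply C_ext; unfold Cser; destruct c as [a b]; unfold Re, Im, Cmult; simpl; fold (Re) in *.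
  - rewrite Series_minus.
    + now rewrite !Series_scal_l.
    + now apply (ex_series_scal (V := R_NormedModule)).
    + now apply (ex_series_scal (V := R_NormedModule)).
  - rewrite Series_plus.
    + now rewrite !Series_scal_l.
    + now apply (ex_series_scal (V := R_NormedModule)).
    + now apply (ex_series_scal (V := R_NormedModule)).
Qed.

(** The factor [q] may depend on [M]: with [q = (r / r1)^M] it yields geometric decay of the
    remainder against one fixed majorant. *)
Lemma series_tail (a b : nat -> R) q M : 0 <= q ->
  (forall n, (M <= n)%nat -> Rabs (a n) <= q * b n) -> (forall n, 0 <= b n) -> ex_series b ->
  ex_series (fun n => Rabs (a n)) ->
  Rabs (Series a - lsum a (seq 0 M)) <= q * Series b.
Proof.
  intros Hq Hab Hb Hbs Ha.
  assert (E : forall f : nat -> R, ex_series f ->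
    Series f - lsum f (seq 0 M) = Series (fun k => f (M + k)%nat)).
  { intros f Hf. destruct M as [|M].
    - simpl. rewrite Rminus_0_r. now apply Series_ext.
    - rewrite (Series_incr_n f (S M)) by (lia || assumption).
      rewrite lsum_sum_n, sum_n_Reals. simpl pred. ring. }
  rewrite (E a (ex_series_Rabs _ Ha)).
  assert (Hb' : 0 <= lsum b (seq 0 M)) by (apply lsum_nonneg; intros; apply Hb).
  apply Rle_trans with (q * Series (fun k => b (M + k)%nat)).
  2:{ apply Rmult_le_compat_l; [assumption|]. rewrite <- (E b Hbs). lra. }
  assert (Hbs' : ex_series (fun k => b (M + k)%nat)) by now apply (ex_series_incr_n (V := R_NormedModule)).
  assert (Ha' : ex_series (fun k => Rabs (a (M + k)%nat))).
  { apply (ex_series_incr_n (V := R_NormedModule) (fun n => Rabs (a n)) M). assumption. }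
  eapply Rle_trans; [apply Series_Rabs; assumption|].
  rewrite <- Series_scal_l. apply Series_le.
  - intros n. split; [apply Rabs_pos|]. apply Hab. lia.
  - now apply (ex_series_scal (V := R_NormedModule)).
Qed.

Lemma Cser_tail u (b : nat -> R) q M : 0 <= q ->
  (forall n, (M <= n)%nat -> Cmod (u n) <= q * b n) -> (forall n, 0 <= b n) -> ex_series b ->
  cabs u -> Cmod (Cser u - csum u M)%C <= 2 * (q * Series b).
Proof.
  intros Hq Hab Hb Hbs Hu.
  eapply Rle_trans; [apply Cmod_le_abs|].
  assert (E1 : Re (Cser u - csum u M)%C = Series (fun n => Re (u n)) - lsum (fun n => Re (u n)) (seq 0 M)).
  { rewrite <- csum_Re. reflexivity. }
  assert (E2 : Im (Cser u - csum u M)%C = Series (fun n => Im (u n)) - lsum (fun n => Im (u n)) (seq 0 M)).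
  { rewrite <- csum_Im. reflexivity. }
  rewrite E1, E2.
  assert (Rabs (Series (fun n => Re (u n)) - lsum (fun n => Re (u n)) (seq 0 M)) <= q * Series b).
  { apply series_tail; auto; [|now apply cabs_re].
    intros n Hn. eapply Rle_trans; [apply re_le_Cmod | now apply Hab]. }
  assert (Rabs (Series (fun n => Im (u n)) - lsum (fun n => Im (u n)) (seq 0 M)) <= q * Series b).
  { apply series_tail; auto; [|now apply cabs_im].
    intros n Hn. eapply Rle_trans; [apply im_le_Cmod | now apply Hab]. }
  lra.
Qed.

Lemma Cser_bound u (b : nat -> R) : (forall n, Cmod (u n) <= b n) -> ex_series b ->
  Cmod (Cser u) <= 2 * Series b.
Proof.
  intros H Hb.
  assert (Hb0 : forall n, 0 <= b n) by (intros n; eapply Rle_trans; [apply Cmod_ge_0|apply H]).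
  pose proof (Cser_tail u b 1 0 ltac:(lra)) as HT.
  replace (Cser u) with (Cser u - csum u 0)%C by (simpl; ring).
  rewrite Rmult_1_l in HT. apply HT; auto.
  - intros n _. rewrite Rmult_1_l. apply H.
  - now apply cabs_le with b.
Qed.

(** A geometric rate for the remainders already proves convergence, so no summability has to be
    known beforehand. *)
Lemma Cser_unique u l K q : 0 <= q < 1 -> (forall M, Cmod (l - csum u M)%C <= K * q ^ M) -> Cser u = l.
Proof.
  intros Hq H.
  assert (HK : is_lim_seq (fun M => K * q ^ M) 0).
  { replace (Finite 0) with (Rbar_mult K 0) by (simpl; f_equal; ring).
    apply is_lim_seq_scal_l. apply is_lim_seq_geom. rewrite Rabs_pos_eq; lra. }
  assert (G : forall f : nat -> R, forall x, (forall M, Rabs (x - lsum f (seq 0 M)) <= K * q ^ M) -> Series f = x).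
  { intros f x Hf. apply is_series_unique.
    change (is_lim_seq (sum_n f) x). apply is_lim_seq_ext with (fun n => lsum f (seq 0 (S n))).
    - intros n. apply lsum_sum_n.
    - apply -> (is_lim_seq_incr_1 (fun n => lsum f (seq 0 n))).
      apply is_lim_seq_ext with (fun n => x - (x - lsum f (seq 0 n))); [intros; ring|].
      replace (Finite x) with (Finite (x - 0)) by (f_equal; ring).
      apply is_lim_seq_minus'; [apply is_lim_seq_const|].
      apply is_lim_seq_abs_0.
      apply is_lim_seq_le_le with (fun _ => 0) (fun M => K * q ^ M); auto.
      + intros n. split; [apply Rabs_pos | apply Hf].
      + apply is_lim_seq_const. }
  apply C_ext; unfold Cser.
  - apply G. intros M. rewrite <- csum_Re. eapply Rle_trans; [|apply H].
    eapply Rle_trans; [|apply re_le_Cmod]. right. reflexivity.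
  - apply G. intros M. rewrite <- csum_Im. eapply Rle_trans; [|apply H].
    eapply Rle_trans; [|apply im_le_Cmod]. right. reflexivity.
Qed.

(** * The complex exponential *)

Definition ce (z : C) : C := (exp (Re z) * cos (Im z), exp (Re z) * sin (Im z)).

Lemma ce_add a b : ce (a + b) = (ce a * ce b)%C.
Proof.
  unfold ce, Cmult; destruct a as [a1 a2], b as [b1 b2]; simpl.
  rewrite exp_plus, cos_plus, sin_plus. f_equal; ring.
Qed.

Lemma Cmod_ce z : Cmod (ce z) = exp (Re z).
Proof.
  unfold Cmod, ce; simpl.
  replace (exp (Re z) * cos (Im z) * (exp (Re z) * cos (Im z) * 1) +
     exp (Re z) * sin (Im z) * (exp (Re z) * sin (Im z) * 1)) with (exp (Re z) * exp (Re z)).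
  - apply sqrt_square. left. apply exp_pos.
  - pose proof (sin2_cos2 (Im z)) as H. unfold Rsqr in H.
    transitivity (exp (Re z) * exp (Re z) * (sin (Im z) * sin (Im z) + cos (Im z) * cos (Im z))); [rewrite H; ring|ring].
Qed.

Lemma ce_0 : ce 0 = RtoC 1.
Proof. unfold ce; simpl. rewrite exp_0, cos_0, sin_0. unfold RtoC. f_equal; ring. Qed.

(** Were the radius smaller than [rho], the terms would be bounded at the midpoint between the two,
    beyond the radius of convergence. *)
Lemma CV_radius_ge (a : nat -> R) (rho : R) : 0 < rho ->
  (forall r, 0 < r < rho -> exists M, forall n, Rabs (a n) * r ^ n <= M) ->
  Rbar_le rho (CV_radius a).
Proof.
  intros Hrho H.
  destruct (CV_radius_bounded a) as [Hub _].
  destruct (Rbar_le_lt_dec rho (CV_radius a)) as [|h]; [assumption|exfalso].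
  assert (H0 : Rbar_le 0 (CV_radius a)) by apply CV_radius_ge_0.
  destruct (CV_radius a) as [x| |]; simpl in h, H0; try lra.
  set (r := (x + rho) / 2).
  destruct (H r ltac:(unfold r; lra)) as [M HM].
  assert (Rbar_le r x).
  { apply Hub. exists M. intros n. rewrite Rabs_mult, <- RPow_abs, (Rabs_pos_eq r) by (unfold r; lra). apply HM. }
  simpl in H1. unfold r in H1. lra.
Qed.

Lemma pow_fact_le_exp x n : 0 <= x -> x ^ n / INR (fact n) <= exp x.
Proof.
  intros Hx. pose proof (is_exp_Reals x) as H. apply is_pseries_unique in H.
  rewrite <- H. unfold PSeries.
  assert (Hex : ex_series (fun k => / INR (fact k) * x ^ k)).
  { assert (E : ex_pseries (fun n => / INR (fact n)) x) by (eexists; apply is_exp_Reals).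
    now apply ex_pseries_R in E. }
  assert (Hpos : forall k, 0 <= / INR (fact k) * x ^ k).
  { intros k. apply Rmult_le_pos; [left; apply Rinv_0_lt_compat, INR_fact_lt_0 | now apply pow_le]. }
  assert (0 <= Series (fun k => / INR (fact k) * x ^ k) - lsum (fun k => / INR (fact k) * x ^ k) (seq 0 (S n))).
  { rewrite (Series_incr_n _ (S n)) by (lia || assumption).
    rewrite lsum_sum_n, sum_n_Reals. simpl pred.
    assert (0 <= Series (fun k => / INR (fact (S n + k)) * x ^ (S n + k))); [|lra].
    apply Rle_trans with (Series (fun _ => 0)).
    { rewrite (Series_finite (fun _ => 0) 0) by reflexivity. simpl. lra. }
    apply Series_le.
    - intros k. split; [lra|]. apply Hpos.
    - apply (ex_series_incr_n (V := R_NormedModule) (fun k => / INR (fact k) * x ^ k) (S n)). assumption. }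
  rewrite lsum_seq_S in H0.
  assert (0 <= lsum (fun k => / INR (fact k) * x ^ k) (seq 0 n)) by (apply lsum_nonneg; intros; apply Hpos).
  unfold Rdiv. rewrite Rmult_comm. lra.
Qed.

Lemma ex_series_exp x : ex_series (fun n => x ^ n / INR (fact n)).
Proof.
  assert (E : ex_pseries (fun n => / INR (fact n)) x) by (eexists; apply is_exp_Reals).
  apply ex_pseries_R in E. apply ex_series_ext with (2 := E). intros n. apply Rmult_comm.
Qed.

Lemma Series_exp x : Series (fun n => x ^ n / INR (fact n)) = exp x.
Proof.
  rewrite <- (is_pseries_unique _ _ _ (is_exp_Reals x)). unfold PSeries.
  apply Series_ext. intros n. unfold Rdiv. ring.
Qed.

Definition cexpt (z : C) (n : nat) : C := (z ^ n * RtoC (/ INR (fact n)))%C.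

Lemma Cmod_cexpt z n : Cmod (cexpt z n) = Cmod z ^ n / INR (fact n).
Proof.
  unfold cexpt. rewrite Cmod_mult, Cmod_pow, Cmod_R, Rabs_pos_eq; [reflexivity|].
  left; apply Rinv_0_lt_compat, INR_fact_lt_0.
Qed.

Lemma cexpt_S z n : (RtoC (INR (S n)) * cexpt z (S n) = z * cexpt z n)%C.
Proof.
  unfold cexpt. rewrite Cpow_S, fact_simpl, mult_INR.
  assert (H1 : INR (fact n) <> 0) by apply INR_fact_neq_0.
  assert (H2 : INR (S n) <> 0) by (apply not_0_INR; lia).
  rewrite Rinv_mult, RtoC_mult.
  assert (E : (RtoC (INR (S n)) * RtoC (/ INR (S n)) = RtoC 1)%C).
  { rewrite <- RtoC_mult. f_equal. now apply Rinv_r. }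
  transitivity ((RtoC (INR (S n)) * RtoC (/ INR (S n))) * (z * (z ^ n * RtoC (/ INR (fact n)))))%C; [ring|].
  rewrite E. ring.
Qed.

Lemma cabs_cexpt z : cabs (cexpt z).
Proof.
  apply cabs_le with (fun n => Cmod z ^ n / INR (fact n)); [|apply ex_series_exp].
  intros n. rewrite Cmod_cexpt. lra.
Qed.

(** Along the real parameter [r], the series at [r z] satisfies the linear differential equation of
    [e^(rz)]; comparing the two at [r = 1] gives the claim. *)
Lemma ce_series z : Cser (cexpt z) = ce z.
Proof.
  set (a := fun n => Re (cexpt z n)). set (b := fun n => Im (cexpt z n)).
  assert (Hrad : forall c : nat -> R, (forall n, Rabs (c n) <= Cmod z ^ n / INR (fact n)) -> forall r, Rbar_lt (Rabs r) (CV_radius c)).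
  { intros c Hc r. apply Rbar_lt_le_trans with (Rabs r + 1); [simpl; lra|].
    pose proof (Rabs_pos r).
    apply CV_radius_ge; [lra|]. intros s Hs. exists (exp (Cmod z * s)).
    intros n. eapply Rle_trans; [|apply pow_fact_le_exp].
    - rewrite Rpow_mult_distr. unfold Rdiv. rewrite Rmult_assoc, (Rmult_comm (s ^ n)), <- Rmult_assoc.
      apply Rmult_le_compat_r; [apply pow_le; lra | apply Hc].
    - apply Rmult_le_pos; [apply Cmod_ge_0 | lra]. }
  assert (Ha : forall r, Rbar_lt (Rabs r) (CV_radius a)).
  { apply Hrad. intros n. unfold a. rewrite <- Cmod_cexpt. apply re_le_Cmod. }
  assert (Hb : forall r, Rbar_lt (Rabs r) (CV_radius b)).
  { apply Hrad. intros n. unfold b. rewrite <- Cmod_cexpt. apply im_le_Cmod. }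
  set (x := Re z). set (y := Im z).
  assert (HSa : forall n, PS_derive a n = x * a n - y * b n).
  { intros n. unfold PS_derive, a, b, x, y. pose proof (cexpt_S z n) as E.
    apply (f_equal Re) in E. rewrite re_scal_l in E. rewrite E. reflexivity. }
  assert (HSb : forall n, PS_derive b n = x * b n + y * a n).
  { intros n. unfold PS_derive, a, b, x, y. pose proof (cexpt_S z n) as E.
    apply (f_equal Im) in E. rewrite im_scal_l in E. rewrite E. reflexivity. }
  assert (exa : forall r, ex_series (fun n => a n * r ^ n)).
  { intros r. specialize (Ha r). apply CV_radius_inside in Ha. now apply ex_pseries_R in Ha. }
  assert (exb : forall r, ex_series (fun n => b n * r ^ n)).
  { intros r. specialize (Hb r). apply CV_radius_inside in Hb. now apply ex_pseries_R in Hb. }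
  assert (Da : forall r, is_derive (PSeries a) r (x * PSeries a r - y * PSeries b r)).
  { intros r. pose proof (is_derive_PSeries a r (Ha r)) as H.
    replace (x * PSeries a r - y * PSeries b r) with (PSeries (PS_derive a) r); [assumption|].
    unfold PSeries. rewrite <- !Series_scal_l, <- Series_minus.
    - apply Series_ext. intros n. rewrite HSa. ring.
    - apply (ex_series_scal (V := R_NormedModule)). apply exa.
    - apply (ex_series_scal (V := R_NormedModule)). apply exb. }
  assert (Db : forall r, is_derive (PSeries b) r (x * PSeries b r + y * PSeries a r)).
  { intros r. pose proof (is_derive_PSeries b r (Hb r)) as H.
    replace (x * PSeries b r + y * PSeries a r) with (PSeries (PS_derive b) r); [assumption|].
    unfold PSeries. rewrite <- !Series_scal_l, <- Series_plus.
    - apply Series_ext. intros n. rewrite HSb. ring.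
    - apply (ex_series_scal (V := R_NormedModule)). apply exb.
    - apply (ex_series_scal (V := R_NormedModule)). apply exa. }
  (* [H1 + i H2] is [e^(-rz)] times the series at [r z]; its derivative vanishes, so its value at 1
     equals its value 1 at 0. *)
  set (H1 := fun r => exp (- x * r) * (PSeries a r * cos (y * r) + PSeries b r * sin (y * r))).
  set (H2 := fun r => exp (- x * r) * (PSeries b r * cos (y * r) - PSeries a r * sin (y * r))).
  assert (E1 : H1 0 = H1 1).
  { apply (eq_is_derive (V := R_NormedModule) H1 0 1); [|lra]. intros r _. unfold H1, zero; simpl.
    auto_derive.
    - repeat split; eexists; [apply Da | apply Db].
    - replace (Derive (fun x0 => PSeries a x0) r) with (x * PSeries a r - y * PSeries b r)
        by (symmetry; apply is_derive_unique, Da).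
      replace (Derive (fun x0 => PSeries b x0) r) with (x * PSeries b r + y * PSeries a r)
        by (symmetry; apply is_derive_unique, Db). ring. }
  assert (E2 : H2 0 = H2 1).
  { apply (eq_is_derive (V := R_NormedModule) H2 0 1); [|lra]. intros r _. unfold H2, zero; simpl.
    auto_derive.
    - repeat split; eexists; [apply Db | apply Da].
    - replace (Derive (fun x0 => PSeries a x0) r) with (x * PSeries a r - y * PSeries b r)
        by (symmetry; apply is_derive_unique, Da).
      replace (Derive (fun x0 => PSeries b x0) r) with (x * PSeries b r + y * PSeries a r)
        by (symmetry; apply is_derive_unique, Db). ring. }
  assert (A0 : PSeries a 0 = 1).
  { rewrite PSeries_0. unfold a, cexpt. simpl. field. }
  assert (B0 : PSeries b 0 = 0).
  { rewrite PSeries_0. unfold b, cexpt. simpl. field. }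
  unfold H1 in E1. unfold H2 in E2. rewrite A0, B0 in E1, E2.
  rewrite !Rmult_0_r, exp_0, cos_0, sin_0, !Rmult_1_r in E1, E2.
  assert (Ex : exp x * exp (- x) = 1) by (rewrite <- exp_plus, Rplus_opp_r; apply exp_0).
  pose proof (sin2_cos2 y) as Hsc. unfold Rsqr in Hsc.
  assert (HA : PSeries a 1 = exp x * cos y).
  { set (A1 := PSeries a 1) in *. set (B1 := PSeries b 1) in *. set (e := exp (- x)) in *.
    set (E := exp x) in *. set (c := cos y) in *. set (s := sin y) in *. clearbody A1 B1 e E c s.
    assert (e * A1 = c).
    { assert (e * (A1 * c + B1 * s) * c - e * (B1 * c - A1 * s) * s = c) by (rewrite <- E1, <- E2; ring).
      transitivity (e * A1 * (s * s + c * c)); [rewrite Hsc; ring|]. eapply eq_trans; [|exact H]. ring. }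
    rewrite <- H. rewrite <- Rmult_assoc, Ex. ring. }
  assert (HB : PSeries b 1 = exp x * sin y).
  { set (A1 := PSeries a 1) in *. set (B1 := PSeries b 1) in *. set (e := exp (- x)) in *.
    set (E := exp x) in *. set (c := cos y) in *. set (s := sin y) in *. clearbody A1 B1 e E c s.
    assert (e * B1 = s).
    { assert (e * (A1 * c + B1 * s) * s + e * (B1 * c - A1 * s) * c = s) by (rewrite <- E1, <- E2; ring).
      transitivity (e * B1 * (s * s + c * c)); [rewrite Hsc; ring|]. eapply eq_trans; [|exact H]. ring. }
    rewrite <- H. rewrite <- Rmult_assoc, Ex. ring. }
  unfold ce. fold x y. rewrite <- HA, <- HB. unfold Cser, PSeries. f_equal; apply Series_ext; intros n;
   rewrite pow1, Rmult_1_r; reflexivity.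
Qed.

(** From index [M] on, each term is at most [(|z|/R)^M] times the term of the series of [e^R]. The
    free [R] is later taken as [r v], so that the bound is geometric uniformly in [v]. *)
Lemma ce_tail z R M : 0 < R -> Cmod z <= R ->
  Cmod (ce z - csum (cexpt z) M)%C <= 2 * ((Cmod z / R) ^ M * exp R).
Proof.
  intros HR Hz. rewrite <- ce_series, <- (Series_exp R).
  assert (Hq : 0 <= Cmod z / R <= 1).
  { pose proof (Cmod_ge_0 z). split; [apply Rdiv_le_0_compat; lra|].
    apply Rmult_le_reg_r with R; [assumption|]. unfold Rdiv. rewrite Rmult_assoc, Rinv_l; lra. }
  apply Cser_tail.
  - apply pow_le; lra.
  - intros n Hn. rewrite Cmod_cexpt. unfold Rdiv at 1 3. rewrite <- Rmult_assoc.
    apply Rmult_le_compat_r; [left; apply Rinv_0_lt_compat, INR_fact_lt_0|].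
    replace (Cmod z ^ n) with ((Cmod z / R) ^ n * R ^ n).
    + apply Rmult_le_compat_r; [apply pow_le; lra|].
      replace n with (M + (n - M))%nat by lia. rewrite pow_add.
      rewrite <- (Rmult_1_r ((Cmod z / R) ^ M)) at 2.
      apply Rmult_le_compat_l; [apply pow_le; lra|].
      rewrite <- (pow1 (n - M)). apply pow_incr. lra.
    + rewrite <- Rpow_mult_distr. f_equal. field. lra.
  - intros n. apply Rmult_le_pos; [apply pow_le; lra|]. left. apply Rinv_0_lt_compat, INR_fact_lt_0.
  - apply ex_series_exp.
  - apply cabs_cexpt.
Qed.

(** * Laplace integrals of step functions of exponential growth *)

(** Growth of order [kap], together with integrability against every continuous kernel; the latter
    is a hypothesis because the functions in question have jumps. *)
Definition adm (kap C : R) (g : R -> R) : Prop :=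
  (forall k W, 0 <= W -> (forall v, continuous k v) -> ex_RInt (fun v => k v * g v) 0 W) /\
  (forall v, 0 <= v -> Rabs (g v) <= C * exp (kap * v)).

Definition kern (bet Ck : R) (k : R -> R) : Prop :=
  (forall v, continuous k v) /\ (forall v, 0 <= v -> Rabs (k v) <= Ck * exp (- bet * v)).

(** Improper integral over [0, +oo); a junk value when the limit does not exist. *)
Definition LI (g k : R -> R) : R := real (Lim_seq (fun n => RInt (fun v => k v * g v) 0 (INR n))).

Lemma adm_nonneg kap C g : adm kap C g -> 0 <= C.
Proof.
  intros [_ H]. specialize (H 0 ltac:(lra)). rewrite Rmult_0_r, exp_0, Rmult_1_r in H.
  pose proof (Rabs_pos (g 0)). lra.
Qed.

Lemma kern_nonneg bet Ck k : kern bet Ck k -> 0 <= Ck.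
Proof.
  intros [_ H]. specialize (H 0 ltac:(lra)). rewrite Rmult_0_r, exp_0, Rmult_1_r in H.
  pose proof (Rabs_pos (k 0)). lra.
Qed.

Lemma adm_ex kap C g k v w : adm kap C g -> (forall v, continuous k v) -> 0 <= v <= w ->
  ex_RInt (fun v => k v * g v) v w.
Proof.
  intros [H _] Hk Hv. apply (ex_RInt_Chasles_2 (V := R_CompleteNormedModule)) with 0; [lra|].
  apply H; auto. lra.
Qed.

Lemma LI_tail kap C g bet Ck k v w : adm kap C g -> kern bet Ck k -> kap < bet -> 0 <= v <= w ->
  Rabs (RInt (fun v => k v * g v) v w) <= C * Ck / (bet - kap) * exp (- (bet - kap) * v).
Proof.
  intros Hg Hk Hb Hv.
  pose proof (adm_nonneg _ _ _ Hg). pose proof (kern_nonneg _ _ _ Hk).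
  eapply Rle_trans; [apply (RInt_exp_bound _ (C * Ck) (- (bet - kap)))|].
  - lra.
  - lra.
  - apply adm_ex with kap C; auto. apply Hk.
  - intros x Hx. rewrite Rabs_mult.
    replace (- (bet - kap) * x) with (- bet * x + kap * x) by ring. rewrite exp_plus.
    replace (C * Ck * (exp (- bet * x) * exp (kap * x))) with ((Ck * exp (- bet * x)) * (C * exp (kap * x))) by ring.
    apply Rmult_le_compat; try apply Rabs_pos; [apply Hk | apply Hg]; lra.
  - assert (0 <= C * Ck / (bet - kap)).
    { apply Rdiv_le_0_compat; [apply Rmult_le_pos; assumption | lra]. }
    pose proof (exp_pos (- (bet - kap) * w)).
    replace (C * Ck / - (bet - kap) * (exp (- (bet - kap) * w) - exp (- (bet - kap) * v)))
      with (C * Ck / (bet - kap) * (exp (- (bet - kap) * v) - exp (- (bet - kap) * w))) by (field; lra).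
    apply Rmult_le_compat_l; lra.
Qed.

Lemma exp_neg_small a K : 0 < a -> 0 <= K -> forall eps, 0 < eps ->
  exists N, forall n, (N <= n)%nat -> K * exp (- a * INR n) < eps.
Proof.
  intros Ha HK eps Heps.
  destruct (INR_unbounded (K / (a * eps))) as [N HN]. exists N. intros n Hn.
  assert (INR N <= INR n) by now apply le_INR.
  assert (Hp : 0 < exp (a * INR n)) by apply exp_pos.
  replace (- a * INR n) with (- (a * INR n)) by ring. rewrite exp_Ropp.
  apply Rmult_lt_reg_r with (exp (a * INR n)); [assumption|].
  rewrite Rmult_assoc, Rinv_l, Rmult_1_r by lra.
  pose proof (exp_ineq1_le (a * INR n)).
  assert (K < eps * (a * INR n)).
  { apply Rmult_lt_reg_r with (/ (a * eps)); [apply Rinv_0_lt_compat; nra|].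
    fold (K / (a * eps)). replace (eps * (a * INR n) * / (a * eps)) with (INR n) by (field; lra). lra. }
  nra.
Qed.

Lemma LI_conv kap C g bet Ck k : adm kap C g -> kern bet Ck k -> kap < bet ->
  is_lim_seq (fun n => RInt (fun v => k v * g v) 0 (INR n)) (LI g k).
Proof.
  intros Hg Hk Hb.
  pose proof (adm_nonneg _ _ _ Hg). pose proof (kern_nonneg _ _ _ Hk).
  assert (Hex : ex_finite_lim_seq (fun n => RInt (fun v => k v * g v) 0 (INR n))).
  { apply ex_lim_seq_cauchy_corr. intros eps.
    assert (HK : 0 <= C * Ck / (bet - kap)).
    { apply Rdiv_le_0_compat; [apply Rmult_le_pos; assumption | lra]. }
    destruct (exp_neg_small (bet - kap) (C * Ck / (bet - kap)) ltac:(lra) HK eps (cond_pos eps)) as [N HN].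
    exists N.
    assert (Hle : forall n m, (N <= n)%nat -> (n <= m)%nat ->
       Rabs (RInt (fun v => k v * g v) 0 (INR m) - RInt (fun v => k v * g v) 0 (INR n)) < eps).
    { intros n m Hn Hm.
      assert (0 <= INR n <= INR m) by (split; [apply pos_INR | now apply le_INR]).
      assert (E : RInt (fun v => k v * g v) 0 (INR m) - RInt (fun v => k v * g v) 0 (INR n)
         = RInt (fun v => k v * g v) (INR n) (INR m)).
      { rewrite <- (RInt_Chasles (V := R_CompleteNormedModule) (fun v => k v * g v) 0 (INR n) (INR m)).
        - unfold plus; simpl. ring.
        - apply adm_ex with kap C; auto; [apply Hk | lra].
        - apply adm_ex with kap C; auto. apply Hk. }
      rewrite E. eapply Rle_lt_trans; [apply (LI_tail kap C g bet Ck); auto|]. now apply HN. }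
    intros n m Hn Hm. destruct (le_lt_dec n m) as [h|h].
    - rewrite Rabs_minus_sym. now apply Hle.
    - apply Hle; lia. }
  destruct Hex as [l Hl]. unfold LI. rewrite (is_lim_seq_unique _ _ Hl). exact Hl.
Qed.

(** The tail bound of [LI_tail] passes to the limit. The exponentially small cost of stopping at [W]
    is what later allows [W] to be a multiple of [log t]. *)
Lemma LI_trunc kap C g bet Ck k W : adm kap C g -> kern bet Ck k -> kap < bet -> 0 <= W ->
  Rabs (LI g k - RInt (fun v => k v * g v) 0 W) <= C * Ck / (bet - kap) * exp (- (bet - kap) * W).
Proof.
  intros Hg Hk Hb HW.
  pose proof (LI_conv _ _ _ _ _ _ Hg Hk Hb) as HL.
  assert (HL' : is_lim_seq (fun n => Rabs (RInt (fun v => k v * g v) 0 (INR n) - RInt (fun v => k v * g v) 0 W))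
      (Rabs (LI g k - RInt (fun v => k v * g v) 0 W))).
  { apply (is_lim_seq_abs _ (Finite _)). apply is_lim_seq_minus'; [assumption|apply is_lim_seq_const]. }
  set (B := C * Ck / (bet - kap) * exp (- (bet - kap) * W)).
  assert (HB : is_lim_seq (fun _ : nat => B) B) by apply is_lim_seq_const.
  apply (is_lim_seq_le_loc _ _ (Finite _) (Finite _)) with (2 := HL') (3 := HB).
  destruct (INR_unbounded W) as [N HN]. exists N. intros n Hn.
  assert (INR N <= INR n) by now apply le_INR.
  assert (E : RInt (fun v => k v * g v) 0 (INR n) - RInt (fun v => k v * g v) 0 W
         = RInt (fun v => k v * g v) W (INR n)).
  { rewrite <- (RInt_Chasles (V := R_CompleteNormedModule) (fun v => k v * g v) 0 W (INR n)).
    - unfold plus; simpl. ring.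
    - apply adm_ex with kap C; auto; [apply Hk | lra].
    - apply adm_ex with kap C; auto; [apply Hk | lra]. }
  rewrite E. apply LI_tail; auto. lra.
Qed.

Lemma LI_bound kap C g bet Ck k : adm kap C g -> kern bet Ck k -> kap < bet ->
  Rabs (LI g k) <= C * Ck / (bet - kap).
Proof.
  intros Hg Hk Hb. pose proof (LI_trunc _ _ _ _ _ _ 0 Hg Hk Hb (Rle_refl 0)) as H.
  rewrite RInt_point, Rmult_0_r, exp_0, Rmult_1_r in H. unfold zero in H; simpl in H.
  now rewrite Rminus_0_r in H.
Qed.

Lemma LI_unique g k l : is_lim_seq (fun n => RInt (fun v => k v * g v) 0 (INR n)) (Finite l) -> LI g k = l.
Proof. intros H. unfold LI. now rewrite (is_lim_seq_unique _ _ H). Qed.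

Lemma LI_plus kap C g bet C1 C2 k1 k2 : adm kap C g -> kern bet C1 k1 -> kern bet C2 k2 -> kap < bet ->
  LI g (fun v => k1 v + k2 v) = LI g k1 + LI g k2.
Proof.
  intros Hg H1 H2 Hb. apply LI_unique.
  apply is_lim_seq_ext with (fun n => RInt (fun v => k1 v * g v) 0 (INR n) + RInt (fun v => k2 v * g v) 0 (INR n)).
  - intros n. rewrite <- (RInt_plus (V := R_CompleteNormedModule)).
    + apply RInt_ext. intros v _. unfold plus; simpl. ring.
    + apply Hg; [apply pos_INR | apply H1].
    + apply Hg; [apply pos_INR | apply H2].
  - apply is_lim_seq_plus'; eapply LI_conv; eauto.
Qed.

Lemma LI_scal kap C g bet C1 k1 c : adm kap C g -> kern bet C1 k1 -> kap < bet ->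
  LI g (fun v => c * k1 v) = c * LI g k1.
Proof.
  intros Hg H1 Hb. apply LI_unique.
  apply is_lim_seq_ext with (fun n => c * RInt (fun v => k1 v * g v) 0 (INR n)).
  - intros n. rewrite <- (RInt_scal (V := R_CompleteNormedModule) (fun v => k1 v * g v)).
    + apply RInt_ext. intros v _. unfold scal; simpl; unfold mult; simpl. ring.
    + apply Hg; [apply pos_INR | apply H1].
  - apply (is_lim_seq_scal_l _ c (Finite _)). eapply LI_conv; eauto.
Qed.

Lemma LI_plus_g kap C1 C2 g1 g2 bet Ck k : adm kap C1 g1 -> adm kap C2 g2 -> kern bet Ck k -> kap < bet ->
  LI (fun v => g1 v + g2 v) k = LI g1 k + LI g2 k.
Proof.
  intros H1 H2 Hk Hb. apply LI_unique.
  apply is_lim_seq_ext with (fun n => RInt (fun v => k v * g1 v) 0 (INR n) + RInt (fun v => k v * g2 v) 0 (INR n)).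
  - intros n. rewrite <- (RInt_plus (V := R_CompleteNormedModule)).
    + apply RInt_ext. intros v _. unfold plus; simpl. ring.
    + apply H1; [apply pos_INR | apply Hk].
    + apply H2; [apply pos_INR | apply Hk].
  - apply is_lim_seq_plus'; eapply LI_conv; eauto.
Qed.

Lemma LI_scal_g kap C1 g1 bet Ck k c : adm kap C1 g1 -> kern bet Ck k -> kap < bet ->
  LI (fun v => c * g1 v) k = c * LI g1 k.
Proof.
  intros H1 Hk Hb. apply LI_unique.
  apply is_lim_seq_ext with (fun n => c * RInt (fun v => k v * g1 v) 0 (INR n)).
  - intros n. rewrite <- (RInt_scal (V := R_CompleteNormedModule) (fun v => k v * g1 v)).
    + apply RInt_ext. intros v _. unfold scal; simpl; unfold mult; simpl. ring.
    + apply H1; [apply pos_INR | apply Hk].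
  - apply (is_lim_seq_scal_l _ c (Finite _)). eapply LI_conv; eauto.
Qed.

Lemma LI_ext g k1 k2 : (forall v, k1 v = k2 v) -> LI g k1 = LI g k2.
Proof.
  intros H. unfold LI. f_equal. apply Lim_seq_ext. intros n. apply RInt_ext.
  intros v _. now rewrite H.
Qed.

Definition ccont (k : R -> C) : Prop :=
  (forall v, continuous (fun v => Re (k v)) v) /\ (forall v, continuous (fun v => Im (k v)) v).
Definition ckern (bet Ck : R) (k : R -> C) : Prop :=
  ccont k /\ (forall v, 0 <= v -> Cmod (k v) <= Ck * exp (- bet * v)).

Definition CI (g : R -> R) (k : R -> C) : C := (LI g (fun v => Re (k v)), LI g (fun v => Im (k v))).

Lemma ckern_re bet Ck k : ckern bet Ck k -> kern bet Ck (fun v => Re (k v)).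
Proof.
  intros [[H1 _] H]. split; [exact H1|]. intros v Hv.
  eapply Rle_trans; [apply re_le_Cmod | now apply H].
Qed.
Lemma ckern_im bet Ck k : ckern bet Ck k -> kern bet Ck (fun v => Im (k v)).
Proof.
  intros [[_ H1] H]. split; [exact H1|]. intros v Hv.
  eapply Rle_trans; [apply im_le_Cmod | now apply H].
Qed.

Lemma CI_bound kap C g bet Ck k : adm kap C g -> ckern bet Ck k -> kap < bet ->
  Cmod (CI g k) <= 2 * (C * Ck / (bet - kap)).
Proof.
  intros Hg Hk Hb. eapply Rle_trans; [apply Cmod_le_abs|].
  pose proof (LI_bound _ _ _ _ _ _ Hg (ckern_re _ _ _ Hk) Hb).
  pose proof (LI_bound _ _ _ _ _ _ Hg (ckern_im _ _ _ Hk) Hb).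
  unfold CI; simpl. lra.
Qed.

Lemma CI_ext g k1 k2 : (forall v, k1 v = k2 v) -> CI g k1 = CI g k2.
Proof. intros H. unfold CI. f_equal; apply LI_ext; intros v; now rewrite H. Qed.

Lemma CI_plus kap C g bet C1 C2 k1 k2 : adm kap C g -> ckern bet C1 k1 -> ckern bet C2 k2 -> kap < bet ->
  CI g (fun v => k1 v + k2 v)%C = (CI g k1 + CI g k2)%C.
Proof.
  intros Hg H1 H2 Hb. apply C_ext.
  - apply (LI_plus kap C g bet C1 C2 (fun v => Re (k1 v)) (fun v => Re (k2 v))); auto; now apply ckern_re.
  - apply (LI_plus kap C g bet C1 C2 (fun v => Im (k1 v)) (fun v => Im (k2 v))); auto; now apply ckern_im.
Qed.

Lemma CI_plus_g kap C1 C2 g1 g2 bet Ck k : adm kap C1 g1 -> adm kap C2 g2 -> ckern bet Ck k -> kap < bet ->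
  CI (fun v => g1 v + g2 v) k = (CI g1 k + CI g2 k)%C.
Proof.
  intros H1 H2 Hk Hb. apply C_ext.
  - eapply LI_plus_g; eauto. eapply ckern_re; exact Hk.
  - eapply LI_plus_g; eauto. eapply ckern_im; exact Hk.
Qed.

Lemma CI_scal_g kap C1 g1 bet Ck k c : adm kap C1 g1 -> ckern bet Ck k -> kap < bet ->
  CI (fun v => c * g1 v) k = (RtoC c * CI g1 k)%C.
Proof.
  intros H1 Hk Hb. apply C_ext.
  - rewrite re_scal_l. eapply LI_scal_g; eauto. eapply ckern_re; exact Hk.
  - rewrite im_scal_l. eapply LI_scal_g; eauto. eapply ckern_im; exact Hk.
Qed.

Lemma kern_scal bet Ck k c : kern bet Ck k -> kern bet (Rabs c * Ck) (fun v => c * k v).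
Proof.
  intros [H1 H2]. split.
  - intros v. apply (continuous_mult (K := R_AbsRing)); [apply continuous_const | apply H1].
  - intros v Hv. rewrite Rabs_mult, Rmult_assoc. apply Rmult_le_compat_l; [apply Rabs_pos | now apply H2].
Qed.

Lemma CI_scal kap C g bet Ck k c : adm kap C g -> ckern bet Ck k -> kap < bet ->
  CI g (fun v => c * k v)%C = (c * CI g k)%C.
Proof.
  intros Hg Hk Hb. pose proof (ckern_re _ _ _ Hk) as K1. pose proof (ckern_im _ _ _ Hk) as K2.
  destruct c as [a b]. apply C_ext.
  - change (LI g (fun v => a * Re (k v) - b * Im (k v)) = a * LI g (fun v => Re (k v)) - b * LI g (fun v => Im (k v))).
    rewrite (LI_ext g _ (fun v => a * Re (k v) + (- b) * Im (k v))) by (intros; ring).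
    rewrite (LI_plus kap C g bet (Rabs a * Ck) (Rabs (- b) * Ck)
       (fun v => a * Re (k v)) (fun v => - b * Im (k v))); auto; try now apply kern_scal.
    rewrite (LI_scal kap C g bet Ck (fun v => Re (k v))), (LI_scal kap C g bet Ck (fun v => Im (k v))); auto. ring.
  - change (LI g (fun v => a * Im (k v) + b * Re (k v)) = a * LI g (fun v => Im (k v)) + b * LI g (fun v => Re (k v))).
    rewrite (LI_plus kap C g bet (Rabs a * Ck) (Rabs b * Ck)
       (fun v => a * Im (k v)) (fun v => b * Re (k v))); auto; try now apply kern_scal.
    rewrite (LI_scal kap C g bet Ck (fun v => Re (k v))), (LI_scal kap C g bet Ck (fun v => Im (k v))); auto.
Qed.

Lemma ccont_plus k1 k2 : ccont k1 -> ccont k2 -> ccont (fun v => k1 v + k2 v)%C.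
Proof.
  intros [A1 A2] [B1 B2]. split; intros v.
  - apply (continuous_plus (V := R_NormedModule)); auto.
  - apply (continuous_plus (V := R_NormedModule)); auto.
Qed.

Lemma ccont_mult k1 k2 : ccont k1 -> ccont k2 -> ccont (fun v => k1 v * k2 v)%C.
Proof.
  intros [A1 A2] [B1 B2]. split; intros v.
  - apply (continuous_minus (V := R_NormedModule)); apply (continuous_mult (K := R_AbsRing)); auto.
  - apply (continuous_plus (V := R_NormedModule)); apply (continuous_mult (K := R_AbsRing)); auto.
Qed.

Lemma ccont_const c : ccont (fun _ => c).
Proof. split; intros v; apply continuous_const. Qed.

Lemma ccont_R k : (forall v, continuous k v) -> ccont (fun v => RtoC (k v)).
Proof. intros H. split; intros v; [apply H | apply continuous_const]. Qed.

Lemma ccont_ce z : ccont (fun v => ce (RtoC v * z)%C).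
Proof.
  split; intros v; apply (ex_derive_continuous (V := R_NormedModule)); unfold ce; simpl;
    destruct z as [x y]; simpl; auto_derive; exact I.
Qed.

Lemma ccont_pow z n : ccont (fun v => (RtoC v * z) ^ n)%C.
Proof.
  induction n; simpl.
  - apply ccont_const.
  - apply ccont_mult; [|assumption]. apply ccont_mult; [|apply ccont_const].
    apply ccont_R. intros; apply continuous_id.
Qed.

Lemma ccont_ext k1 k2 : (forall v, k1 v = k2 v) -> ccont k1 -> ccont k2.
Proof.
  intros H [H1 H2]. split; intros v.
  - apply continuous_ext with (2 := H1 v). intros; now rewrite H.
  - apply continuous_ext with (2 := H2 v). intros; now rewrite H.
Qed.

(** * Laplace transforms and their Taylor expansions *)

(** The Taylor coefficient at 0 of the transform of [g] with kernel [k0(v) e^(-vz)]: a moment of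
    [(-v)^n / n!]. *)
Definition taylor_coef (g : R -> R) (k0 : R -> C) (n : nat) : C :=
  CI g (fun v => k0 v * cexpt (RtoC (- v)) n)%C.

Definition geom_bounded (rho : R) (a : nat -> C) : Prop :=
  forall r, 0 < r < rho -> exists K, forall n, Cmod (a n) * r ^ n <= K.

(** Since [v^n / n! <= r^(-n) e^(rv)], giving up the part [r] of the decay buys a geometric bound in
    [n]. *)
Lemma ckern_taylor bet Ck k0 r n : ckern bet Ck k0 -> 0 < r ->
  ckern (bet - r) (Ck * (/ r) ^ n) (fun v => k0 v * cexpt (RtoC (- v)) n)%C.
Proof.
  intros [Hc Hk] Hr. split.
  - apply ccont_mult; [assumption|]. unfold cexpt. apply ccont_mult; [|apply ccont_const].
    apply ccont_ext with (fun v => (RtoC v * RtoC (-1)) ^ n)%C; [|apply ccont_pow].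
    intros v. f_equal. rewrite <- RtoC_mult. f_equal. ring.
  - intros v Hv. rewrite Cmod_mult, Cmod_cexpt, Cmod_R, Rabs_Ropp, Rabs_pos_eq by assumption.
    specialize (Hk v Hv).
    replace (- (bet - r) * v) with (- bet * v + r * v) by ring. rewrite exp_plus.
    replace (Ck * (/ r) ^ n * (exp (- bet * v) * exp (r * v)))
      with ((Ck * exp (- bet * v)) * ((/ r) ^ n * exp (r * v))) by ring.
    assert (0 <= v ^ n / INR (fact n)).
    { apply Rmult_le_pos; [now apply pow_le|]. left. apply Rinv_0_lt_compat, INR_fact_lt_0. }
    apply Rmult_le_compat; auto; [apply Cmod_ge_0|].
    replace (v ^ n / INR (fact n)) with ((/ r) ^ n * ((r * v) ^ n / INR (fact n))).
    + apply Rmult_le_compat_l; [apply pow_le; left; now apply Rinv_0_lt_compat|].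
      apply pow_fact_le_exp. nra.
    + unfold Rdiv. rewrite <- Rmult_assoc, <- Rpow_mult_distr. do 2 f_equal. field. lra.
Qed.

(** The decay [bet] exceeds the growth [kap] by exactly the radius of the disc. Integral and sum are
    exchanged by estimating the remainder kernel, not by a general theorem on series of
    functions. *)
Lemma CI_taylor kap C g bet Ck k0 : adm kap C g -> ckern bet Ck k0 -> kap < bet ->
  geom_bounded (bet - kap) (taylor_coef g k0) /\
  forall z, Cmod z < bet - kap ->
    CI g (fun v => k0 v * ce (RtoC v * - z))%C = Cser (fun n => taylor_coef g k0 n * z ^ n)%C.
Proof.
  intros Hg Hk Hb.
  pose proof (adm_nonneg _ _ _ Hg) as HC.
  assert (HCk : 0 <= Ck) by (apply (kern_nonneg _ _ _ (ckern_re _ _ _ Hk))).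
  split.
  - intros r Hr. exists (2 * (C * Ck / (bet - r - kap))). intros n.
    pose proof (ckern_taylor bet Ck k0 r n Hk ltac:(lra)) as HT.
    pose proof (CI_bound _ _ _ _ _ _ Hg HT ltac:(lra)) as H. fold (taylor_coef g k0 n) in H.
    assert (Hrn : 0 < r ^ n) by (apply pow_lt; lra).
    apply Rle_trans with (2 * (C * (Ck * (/ r) ^ n) / (bet - r - kap)) * r ^ n).
    + apply Rmult_le_compat_r; lra.
    + rewrite pow_inv. right. field. lra.
  - intros z Hz. symmetry.
    pose proof (Cmod_ge_0 z) as Hz0.
    (* Any [r] strictly between [|z|] and the radius works: [r > |z|] gives the ratio [|z|/r < 1],
       and [r < bet - kap] keeps the integrals convergent. *)
    set (r := (Cmod z + (bet - kap)) / 2).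
    assert (Hr : Cmod z < r < bet - kap) by (unfold r; lra).
    apply Cser_unique with (K := 2 * (C * (2 * Ck) / (bet - r - kap))) (q := Cmod z / r).
    { split; [apply Rdiv_le_0_compat; lra|]. apply Rmult_lt_reg_r with r; [lra|].
      unfold Rdiv. rewrite Rmult_assoc, Rinv_l; lra. }
    intros M.
    assert (HS : exists CM, ckern (bet - r) CM (fun v => k0 v * csum (cexpt (RtoC v * - z)) M)%C /\
      CI g (fun v => k0 v * csum (cexpt (RtoC v * - z)) M)%C = csum (fun n => taylor_coef g k0 n * z ^ n)%C M).
    { induction M as [|M [CM [IH1 IH2]]].
      - exists 0. assert (E : ckern (bet - r) 0 (fun v => k0 v * csum (cexpt (RtoC v * - z)) 0)%C).
        { split.
          - apply ccont_ext with (fun _ => RtoC 0); [|apply ccont_const]. intros v; simpl; ring.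
          - intros v _. simpl. rewrite Cmult_0_r, Cmod_0. lra. }
        split; [exact E|]. simpl.
        rewrite (CI_ext g _ (fun v => RtoC 0 * (k0 v * csum (cexpt (RtoC v * - z)) 0))%C) by (intros; simpl; ring).
        rewrite (CI_scal kap C g _ _ _ _ Hg E) by lra. ring.
      - pose proof (ckern_taylor bet Ck k0 r M Hk ltac:(lra)) as HT.
        assert (HTz : ckern (bet - r) (Cmod (z ^ M) * (Ck * (/ r) ^ M)) (fun v => z ^ M * (k0 v * cexpt (RtoC (- v)) M))%C).
        { destruct HT as [HT1 HT2]. split.
          - apply ccont_mult; [apply ccont_const | assumption].
          - intros v Hv. rewrite Cmod_mult, Rmult_assoc. apply Rmult_le_compat_l; [apply Cmod_ge_0 | now apply HT2]. }
        assert (Es : forall v, (k0 v * csum (cexpt (RtoC v * - z)) (S M))%C =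
            (k0 v * csum (cexpt (RtoC v * - z)) M + z ^ M * (k0 v * cexpt (RtoC (- v)) M))%C).
        { intros v. simpl. unfold cexpt.
          replace (RtoC v * - z)%C with (RtoC (- v) * z)%C by (rewrite RtoC_opp; ring).
          rewrite Cpow_mult_l. ring. }
        exists (CM + Cmod (z ^ M) * (Ck * (/ r) ^ M)). split.
        + destruct IH1 as [I1 I2]. destruct HTz as [T1 T2]. split.
          * apply ccont_ext with (1 := fun v => eq_sym (Es v)). now apply ccont_plus.
          * intros v Hv. rewrite Es. eapply Rle_trans; [apply Cmod_triangle|].
            specialize (I2 v Hv). specialize (T2 v Hv). lra.
        + rewrite (CI_ext g _ _ Es). rewrite (CI_plus kap C g _ _ _ _ _ Hg IH1 HTz) by lra.
          rewrite IH2, (CI_scal kap C g _ _ _ _ Hg HT) by lra. simpl. unfold taylor_coef. ring. }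
    destruct HS as (CM & HS1 & HS2). rewrite <- HS2.
    assert (HE : ckern bet Ck k0) by assumption.
    (* The remainder of the exponential series at [- v z], with [R = r v] in [ce_tail]: the factor
       [e^(rv)] is absorbed by the decay, and the ratio [|z|/r] no longer involves [v]. *)
    assert (HR : ckern (bet - r) (2 * Ck * (Cmod z / r) ^ M)
       (fun v => k0 v * ce (RtoC v * - z) + - (1) * (k0 v * csum (cexpt (RtoC v * - z)) M))%C).
    { split.
      - apply ccont_plus.
        + apply ccont_mult; [apply Hk | apply ccont_ce].
        + apply ccont_mult; [apply ccont_const | apply HS1].
      - intros v Hv.
        replace (k0 v * ce (RtoC v * - z) + - (1) * (k0 v * csum (cexpt (RtoC v * - z)) M))%C
          with (k0 v * (ce (RtoC v * - z) - csum (cexpt (RtoC v * - z)) M))%C by ring.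
        rewrite Cmod_mult.
        replace (- (bet - r) * v) with (- bet * v + r * v) by ring. rewrite exp_plus.
        replace (2 * Ck * (Cmod z / r) ^ M * (exp (- bet * v) * exp (r * v)))
          with ((Ck * exp (- bet * v)) * (2 * ((Cmod z / r) ^ M * exp (r * v)))) by ring.
        apply Rmult_le_compat; try apply Cmod_ge_0; [now apply Hk|].
        (* At [v = 0] the choice [R = r v] degenerates, so this point is computed directly. *)
        destruct (Rle_lt_or_eq_dec 0 v Hv) as [Hv'|<-].
        + assert (Em : Cmod (RtoC v * - z) = v * Cmod z).
          { rewrite Cmod_mult, Cmod_R, Cmod_opp, Rabs_pos_eq; lra. }
          pose proof (ce_tail (RtoC v * - z) (r * v) M ltac:(nra)) as HT. rewrite Em in HT.
          replace (v * Cmod z / (r * v)) with (Cmod z / r) in HT by (field; lra).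
          apply HT. nra.
        + replace (RtoC 0 * - z)%C with (RtoC 0) by ring. rewrite ce_0.
          assert (0 <= Cmod z / r) by (apply Rdiv_le_0_compat; lra).
          rewrite Rmult_0_r, exp_0.
          destruct M as [|M].
          * simpl. replace (RtoC 1 - RtoC 0)%C with (RtoC 1) by ring. rewrite Cmod_1. lra.
          * replace (csum (cexpt (RtoC 0)) (S M)) with (RtoC 1).
            -- replace (RtoC 1 - RtoC 1)%C with (RtoC 0) by ring. rewrite Cmod_0.
               assert (0 <= (Cmod z / r) ^ S M) by now apply pow_le. lra.
            -- clear. induction M.
               ++ unfold cexpt; simpl. rewrite Rinv_1. ring.
               ++ change (csum (cexpt 0) (S (S M))) with (csum (cexpt 0) (S M) + cexpt 0 (S M))%C.
                  rewrite <- IHM. unfold cexpt. rewrite Cpow_S. ring. }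
    assert (Hfull : ckern (bet - r) (Ck) (fun v => k0 v * ce (RtoC v * - z))%C).
    { split.
      - apply ccont_mult; [apply Hk | apply ccont_ce].
      - intros v Hv. rewrite Cmod_mult, Cmod_ce.
        replace (- (bet - r) * v) with (- bet * v + r * v) by ring. rewrite exp_plus, <- Rmult_assoc.
        apply Rmult_le_compat; [apply Cmod_ge_0 | left; apply exp_pos | now apply Hk|].
        apply exp_le. destruct z as [x y]; simpl.
        pose proof (re_le_Cmod (x, y)) as Hx. simpl in Hx. apply Rabs_le_between in Hx.
        assert (- x <= r) by lra. nra. }
    assert (HN : ckern (bet - r) CM (fun v => - (1) * (k0 v * csum (cexpt (RtoC v * - z)) M))%C).
    { destruct HS1 as [S1 S2]. split.
      - apply ccont_mult; [apply ccont_const | assumption].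
      - intros v Hv. rewrite Cmod_mult, Cmod_m1, Rmult_1_l. now apply S2. }
    replace (CI g (fun v => k0 v * ce (RtoC v * - z))%C - CI g (fun v => k0 v * csum (cexpt (RtoC v * - z)) M)%C)%C
      with (CI g (fun v => k0 v * ce (RtoC v * - z) + - (1) * (k0 v * csum (cexpt (RtoC v * - z)) M))%C).
    2:{ rewrite (CI_plus kap C g _ _ _ _ _ Hg Hfull HN) by lra.
        rewrite (CI_scal kap C g _ _ _ _ Hg HS1) by lra. ring. }
    eapply Rle_trans; [apply (CI_bound _ _ _ _ _ _ Hg HR); lra|].
    right. field. lra.
Qed.

(** * Power series in a disc *)

Definition summ (rho : R) (a : nat -> C) : Prop :=
  forall r, 0 <= r < rho -> ex_series (fun n => Cmod (a n) * r ^ n).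

Lemma geom_bounded_summ rho a : geom_bounded rho a -> summ rho a.
Proof.
  intros H r Hr. set (r1 := (r + rho) / 2).
  destruct (H r1 ltac:(unfold r1; lra)) as [K HK].
  apply (ex_series_le (V := R_CompleteNormedModule)) with (fun n => K * (r / r1) ^ n).
  - intros n. change (Rabs (Cmod (a n) * r ^ n) <= K * (r / r1) ^ n).
    rewrite Rabs_pos_eq by (apply Rmult_le_pos; [apply Cmod_ge_0 | apply pow_le; lra]).
    specialize (HK n). assert (0 < r1) by (unfold r1; lra).
    replace (r ^ n) with (r1 ^ n * (r / r1) ^ n) by (rewrite <- Rpow_mult_distr; f_equal; field; lra).
    rewrite <- Rmult_assoc. apply Rmult_le_compat_r; [|assumption].
    apply pow_le, Rdiv_le_0_compat; lra.
  - apply (ex_series_scal (V := R_NormedModule)). apply ex_series_geom.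
    assert (0 < r1) by (unfold r1; lra).
    rewrite Rabs_pos_eq by (apply Rdiv_le_0_compat; lra).
    apply Rmult_lt_reg_r with r1; [lra|]. unfold Rdiv. rewrite Rmult_assoc, Rinv_l; unfold r1 in *; lra.
Qed.

Lemma summ_cabs rho a z : summ rho a -> Cmod z < rho -> cabs (fun n => a n * z ^ n)%C.
Proof.
  intros H Hz. apply cabs_le with (2 := H (Cmod z) (conj (Cmod_ge_0 z) Hz)).
  intros n. rewrite Cmod_mult, Cmod_pow. lra.
Qed.

Lemma term_le_Series (a : nat -> R) n : (forall k, 0 <= a k) -> ex_series a -> a n <= Series a.
Proof.
  intros Ha Hs.
  pose proof (series_tail a a 1 (S n) ltac:(lra)) as HT.
  assert (HL : 0 <= Series a - lsum a (seq 0 (S n))).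
  { rewrite (Series_incr_n a (S n)) by (lia || assumption).
    rewrite lsum_sum_n, sum_n_Reals. simpl pred.
    assert (0 <= Series (fun k => a (S n + k)%nat)); [|lra].
    apply Rle_trans with (Series (fun _ => 0)).
    { rewrite (Series_finite (fun _ => 0) 0) by reflexivity. simpl. lra. }
    apply Series_le.
    - intros k. split; [lra|]. apply Ha.
    - now apply (ex_series_incr_n (V := R_NormedModule)). }
  rewrite lsum_seq_S in HL.
  assert (0 <= lsum a (seq 0 n)) by (apply lsum_nonneg; intros; apply Ha). lra.
Qed.

Lemma summ_radius rho a (c : nat -> R) : 0 < rho -> summ rho a -> (forall n, Rabs (c n) <= Cmod (a n)) ->
  Rbar_le rho (CV_radius c).
Proof.
  intros Hrho H Hc. apply CV_radius_ge; [assumption|]. intros r Hr.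
  exists (Series (fun n => Cmod (a n) * r ^ n)). intros n.
  apply Rle_trans with (Cmod (a n) * r ^ n).
  - apply Rmult_le_compat_r; [apply pow_le; lra | apply Hc].
  - apply (term_le_Series (fun n => Cmod (a n) * r ^ n)).
    + intros k. apply Rmult_le_pos; [apply Cmod_ge_0 | apply pow_le; lra].
    + apply H; lra.
Qed.

Definition cau (a b : nat -> C) (n : nat) : C := csum (fun k => a k * b (n - k)%nat)%C (S n).

Lemma lsum_sum_f (f : nat -> R) n : lsum f (seq 0 (S n)) = sum_f_R0 f n.
Proof. rewrite lsum_sum_n. apply sum_n_Reals. Qed.

Lemma Cmod_csum u n : Cmod (csum u n) <= lsum (fun k => Cmod (u k)) (seq 0 n).
Proof.
  induction n; [simpl; rewrite Cmod_0; lra|]. rewrite lsum_seq_S. simpl.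
  eapply Rle_trans; [apply Cmod_triangle|]. lra.
Qed.

Lemma cabs_series u : cabs u -> is_series (fun n => Rabs (Cmod (u n))) (Series (fun n => Cmod (u n))) /\
  ex_series (fun n => Rabs (Rabs (Cmod (u n)))).
Proof.
  intros H. split.
  - apply is_series_ext with (fun n => Cmod (u n)).
    + intros n. symmetry. apply Rabs_pos_eq, Cmod_ge_0.
    + now apply Series_correct.
  - apply ex_series_ext with (fun n => Cmod (u n)); [|assumption].
    intros n. now rewrite !(Rabs_pos_eq (Cmod (u n))) by apply Cmod_ge_0.
Qed.

Lemma Cser_mult u w : cabs u -> cabs w ->
  cabs (cau u w) /\ Cser (cau u w) = (Cser u * Cser w)%C.
Proof.
  intros Hu Hw. split.
  - destruct (cabs_series u Hu) as [U1 U2]. destruct (cabs_series w Hw) as [W1 W2].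
    pose proof (is_series_mult _ _ _ _ U1 W1 U2 W2) as HM.
    apply cabs_le with (fun n => sum_f_R0 (fun k => Rabs (Cmod (u k)) * Rabs (Cmod (w (n - k)%nat))) n).
    + intros n. unfold cau. eapply Rle_trans; [apply Cmod_csum|].
      rewrite <- lsum_sum_f. right. apply lsum_ext. intros k _.
      now rewrite Cmod_mult, !Rabs_pos_eq by apply Cmod_ge_0.
    + eexists; exact HM.
  - assert (G : forall f g : nat -> R, ex_series (fun n => Rabs (f n)) -> ex_series (fun n => Rabs (g n)) ->
      is_series (fun n => lsum (fun k => f k * g (n - k)%nat) (seq 0 (S n))) (Series f * Series g)).
    { intros f g Hf Hg.
      apply is_series_ext with (fun n => sum_f_R0 (fun k => f k * g (n - k)%nat) n).
      - intros n. symmetry. apply lsum_sum_f.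
      - apply is_series_mult; auto; apply Series_correct; now apply ex_series_Rabs. }
    pose proof (G _ _ (cabs_re u Hu) (cabs_re w Hw)) as G1.
    pose proof (G _ _ (cabs_im u Hu) (cabs_im w Hw)) as G2.
    pose proof (G _ _ (cabs_re u Hu) (cabs_im w Hw)) as G3.
    pose proof (G _ _ (cabs_im u Hu) (cabs_re w Hw)) as G4.
    apply C_ext; unfold Cser at 1.
    + apply is_series_unique.
      apply is_series_ext with (2 := is_series_minus _ _ _ _ G1 G2).
      intros n. unfold cau. rewrite csum_Re. unfold minus, plus, opp; simpl AbelianMonoid.sort.
      change (lsum (fun k => Re (u k) * Re (w (n - k)%nat)) (seq 0 (S n))
        + - lsum (fun k => Im (u k) * Im (w (n - k)%nat)) (seq 0 (S n)) = lsum (fun k => Re (u k * w (n - k)%nat)) (seq 0 (S n))).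
      replace (- lsum (fun k => Im (u k) * Im (w (n - k)%nat)) (seq 0 (S n)))
        with (-1 * lsum (fun k => Im (u k) * Im (w (n - k)%nat)) (seq 0 (S n))) by ring.
      rewrite <- lsum_scal, <- lsum_plus. apply lsum_ext. intros k _.
      unfold Re, Im, Cmult; simpl. ring.
    + apply is_series_unique.
      apply is_series_ext with (2 := is_series_plus _ _ _ _ G3 G4).
      intros n. unfold cau. rewrite csum_Im.
      change (lsum (fun k => Re (u k) * Im (w (n - k)%nat)) (seq 0 (S n))
        + lsum (fun k => Im (u k) * Re (w (n - k)%nat)) (seq 0 (S n)) = lsum (fun k => Im (u k * w (n - k)%nat)) (seq 0 (S n))).
      rewrite <- lsum_plus. apply lsum_ext. intros k _.
      unfold Re, Im, Cmult; simpl. ring.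
Qed.

(** One power series represents [f] on the whole disc. Continuation inside the disc then reduces to
    a statement about its coefficients. *)
Definition AN (rho : R) (f : C -> C) : Prop :=
  exists a, summ rho a /\ forall z, Cmod z < rho -> f z = Cser (fun n => a n * z ^ n)%C.

Lemma AN_plus rho f g : AN rho f -> AN rho g -> AN rho (fun z => f z + g z)%C.
Proof.
  intros (a & Ha & Hf) (b & Hb & Hg). exists (fun n => a n + b n)%C. split.
  - intros r Hr.
    apply (ex_series_le (V := R_CompleteNormedModule)) with (fun n => Cmod (a n) * r ^ n + Cmod (b n) * r ^ n).
    + intros n. change (Rabs (Cmod (a n + b n) * r ^ n) <= Cmod (a n) * r ^ n + Cmod (b n) * r ^ n).
      assert (0 <= r ^ n) by (apply pow_le; lra).
      rewrite Rabs_pos_eq by (apply Rmult_le_pos; [apply Cmod_ge_0 | assumption]).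
      rewrite <- Rmult_plus_distr_r. apply Rmult_le_compat_r; [assumption | apply Cmod_triangle].
    + apply (ex_series_plus (V := R_NormedModule)); auto.
  - intros z Hz. rewrite Hf, Hg by assumption.
    rewrite <- Cser_plus by (eapply summ_cabs; eauto). apply Cser_ext. intros n. ring.
Qed.

Lemma Cser_finite u n : (forall k, (n <= k)%nat -> u k = RtoC 0) -> Cser u = csum u n.
Proof.
  intros H. apply C_ext; [rewrite csum_Re | rewrite csum_Im]; unfold Cser; simpl;
   apply Series_finite; intros j Hj; now rewrite H.
Qed.

Lemma summ_finite rho a n : (forall k, (n <= k)%nat -> a k = RtoC 0) -> summ rho a.
Proof.
  intros H r _. apply (ex_series_incr_n (V := R_NormedModule) _ n).
  apply ex_series_ext with (fun _ => 0).
  - intros k. rewrite H by lia. rewrite Cmod_0. symmetry. apply Rmult_0_l.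
  - exists 0. change (is_lim_seq (sum_n (fun _ => 0)) 0).
    apply is_lim_seq_ext with (fun _ => 0); [|apply is_lim_seq_const].
    intros k. rewrite <- lsum_sum_n. symmetry. now apply lsum_0.
Qed.

Lemma AN_const rho c : AN rho (fun _ => c).
Proof.
  exists (fun n => match n with O => c | _ => RtoC 0 end). split.
  - apply summ_finite with 1%nat. intros [|k] Hk; [lia|reflexivity].
  - intros z _. rewrite (Cser_finite _ 1).
    + simpl. ring.
    + intros [|k] Hk; [lia|]. ring.
Qed.

Lemma AN_id rho : AN rho (fun z => z).
Proof.
  exists (fun n => match n with 1%nat => RtoC 1 | _ => RtoC 0 end). split.
  - apply summ_finite with 2%nat. intros [|[|k]] Hk; [lia|lia|reflexivity].
  - intros z _. rewrite (Cser_finite _ 2).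
    + simpl. ring.
    + intros [|[|k]] Hk; [lia|lia|]. ring.
Qed.

Lemma cau_pow a b z n : cau (fun k => a k * z ^ k)%C (fun k => b k * z ^ k)%C n = (cau a b n * z ^ n)%C.
Proof.
  unfold cau. rewrite Cmult_comm, <- csum_scal. apply csum_ext. intros k Hk.
  replace (z ^ n)%C with (z ^ k * z ^ (n - k))%C by (rewrite <- Cpow_add_r; f_equal; lia). ring.
Qed.

Lemma AN_mult rho f g : AN rho f -> AN rho g -> AN rho (fun z => f z * g z)%C.
Proof.
  intros (a & Ha & Hf) (b & Hb & Hg). exists (cau a b). split.
  - intros r Hr. assert (Hr' : Cmod (RtoC r) < rho) by (rewrite Cmod_R, Rabs_pos_eq; lra).
    destruct (Cser_mult _ _ (summ_cabs _ _ _ Ha Hr') (summ_cabs _ _ _ Hb Hr')) as [Hc _].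
    apply ex_series_ext with (2 := Hc). intros n. rewrite cau_pow, Cmod_mult, Cmod_pow, Cmod_R, Rabs_pos_eq by lra.
    reflexivity.
  - intros z Hz. rewrite Hf, Hg by assumption.
    destruct (Cser_mult _ _ (summ_cabs _ _ _ Ha Hz) (summ_cabs _ _ _ Hb Hz)) as [_ <-].
    apply Cser_ext. intros n. apply cau_pow.
Qed.

Lemma Re_mult_pow_R c x n : Re (c * RtoC x ^ n)%C = Re c * x ^ n.
Proof. rewrite <- RtoC_pow. apply re_scal_r. Qed.
Lemma Im_mult_pow_R c x n : Im (c * RtoC x ^ n)%C = Im c * x ^ n.
Proof. rewrite <- RtoC_pow. apply im_scal_r. Qed.

(** On the real axis the real and imaginary parts are real power series with coefficients [Re (a n)]
    and [Im (a n)]; vanishing near 0 kills all of them. *)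
Lemma AN_zero rho delta f : 0 < delta <= rho -> AN rho f ->
  (forall x : R, Rabs x < delta -> f (RtoC x) = RtoC 0) -> forall z, Cmod z < rho -> f z = RtoC 0.
Proof.
  intros Hd (a & Ha & Hf) Hz.
  assert (G : forall c : nat -> R, (forall n, Rabs (c n) <= Cmod (a n)) ->
     (forall x, Rabs x < delta -> PSeries c x = 0) -> forall n, c n = 0).
  { intros c Hc Hx n.
    pose proof (summ_radius rho a c ltac:(lra) Ha Hc) as Hr.
    apply (PSeries_ext_recip c (fun _ => 0) n).
    - apply Rbar_lt_le_trans with (2 := Hr). simpl. lra.
    - rewrite CV_radius_const_0. exact I.
    - assert (Hd' : 0 < delta) by lra. exists (mkposreal _ Hd'). intros x Hxx.
      unfold ball in Hxx; simpl in Hxx; unfold AbsRing_ball, abs, minus, plus, opp in Hxx; simpl in Hxx.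
      rewrite Ropp_0, Rplus_0_r in Hxx. rewrite Hx by assumption.
      symmetry. unfold PSeries. rewrite (Series_finite _ 0); [reflexivity|]. intros; ring. }
  assert (HR : forall x, Rabs x < delta -> Cser (fun n => a n * RtoC x ^ n)%C = RtoC 0).
  { intros x Hx. rewrite <- Hf; [now apply Hz|]. rewrite Cmod_R. lra. }
  assert (Hre : forall n, Re (a n) = 0).
  { apply G; [intros; apply re_le_Cmod|]. intros x Hx. specialize (HR x Hx).
    apply (f_equal Re) in HR. simpl in HR. rewrite <- HR. unfold PSeries. apply Series_ext.
    intros n. symmetry. apply Re_mult_pow_R. }
  assert (Him : forall n, Im (a n) = 0).
  { apply G; [intros; apply im_le_Cmod|]. intros x Hx. specialize (HR x Hx).
    apply (f_equal Im) in HR. simpl in HR. rewrite <- HR. unfold PSeries. apply Series_ext.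
    intros n. symmetry. apply Im_mult_pow_R. }
  intros z Hzz. rewrite Hf by assumption. rewrite (Cser_finite _ 0); [reflexivity|].
  intros k _. replace (a k) with (RtoC 0); [ring|]. apply C_ext; simpl; auto.
Qed.

Definition dcoef (a : nat -> C) (n : nat) : C := (RtoC (INR (S n)) * a (S n))%C.

Lemma summ_dcoef rho a : 0 < rho -> summ rho a -> summ rho (dcoef a).
Proof.
  intros Hrho Ha r Hr.
  pose proof (summ_radius rho a (fun n => Cmod (a n)) Hrho Ha) as HR.
  assert (HR' : Rbar_le rho (CV_radius (fun n => Cmod (a n)))).
  { apply HR. intros n. rewrite Rabs_pos_eq by apply Cmod_ge_0. lra. }
  rewrite <- CV_radius_derive in HR'.
  assert (Hx : Rbar_lt (Rabs r) (CV_radius (PS_derive (fun n => Cmod (a n))))).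
  { apply Rbar_lt_le_trans with (2 := HR'). simpl. rewrite Rabs_pos_eq; lra. }
  apply CV_disk_inside in Hx. apply ex_series_ext with (2 := Hx).
  intros n. unfold PS_derive, dcoef. rewrite Cmod_mult, Cmod_R.
  assert (0 <= r ^ n) by (apply pow_le; lra).
  rewrite !Rabs_mult, (Rabs_pos_eq (r ^ n)), (Rabs_pos_eq (Cmod _)) by (assumption || apply Cmod_ge_0).
  reflexivity.
Qed.

(** Derivatives are taken only along rays from the centre, where the real theory of power series in
    [r] applies to both components. This suffices for the differential equation of [Z]. *)
Lemma ray_derive rho a u r : 0 < rho -> summ rho a -> Cmod u = 1 -> Rabs r < rho ->
  is_derive (fun r => Re (Cser (fun n => a n * (RtoC r * u) ^ n)%C)) r
    (Re (u * Cser (fun n => dcoef a n * (RtoC r * u) ^ n))%C) /\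
  is_derive (fun r => Im (Cser (fun n => a n * (RtoC r * u) ^ n)%C)) r
    (Im (u * Cser (fun n => dcoef a n * (RtoC r * u) ^ n))%C).
Proof.
  intros Hrho Ha Hu Hr.
  assert (Hz : Cmod (RtoC r * u) < rho) by (rewrite Cmod_mult, Cmod_R, Hu; lra).
  pose proof (summ_cabs _ _ _ (summ_dcoef _ _ Hrho Ha) Hz) as Hd.
  rewrite <- Cser_scal by assumption.
  assert (Hm : forall n, Cmod (a n * u ^ n) = Cmod (a n)).
  { intros n. rewrite Cmod_mult, Cmod_pow, Hu, pow1. ring. }
  assert (E : forall n x, (a n * (RtoC x * u) ^ n = (a n * u ^ n) * RtoC x ^ n)%C).
  { intros n x. rewrite Cpow_mult_l. ring. }
  assert (ED : forall n, (u * (dcoef a n * (RtoC r * u) ^ n) = RtoC (INR (S n)) * ((a (S n) * u ^ (S n)) * RtoC r ^ n))%C).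
  { intros n. unfold dcoef. rewrite Cpow_mult_l, Cpow_S. ring. }
  split.
  - set (c := fun n => Re (a n * u ^ n)%C).
    assert (HR : Rbar_lt (Rabs r) (CV_radius c)).
    { apply Rbar_lt_le_trans with rho; [exact Hr|]. apply summ_radius with a; auto.
      intros n. unfold c. rewrite <- Hm. apply re_le_Cmod. }
    apply is_derive_ext with (PSeries c).
    + intros x. change (PSeries c x = Series (fun n => Re (a n * (RtoC x * u) ^ n)%C)).
      apply Series_ext. intros n. rewrite E, Re_mult_pow_R. reflexivity.
    + replace (Re (Cser (fun n => u * (dcoef a n * (RtoC r * u) ^ n))%C)) with (PSeries (PS_derive c) r).
      * now apply is_derive_PSeries.
      * change (PSeries (PS_derive c) r = Series (fun n => Re (u * (dcoef a n * (RtoC r * u) ^ n))%C)).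
        apply Series_ext. intros n. rewrite ED, re_scal_l, Re_mult_pow_R.
        unfold PS_derive, c. ring.
  - set (c := fun n => Im (a n * u ^ n)%C).
    assert (HR : Rbar_lt (Rabs r) (CV_radius c)).
    { apply Rbar_lt_le_trans with rho; [exact Hr|]. apply summ_radius with a; auto.
      intros n. unfold c. rewrite <- Hm. apply im_le_Cmod. }
    apply is_derive_ext with (PSeries c).
    + intros x. change (PSeries c x = Series (fun n => Im (a n * (RtoC x * u) ^ n)%C)).
      apply Series_ext. intros n. rewrite E, Im_mult_pow_R. reflexivity.
    + replace (Im (Cser (fun n => u * (dcoef a n * (RtoC r * u) ^ n))%C)) with (PSeries (PS_derive c) r).
      * now apply is_derive_PSeries.
      * change (PSeries (PS_derive c) r = Series (fun n => Im (u * (dcoef a n * (RtoC r * u) ^ n))%C)).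
        apply Series_ext. intros n. rewrite ED, im_scal_l, Im_mult_pow_R.
        unfold PS_derive, c. ring.
Qed.

(** * The Borel-Caratheodory inequality *)

Lemma is_RInt_eq (f g : R -> R) (a b v w : R) :
  is_RInt f a b v -> (forall x, f x = g x) -> v = w -> is_RInt g a b w.
Proof. intros H Hfg <-. apply is_RInt_ext with (2 := H). intros; apply Hfg. Qed.

Lemma sin_2piZ x z : sin (x + 2 * IZR z * PI) = sin x.
Proof.
  destruct (Z_le_gt_dec 0 z) as [h|h].
  - rewrite <- (Z2Nat.id z h), <- INR_IZR_INZ. apply sin_period.
  - assert (h' : (0 <= - z)%Z) by lia.
    rewrite <- (sin_period (x + 2 * IZR z * PI) (Z.to_nat (- z))).
    rewrite INR_IZR_INZ, Z2Nat.id, opp_IZR by assumption. f_equal. ring.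
Qed.

Lemma int_cosZ z chi : is_RInt (fun x => cos (IZR z * x + chi)) 0 (2 * PI)
  (if Z.eq_dec z 0 then 2 * PI * cos chi else 0).
Proof.
  destruct (Z.eq_dec z 0) as [->|h].
  - apply is_RInt_ext with (fun _ => cos chi).
    + intros x _. f_equal. ring.
    + pose proof (is_RInt_const (V := R_NormedModule) 0 (2 * PI) (cos chi)) as H.
      unfold scal in H; simpl in H; unfold mult in H; simpl in H. now rewrite Rminus_0_r in H.
  - assert (hz : IZR z <> 0) by now apply not_0_IZR.
    replace 0 with (sin (IZR z * (2 * PI) + chi) / IZR z - sin (IZR z * 0 + chi) / IZR z) at 2.
    + apply (is_RInt_derive (V := R_CompleteNormedModule) (fun x => sin (IZR z * x + chi) / IZR z)).
      * intros x _. auto_derive; [exact I|]. field. assumption.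
      * intros x _. apply (ex_derive_continuous (V := R_NormedModule)). auto_derive. exact I.
    + replace (IZR z * (2 * PI) + chi) with (chi + 2 * IZR z * PI) by ring.
      rewrite sin_2piZ. replace (IZR z * 0 + chi) with chi by ring. ring.
Qed.

(** Orthogonality of the trigonometric system. After product-to-sum, only the frequency [k - n] can
    be zero and leave a contribution. *)
Lemma int_trig (k n : nat) (A B al be : R) : (1 <= k)%nat -> (1 <= n)%nat ->
  is_RInt (fun x => (A * cos (INR k * x) - B * sin (INR k * x)) * (1 + al * cos (INR n * x) + be * sin (INR n * x)))
    0 (2 * PI) (if Nat.eq_dec k n then PI * (A * al - B * be) else 0).
Proof.
  intros Hk Hn.
  pose proof (int_cosZ (Z.of_nat k) 0) as I1. pose proof (int_cosZ (Z.of_nat k) (PI / 2)) as I2.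
  pose proof (int_cosZ (Z.of_nat k - Z.of_nat n) 0) as I3. pose proof (int_cosZ (Z.of_nat k - Z.of_nat n) (PI / 2)) as I4.
  pose proof (int_cosZ (Z.of_nat k + Z.of_nat n) 0) as I5. pose proof (int_cosZ (Z.of_nat k + Z.of_nat n) (PI / 2)) as I6.
  rewrite minus_IZR in I3, I4. rewrite plus_IZR in I5, I6. rewrite <- !INR_IZR_INZ in *.
  destruct (Z.eq_dec (Z.of_nat k) 0); [lia|].
  destruct (Z.eq_dec (Z.of_nat k + Z.of_nat n) 0); [lia|].
  pose proof (is_RInt_scal _ _ _ A _ I1) as J1. pose proof (is_RInt_scal _ _ _ B _ I2) as J2.
  pose proof (is_RInt_scal _ _ _ ((A * al - B * be) / 2) _ I3) as J3.
  pose proof (is_RInt_scal _ _ _ ((A * be + B * al) / 2) _ I4) as J4.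
  pose proof (is_RInt_scal _ _ _ ((A * al + B * be) / 2) _ I5) as J5.
  pose proof (is_RInt_scal _ _ _ ((B * al - A * be) / 2) _ I6) as J6.
  pose proof (is_RInt_plus _ _ _ _ _ _ (is_RInt_plus _ _ _ _ _ _ J1 J2)
    (is_RInt_plus _ _ _ _ _ _ (is_RInt_plus _ _ _ _ _ _ J3 J4) (is_RInt_plus _ _ _ _ _ _ J5 J6))) as J.
  unfold scal, plus in J; simpl in J. unfold mult in J; simpl in J.
  apply (is_RInt_eq _ _ _ _ _ _ J).
  - intros x.
    rewrite !Rplus_0_r, !cos_plus, cos_PI2, sin_PI2.
    replace ((INR k - INR n) * x) with (INR k * x - INR n * x) by ring.
    replace ((INR k + INR n) * x) with (INR k * x + INR n * x) by ring.
    rewrite cos_minus, sin_minus, cos_plus, sin_plus. field.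
  - destruct (Nat.eq_dec k n) as [->|h].
    + destruct (Z.eq_dec (Z.of_nat n - Z.of_nat n) 0); [|lia].
      rewrite cos_0, cos_PI2. field.
    + destruct (Z.eq_dec (Z.of_nat k - Z.of_nat n) 0); [lia|]. ring.
Qed.

Lemma is_RInt_lsum {T} (f : T -> R -> R) (I : T -> R) l a b :
  (forall x, In x l -> is_RInt (f x) a b (I x)) ->
  is_RInt (fun v => lsum (fun x => f x v) l) a b (lsum I l).
Proof.
  induction l as [|x l IH]; intros H; simpl.
  - pose proof (is_RInt_const (V := R_NormedModule) a b 0) as HC.
    unfold scal in HC; simpl in HC; unfold mult in HC; simpl in HC. now rewrite Rmult_0_r in HC.
  - apply (is_RInt_plus (V := R_NormedModule)); [apply H; now left | apply IH; intros; apply H; now right].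
Qed.

Definition cis (x : R) : C := (cos x, sin x).
Lemma Cmod_cis x : Cmod (cis x) = 1.
Proof.
  replace (cis x) with (ce (0, x)).
  - rewrite Cmod_ce. simpl. apply exp_0.
  - unfold ce, cis; simpl. rewrite exp_0. f_equal; ring.
Qed.
Lemma cis_pow x n : (cis x ^ n)%C = cis (INR n * x).
Proof.
  induction n.
  - simpl. unfold cis. rewrite Rmult_0_l, cos_0, sin_0. reflexivity.
  - rewrite Cpow_S, IHn, S_INR. unfold cis, Cmult; simpl.
    replace ((INR n + 1) * x) with (x + INR n * x) by ring. rewrite cos_plus, sin_plus. f_equal; ring.
Qed.

(** The kernel [1 + al cos(n x) + be sin(n x)] is nonnegative when [al^2 + be^2 <= 1]. Integrating
    it against [M - Re f] over the circle gives [2 PI M - PI (A_n al - B_n be) >= 0], and the best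
    direction yields the modulus of the coefficient. *)
Lemma borel_caratheodory rho f r M : 0 < r < rho -> summ rho f -> f 0%nat = RtoC 0 ->
  (forall z, Cmod z = r -> Re (Cser (fun n => f n * z ^ n)%C) <= M) ->
  forall n, (1 <= n)%nat -> Cmod (f n) * r ^ n <= 2 * M.
Proof.
  intros Hr Hf Hf0 HM n Hn.
  set (A := fun k => Re (f k) * r ^ k). set (B := fun k => Im (f k) * r ^ k).
  assert (key : forall al be, al * al + be * be <= 1 -> A n * al - B n * be <= 2 * M).
  { intros al be Hab. apply le_epsilon. intros delta Hdelta.
    set (r1 := (r + rho) / 2). assert (Hr1 : r < r1 < rho) by (unfold r1; lra).
    assert (Hq : 0 <= r / r1 < 1).
    { split; [apply Rdiv_le_0_compat; lra|]. apply Rmult_lt_reg_r with r1; [lra|].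
      unfold Rdiv. rewrite Rmult_assoc, Rinv_l; lra. }
    (* The series is cut at a [K] beyond which its remainder on the circle is at most [delta / 2]; a
       finite sum can be integrated term by term. *)
    set (S1 := Series (fun n => Cmod (f n) * r1 ^ n)).
    assert (HS1 : ex_series (fun n => Cmod (f n) * r1 ^ n)) by (apply Hf; lra).
    assert (HS1p : forall k, 0 <= Cmod (f k) * r1 ^ k).
    { intros k. apply Rmult_le_pos; [apply Cmod_ge_0 | apply pow_le; lra]. }
    assert (HS0 : 0 <= S1) by (eapply Rle_trans; [apply (HS1p 0%nat)|apply (term_le_Series _ 0 HS1p HS1)]).
    destruct (pow_lt_1_zero (r / r1) ltac:(rewrite Rabs_pos_eq; lra) (delta / (4 * (S1 + 1)))
      ltac:(apply Rdiv_lt_0_compat; lra)) as [N HN].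
    set (K := (N + S n)%nat).
    specialize (HN K ltac:(unfold K; lia)). rewrite Rabs_pos_eq in HN by (apply pow_le; lra).
    assert (Htail : forall z, Cmod z = r -> Rabs (Re (Cser (fun n => f n * z ^ n)%C) - Re (csum (fun n => f n * z ^ n)%C K)) <= delta / 2).
    { intros z Hz.
      assert (HT : Cmod (Cser (fun n => f n * z ^ n)%C - csum (fun n => f n * z ^ n)%C K)%C <= 2 * ((r / r1) ^ K * S1)).
      { apply Cser_tail; auto.
        - apply pow_le; lra.
        - intros k Hk. rewrite Cmod_mult, Cmod_pow, Hz.
          replace (r ^ k) with ((r / r1) ^ k * r1 ^ k) by (rewrite <- Rpow_mult_distr; f_equal; field; lra).
          replace ((r / r1) ^ K * (Cmod (f k) * r1 ^ k)) with (Cmod (f k) * ((r / r1) ^ K * r1 ^ k)) by ring.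
          apply Rmult_le_compat_l; [apply Cmod_ge_0|]. apply Rmult_le_compat_r; [apply pow_le; lra|].
          replace k with (K + (k - K))%nat by lia. rewrite pow_add.
          rewrite <- (Rmult_1_r ((r / r1) ^ K)) at 2. apply Rmult_le_compat_l; [apply pow_le; lra|].
          rewrite <- (pow1 (k - K)). apply pow_incr. lra.
        - apply summ_cabs with rho; auto. lra. }
      apply Rle_trans with (Cmod (Cser (fun n => f n * z ^ n)%C - csum (fun n => f n * z ^ n)%C K)%C).
      - eapply Rle_trans; [|apply re_le_Cmod]. right. reflexivity.
      - eapply Rle_trans; [exact HT|].
        assert ((r / r1) ^ K * S1 <= delta / (4 * (S1 + 1)) * S1) by (apply Rmult_le_compat_r; lra).
        assert (delta / (4 * (S1 + 1)) * S1 <= delta / 4).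
        { replace (delta / (4 * (S1 + 1)) * S1) with (delta / 4 * (S1 / (S1 + 1))) by (field; lra).
          rewrite <- (Rmult_1_r (delta / 4)) at 2. apply Rmult_le_compat_l; [lra|].
          apply Rmult_le_reg_r with (S1 + 1); [lra|]. unfold Rdiv. rewrite Rmult_assoc, Rinv_l; lra. }
        lra. }
    (* On the circle the real part is a trigonometric polynomial; it has no constant term because
       [f 0 = 0]. *)
    set (P := fun x => lsum (fun k => A k * cos (INR k * x) - B k * sin (INR k * x)) (seq 1 (K - 1))).
    assert (HP : forall x, Re (csum (fun n => f n * (RtoC r * cis x) ^ n)%C K) = P x).
    { intros x. rewrite csum_Re. replace K with (S (K - 1)) at 1 by (unfold K; lia).
      change (seq 0 (S (K - 1))) with (0%nat :: seq 1 (K - 1)). cbn [lsum].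
      rewrite Hf0. replace (Re (RtoC 0 * (RtoC r * cis x) ^ 0)%C) with 0 by (simpl; ring).
      rewrite Rplus_0_l. apply lsum_ext. intros k _.
      rewrite Cpow_mult_l, cis_pow, <- RtoC_pow. unfold A, B.
      destruct (f k) as [f1 f2]. unfold cis, Re, Im, RtoC, Cmult; simpl. ring. }
    assert (HI : is_RInt (fun x => P x * (1 + al * cos (INR n * x) + be * sin (INR n * x))) 0 (2 * PI)
        (PI * (A n * al - B n * be))).
    { assert (HI1 : is_RInt (fun x => lsum (fun k => (A k * cos (INR k * x) - B k * sin (INR k * x)) * (1 + al * cos (INR n * x) + be * sin (INR n * x))) (seq 1 (K - 1)))
         0 (2 * PI) (lsum (fun k => if Nat.eq_dec k n then PI * (A k * al - B k * be) else 0) (seq 1 (K - 1)))).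
      { apply is_RInt_lsum. intros k Hk. apply in_seq in Hk. apply int_trig; lia. }
      replace (PI * (A n * al - B n * be)) with (lsum (fun k => if Nat.eq_dec k n then PI * (A k * al - B k * be) else 0) (seq 1 (K - 1))).
      - apply is_RInt_ext with (2 := HI1). intros x _. unfold P.
        rewrite (Rmult_comm (lsum _ _) _), <- lsum_scal. apply lsum_ext. intros k _. ring.
      - replace (K - 1)%nat with ((n - 1) + S (K - 1 - n))%nat by (unfold K; lia).
        rewrite seq_app, lsum_app. replace (1 + (n - 1))%nat with n by lia. simpl seq. cbn [lsum].
        destruct (Nat.eq_dec n n); [|easy].
        rewrite !lsum_0; [ring | |].
        + intros k Hk. apply in_seq in Hk. destruct (Nat.eq_dec k n); [lia|reflexivity].
        + intros k Hk. apply in_seq in Hk. destruct (Nat.eq_dec k n); [lia|reflexivity]. }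
    assert (HJ : is_RInt (fun x => (M + delta / 2) * (1 + al * cos (INR n * x) + be * sin (INR n * x))) 0 (2 * PI)
        ((M + delta / 2) * (2 * PI))).
    { pose proof (int_cosZ 0 0) as I0. pose proof (int_cosZ (Z.of_nat n) 0) as I1.
      pose proof (int_cosZ (Z.of_nat n) (PI / 2)) as I2.
      destruct (Z.eq_dec 0 0); [|lia]. destruct (Z.eq_dec (Z.of_nat n) 0); [lia|].
      rewrite <- INR_IZR_INZ in I1, I2.
      pose proof (is_RInt_plus _ _ _ _ _ _ (is_RInt_scal _ _ _ (M + delta / 2) _ I0)
       (is_RInt_plus _ _ _ _ _ _ (is_RInt_scal _ _ _ ((M + delta / 2) * al) _ I1)
        (is_RInt_scal _ _ _ (- ((M + delta / 2) * be)) _ I2))) as J.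
      unfold scal, plus in J; simpl in J. unfold mult in J; simpl in J.
      apply (is_RInt_eq _ _ _ _ _ _ J); [|rewrite cos_0; ring]. intros x.
      rewrite !Rplus_0_r, !cos_plus, cos_PI2, sin_PI2, Rmult_0_l, cos_0. ring. }
    pose proof (is_RInt_minus _ _ _ _ _ _ HJ HI) as HD.
    unfold minus, plus, opp in HD; simpl in HD.
    pose proof PI_RGT_0 as Hpi.
    assert (H0 : 0 <= (M + delta / 2) * (2 * PI) + - (PI * (A n * al - B n * be))).
    { rewrite <- (is_RInt_unique _ _ _ _ HD). apply RInt_ge_0; [lra | eexists; exact HD |].
      intros x _.
      assert (Hz : Cmod (RtoC r * cis x) = r) by (rewrite Cmod_mult, Cmod_R, Cmod_cis, Rabs_pos_eq; lra).
      specialize (Htail _ Hz). rewrite HP in Htail. specialize (HM _ Hz).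
      apply Rabs_le_between in Htail.
      pose proof (sin2_cos2 (INR n * x)) as Hsc. unfold Rsqr in Hsc.
      set (c := cos (INR n * x)) in *. set (s := sin (INR n * x)) in *.
      assert (0 <= 1 + al * c + be * s).
      { assert ((al * c + be * s) * (al * c + be * s) <= 1).
        { assert (0 <= (al * s - be * c) * (al * s - be * c)) by apply Rle_0_sqr.
          assert ((al * al + be * be) * (s * s + c * c) <= 1) by (rewrite Hsc; lra). lra. }
        nra. }
      replace ((M + delta / 2) * (1 + al * c + be * s) + - (P x * (1 + al * c + be * s)))
        with ((M + delta / 2 - P x) * (1 + al * c + be * s)) by ring.
      apply Rmult_le_pos; lra. }
    nra. }
  assert (Hrn : 0 < r ^ n) by (apply pow_lt; lra).
  assert (Hm : (Cmod (f n) * r ^ n) * (Cmod (f n) * r ^ n) = A n * A n + B n * B n).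
  { pose proof (Cmod2_alt (f n)) as E. unfold A, B. simpl in E. rewrite !Rmult_1_r in E.
    transitivity ((Cmod (f n) * Cmod (f n)) * (r ^ n * r ^ n)); [ring|]. rewrite E. ring. }
  assert (Hm0 : 0 <= Cmod (f n) * r ^ n) by (apply Rmult_le_pos; [apply Cmod_ge_0|lra]).
  set (m := Cmod (f n) * r ^ n) in *.
  destruct (Rle_lt_or_eq_dec 0 m Hm0) as [h|<-].
  (* The unit vector in the direction of the conjugate coefficient, for which the linear form
     attains its maximum [m]. *)
  - pose proof (key (A n / m) (- B n / m)) as H.
    assert (E1 : A n / m * (A n / m) + - B n / m * (- B n / m) = 1).
    { transitivity ((A n * A n + B n * B n) / (m * m)); [field; lra|]. rewrite <- Hm. field. lra. }
    assert (E2 : A n * (A n / m) - B n * (- B n / m) = m).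
    { transitivity ((A n * A n + B n * B n) / m); [field; lra|]. rewrite <- Hm. field. lra. }
    rewrite E1, E2 in H. lra.
  - pose proof (key 0 0 ltac:(lra)). lra.
Qed.

(** * Elementary Laplace transforms *)

Lemma is_lim_exp_neg a K : 0 < a -> is_lim_seq (fun n => K * exp (- a * INR n)) 0.
Proof.
  intros Ha. apply is_lim_seq_abs_0. apply is_lim_seq_spec. intros eps.
  destruct (exp_neg_small a (Rabs K) Ha (Rabs_pos K) eps (cond_pos eps)) as [N HN].
  exists N. intros n Hn. rewrite Rminus_0_r, Rabs_Rabsolu, Rabs_mult, (Rabs_pos_eq (exp _)) by (left; apply exp_pos).
  now apply HN.
Qed.

Lemma is_lim_squeeze0 (u w : nat -> R) : (forall n, Rabs (u n) <= w n) -> is_lim_seq w 0 -> is_lim_seq u 0.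
Proof.
  intros H Hw. apply is_lim_seq_abs_0.
  apply is_lim_seq_le_le with (fun _ => 0) w; auto.
  - intros n. split; [apply Rabs_pos | apply H].
  - apply is_lim_seq_const.
Qed.

Lemma LI_ext_g g1 g2 k : (forall v, g1 v = g2 v) -> LI g1 k = LI g2 k.
Proof.
  intros H. unfold LI. f_equal. apply Lim_seq_ext. intros n. apply RInt_ext.
  intros v _. now rewrite H.
Qed.

Lemma RInt_expk_lim b : 0 < b -> is_lim_seq (fun n => RInt (fun v => exp (- b * v)) 0 (INR n)) (/ b).
Proof.
  intros Hb. apply is_lim_seq_ext with (fun n => / b - / b * exp (- b * INR n)).
  - intros n. symmetry. apply is_RInt_unique.
    apply (is_RInt_eq (fun v => exp (- b * v)) _ _ _ (- / b * exp (- b * INR n) - (- / b * exp (- b * 0)))).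
    + apply (is_RInt_derive (V := R_CompleteNormedModule) (fun v => - / b * exp (- b * v))).
      * intros x _. auto_derive; [exact I|]. field. lra.
      * intros x _. apply (ex_derive_continuous (V := R_NormedModule)). auto_derive. exact I.
    + reflexivity.
    + rewrite Rmult_0_r, exp_0. ring.
  - replace (Finite (/ b)) with (Finite (/ b - 0)) by (f_equal; ring).
    apply is_lim_seq_minus'; [apply is_lim_seq_const | now apply is_lim_exp_neg].
Qed.

Lemma RInt_v_expk_lim b : 0 < b -> is_lim_seq (fun n => RInt (fun v => v * exp (- b * v)) 0 (INR n)) (/ b * / b).
Proof.
  intros Hb.
  apply is_lim_seq_ext with (fun n => / b * / b - / b * (INR n + / b) * exp (- b * INR n)).
  - intros n. symmetry. apply is_RInt_unique.
    apply (is_RInt_eq (fun v => v * exp (- b * v)) _ _ _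
       (- / b * (INR n + / b) * exp (- b * INR n) - (- / b * (0 + / b) * exp (- b * 0)))).
    + apply (is_RInt_derive (V := R_CompleteNormedModule) (fun v => - / b * (v + / b) * exp (- b * v))).
      * intros x _. auto_derive; [exact I|]. field. lra.
      * intros x _. apply (ex_derive_continuous (V := R_NormedModule)). auto_derive. exact I.
    + reflexivity.
    + rewrite Rmult_0_r, exp_0. ring.
  - replace (Finite (/ b * / b)) with (Finite (/ b * / b - 0)) by (f_equal; ring).
    apply is_lim_seq_minus'; [apply is_lim_seq_const |].
    assert (0 < / b) by now apply Rinv_0_lt_compat.
    apply is_lim_squeeze0 with (fun n => (/ b * (2 * / b + / b)) * exp (- (b / 2) * INR n)).
    + intros n. pose proof (pos_INR n) as Hn.
      rewrite Rabs_pos_eq.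
      2:{ apply Rmult_le_pos; [apply Rmult_le_pos; lra | left; apply exp_pos]. }
      replace (- b * INR n) with (- (b / 2) * INR n + - (b / 2) * INR n) by field. rewrite exp_plus.
      pose proof (lin_le_exp (b / 2) (INR n) ltac:(lra)) as H1.
      replace (/ (b / 2)) with (2 * / b) in H1 by (field; lra).
      pose proof (one_le_exp (b / 2 * INR n) ltac:(nra)) as H2.
      assert (E : exp (- (b / 2) * INR n) * exp (b / 2 * INR n) = 1).
      { rewrite <- exp_plus. replace (- (b / 2) * INR n + b / 2 * INR n) with 0 by ring. apply exp_0. }
      set (e := exp (- (b / 2) * INR n)) in *. set (E' := exp (b / 2 * INR n)) in *.
      assert (0 < e) by apply exp_pos.
      rewrite <- Rmult_assoc. apply Rmult_le_compat_r; [lra|].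
      rewrite Rmult_assoc. apply Rmult_le_compat_l; [lra|].
      apply Rle_trans with ((2 * / b + / b) * E' * e); [|rewrite Rmult_assoc, (Rmult_comm E'), E; lra].
      apply Rmult_le_compat_r; [lra|]. nra.
    + apply is_lim_exp_neg. lra.
Qed.

Lemma LI_exp a s : a < s -> LI (fun v => exp (a * v)) (expk s) = / (s - a).
Proof.
  intros H. apply LI_unique. apply is_lim_seq_ext with (2 := RInt_expk_lim (s - a) ltac:(lra)).
  intros n. apply RInt_ext. intros v _. unfold expk. rewrite <- exp_plus. f_equal. ring.
Qed.

Lemma LI_exp_v a s : a < s -> LI (fun v => exp (a * v)) (fun v => v * expk s v) = / (s - a) * / (s - a).
Proof.
  intros H. apply LI_unique. apply is_lim_seq_ext with (2 := RInt_v_expk_lim (s - a) ltac:(lra)).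
  intros n. apply RInt_ext. intros v _. unfold expk. rewrite Rmult_assoc, <- exp_plus. do 2 f_equal. ring.
Qed.

Lemma LI_id s : 0 < s -> LI (fun v => v) (expk s) = / s * / s.
Proof.
  intros H. apply LI_unique. apply is_lim_seq_ext with (2 := RInt_v_expk_lim s H).
  intros n. apply RInt_ext. intros v _. unfold expk. apply Rmult_comm.
Qed.

Lemma kern_expk s : kern s 1 (expk s).
Proof.
  split; [apply expk_continuous|]. intros v _. rewrite Rabs_pos_eq by (left; apply expk_pos). unfold expk. lra.
Qed.

Lemma kern_v_expk s eta : 0 < eta -> kern (s - eta) (/ eta) (fun v => v * expk s v).
Proof.
  intros He. split.
  - intros v. apply (continuous_mult (K := R_AbsRing)); [apply continuous_id | apply expk_continuous].
  - intros v Hv. rewrite Rabs_mult, (Rabs_pos_eq v), (Rabs_pos_eq (expk s v)) by (assumption || (left; apply expk_pos)).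
    replace (- (s - eta) * v) with (eta * v + - s * v) by ring. rewrite exp_plus. fold (expk s v).
    rewrite <- Rmult_assoc. apply Rmult_le_compat_r; [left; apply expk_pos | now apply lin_le_exp].
Qed.

(** * The zeta function and its logarithmic derivative *)

Definition NE P v := N_count P (exp v).
Definition EE P A v := NE P v - A * exp v.
Definition PsiE P v := psi P (exp v).
Definition QE P v := PsiE P v - (exp v - 1 - v).

(** With bounded [gint] the series of ones would diverge, and [N_count] would take its default value
    0 for all large [x], against the growth [A x + O(sqrt x)]. *)
Lemma gint_unbounded P A : 0 < A -> bigO_infty (fun x => N_count P x - A * x) (fun x => sqrt x) ->
  forall X, exists m, X < gint P m.
Proof.
  intros HA [K [M HM]] X.
  destruct (Classical_Prop.classic (exists m, X < gint P m)) as [|Hno]; [assumption|exfalso].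
  assert (Hall : forall m, gint P m <= X).
  { intros m. destruct (Rle_lt_dec (gint P m) X) as [|h]; [assumption|]. exfalso. apply Hno. now exists m. }
  assert (HN0 : forall x, X <= x -> N_count P x = 0).
  { intros x Hx. unfold N_count, sum_le, Series.
    (* [Series] returns the real part of the limit of the partial sums, and the real part of
       [p_infty] is 0. *)
    rewrite (is_lim_seq_unique _ p_infty); [reflexivity|].
    apply is_lim_seq_ext with (fun n => INR (S n)).
    - intros n. rewrite <- lsum_sum_n. rewrite (lsum_ext _ (fun _ => 1)).
      + rewrite lsum_const, length_seq. ring.
      + intros j _. destruct (Rle_dec _ _) as [|h]; [reflexivity|]. specialize (Hall j). lra.
    - apply -> is_lim_seq_incr_1. apply is_lim_seq_INR. }
  set (K' := Rmax K 0). assert (HK' : 0 <= K') by apply Rmax_r.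
  (* Evaluated at [x = y^2] the asymptotics would give [A y^2 <= K' y], which fails for
     [y > K' / A]; the other summands put [y] beyond [X] and [M]. *)
  set (y := (K' / A + 1) + Rabs X + Rabs M + 1).
  pose proof (Rabs_pos X). pose proof (Rabs_pos M). pose proof (Rle_abs X). pose proof (Rle_abs M).
  assert (0 <= K' / A) by (apply Rdiv_le_0_compat; lra).
  assert (Hy : 1 <= y) by (unfold y; lra).
  assert (Hyy : y <= y * y) by nra.
  assert (HyA : K' / A < y) by (unfold y; lra).
  assert (HyX : X < y) by (unfold y; lra). assert (HyM : M < y) by (unfold y; lra). clearbody y.
  specialize (HM (y * y) ltac:(lra)).
  rewrite HN0 in HM by lra.
  rewrite sqrt_square, (Rabs_pos_eq y) in HM by lra.
  rewrite Rabs_minus_sym, Rminus_0_r, Rabs_pos_eq in HM by nra.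
  assert (K * y <= K' * y) by (apply Rmult_le_compat_r; [lra|apply Rmax_l]).
  assert (A * y <= K').
  { apply Rmult_le_reg_r with y; [lra|]. lra. }
  assert (A * (K' / A) = K') by (field; lra).
  nra.
Qed.

Section Analytic.
Variables (P : beurling_system) (A : R).
Hypothesis HA : 0 < A.
Hypothesis hN : bigO_infty (fun x => N_count P x - A * x) (fun x => sqrt x).
Hypothesis hRH : RHv P.

Lemma ncover_ex W : exists m, ncover P W m.
Proof.
  destruct (gint_unbounded P A HA hN (exp W)) as [m Hm]. exists m. intros j Hj.
  unfold nu. rewrite <- (ln_exp W). apply ln_increasing; [apply exp_pos|].
  pose proof (gint_mono P m j Hj). lra.
Qed.

Lemma NE_atoms W m v : ncover P W m -> v <= W -> NE P v = step (atoms_N P m) v.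
Proof.
  intros Hm Hv. apply N_atoms with W; auto.
  - intros j Hj. specialize (Hm j Hj). apply exp_increasing in Hm. unfold nu in Hm.
    rewrite exp_ln in Hm by (pose proof (gint_ge1 P j); lra). exact Hm.
  - intros j. pose proof (gint_ge1 P j); lra.
Qed.

Lemma NE_nonneg v : 0 <= NE P v.
Proof.
  destruct (ncover_ex v) as [m Hm]. rewrite (NE_atoms v m v Hm) by lra.
  apply step_nonneg, atoms_N_wt.
Qed.

Lemma EE_bound : exists C, 0 <= C /\ forall v, 0 <= v -> Rabs (EE P A v) <= C * exp (1 / 2 * v).
Proof.
  apply (bigO_uniform (fun x => N_count P x - A * x) (fun W => NE P W + A * exp W)); [| lra |].
  - intros W HW v Hv. destruct (ncover_ex W) as [m Hm].
    fold (NE P v).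
    assert (NE P v <= NE P W).
    { rewrite !(NE_atoms W m) by (assumption || lra). apply step_mono; [apply atoms_N_wt | lra]. }
    pose proof (NE_nonneg v). pose proof (exp_le v W ltac:(lra)). pose proof (exp_pos v).
    apply Rabs_le. nra.
  - destruct hN as [K [M HM]]. exists K. exists (Rmax M 0). intros x Hx.
    pose proof (Rmax_l M 0). pose proof (Rmax_r M 0).
    specialize (HM x ltac:(lra)). replace (Rpower x (1 / 2)) with (sqrt x); [exact HM|].
    replace (1 / 2) with (/ 2) by field. rewrite Rpower_sqrt; lra.
Qed.

(** The counting functions agree with a finite step function plus a smooth main term on each bounded
    range, which is all that integrability needs. *)
Lemma adm_step g C kap (h : R -> R) :
  (forall W, 0 <= W -> exists L, (forall p, In p L -> 0 <= snd p) /\ forall v, v <= W -> g v = step L v + h v) ->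
  (forall v, continuous h v) ->
  (forall v, 0 <= v -> Rabs (g v) <= C * exp (kap * v)) -> adm kap C g.
Proof.
  intros Hs Hh Hb. split; [|exact Hb]. intros k W HW Hk.
  destruct (Hs W HW) as (L & HL & E).
  apply ex_RInt_ext with (fun v => plus (k v * step L v) (k v * h v)).
  - intros v. rewrite Rmin_left, Rmax_right by lra. intros Hv. rewrite E by lra. unfold plus; simpl. ring.
  - apply (ex_RInt_plus (V := R_NormedModule)).
    + now apply ex_RInt_step.
    + apply ex_RInt_cont_from with (-1); auto; try lra. intros v _.
      apply (continuous_mult (K := R_AbsRing)); auto.
Qed.

Lemma adm_EE kap : 1 / 2 <= kap -> exists C, adm kap C (EE P A).
Proof.
  intros Hk. destruct EE_bound as (C & HC & HE). exists C.
  apply adm_step with (fun v => - A * exp v).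
  - intros W HW. destruct (ncover_ex W) as [m Hm]. exists (atoms_N P m). split; [apply atoms_N_loc|].
    intros v Hv. unfold EE. rewrite (NE_atoms W m v Hm Hv). ring.
  - intros v. apply (ex_derive_continuous (V := R_NormedModule)). auto_derive. exact I.
  - intros v Hv. eapply Rle_trans; [now apply HE|]. apply Rmult_le_compat_l; [assumption|].
    apply exp_le. nra.
Qed.

Lemma adm_QE kap : 1 / 2 < kap -> exists C, adm kap C (QE P).
Proof.
  intros Hk. destruct (hRH (kap - 1 / 2) ltac:(lra)) as [C HC].
  exists (Rabs C + / kap + 1).
  apply adm_step with (fun v => - (exp v - 1 - v)).
  - intros W HW. destruct (pcover_ex P W) as [J HJ]. destruct (kcover_ex P W) as [K HK].
    exists (atoms_psi P J K). split; [apply atoms_psi_loc0|].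
    intros v Hv. unfold QE, PsiE. rewrite (psi_atoms P W J K v HJ HK Hv). ring.
  - intros v. apply (ex_derive_continuous (V := R_NormedModule)). auto_derive. exact I.
  - intros v Hv. specialize (HC v Hv). replace (1 / 2 + (kap - 1 / 2)) with kap in HC by ring.
    pose proof (one_le_exp (kap * v) ltac:(nra)) as H1.
    pose proof (lin_le_exp kap v ltac:(lra)) as H2. pose proof (Rle_abs C) as H3.
    assert (C * exp (kap * v) <= Rabs C * exp (kap * v)) by (apply Rmult_le_compat_r; lra).
    unfold QE, PsiE. apply Rabs_le_between in HC. apply Rabs_le. lra.
Qed.

Lemma adm_NE : exists C, adm 1 C (NE P).
Proof.
  destruct (adm_EE 1 ltac:(lra)) as [C HC]. exists (C + A).
  apply adm_step with (fun v => 0).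
  - intros W HW. destruct (ncover_ex W) as [m Hm]. exists (atoms_N P m). split; [apply atoms_N_loc|].
    intros v Hv. rewrite (NE_atoms W m v Hm Hv). ring.
  - intros v. apply continuous_const.
  - intros v Hv. destruct HC as [_ HC]. specialize (HC v Hv). unfold EE in HC.
    rewrite Rmult_1_l in *. apply Rabs_le_between in HC. apply Rabs_le. pose proof (exp_pos v). nra.
Qed.

Lemma adm_PsiE : exists C, adm 1 C (PsiE P).
Proof.
  destruct (adm_QE 1 ltac:(lra)) as [C HC]. exists (C + 1).
  apply adm_step with (fun v => 0).
  - intros W HW. destruct (pcover_ex P W) as [J HJ]. destruct (kcover_ex P W) as [K HK].
    exists (atoms_psi P J K). split; [apply atoms_psi_loc0|].
    intros v Hv. unfold PsiE. rewrite (psi_atoms P W J K v HJ HK Hv). ring.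
  - intros v. apply continuous_const.
  - intros v Hv. destruct HC as [_ HC]. specialize (HC v Hv). unfold QE in HC.
    rewrite Rmult_1_l in *. pose proof (psi_nonneg_exp P v) as H0. fold (PsiE P v) in H0.
    pose proof (exp_ineq1_le v).
    apply Rabs_le_between in HC. apply Rabs_le. lra.
Qed.

(** Abel summation up to [e^n], in the limit: the boundary term disappears, and the Dirichlet series
    becomes minus the transform with kernel [k']. *)
Lemma abel_lim g C k k' bet Ck (u : nat -> R) : adm 1 C g -> kern bet Ck k' -> 1 < bet ->
  (forall v, is_derive k v (k' v)) ->
  is_lim_seq (fun n => k (INR n) * g (INR n)) 0 ->
  (forall n, exists L, (forall p, In p L -> 0 <= snd p) /\ (forall v, v <= INR n -> g v = step L v) /\
      u n = step (reweigh k L) (INR n)) ->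
  is_lim_seq u (- LI g k').
Proof.
  intros Hg Hk' Hb Hd H0 Hu.
  apply is_lim_seq_ext with (fun n => k (INR n) * g (INR n) - RInt (fun v => k' v * g v) 0 (INR n)).
  - intros n. destruct (Hu n) as (L & HL & Eg & ->).
    pose proof (abel_step k k' L 0 (INR n) (pos_INR n) HL (fun v _ => Hd v) (fun v _ => proj1 Hk' v)) as HAb.
    apply (is_RInt_unique (V := R_CompleteNormedModule)) in HAb.
    rewrite (RInt_ext (fun v => k' v * g v) (fun v => k' v * step L v)).
    + rewrite HAb, (Eg (INR n)) by lra. ring.
    + intros v. rewrite Rmin_left, Rmax_right by apply pos_INR. intros Hv. rewrite Eg by lra. reflexivity.
  - replace (Finite (- LI g k')) with (Finite (0 - LI g k')) by (f_equal; ring).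
    apply is_lim_seq_minus'; [assumption|]. eapply LI_conv; eauto.
Qed.

Lemma boundary_lim g C k bet Ck : adm 1 C g -> (forall v, 0 <= v -> Rabs (k v) <= Ck * exp (- bet * v)) -> 1 < bet ->
  is_lim_seq (fun n => k (INR n) * g (INR n)) 0.
Proof.
  intros [_ Hg] Hk Hb. apply is_lim_squeeze0 with (fun n => Ck * C * exp (- (bet - 1) * INR n)).
  - intros n. pose proof (pos_INR n) as Hn. rewrite Rabs_mult.
    replace (- (bet - 1) * INR n) with (- bet * INR n + 1 * INR n) by ring. rewrite exp_plus.
    replace (Ck * C * (exp (- bet * INR n) * exp (1 * INR n))) with ((Ck * exp (- bet * INR n)) * (C * exp (1 * INR n))) by ring.
    apply Rmult_le_compat; try apply Rabs_pos; auto.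
  - apply is_lim_exp_neg. lra.
Qed.

(** [-zeta' = (psi transform) * zeta] at real [s > 1]. *)
Lemma log_derivative_LI s : 1 < s ->
  s * LI (NE P) (fun v => v * expk s v) - LI (NE P) (expk s)
  = (s * LI (PsiE P) (expk s)) * (s * LI (NE P) (expk s)).
Proof.
  intros Hs. destruct adm_NE as [CN HN]. destruct adm_PsiE as [Cp HP].
  set (eta := (s - 1) / 2). assert (Heta : 0 < eta) by (unfold eta; lra).
  pose proof (kern_expk s) as K1. pose proof (kern_v_expk s eta Heta) as K2.
  (* The truncated sums need cutoffs depending on [n]; choosing them once turns the sums into
     sequences with limits. *)
  assert (Hsel : forall n, exists mJK : nat * nat * nat,
     ncover P (INR n) (fst (fst mJK)) /\ pcover P (INR n) (snd (fst mJK)) /\ INR n < INR (S (snd mJK)) * lam P 0).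
  { intros n. destruct (ncover_ex (INR n)) as [m Hm]. destruct (pcover_ex P (INR n)) as [J HJ].
    destruct (kcover_ex P (INR n)) as [K HK]. exists (m, J, K). simpl fst; simpl snd. auto. }
  set (f := fun n => proj1_sig (ClassicalEpsilon.constructive_indefinite_description _ (Hsel n))).
  assert (Hf : forall n, ncover P (INR n) (fst (fst (f n))) /\ pcover P (INR n) (snd (fst (f n))) /\ INR n < INR (S (snd (f n))) * lam P 0)
    by (intros n; exact (proj2_sig (ClassicalEpsilon.constructive_indefinite_description _ (Hsel n)))).
  clearbody f.
  set (LN := fun n => atoms_N P (fst (fst (f n)))). set (LP := fun n => atoms_psi P (snd (fst (f n))) (snd (f n))).
  assert (EN : forall n v, v <= INR n -> NE P v = step (LN n) v).
  { intros n v Hv. apply NE_atoms with (INR n); [apply Hf | assumption]. }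
  assert (EP : forall n v, v <= INR n -> PsiE P v = step (LP n) v).
  { intros n v Hv. apply psi_atoms with (INR n); [apply Hf | apply Hf | assumption]. }
  assert (K1' : kern s (Rabs (- s) * 1) (fun v => - s * expk s v)) by now apply kern_scal.
  assert (L1 : is_lim_seq (fun n => step (reweigh (expk s) (LN n)) (INR n)) (s * LI (NE P) (expk s))).
  { replace (s * LI (NE P) (expk s)) with (- LI (NE P) (fun v => - s * expk s v)).
    - eapply (abel_lim (NE P) CN (expk s)); eauto.
      + apply expk_derive.
      + apply (boundary_lim (NE P) CN (expk s) s 1); [exact HN | apply K1 | assumption].
      + intros n. exists (LN n). split; [apply atoms_N_loc|]. split; [apply EN | reflexivity].
    - rewrite (LI_scal 1 CN (NE P) s 1) by auto. ring. }
  assert (L2 : is_lim_seq (fun n => step (reweigh (expk s) (LP n)) (INR n)) (s * LI (PsiE P) (expk s))).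
  { replace (s * LI (PsiE P) (expk s)) with (- LI (PsiE P) (fun v => - s * expk s v)).
    - eapply (abel_lim (PsiE P) Cp (expk s)); eauto.
      + apply expk_derive.
      + apply (boundary_lim (PsiE P) Cp (expk s) s 1); [exact HP | apply K1 | assumption].
      + intros n. exists (LP n). split; [apply atoms_psi_loc0|]. split; [apply EP | reflexivity].
    - rewrite (LI_scal 1 Cp (PsiE P) s 1) by auto. ring. }
  assert (K3 : kern (s - eta) 1 (expk s)).
  { split; [apply K1|]. intros v Hv. eapply Rle_trans; [now apply K1|]. apply Rmult_le_compat_l; [lra|]. apply exp_le. nra. }
  assert (K2' : kern (s - eta) (Rabs (- s) * / eta) (fun v => - s * (v * expk s v))) by now apply kern_scal.
  assert (K4 : kern (s - eta) (1 + Rabs (- s) * / eta) (fun v => expk s v + - s * (v * expk s v))).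
  { split.
    - intros v. apply (continuous_plus (V := R_NormedModule)); [apply K3 | apply K2'].
    - intros v Hv. eapply Rle_trans; [apply Rabs_triang|]. rewrite Rmult_plus_distr_r.
      apply Rplus_le_compat; [now apply K3 | now apply K2']. }
  assert (L3 : is_lim_seq (fun n => step (reweigh (fun v => v * expk s v) (LN n)) (INR n))
     (s * LI (NE P) (fun v => v * expk s v) - LI (NE P) (expk s))).
  { replace (s * LI (NE P) (fun v => v * expk s v) - LI (NE P) (expk s))
      with (- LI (NE P) (fun v => expk s v + - s * (v * expk s v))).
    - eapply (abel_lim (NE P) CN (fun v => v * expk s v)); eauto.
      + unfold eta; lra.
      + intros v. pose proof (expk_derive s v) as H.
        auto_derive; [eexists; exact H|]. replace (Derive (fun x => expk s x) v) with (- s * expk s v)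
          by (symmetry; now apply is_derive_unique). ring.
      + apply (boundary_lim (NE P) CN (fun v => v * expk s v) (s - eta) (/ eta)); [exact HN | apply K2 | unfold eta; lra].
      + intros n. exists (LN n). split; [apply atoms_N_loc|]. split; [apply EN | reflexivity].
    - rewrite (LI_plus 1 CN (NE P) (s - eta) 1 (Rabs (- s) * / eta) (expk s) (fun v => - s * (v * expk s v)))
        by (auto; unfold eta; lra).
      rewrite (LI_scal 1 CN (NE P) (s - eta) (/ eta) (fun v => v * expk s v)) by (auto; unfold eta; lra). ring. }
  destruct (log_derivative_truncated P s CN Cp Hs (adm_nonneg _ _ _ HN) (adm_nonneg _ _ _ HP)) as [C HC].
  assert (L4 : is_lim_seq (fun n => step (reweigh (expk s) (LP n)) (INR n) * step (reweigh (expk s) (LN n)) (INR n)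
     - step (reweigh (fun v => v * expk s v) (LN n)) (INR n)) 0).
  { apply is_lim_squeeze0 with (fun n => C * exp (- ((s - 1) / 2) * INR n)).
    - intros n. apply HC; try apply Hf; [apply pos_INR | |].
      + intros v Hv. change (step (LN n) v <= CN * exp v). rewrite <- (EN n v) by lra. eapply Rle_trans; [apply Rle_abs|].
        eapply Rle_trans; [apply HN; lra|]. rewrite Rmult_1_l. lra.
      + intros v Hv. change (step (LP n) v <= Cp * exp v). rewrite <- (EP n v) by lra. eapply Rle_trans; [apply Rle_abs|].
        eapply Rle_trans; [apply HP; lra|]. rewrite Rmult_1_l. lra.
    - apply is_lim_exp_neg. exact Heta. }
  pose proof (is_lim_seq_minus' _ _ _ _ (is_lim_seq_mult' _ _ _ _ L2 L1) L3) as L5.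
  apply is_lim_seq_unique in L5. apply is_lim_seq_unique in L4. rewrite L4 in L5.
  injection L5. intros E. lra.
Qed.

Definition Lap (g : R -> R) (s : C) : C := CI g (fun v => ce (RtoC v * - s)).
(** Minus the derivative of [Lap g]. *)
Definition Lap1 (g : R -> R) (s : C) : C := CI g (fun v => RtoC v * ce (RtoC v * - s))%C.
(** [Zf s = (s - 1) zeta(s) / s] and, by RH, [Df] continues [- Zf' / Zf] to [Re s > 1/2]. *)
Definition Zf (s : C) : C := (RtoC A + (s - 1) * Lap (EE P A) s)%C.
Definition Df (s : C) : C := (s * Lap (QE P) s)%C.

Lemma ce_real v s : ce (RtoC v * - RtoC s) = RtoC (expk s v).
Proof.
  unfold ce, expk, RtoC; simpl. replace (v * - 0 + 0 * - s) with 0 by ring.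
  rewrite cos_0, sin_0. f_equal; [|ring]. rewrite Rmult_1_r. f_equal. ring.
Qed.

Lemma LI_0 g : LI g (fun _ => 0) = 0.
Proof.
  apply LI_unique. apply is_lim_seq_ext with (fun _ => 0); [|apply is_lim_seq_const].
  intros n. symmetry. apply is_RInt_unique. apply is_RInt_zero; [apply pos_INR|]. intros; ring.
Qed.

Lemma Lap_real g s : Lap g (RtoC s) = RtoC (LI g (expk s)).
Proof.
  unfold Lap, CI. rewrite (LI_ext g _ (expk s)) by (intros; now rewrite ce_real).
  rewrite (LI_ext g (fun v => Im _) (fun _ => 0)) by (intros; now rewrite ce_real).
  now rewrite LI_0.
Qed.

Lemma Lap1_real g s : Lap1 g (RtoC s) = RtoC (LI g (fun v => v * expk s v)).
Proof.
  unfold Lap1, CI.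
  rewrite (LI_ext g _ (fun v => v * expk s v)) by (intros; now rewrite ce_real, re_scal_l).
  rewrite (LI_ext g (fun v => Im _) (fun _ => 0)) by (intros; rewrite ce_real, im_scal_l; simpl; ring).
  now rewrite LI_0.
Qed.

(** This is [Z' = - D Z] at real [s > 1]: the relation of [log_derivative_LI] after the main terms
    [A e^v] of [N] and [e^v - 1 - v] of [psi] are split off with their explicit transforms. *)
Lemma EE_QE_real s : 1 < s ->
  LI (EE P A) (expk s) - (s - 1) * LI (EE P A) (fun v => v * expk s v)
  = - (s * LI (QE P) (expk s)) * (A + (s - 1) * LI (EE P A) (expk s)).
Proof.
  intros Hs. pose proof (log_derivative_LI s Hs) as HL.
  destruct (adm_EE 1 ltac:(lra)) as [CE HE]. destruct (adm_QE 1 ltac:(lra)) as [CQ HQ].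
  set (eta := (s - 1) / 2). assert (Heta : 0 < eta) by (unfold eta; lra).
  pose proof (kern_expk s) as K1. pose proof (kern_v_expk s eta Heta) as K2.
  assert (Hcont : forall (g : R -> R) (C : R), (forall v, continuous g v) -> (forall v : R, 0 <= v -> Rabs (g v) <= C * exp (1 * v)) -> adm 1 C g).
  { intros g C Hc Hb. apply adm_step with g; auto. intros W _. exists nil. split; [easy|].
    intros v _. unfold step; simpl. symmetry. apply Rplus_0_l. }
  assert (Hexp : adm 1 1 (fun v => exp (1 * v))).
  { apply Hcont; [|intros v _; rewrite Rabs_pos_eq by (left; apply exp_pos); lra].
    intros v. apply (ex_derive_continuous (V := R_NormedModule)). auto_derive. exact I. }
  assert (H0exp : adm 1 1 (fun v => exp (0 * v))).
  { apply Hcont.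
    - intros v. apply (ex_derive_continuous (V := R_NormedModule)). auto_derive. exact I.
    - intros v Hv. rewrite Rabs_pos_eq, Rmult_1_l by (left; apply exp_pos). apply exp_le. lra. }
  assert (Hid : adm 1 1 (fun v => v)).
  { apply Hcont; [intros v; apply continuous_id|]. intros v Hv. rewrite Rabs_pos_eq, !Rmult_1_l by assumption.
    pose proof (exp_ineq1_le v). lra. }
  assert (Hscal : forall (c : R) (g : R -> R) (C : R), adm 1 C g -> (forall v, continuous g v) -> adm 1 (Rabs c * C) (fun v => c * g v)).
  { intros c g C [_ Hg] Hgc. apply Hcont.
    - intros v. apply (continuous_mult (K := R_AbsRing)); [apply continuous_const | apply Hgc].
    - intros v Hv. rewrite Rabs_mult, Rmult_assoc. apply Rmult_le_compat_l; [apply Rabs_pos | now apply Hg]. }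
  assert (Hce : forall a v, continuous (fun v => exp (a * v)) v).
  { intros a v. apply (ex_derive_continuous (V := R_NormedModule)). auto_derive. exact I. }
  assert (HAexp : adm 1 (Rabs A * 1) (fun v => A * exp (1 * v))) by (apply Hscal; auto).
  assert (ENk : forall k bet Ck, kern bet Ck k -> 1 < bet ->
     LI (NE P) k = LI (EE P A) k + A * LI (fun v => exp (1 * v)) k).
  { intros k bet Ck Hk Hb. rewrite <- (LI_scal_g 1 1 (fun v => exp (1 * v)) bet Ck k A) by auto.
    rewrite <- (LI_plus_g 1 CE (Rabs A * 1) (EE P A) (fun v => A * exp (1 * v)) bet Ck k) by auto.
    apply LI_ext_g. intros v. unfold EE.
    rewrite Rmult_1_l. ring. }
  assert (EPk : LI (PsiE P) (expk s) = LI (QE P) (expk s) + (/ (s - 1) - / s - / s * / s)).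
  { assert (V1 : LI (fun v => exp (1 * v)) (expk s) = / (s - 1)) by (apply LI_exp; lra).
    assert (V2 : LI (fun v => exp (0 * v)) (expk s) = / s) by (rewrite LI_exp by lra; f_equal; ring).
    assert (V3 : LI (fun v => v) (expk s) = / s * / s) by (apply LI_id; lra).
    transitivity (LI (QE P) (expk s) + (LI (fun v => exp (1 * v)) (expk s) + (-1 * LI (fun v => exp (0 * v)) (expk s)
       + -1 * LI (fun v => v) (expk s)))); [|rewrite V1, V2, V3; ring].
    clear V1 V2 V3.
    assert (A1 : adm 1 (Rabs (-1) * 1) (fun v => -1 * exp (0 * v))) by (apply Hscal; auto).
    assert (A2 : adm 1 (Rabs (-1) * 1) (fun v => -1 * v)) by (apply Hscal; auto; intros; apply continuous_id).
    assert (Hadd : forall C1 C2 g1 g2, adm 1 C1 g1 -> adm 1 C2 g2 -> adm 1 (C1 + C2) (fun v => g1 v + g2 v)).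
    { intros C1 C2 g1 g2 [G1 G1'] [G2 G2']. split.
      - intros k W HW Hk. apply ex_RInt_ext with (fun v => plus (k v * g1 v) (k v * g2 v)).
        + intros v _. unfold plus; simpl. ring.
        + apply (ex_RInt_plus (V := R_NormedModule)); auto.
      - intros v Hv. eapply Rle_trans; [apply Rabs_triang|]. rewrite Rmult_plus_distr_r.
        apply Rplus_le_compat; auto. }
    rewrite <- (LI_scal_g 1 1 (fun v => exp (0 * v)) s 1 (expk s) (-1)) by auto.
    rewrite <- (LI_scal_g 1 1 (fun v => v) s 1 (expk s) (-1)) by auto.
    rewrite <- (LI_plus_g 1 _ _ _ _ s 1 (expk s) A1 A2 K1 Hs).
    rewrite <- (LI_plus_g 1 _ _ _ _ s 1 (expk s) Hexp (Hadd _ _ _ _ A1 A2) K1 Hs).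
    rewrite <- (LI_plus_g 1 _ _ _ _ s 1 (expk s) HQ (Hadd _ _ _ _ Hexp (Hadd _ _ _ _ A1 A2)) K1 Hs).
    apply LI_ext_g. intros v. unfold QE.
    rewrite Rmult_1_l, Rmult_0_l, exp_0. ring. }
  rewrite EPk, (ENk _ _ _ K1 Hs), (ENk _ _ _ K2 ltac:(unfold eta; lra)), LI_exp, LI_exp_v in HL by lra.
  set (x := LI (EE P A) (expk s)) in *. set (y := LI (EE P A) (fun v => v * expk s v)) in *.
  set (q := LI (QE P) (expk s)) in *. clearbody x y q.
  (* Multiplying by [s - 1] leaves the same term [A / (s - 1)] on both sides, and the pole
     cancels. *)
  assert (E : s * (s - 1) * y - s * x = s * s * q * (A + (s - 1) * x)).
  { apply (f_equal (fun t => t * (s - 1))) in HL.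
    replace ((s * (y + A * (/ (s - 1) * / (s - 1))) - (x + A * / (s - 1))) * (s - 1))
      with (s * (s - 1) * y + A * / (s - 1) - (s - 1) * x) in HL by (field; lra).
    replace (s * (q + (/ (s - 1) - / s - / s * / s)) * (s * (x + A * / (s - 1))) * (s - 1))
      with (s * s * q * (A + (s - 1) * x) + A * / (s - 1) + x) in HL by (field; lra).
    lra. }
  apply Rmult_eq_reg_l with (- s); [|lra]. lra.
Qed.
End Analytic.

(** * Analyticity of the transforms and continuation from the real half-line *)

Lemma RtoC_m1 : RtoC (-1) = (- (1))%C.
Proof. unfold RtoC, Copp; simpl. f_equal; ring. Qed.

Lemma Re_ce_arg v s : Re (RtoC v * - s)%C = - Re s * v.
Proof. destruct s; simpl. ring. Qed.

Lemma ce_kernel s T v :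
  ce (RtoC v * - ((s, T) : C)) = (exp (- s * v) * cos (T * v), - (exp (- s * v) * sin (T * v))).
Proof.
  unfold ce; simpl. replace (v * - T + 0 * - s) with (- (T * v)) by ring.
  replace (v * - s - 0 * - T) with (- s * v) by ring. rewrite cos_neg, sin_neg. f_equal; ring.
Qed.

Lemma ckern_ce s : ckern (Re s) 1 (fun v => ce (RtoC v * - s)).
Proof.
  split; [apply ccont_ce|]. intros v _. rewrite Cmod_ce, Re_ce_arg. lra.
Qed.

Lemma ckern_v_ce s eta : 0 < eta -> ckern (Re s - eta) (/ eta) (fun v => RtoC v * ce (RtoC v * - s))%C.
Proof.
  intros He. split.
  - apply ccont_mult; [|apply ccont_ce]. apply ccont_R. intros; apply continuous_id.
  - intros v Hv. rewrite Cmod_mult, Cmod_ce, Re_ce_arg, Cmod_R, Rabs_pos_eq by assumption.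
    replace (- (Re s - eta) * v) with (eta * v + - Re s * v) by ring. rewrite exp_plus, <- Rmult_assoc.
    apply Rmult_le_compat_r; [left; apply exp_pos | now apply lin_le_exp].
Qed.

Lemma summ_mono rho rho' a : rho' <= rho -> summ rho a -> summ rho' a.
Proof. intros H Ha r Hr. apply Ha. lra. Qed.

Lemma ce_shift v s0 z : ce (RtoC v * - (s0 + z)) = (ce (RtoC v * - s0) * ce (RtoC v * - z))%C.
Proof. rewrite <- ce_add. f_equal. ring. Qed.

Lemma Lap_taylor g kap C s0 : adm kap C g -> kap < Re s0 ->
  summ (Re s0 - kap) (taylor_coef g (fun v => ce (RtoC v * - s0))) /\
  forall z, Cmod z < Re s0 - kap -> Lap g (s0 + z)%C = Cser (fun n => taylor_coef g (fun v => ce (RtoC v * - s0)) n * z ^ n)%C.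
Proof.
  intros Hg Hs. destruct (CI_taylor kap C g (Re s0) 1 _ Hg (ckern_ce s0) Hs) as [H1 H2].
  split; [now apply geom_bounded_summ|]. intros z Hz. rewrite <- (H2 z Hz). apply CI_ext. intros v. apply ce_shift.
Qed.

Lemma Lap1_taylor g kap C s0 rho : adm kap C g -> 0 < rho < Re s0 - kap ->
  summ rho (taylor_coef g (fun v => RtoC v * ce (RtoC v * - s0))%C) /\
  forall z, Cmod z < rho -> Lap1 g (s0 + z)%C = Cser (fun n => taylor_coef g (fun v => RtoC v * ce (RtoC v * - s0))%C n * z ^ n)%C.
Proof.
  intros Hg Hs. set (eta := Re s0 - kap - rho). assert (He : 0 < eta) by (unfold eta; lra).
  destruct (CI_taylor kap C g (Re s0 - eta) (/ eta) _ Hg (ckern_v_ce s0 eta He) ltac:(unfold eta; lra)) as [H1 H2].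
  replace (Re s0 - eta - kap) with rho in * by (unfold eta; ring).
  split; [now apply geom_bounded_summ|]. intros z Hz. rewrite <- (H2 z Hz). apply CI_ext. intros v.
  rewrite ce_shift. ring.
Qed.

Lemma Lap_AN g kap C s0 rho : adm kap C g -> 0 < rho <= Re s0 - kap -> AN rho (fun z => Lap g (s0 + z)%C).
Proof.
  intros Hg Hr. destruct (Lap_taylor g kap C s0 Hg ltac:(lra)) as [H1 H2].
  eexists. split; [apply (summ_mono (Re s0 - kap)); [lra | exact H1]|]. intros z Hz. apply H2. lra.
Qed.

Lemma Lap1_AN g kap C s0 rho : adm kap C g -> 0 < rho < Re s0 - kap -> AN rho (fun z => Lap1 g (s0 + z)%C).
Proof.
  intros Hg Hr. destruct (Lap1_taylor g kap C s0 rho Hg Hr) as [H1 H2]. eexists. split; eauto.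
Qed.

(** Differentiation in a real parameter, by components; here the parameter is the distance along a
    ray. *)
Definition cder (f : R -> C) (r : R) (l : C) : Prop :=
  is_derive (fun x => Re (f x)) r (Re l) /\ is_derive (fun x => Im (f x)) r (Im l).

Lemma cder_eq f g r l l' : cder f r l -> (forall x, f x = g x) -> l = l' -> cder g r l'.
Proof.
  intros [H1 H2] E <-. split; [apply is_derive_ext with (2 := H1) | apply is_derive_ext with (2 := H2)];
   intros; now rewrite E.
Qed.

Lemma cder_eq_loc f g r l l' : cder f r l -> locally r (fun x => f x = g x) -> l = l' -> cder g r l'.
Proof.
  intros [H1 H2] E <-. split; [apply is_derive_ext_loc with (2 := H1) | apply is_derive_ext_loc with (2 := H2)];
   apply filter_imp with (2 := E); intros x ->; reflexivity.
Qed.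

Lemma cder_const c r : cder (fun _ => c) r (RtoC 0).
Proof. split; apply (is_derive_const (V := R_NormedModule)). Qed.

Lemma cder_plus f g r a b : cder f r a -> cder g r b -> cder (fun x => f x + g x)%C r (a + b)%C.
Proof.
  intros [F1 F2] [G1 G2]. split; apply (is_derive_plus (V := R_NormedModule)); assumption.
Qed.

Lemma is_derive_mult_R (f g : R -> R) (x a b : R) :
  is_derive f x a -> is_derive g x b -> is_derive (fun y => f y * g y) x (a * g x + f x * b).
Proof.
  intros Hf Hg. apply (is_derive_mult (K := R_AbsRing) f g x a b Hf Hg). intros; apply Rmult_comm.
Qed.

Lemma cder_mult f g r a b : cder f r a -> cder g r b -> cder (fun x => f x * g x)%C r (a * g r + f r * b)%C.
Proof.
  intros [F1 F2] [G1 G2]. split.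
  - pose proof (is_derive_minus _ _ _ _ _ (is_derive_mult_R _ _ _ _ _ F1 G1) (is_derive_mult_R _ _ _ _ _ F2 G2)) as H.
    unfold minus, plus, opp in H; simpl in H.
    replace (Re (a * g r + f r * b)%C) with (Re a * Re (g r) + Re (f r) * Re b + - (Im a * Im (g r) + Im (f r) * Im b)); [exact H|].
    destruct a, b, (f r), (g r); simpl; ring.
  - pose proof (is_derive_plus _ _ _ _ _ (is_derive_mult_R _ _ _ _ _ F1 G2) (is_derive_mult_R _ _ _ _ _ F2 G1)) as H.
    unfold plus in H; simpl in H.
    replace (Im (a * g r + f r * b)%C) with (Re a * Im (g r) + Re (f r) * Im b + (Im a * Re (g r) + Im (f r) * Re b)); [exact H|].
    destruct a, b, (f r), (g r); simpl; ring.
Qed.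

Lemma cder_ray u s0 r : cder (fun x => s0 + RtoC x * u)%C r u.
Proof.
  destruct u as [a b], s0 as [c d]. split; simpl; auto_derive; auto; ring.
Qed.

(** Differentiation under the integral sign, at the level of coefficients:
    [(n+1) (-v)^(n+1)/(n+1)! = - v (-v)^n/n!]. *)
Lemma dcoef_taylor g kap C s0 n : adm kap C g -> kap < Re s0 ->
  dcoef (taylor_coef g (fun v => ce (RtoC v * - s0))) n = (- taylor_coef g (fun v => RtoC v * ce (RtoC v * - s0))%C n)%C.
Proof.
  intros Hg Hs. unfold dcoef, taylor_coef.
  set (r := (Re s0 - kap) / 4). assert (Hr : 0 < r) by (unfold r; lra).
  pose proof (ckern_taylor _ _ _ r (S n) (ckern_ce s0) Hr) as K1.
  pose proof (ckern_taylor _ _ _ r n (ckern_v_ce s0 r Hr) Hr) as K2.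
  rewrite <- (CI_scal kap C g _ _ _ _ Hg K1) by (unfold r in *; lra).
  replace (- CI g (fun v => RtoC v * ce (RtoC v * - s0) * cexpt (RtoC (- v)) n)%C)%C
    with (RtoC (-1) * CI g (fun v => RtoC v * ce (RtoC v * - s0) * cexpt (RtoC (- v)) n)%C)%C by (rewrite RtoC_m1; ring).
  rewrite <- (CI_scal kap C g _ _ _ _ Hg K2) by (unfold r in *; lra).
  apply CI_ext. intros v.
  transitivity (ce (RtoC v * - s0) * (RtoC (INR (S n)) * cexpt (RtoC (- v)) (S n)))%C; [ring|].
  rewrite cexpt_S, RtoC_m1, RtoC_opp. ring.
Qed.

Lemma Lap_ray_derive g kap C s0 u r : adm kap C g -> kap < Re s0 -> Cmod u = 1 -> Rabs r < Re s0 - kap ->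
  cder (fun x => Lap g (s0 + RtoC x * u)%C) r (- (u * Lap1 g (s0 + RtoC r * u)))%C.
Proof.
  intros Hg Hs Hu Hr.
  destruct (Lap_taylor g kap C s0 Hg Hs) as [H1 H2].
  pose proof (ray_derive (Re s0 - kap) _ u r ltac:(lra) H1 Hu Hr) as HD.
  set (rho := (Rabs r + (Re s0 - kap)) / 2). pose proof (Rabs_pos r).
  destruct (Lap1_taylor g kap C s0 rho Hg ltac:(unfold rho; lra)) as [H3 H4].
  assert (Hz : Cmod (RtoC r * u) < rho) by (rewrite Cmod_mult, Cmod_R, Hu; unfold rho; lra).
  apply (cder_eq_loc _ _ _ _ _ HD).
  - assert (Hp : 0 < Re s0 - kap - Rabs r) by lra. exists (mkposreal _ Hp). intros y Hy.
    unfold ball in Hy; simpl in Hy; unfold AbsRing_ball, abs, minus, plus, opp in Hy; simpl in Hy.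
    symmetry. apply H2. rewrite Cmod_mult, Cmod_R, Hu, Rmult_1_r.
    replace y with ((y + - r) + r) by ring. eapply Rle_lt_trans; [apply Rabs_triang|]. lra.
  - rewrite (H4 _ Hz). replace (- (u * Cser (fun n => taylor_coef g (fun v => RtoC v * ce (RtoC v * - s0)) n * (RtoC r * u) ^ n)))%C
      with (u * (RtoC (-1) * Cser (fun n => taylor_coef g (fun v => RtoC v * ce (RtoC v * - s0)) n * (RtoC r * u) ^ n)))%C by (rewrite RtoC_m1; ring).
    f_equal. rewrite <- Cser_scal by (now apply summ_cabs with rho).
    apply Cser_ext. intros n. rewrite (dcoef_taylor g kap C s0 n Hg Hs), RtoC_m1. ring.
Qed.

Lemma Lap_bound g kap C s : adm kap C g -> kap < Re s -> Cmod (Lap g s) <= 2 * (C / (Re s - kap)).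
Proof.
  intros Hg Hs. pose proof (CI_bound _ _ _ _ _ _ Hg (ckern_ce s) Hs) as H. rewrite Rmult_1_r in H. exact H.
Qed.

Section Analytic2.
Variables (P : beurling_system) (A : R).
Hypothesis HA : 0 < A.
Hypothesis hN : bigO_infty (fun x => N_count P x - A * x) (fun x => sqrt x).
Hypothesis hRH : RHv P.

(** The discs [|s - c| < c - kap] exhaust the half-plane [Re s > kap] as [c] grows: squared, the
    condition reads [|s|^2 - kap^2 < 2 c (Re s - kap)]. With [c >= 3] the centre lies well inside
    [s > 1]. *)
Lemma far_center s kap : kap < Re s -> exists c : R, 3 <= c /\ kap < c /\ Cmod (s - RtoC c)%C < c - kap.
Proof.
  intros Hs. set (x := Re s) in *. set (y := Im s).
  set (d := x - kap). assert (Hd : 0 < d) by (unfold d; lra).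
  set (Q := (x * x + y * y + kap * kap) / d).
  assert (HQ : 0 <= Q).
  { apply Rdiv_le_0_compat; [|assumption]. pose proof (Rle_0_sqr x). pose proof (Rle_0_sqr y).
    pose proof (Rle_0_sqr kap). unfold Rsqr in *. lra. }
  exists (Q + Rabs kap + 3). pose proof (Rabs_pos kap). pose proof (Rle_abs kap).
  set (c := Q + Rabs kap + 3).
  assert (Hc : 3 <= c) by (unfold c; lra). assert (Hck : kap < c) by (unfold c; lra).
  repeat split; auto.
  unfold Cmod. rewrite <- (sqrt_square (c - kap)) by lra. apply sqrt_lt_1_alt.
  assert (E : fst (s - RtoC c)%C = x - c /\ snd (s - RtoC c)%C = y).
  { destruct s; simpl in *. unfold x, y; simpl. split; ring. }
  destruct E as [-> ->].
  assert (HQd : Q * d = x * x + y * y + kap * kap) by (unfold Q; field; lra).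
  assert (Hcd : (Q + 3) * d <= c * d) by (apply Rmult_le_compat_r; unfold c; lra).
  assert (H0d : 0 < c * d) by (apply Rmult_lt_0_compat; lra).
  assert (E1 : x = d + kap) by (unfold d; ring).
  pose proof (Rle_0_sqr (x - c)) as S1. pose proof (Rle_0_sqr y) as S2. pose proof (Rle_0_sqr kap) as S3.
  unfold Rsqr in *. clearbody c Q d x y. subst x. split; lra.
Qed.

(** Analytic continuation from the real half-line through a disc with far center. *)
Lemma Zf_derivative s : 1 / 2 < Re s ->
  (Lap (EE P A) s - (s - 1) * Lap1 (EE P A) s)%C = (- (Df P s * Zf P A s))%C.
Proof.
  intros Hs. set (d := (Re s - 1 / 2) / 3). assert (Hd : 0 < d) by (unfold d; lra).
  (* Here [1/2 < kap < kap' < Re s]. Growth rate [kap] is available for both [E] and [Q], while the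
     disc stops at [kap'], which leaves the strict margin that [Lap1_AN] requires. *)
  set (kap := 1 / 2 + d). set (kap' := 1 / 2 + 2 * d).
  destruct (adm_EE P A HA hN kap ltac:(unfold kap; lra)) as [CE HE].
  destruct (adm_QE P hRH kap ltac:(unfold kap; lra)) as [CQ HQ].
  destruct (far_center s kap' ltac:(unfold kap', d in *; lra)) as (c & Hc3 & Hck & Hcs).
  set (rho := c - kap').
  set (W := fun z => (Lap (EE P A) (RtoC c + z) + (- (1)) * ((RtoC c + z - 1) * Lap1 (EE P A) (RtoC c + z))
     + Df P (RtoC c + z) * Zf P A (RtoC c + z))%C).
  assert (Hrho : 0 < rho < Re (RtoC c) - kap) by (simpl; unfold rho, kap, kap' in *; lra).
  assert (AZ : AN rho (fun z => RtoC c + z)%C) by (apply AN_plus; [apply AN_const | apply AN_id]).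
  assert (AE : AN rho (fun z => Lap (EE P A) (RtoC c + z)%C)) by (apply (Lap_AN _ kap CE); auto; lra).
  assert (AE1 : AN rho (fun z => Lap1 (EE P A) (RtoC c + z)%C)) by (apply (Lap1_AN _ kap CE); auto).
  assert (AQ : AN rho (fun z => Lap (QE P) (RtoC c + z)%C)) by (apply (Lap_AN _ kap CQ); auto; lra).
  assert (AZ1 : AN rho (fun z => RtoC c + z - 1)%C) by (apply (AN_plus rho (fun z => RtoC c + z)%C (fun _ => - (1))%C); [exact AZ | apply AN_const]).
  assert (AW : AN rho W).
  { unfold W. apply AN_plus; [apply AN_plus; [exact AE|]|].
    - apply (AN_mult rho (fun _ => - (1))%C); [apply AN_const|]. now apply AN_mult.
    - unfold Df, Zf. apply AN_mult; [now apply AN_mult|]. apply AN_plus; [apply AN_const|]. now apply AN_mult. }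
  assert (H0 : W (s - RtoC c)%C = RtoC 0).
  { apply (AN_zero rho (Rmin 1 rho) W); auto.
    - split; [apply Rmin_pos; lra | apply Rmin_r].
    - intros x Hx. pose proof (Rmin_l 1 rho). apply Rabs_lt_between in Hx.
      unfold W, Df, Zf. rewrite <- RtoC_plus, !Lap_real, !Lap1_real, RtoC_plus.
      pose proof (EE_QE_real P A HA hN hRH (c + x) ltac:(lra)) as E.
      set (a := LI (EE P A) (expk (c + x))) in *. set (b := LI (EE P A) (fun v => v * expk (c + x) v)) in *.
      set (q := LI (QE P) (expk (c + x))) in *. clearbody a b q.
      apply (f_equal RtoC) in E.
      repeat first [rewrite RtoC_minus in E | rewrite RtoC_plus in E | rewrite RtoC_mult in E | rewrite RtoC_opp in E].
      match type of E with ?l = ?r => transitivity (l - r)%C; [ring|rewrite E; ring] end. }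
  unfold W in H0. replace (RtoC c + (s - RtoC c))%C with s in H0 by ring.
  match type of H0 with ?l = _ => transitivity (l - Df P s * Zf P A s)%C; [ring | rewrite H0; ring] end.
Qed.
End Analytic2.

(** * Lower bound for the zeta function far to the right *)

Lemma RInt_lin (f g : R -> R) (a b x y : R) : ex_RInt f x y -> ex_RInt g x y ->
  RInt (fun v => a * f v + b * g v) x y = a * RInt f x y + b * RInt g x y.
Proof.
  intros Hf Hg. apply is_RInt_unique.
  apply (is_RInt_plus (V := R_NormedModule) (fun v => a * f v) (fun v => b * g v) x y (a * RInt f x y) (b * RInt g x y)).
  - apply (is_RInt_scal (V := R_NormedModule) f x y a). now apply (RInt_correct (V := R_CompleteNormedModule)).
  - apply (is_RInt_scal (V := R_NormedModule) g x y b). now apply (RInt_correct (V := R_CompleteNormedModule)).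
Qed.

Lemma RInt_eq_val (f g : R -> R) (x y l : R) : is_RInt f x y l -> (forall v, f v = g v) -> RInt g x y = l.
Proof. intros Hf Hfg. apply is_RInt_unique. now apply (is_RInt_eq f g x y l l). Qed.

Section Analytic3.
Variables (P : beurling_system) (A : R).
Hypothesis HA : 0 < A.
Hypothesis hN : bigO_infty (fun x => N_count P x - A * x) (fun x => sqrt x).
Hypothesis hRH : RHv P.

(** The integer 1 comes only from the empty representation, so it is simple, and the next integer is
    at least [p_1]. This gap lets the first term dominate. *)
Lemma nu_one : exists j0, nu P j0 = 0 /\ forall j, j <> j0 -> lam P 0 <= nu P j.
Proof.
  destruct (gint_enum P) as (rep & Hrep). destruct Hrep as (Hs & Hinj & Hsur & Hv).
  destruct (Hsur nil) as [j0 H0]; [constructor|]. exists j0. split.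
  - unfold nu. rewrite Hv, H0. simpl. apply ln_1.
  - intros j Hj. destruct (rep j) as [|q l] eqn:E.
    + exfalso. apply Hj, Hinj. congruence.
    + apply Rle_trans with (lam P q); [apply lam_ge|].
      apply (nu_ge_lam P rep); [repeat split; auto|]. rewrite E. now left.
Qed.

(** Far to the right the term [1] dominates the Dirichlet series of the zeta function. *)
Lemma zeta_right : exists c, 3 <= c /\ forall T w m, 0 <= w -> ncover P w m ->
  1 / 2 <= step (reweigh (fun v => expk c v * cos (T * v)) (atoms_N P m)) w.
Proof.
  destruct (adm_NE P A HA hN) as [CN HN]. pose proof (adm_nonneg _ _ _ HN) as HC.
  pose proof (lam0_pos P) as Hl. destruct nu_one as (j0 & Hj0 & Hj).
  set (C2 := CN * (1 + 2 / (2 - 1))). assert (HC2 : 0 <= C2) by (unfold C2; lra).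
  (* Then [(c - 2) log p_1 = log p_1 + 2 C2]. The terms with [n > 1] are at most
     [e^(-(c-2) log p_1) n^(-2)], and [e^x >= 1 + x] makes their sum at most 1/2. *)
  set (c := 3 + 2 * C2 / lam P 0).
  assert (Hc : 3 <= c) by (unfold c; assert (0 <= 2 * C2 / lam P 0) by (apply Rdiv_le_0_compat; lra); lra).
  exists c. split; [assumption|]. intros T w m Hw Hm.
  assert (Hsmall : exp (- (c - 2) * lam P 0) * C2 <= 1 / 2).
  { replace (- (c - 2) * lam P 0) with (- ((c - 2) * lam P 0)) by ring. rewrite exp_Ropp.
    apply Rmult_le_reg_l with (exp ((c - 2) * lam P 0)); [apply exp_pos|].
    pose proof (exp_ineq1_le ((c - 2) * lam P 0)).
    assert ((c - 2) * lam P 0 = lam P 0 + 2 * C2) by (unfold c; field; lra).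
    rewrite <- Rmult_assoc, Rinv_r by (apply Rgt_not_eq, exp_pos). lra. }
  assert (Hsum : step (reweigh (expk 2) (atoms_N P m)) w <= C2).
  { apply (dirichlet_bound (atoms_N P m) CN 2 w); auto; try lra.
    - apply atoms_N_loc.
    - apply atoms_N_wt.
    - intros v Hv. rewrite <- (NE_atoms P w m v Hm) by lra. eapply Rle_trans; [apply Rle_abs|].
      eapply Rle_trans; [apply HN; lra|]. rewrite Rmult_1_l. lra. }
  rewrite step_reweigh in *. unfold atoms_N in *. rewrite lsum_map in *. cbn [fst snd] in *.
  assert (Hj0m : (j0 < m)%nat).
  { destruct (le_lt_dec m j0) as [h|h]; [|assumption]. specialize (Hm j0 h). lra. }
  apply Rle_trans with (lsum (fun j => if Nat.eq_dec j j0 then 1 else 0) (seq 0 m)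
     + (- exp (- (c - 2) * lam P 0)) * lsum (fun j => if Rle_dec (ln (gint P j)) w then 1 * expk 2 (ln (gint P j)) else 0) (seq 0 m)).
  - replace (lsum (fun j => if Nat.eq_dec j j0 then 1 else 0) (seq 0 m)) with 1.
    + pose proof (exp_pos (- (c - 2) * lam P 0)). nra.
    + symmetry. clear - Hj0m. induction m; [lia|]. rewrite lsum_seq_S.
      destruct (Nat.eq_dec m j0) as [->|h].
      * rewrite lsum_0; [ring|]. intros x Hx. apply in_seq in Hx. destruct (Nat.eq_dec x j0); [lia|reflexivity].
      * rewrite IHm by lia. ring.
  - rewrite <- lsum_scal, <- lsum_plus. apply lsum_le. intros j _. fold (nu P j).
    set (e := exp (- (c - 2) * lam P 0)). assert (0 < e) by apply exp_pos.
    pose proof (expk_pos 2 (nu P j)) as Hp2. pose proof (expk_pos c (nu P j)) as Hpc.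
    pose proof (COS_bound (T * nu P j)) as Hcos.
    destruct (Nat.eq_dec j j0) as [->|h].
    + rewrite Hj0. destruct (Rle_dec 0 w); [|lra].
      unfold expk. rewrite !Rmult_0_r, exp_0, cos_0. lra.
    + specialize (Hj j h). destruct (Rle_dec (nu P j) w); [|lra].
      assert (expk c (nu P j) <= e * expk 2 (nu P j)).
      { unfold e, expk. rewrite <- exp_plus. apply exp_le. nra. }
      assert (expk c (nu P j) * -1 <= expk c (nu P j) * cos (T * nu P j)) by (apply Rmult_le_compat_l; lra).
      lra.
Qed.

Lemma adm_exp : adm 1 1 (fun v => exp v).
Proof.
  apply adm_step with (fun v => exp v).
  - intros W _. exists nil. split; [easy|]. intros v _. unfold step; simpl. ring.
  - intros v. apply (ex_derive_continuous (V := R_NormedModule)). auto_derive. exact I.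
  - intros v _. rewrite Rabs_pos_eq by (left; apply exp_pos). rewrite !Rmult_1_l. lra.
Qed.

Lemma Lap_exp (s : C) : 1 < Re s -> Lap (fun v => exp v) s = (/ (s - 1))%C.
Proof.
  intros Hs.
  pose proof adm_exp as Hadm.
  pose proof (ckern_ce s) as K. pose proof (ckern_re _ _ _ K) as K1. pose proof (ckern_im _ _ _ K) as K2.
  pose proof (LI_conv _ _ _ _ _ _ Hadm K1 Hs) as L1. pose proof (LI_conv _ _ _ _ _ _ Hadm K2 Hs) as L2.
  destruct s as [c T]. simpl in Hs.
  set (a := c - 1). assert (Ha : 0 < a) by (unfold a; lra).
  set (x := LI (fun v => exp v) (fun v => Re (ce (RtoC v * - (c, T)%C)))) in *.
  set (y := LI (fun v => exp v) (fun v => Im (ce (RtoC v * - (c, T)%C)))) in *.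
  assert (Ere : forall v, Re (ce (RtoC v * - (c, T)%C)) = exp (- c * v) * cos (T * v)) by (intros v; exact (f_equal Re (ce_kernel c T v))).
  assert (Eim : forall v, Im (ce (RtoC v * - (c, T)%C)) = - (exp (- c * v) * sin (T * v))) by (intros v; exact (f_equal Im (ce_kernel c T v))).
  (* Integrating the derivatives of e^{-av} cos(Tv) and e^{-av} sin(Tv) gives two linear equations. *)
  assert (Q1 : a * x - T * y = 1).
  { assert (Hl : is_lim_seq (fun n => 1 - exp (- a * INR n) * cos (T * INR n)) (a * x - T * y)).
    { apply is_lim_seq_ext with (fun n => a * RInt (fun v => Re (ce (RtoC v * - (c, T)%C)) * exp v) 0 (INR n)
        - T * RInt (fun v => Im (ce (RtoC v * - (c, T)%C)) * exp v) 0 (INR n)).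
      - intros n.
        assert (X1 : ex_RInt (fun v => Re (ce (RtoC v * - (c, T)%C)) * exp v) 0 (INR n)) by (apply Hadm; [apply pos_INR|apply K1]).
        assert (X2 : ex_RInt (fun v => Im (ce (RtoC v * - (c, T)%C)) * exp v) 0 (INR n)) by (apply Hadm; [apply pos_INR|apply K2]).
        assert (H2 : is_RInt (fun v => a * (exp (- c * v) * cos (T * v) * exp v) - T * (- (exp (- c * v) * sin (T * v)) * exp v)) 0 (INR n)
            (- (exp (- a * INR n) * cos (T * INR n)) - - (exp (- a * 0) * cos (T * 0)))).
        { apply (is_RInt_eq (fun v => a * exp (- a * v) * cos (T * v) + exp (- a * v) * (T * sin (T * v))) _ _ _
            (- (exp (- a * INR n) * cos (T * INR n)) - - (exp (- a * 0) * cos (T * 0)))).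
          - apply (is_RInt_derive (V := R_CompleteNormedModule) (fun v => - (exp (- a * v) * cos (T * v)))).
            + intros z _. auto_derive; [exact I|]. ring.
            + intros z _. apply (ex_derive_continuous (V := R_NormedModule)). auto_derive. exact I.
          - intros v. replace (- a * v) with (- c * v + v) by (unfold a; ring). rewrite exp_plus. ring.
          - reflexivity. }
        pose proof (RInt_lin _ _ a (- T) _ _ X1 X2) as H1. cbv beta in H1.
        rewrite (RInt_eq_val _ (fun v => a * (Re (ce (RtoC v * - (c, T)%C)) * exp v) + - T * (Im (ce (RtoC v * - (c, T)%C)) * exp v)) _ _ _ H2) in H1
          by (intros v; rewrite Ere, Eim; ring).
        rewrite !Rmult_0_r, exp_0, cos_0 in H1. lra.
      - apply is_lim_seq_minus'; [apply (is_lim_seq_scal_l _ a (Finite _)) | apply (is_lim_seq_scal_l _ T (Finite _))]; assumption. }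
    assert (Hl' : is_lim_seq (fun n => 1 - exp (- a * INR n) * cos (T * INR n)) (1 - 0)).
    { apply is_lim_seq_minus'; [apply is_lim_seq_const|].
      apply is_lim_squeeze0 with (fun n => 1 * exp (- a * INR n)); [|now apply is_lim_exp_neg].
      intros n. rewrite Rabs_mult, (Rabs_pos_eq (exp _)) by (left; apply exp_pos).
      rewrite Rmult_comm. apply Rmult_le_compat_r; [left; apply exp_pos|]. apply Rabs_le, COS_bound. }
    apply is_lim_seq_unique in Hl. apply is_lim_seq_unique in Hl'. rewrite Hl in Hl'. injection Hl'. intros. lra. }
  assert (Q2 : a * y + T * x = 0).
  { assert (Hl : is_lim_seq (fun n => exp (- a * INR n) * sin (T * INR n)) (a * y + T * x)).
    { apply is_lim_seq_ext with (fun n => a * RInt (fun v => Im (ce (RtoC v * - (c, T)%C)) * exp v) 0 (INR n)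
        + T * RInt (fun v => Re (ce (RtoC v * - (c, T)%C)) * exp v) 0 (INR n)).
      - intros n.
        assert (X1 : ex_RInt (fun v => Re (ce (RtoC v * - (c, T)%C)) * exp v) 0 (INR n)) by (apply Hadm; [apply pos_INR|apply K1]).
        assert (X2 : ex_RInt (fun v => Im (ce (RtoC v * - (c, T)%C)) * exp v) 0 (INR n)) by (apply Hadm; [apply pos_INR|apply K2]).
        assert (H2 : is_RInt (fun v => a * (- (exp (- c * v) * sin (T * v)) * exp v) + T * (exp (- c * v) * cos (T * v) * exp v)) 0 (INR n)
            ((exp (- a * INR n) * sin (T * INR n)) - (exp (- a * 0) * sin (T * 0)))).
        { apply (is_RInt_eq (fun v => - a * exp (- a * v) * sin (T * v) + exp (- a * v) * (T * cos (T * v))) _ _ _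
            ((exp (- a * INR n) * sin (T * INR n)) - (exp (- a * 0) * sin (T * 0)))).
          - apply (is_RInt_derive (V := R_CompleteNormedModule) (fun v => (exp (- a * v) * sin (T * v)))).
            + intros z _. auto_derive; [exact I|]. ring.
            + intros z _. apply (ex_derive_continuous (V := R_NormedModule)). auto_derive. exact I.
          - intros v. replace (- a * v) with (- c * v + v) by (unfold a; ring). rewrite exp_plus. ring.
          - reflexivity. }
        pose proof (RInt_lin _ _ a T _ _ X2 X1) as H1. cbv beta in H1.
        rewrite (RInt_eq_val _ (fun v => a * (Im (ce (RtoC v * - (c, T)%C)) * exp v) + T * (Re (ce (RtoC v * - (c, T)%C)) * exp v)) _ _ _ H2) in H1
          by (intros v; rewrite Ere, Eim; ring).
        rewrite !Rmult_0_r, sin_0 in H1. lra.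
      - apply is_lim_seq_plus'; [apply (is_lim_seq_scal_l _ a (Finite _)) | apply (is_lim_seq_scal_l _ T (Finite _))]; assumption. }
    assert (Hl' : is_lim_seq (fun n => exp (- a * INR n) * sin (T * INR n)) 0).
    { apply is_lim_squeeze0 with (fun n => 1 * exp (- a * INR n)); [|now apply is_lim_exp_neg].
      intros n. rewrite Rabs_mult, (Rabs_pos_eq (exp _)) by (left; apply exp_pos).
      rewrite Rmult_comm. apply Rmult_le_compat_r; [left; apply exp_pos|]. apply Rabs_le, SIN_bound. }
    apply is_lim_seq_unique in Hl. apply is_lim_seq_unique in Hl'. rewrite Hl in Hl'. injection Hl'. intros. lra. }
  assert (Hne : ((c, T) - 1)%C <> RtoC 0).
  { intros E. apply (f_equal Re) in E. simpl in E. unfold a in Ha. lra. }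
  assert (Hprod : (((c, T) - 1) * Lap (fun v => exp v) (c, T) = 1)%C).
  { unfold Lap, CI. fold x y. unfold RtoC, Cminus, Cplus, Copp, Cmult; simpl. fold a.
    change (c + - (1)) with (c - 1). fold a. f_equal; lra. }
  transitivity (/ ((c, T) - 1) * (((c, T) - 1) * Lap (fun v => exp v) (c, T)))%C; [field; exact Hne | rewrite Hprod; ring].
Qed.

(** Here [Z = (s - 1) L(N)] and [s L(N)] is the zeta function, of modulus at least 1/2 by
    [zeta_right]; the other factor 1/2 is [|s - 1| >= |s| / 2]. *)
Lemma Zf_lower : exists c, 3 <= c /\ forall T, 1 / 4 <= Cmod (Zf P A (c, T)).
Proof.
  destruct zeta_right as (c & Hc & Hz). exists c. split; [assumption|]. intros T.
  destruct (adm_NE P A HA hN) as [CN HN]. destruct (adm_EE P A HA hN 1 ltac:(lra)) as [CE HE].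
  set (s := (c, T) : C). assert (Hs : 1 < Re s) by (simpl; lra).
  pose proof (ckern_ce s) as K.
  assert (K1 : kern c 1 (fun v => Re (ce (RtoC v * - s)))) by exact (ckern_re _ _ _ K).
  assert (K2 : kern c 1 (fun v => Im (ce (RtoC v * - s)))) by exact (ckern_im _ _ _ K).
  set (k := fun v => expk c v * cos (T * v)).
  set (k' := fun v => - c * Re (ce (RtoC v * - s)) + T * Im (ce (RtoC v * - s))).
  assert (Ere : forall v, Re (ce (RtoC v * - s)) = exp (- c * v) * cos (T * v)) by (intros v; exact (f_equal Re (ce_kernel c T v))).
  assert (Eim : forall v, Im (ce (RtoC v * - s)) = - (exp (- c * v) * sin (T * v))) by (intros v; exact (f_equal Im (ce_kernel c T v))).
  assert (K1' := kern_scal _ _ _ (- c) K1). assert (K2' := kern_scal _ _ _ T K2).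
  assert (Kk' : kern c (Rabs (- c) * 1 + Rabs T * 1) k').
  { split.
    - intros v. apply (continuous_plus (V := R_NormedModule)); [apply K1' | apply K2'].
    - intros v Hv. eapply Rle_trans; [apply Rabs_triang|]. rewrite Rmult_plus_distr_r.
      apply Rplus_le_compat; [now apply K1' | now apply K2']. }
  assert (Hsel : forall n, exists m, ncover P (INR n) m) by (intros n; apply (ncover_ex P A HA hN)).
  set (f := fun n => proj1_sig (constructive_indefinite_description _ (Hsel n))).
  assert (Hf : forall n, ncover P (INR n) (f n)) by (intros n; exact (proj2_sig (constructive_indefinite_description _ (Hsel n)))).
  clearbody f.
  assert (Hlim : is_lim_seq (fun n => step (reweigh k (atoms_N P (f n))) (INR n)) (- LI (NE P) k')).
  { apply (abel_lim (NE P) CN k k' c (Rabs (- c) * 1 + Rabs T * 1)); auto; try lra.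
    - intros v. unfold k, k', expk. rewrite Ere, Eim. auto_derive; [exact I|]. ring.
    - apply (boundary_lim (NE P) CN k c 1); auto; try lra.
      intros v _. unfold k. rewrite Rabs_mult, (Rabs_pos_eq (expk c v)), Rmult_comm by (left; apply expk_pos).
      apply Rmult_le_compat_r; [left; apply exp_pos|]. apply Rabs_le, COS_bound.
    - intros n. exists (atoms_N P (f n)). split; [apply atoms_N_loc|]. split; [|reflexivity].
      intros v Hv. now apply (NE_atoms P (INR n)). }
  assert (Hge : 1 / 2 <= - LI (NE P) k').
  { apply (is_lim_seq_le (fun _ => 1 / 2) (fun n => step (reweigh k (atoms_N P (f n))) (INR n)) (1 / 2) (- LI (NE P) k')); auto.
    - intros n. apply Hz; [apply pos_INR | apply Hf].
    - apply is_lim_seq_const. }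
  assert (Ek' : LI (NE P) k' = - Re (s * Lap (NE P) s)%C).
  { unfold k'. rewrite (LI_plus 1 CN (NE P) c _ _ _ _ HN K1' K2') by lra.
    rewrite (LI_scal 1 CN (NE P) c 1 _ _ HN K1), (LI_scal 1 CN (NE P) c 1 _ _ HN K2) by lra.
    unfold Lap, CI. unfold s at 3; simpl. ring. }
  assert (Hzeta : 1 / 2 <= Cmod s * Cmod (Lap (NE P) s)).
  { rewrite <- Cmod_mult. eapply Rle_trans; [|apply re_le_Cmod]. eapply Rle_trans; [|apply Rle_abs]. lra. }
  assert (Hne : (s - 1)%C <> RtoC 0).
  { intros E. apply (f_equal Re) in E. unfold s in E; simpl in E. lra. }
  assert (HZ : Zf P A s = ((s - 1) * Lap (NE P) s)%C).
  { pose proof adm_exp as Hexp.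
    assert (HAexp : adm 1 (A * 1) (fun v => A * exp v)).
    { apply adm_step with (fun v => A * exp v).
      - intros W _. exists nil. split; [easy|]. intros v _. unfold step; simpl. ring.
      - intros v. apply (ex_derive_continuous (V := R_NormedModule)). auto_derive. exact I.
      - intros v _. rewrite Rabs_mult, (Rabs_pos_eq (exp v)), (Rabs_pos_eq A) by (lra || (left; apply exp_pos)).
        rewrite Rmult_1_l. lra. }
    assert (EN : Lap (NE P) s = (Lap (EE P A) s + RtoC A * / (s - 1))%C).
    { rewrite <- (Lap_exp s Hs). unfold Lap. rewrite <- (CI_scal_g 1 1 (fun v => exp v) (Re s) 1 _ A Hexp K Hs).
      rewrite <- (CI_plus_g 1 CE (A * 1) (EE P A) (fun v => A * exp v) (Re s) 1 _ HE HAexp K Hs).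
      unfold CI. f_equal; apply LI_ext_g; intros v; unfold EE; ring. }
    rewrite EN. unfold Zf. field. exact Hne. }
  rewrite HZ, Cmod_mult.
  assert (H1 : Cmod s <= 2 * Cmod (s - 1)%C).
  { assert (Cmod s <= Cmod (s - 1)%C + 1).
    { replace s with ((s - 1) + 1)%C at 1 by ring. eapply Rle_trans; [apply Cmod_triangle|]. rewrite Cmod_1. lra. }
    assert (2 <= Cmod (s - 1)%C).
    { eapply Rle_trans; [|apply re_le_Cmod]. eapply Rle_trans; [|apply Rle_abs]. unfold s; simpl. lra. }
    lra. }
  pose proof (Cmod_ge_0 (Lap (NE P) s)). nra.
Qed.
End Analytic3.

(** * The logarithmic derivative near the critical line *)

Lemma is_derive_eq_R (f : R -> R) (x l l' : R) : is_derive f x l -> l = l' -> is_derive f x l'.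
Proof. now intros H <-. Qed.

(** The quotient [X exp(- H)] is constant, and only its squared modulus is differentiated. So [Re H]
    measures [log |X|] without any branch of a complex logarithm. *)
Lemma cder_ode_norm (X H : R -> C) (h : R -> C) r : 0 < r ->
  (forall x, 0 <= x <= r -> cder X x (h x * X x)%C) -> (forall x, 0 <= x <= r -> cder H x (h x)) ->
  (Cmod (X r)) ^ 2 * exp (- 2 * Re (H r)) = (Cmod (X 0)) ^ 2 * exp (- 2 * Re (H 0)).
Proof.
  intros Hr HX HH. symmetry.
  set (Y := fun x => (Re (X x) * Re (X x) + Im (X x) * Im (X x)) * exp (- 2 * Re (H x))).
  assert (EY : forall x, Cmod (X x) ^ 2 * exp (- 2 * Re (H x)) = Y x).
  { intros x. unfold Y. rewrite Cmod2_alt. ring. }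
  rewrite !EY. apply (eq_is_derive (V := R_NormedModule) Y 0 r); [|assumption].
  intros x Hx. unfold Y, zero; simpl.
  destruct (HX x Hx) as [X1 X2]. destruct (HH x Hx) as [H1 _].
  pose proof (is_derive_mult_R _ _ _ _ _ X1 X1) as D1. pose proof (is_derive_mult_R _ _ _ _ _ X2 X2) as D2.
  assert (D3 : is_derive (fun x => Re (X x) * Re (X x) + Im (X x) * Im (X x)) x
     (Re (h x * X x)%C * Re (X x) + Re (X x) * Re (h x * X x)%C + (Im (h x * X x)%C * Im (X x) + Im (X x) * Im (h x * X x)%C)))
    by exact (is_derive_plus _ _ _ _ _ D1 D2).
  assert (D4 : is_derive (fun x => exp (- 2 * Re (H x))) x (- 2 * Re (h x) * exp (- 2 * Re (H x)))).
  { pose proof (is_derive_scal _ x (- 2) _ H1) as S1.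
    pose proof (is_derive_comp exp (fun x => - 2 * Re (H x)) x _ _ (is_derive_exp _) S1) as S2. exact S2. }
  pose proof (is_derive_mult_R _ _ _ _ _ D3 D4) as D5.
  apply (is_derive_eq_R _ _ _ _ D5).
  destruct (X x) as [a b]. destruct (h x) as [p q]. simpl. ring.
Qed.

Section Analytic4.
Variables (P : beurling_system) (A : R).
Hypothesis HA : 0 < A.
Hypothesis hN : bigO_infty (fun x => N_count P x - A * x) (fun x => sqrt x).
Hypothesis hRH : RHv P.

Lemma ex_series_nq q : 0 <= q < 1 -> ex_series (fun n => INR (S n) * q ^ n).
Proof.
  intros Hq.
  assert (H1 : summ 1 (fun _ => RtoC 1)).
  { intros r Hr. apply ex_series_ext with (fun n => r ^ n).
    - intros n. rewrite Cmod_1. symmetry. apply Rmult_1_l.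
    - apply ex_series_geom. rewrite Rabs_pos_eq; lra. }
  apply summ_dcoef in H1; [|lra]. apply ex_series_ext with (2 := H1 q Hq).
  intros n. unfold dcoef. rewrite Cmult_1_r, Cmod_R, Rabs_pos_eq by apply pos_INR. reflexivity.
Qed.

(** In a half-plane [Re s >= kap + const] the transform of [E] is bounded, so [Z] grows no faster
    than its factor [s - 1]. *)
Lemma Zf_bound kap c T r C : adm kap C (EE P A) -> 0 < kap -> 3 <= c -> 0 < r < c - kap ->
  forall z, Cmod z <= r ->
  Cmod (Zf P A ((c, T) + z)%C) <= (A + (2 * c + 1) * (2 * (C / (c - kap - r)))) * (1 + Rabs T).
Proof.
  intros HE Hkap Hc Hr z Hz. set (s := ((c, T) + z)%C).
  pose proof (re_le_Cmod z) as Hre. apply Rabs_le_between in Hre.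
  assert (Hs : c - r <= Re s) by (unfold s; destruct z; simpl in *; lra).
  assert (Hks : kap < Re s) by lra.
  pose proof (Lap_bound _ _ _ s HE Hks) as HL.
  pose proof (adm_nonneg _ _ _ HE) as HC.
  assert (HL2 : Cmod (Lap (EE P A) s) <= 2 * (C / (c - kap - r))).
  { eapply Rle_trans; [exact HL|]. apply Rmult_le_compat_l; [lra|]. unfold Rdiv.
    apply Rmult_le_compat_l; [assumption|]. apply Rinv_le_contravar; lra. }
  assert (Hs1 : Cmod (s - 1)%C <= 2 * c + 1 + Rabs T).
  { unfold s. replace ((c, T) + z - 1)%C with (RtoC (c - 1) + (RtoC T * Ci + z))%C.
    - eapply Rle_trans; [apply Cmod_triangle|]. rewrite Cmod_R, Rabs_pos_eq by lra.
      eapply Rle_trans; [apply Rplus_le_compat_l, Cmod_triangle|]. rewrite Cmod_mult, Cmod_Ci, Cmod_R. lra.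
    - apply C_ext; destruct z; simpl; ring. }
  unfold Zf. eapply Rle_trans; [apply Cmod_triangle|]. rewrite Cmod_mult, Cmod_R, Rabs_pos_eq by lra.
  set (B := 2 * (C / (c - kap - r))) in *.
  assert (HB : 0 <= B) by (unfold B; apply Rmult_le_pos; [lra|]; apply Rdiv_le_0_compat; lra).
  pose proof (Rabs_pos T). pose proof (Cmod_ge_0 (s - 1)%C). pose proof (Cmod_ge_0 (Lap (EE P A) s)).
  assert (Cmod (s - 1)%C * Cmod (Lap (EE P A) s) <= (2 * c + 1 + Rabs T) * B) by (apply Rmult_le_compat; lra).
  clearbody B. assert (0 <= A * Rabs T) by (apply Rmult_le_pos; lra).
  assert (0 <= c * B * Rabs T) by (repeat apply Rmult_le_pos; lra). lra.
Qed.

(** In the disc about [c + iT] the primitive [F] of [- D] with [F(s0) = 0] has real part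
    [log |Z / Z(s0)|], which is [<< log T] by [Zf_bound] and [Zf_lower]. Borel-Caratheodory bounds
    the coefficients of [F], hence the differentiated series [- D] at the point [1/2 + eps + iT]. *)
Lemma Df_bound eps : 0 < eps < 1 -> exists K, 0 <= K /\ forall T,
  Cmod (Df P (1 / 2 + eps, T)) <= K * (1 + ln (1 + Rabs T)).
Proof.
  intros Heps. set (d := eps / 4). assert (Hd : 0 < d < 1 / 4) by (unfold d; lra).
  set (kap := 1 / 2 + d).
  destruct (adm_EE P A HA hN kap ltac:(unfold kap; lra)) as [CE HE].
  destruct (adm_QE P hRH kap ltac:(unfold kap; lra)) as [CQ HQ].
  destruct (Zf_lower P A HA hN) as (c & Hc & HZ0).
  (* Three nested radii: [D] is analytic within [rho], Borel-Caratheodory is applied at [r], and the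
     point sought lies at distance [x], since [c - x = kap + 3 d = 1/2 + eps]. *)
  set (rho := c - kap). set (r := rho - 2 * d). set (x := rho - 3 * d).
  assert (Hkap : 1 / 2 < kap < 3 / 4) by (unfold kap; lra).
  assert (Hr : 0 < r < rho) by (unfold r, rho; lra). assert (Hx : 0 < x < r) by (unfold x, r, rho; lra).
  set (B := Rmax (A + (2 * c + 1) * (2 * (CE / (c - kap - r)))) 1).
  set (q := x / r). assert (Hq : 0 <= q < 1).
  { unfold q. split; [apply Rdiv_le_0_compat; lra|]. apply Rmult_lt_reg_r with r; [lra|].
    unfold Rdiv. rewrite Rmult_assoc, Rinv_l; lra. }
  set (Sq := Series (fun n => INR (S n) * q ^ n)).
  assert (HSq : 0 <= Sq).
  { eapply Rle_trans; [|apply (term_le_Series (fun n => INR (S n) * q ^ n) 0)].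
    - simpl. lra.
    - intros k. apply Rmult_le_pos; [apply pos_INR | apply pow_le; lra].
    - now apply ex_series_nq. }
  assert (HB1 : 1 <= B) by apply Rmax_r.
  assert (Hln4B : 0 <= ln (4 * B)) by (rewrite <- ln_1; apply ln_le'; lra).
  (* From [|f_(n+1)| <= 2 M r^(-n-1)] the derived series is at most [(2 M / r) sum (n+1) q^n]. The
     outer 2 is the loss of [Cser_bound], and [ln (4 * B) + 1] absorbs both parts of [M]. *)
  exists (2 * (2 / r * Sq) * (ln (4 * B) + 1)). split.
  { repeat apply Rmult_le_pos; try lra. left. apply Rinv_0_lt_compat. lra. }
  intros T. pose proof (Rabs_pos T) as HT.
  set (s0 := (c, T) : C). assert (Hs0 : Re s0 = c) by reflexivity.
  (* Taylor coefficients of -D and of its primitive F with F(s0) = 0 *)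
  assert (HDA : AN rho (fun z => (- (1)) * ((s0 + z) * Lap (QE P) (s0 + z)))%C).
  { apply (AN_mult rho (fun _ => - (1))%C); [apply AN_const|].
    apply AN_mult; [apply AN_plus; [apply AN_const|apply AN_id]|].
    apply (Lap_AN _ kap CQ); auto. rewrite Hs0. unfold rho in *. lra. }
  destruct HDA as (g & Hg & HgD).
  set (f := fun n => match n with O => RtoC 0 | S m => (RtoC (/ INR (S m)) * g m)%C end).
  assert (Hdf : forall n, dcoef f n = g n).
  { intros n. unfold dcoef, f. rewrite Cmult_assoc, <- RtoC_mult, Rinv_r by (apply not_0_INR; lia). ring. }
  assert (Hf : summ rho f).
  { intros y Hy. apply (ex_series_incr_1 (V := R_NormedModule)).
    apply (ex_series_le (V := R_CompleteNormedModule)) with (fun n => y * (Cmod (g n) * y ^ n)).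
    - intros n. change (Rabs (Cmod (f (S n)) * y ^ S n) <= y * (Cmod (g n) * y ^ n)).
      assert (0 <= y ^ S n) by (apply pow_le; lra).
      rewrite Rabs_pos_eq by (apply Rmult_le_pos; [apply Cmod_ge_0|assumption]).
      unfold f. rewrite Cmod_mult, Cmod_R.
      assert (1 <= INR (S n)) by (rewrite S_INR; pose proof (pos_INR n); lra).
      rewrite Rabs_pos_eq by (left; apply Rinv_0_lt_compat; lra).
      assert (/ INR (S n) <= 1) by (rewrite <- Rinv_1; apply Rinv_le_contravar; lra).
      pose proof (Cmod_ge_0 (g n)). simpl pow.
      replace (y * (Cmod (g n) * y ^ n)) with (1 * Cmod (g n) * (y * y ^ n)) by ring.
      apply Rmult_le_compat_r; [assumption|]. apply Rmult_le_compat_r; assumption.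
    - apply (ex_series_scal (V := R_NormedModule)). now apply Hg. }
  set (M := ln (4 * B * (1 + Rabs T))).
  assert (HM : forall z, Cmod z = r -> Re (Cser (fun n => f n * z ^ n)%C) <= M).
  { intros z Hz.
    set (u := (z * RtoC (/ r))%C).
    assert (Hu : Cmod u = 1).
    { unfold u. rewrite Cmod_mult, Cmod_R, Hz, Rabs_pos_eq; [field; lra|]. left. apply Rinv_0_lt_compat; lra. }
    assert (Hzu : z = (RtoC r * u)%C).
    { unfold u. transitivity (z * (RtoC r * RtoC (/ r)))%C; [|ring]. rewrite <- RtoC_mult, Rinv_r by lra. ring. }
    set (X := fun y => Zf P A (s0 + RtoC y * u)%C).
    set (Hh := fun y => Cser (fun n => f n * (RtoC y * u) ^ n)%C).
    set (h := fun y => (u * (- (1) * Df P (s0 + RtoC y * u)))%C).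
    assert (HyR : forall y, 0 <= y <= r -> Rabs y < rho) by (intros y Hy; rewrite Rabs_pos_eq; lra).
    assert (Hyu : forall y, 0 <= y <= r -> Cmod (RtoC y * u) < rho).
    { intros y Hy. rewrite Cmod_mult, Cmod_R, Hu, Rmult_1_r. now apply HyR. }
    assert (DX : forall y, 0 <= y <= r -> cder X y (h y * X y)%C).
    { intros y Hy.
      pose proof (Lap_ray_derive (EE P A) kap CE s0 u y HE ltac:(rewrite Hs0; lra) Hu (HyR y Hy)) as L1.
      pose proof (cder_mult _ _ _ _ _ (cder_plus _ _ _ _ _ (cder_ray u s0 y) (cder_const (- (1))%C y)) L1) as L2.
      pose proof (cder_plus _ _ _ _ _ (cder_const (RtoC A) y) L2) as L3.
      apply (cder_eq _ _ _ _ _ L3); [reflexivity|].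
      set (s := (s0 + RtoC y * u)%C).
      assert (Hs : 1 / 2 < Re s).
      { unfold s. pose proof (re_le_Cmod (RtoC y * u)%C) as E. specialize (Hyu y Hy). apply Rabs_le_between in E.
        change (1 / 2 < Re s0 + Re (RtoC y * u)%C). rewrite Hs0. unfold rho in *. lra. }
      pose proof (Zf_derivative P A HA hN hRH s Hs) as E.
      unfold h, X. fold s.
      transitivity (u * (Lap (EE P A) s - (s - 1) * Lap1 (EE P A) s))%C; [ring|]. rewrite E. ring. }
    assert (DH : forall y, 0 <= y <= r -> cder Hh y (h y)).
    { intros y Hy. pose proof (ray_derive rho f u y ltac:(lra) Hf Hu (HyR y Hy)) as E.
      apply (cder_eq _ _ _ _ _ E); [reflexivity|].
      unfold h. f_equal. unfold Df. rewrite (HgD _ (Hyu y Hy)). apply Cser_ext. intros n. now rewrite Hdf. }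
    pose proof (cder_ode_norm X Hh h r ltac:(lra) DX DH) as EQ.
    assert (HX0 : X 0 = Zf P A s0) by (unfold X; f_equal; ring).
    assert (HH0 : Re (Hh 0) = 0).
    { unfold Hh. rewrite (Cser_finite _ 0).
      - reflexivity.
      - intros [|k] _; [simpl; ring|]. rewrite Cpow_S. ring. }
    rewrite HX0, HH0, Rmult_0_r, exp_0, Rmult_1_r in EQ.
    assert (HXr : Cmod (X r) <= B * (1 + Rabs T)).
    { eapply Rle_trans; [apply (Zf_bound kap c T r CE HE); try lra|].
      - unfold rho in *; lra.
      - rewrite <- Hzu. lra.
      - apply Rmult_le_compat_r; [lra|]. apply Rmax_l. }
    rewrite Hzu. fold (Hh r).
    specialize (HZ0 T). fold s0 in HZ0.
    (* If [Re F > log (4 b)] with [b >= |Z|], the conserved quantity would be below 1/16, whereas at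
       the centre it equals [|Z(s0)|^2 >= 1/16]. *)
    destruct (Rle_lt_dec (Re (Hh r)) M) as [|hlt]; [assumption|exfalso].
    set (b := B * (1 + Rabs T)) in *. assert (Hb : 1 <= b) by (unfold b; nra).
    assert (Hexp : exp (- 2 * Re (Hh r)) < / (4 * b) * / (4 * b)).
    { replace (- 2 * Re (Hh r)) with (- Re (Hh r) + - Re (Hh r)) by ring. rewrite exp_plus.
      assert (E1 : exp (- Re (Hh r)) < / (4 * b)).
      { rewrite exp_Ropp. apply Rinv_lt_contravar; [apply Rmult_lt_0_compat; [lra|apply exp_pos]|].
        apply exp_increasing in hlt. unfold M in hlt. rewrite exp_ln in hlt by (unfold b in *; lra).
        unfold b. lra. }
      pose proof (exp_pos (- Re (Hh r))). apply Rmult_gt_0_lt_compat; lra || (apply Rinv_0_lt_compat; lra) || assumption. }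
    pose proof (Cmod_ge_0 (X r)). pose proof (exp_pos (- 2 * Re (Hh r))).
    assert (Hlt : Cmod (X r) ^ 2 * exp (- 2 * Re (Hh r)) < 1 / 16).
    { apply Rle_lt_trans with (b ^ 2 * exp (- 2 * Re (Hh r))).
      - apply Rmult_le_compat_r; [lra|]. apply pow_incr. lra.
      - apply Rlt_le_trans with (b ^ 2 * (/ (4 * b) * / (4 * b))).
        + apply Rmult_lt_compat_l; [apply pow_lt; lra | assumption].
        + right. field. lra. }
    rewrite EQ in Hlt. assert ((1 / 4) ^ 2 <= Cmod (Zf P A s0) ^ 2) by (apply pow_incr; lra). lra. }
  pose proof (borel_caratheodory rho f r M Hr Hf eq_refl HM) as HBC.
  assert (HM0 : M = ln (4 * B) + ln (1 + Rabs T)) by (unfold M; apply ln_mult; lra).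
  assert (HlnT : 0 <= ln (1 + Rabs T)) by (rewrite <- ln_1 at 1; apply ln_le'; lra).
  assert (Hgn : forall n, Cmod (g n * RtoC (- x) ^ n)%C <= 2 / r * M * (INR (S n) * q ^ n)).
  { intros n. rewrite <- Hdf. unfold dcoef. rewrite !Cmod_mult, Cmod_pow, !Cmod_R, Rabs_Ropp.
    rewrite (Rabs_pos_eq x), (Rabs_pos_eq (INR _)) by (lra || apply pos_INR).
    specialize (HBC (S n) ltac:(lia)).
    assert (Hrn : 0 < r ^ S n) by (apply pow_lt; lra).
    assert (Hfn : Cmod (f (S n)) <= 2 * M * / (r ^ S n)).
    { apply Rmult_le_reg_r with (r ^ S n); [assumption|]. rewrite Rmult_assoc, Rinv_l; lra. }
    assert (0 <= INR (S n)) by apply pos_INR. assert (0 <= x ^ n) by (apply pow_le; lra).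
    apply Rle_trans with (INR (S n) * (2 * M * / (r ^ S n)) * x ^ n).
    - apply Rmult_le_compat_r; [assumption|]. apply Rmult_le_compat_l; assumption.
    - right. unfold q, Rdiv. rewrite Rpow_mult_distr, pow_inv. simpl pow. field.
      split; [apply pow_nonzero; lra|lra]. }
  assert (Hser : Cmod (Cser (fun n => g n * RtoC (- x) ^ n)%C) <= 2 * Series (fun n => 2 / r * M * (INR (S n) * q ^ n))).
  { apply Cser_bound; [exact Hgn|]. apply (ex_series_scal (V := R_NormedModule)). now apply ex_series_nq. }
  rewrite Series_scal_l in Hser. fold Sq in Hser.
  assert (Hxc : Cmod (RtoC (- x)) < rho) by (rewrite Cmod_R, Rabs_Ropp, Rabs_pos_eq; lra).
  rewrite <- (HgD _ Hxc) in Hser.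
  replace (s0 + RtoC (- x))%C with ((1 / 2 + eps, T) : C) in Hser.
  2:{ unfold s0, RtoC, Cplus; simpl. f_equal; [|ring]. unfold x, rho, kap, d. field. }
  rewrite Cmod_mult, Cmod_m1, Rmult_1_l in Hser. fold (Df P (1 / 2 + eps, T)) in Hser.
  eapply Rle_trans; [exact Hser|].
  replace (2 * (2 / r * M * Sq)) with (2 * (2 / r * Sq) * M) by ring.
  assert (Hk0 : 0 <= 2 * (2 / r * Sq)).
  { repeat apply Rmult_le_pos; try lra. left. apply Rinv_0_lt_compat. lra. }
  set (k0 := 2 * (2 / r * Sq)) in *.
  rewrite (Rmult_assoc k0 (ln (4 * B) + 1)). apply Rmult_le_compat_l; [exact Hk0|].
  rewrite HM0. assert (0 <= ln (4 * B) * ln (1 + Rabs T)) by (apply Rmult_le_pos; assumption). lra.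
Qed.
End Analytic4.

(** * Fejer smoothing of twisted prime sums *)

Definition dirichlet (m : nat) (x : R) : R := 1 + 2 * lsum (fun j => cos (INR j * x)) (seq 1 m).
Definition fejer (M : nat) (x : R) : R := / INR M * lsum (fun m => dirichlet m x) (seq 0 M).

Lemma lsum_seq_shift (f : nat -> R) a n : lsum f (seq (S a) n) = lsum (fun k => f (S k)) (seq a n).
Proof. rewrite <- seq_shift, lsum_map. reflexivity. Qed.

Lemma lsum_reverse M x : lsum (fun m => cos ((INR M - INR m) * x)) (seq 0 M) = lsum (fun j => cos (INR j * x)) (seq 1 M).
Proof.
  induction M; [reflexivity|].
  change (seq 0 (S M)) with (0%nat :: seq 1 M). cbn [lsum].
  rewrite lsum_seq_shift, (seq_S M 1), lsum_app. cbn [lsum].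
  rewrite (lsum_ext _ (fun m => cos ((INR M - INR m) * x))).
  - rewrite IHM. simpl INR at 2. replace (1 + M)%nat with (S M) by lia. rewrite Rminus_0_r. ring.
  - intros m _. rewrite !S_INR. do 2 f_equal. ring.
Qed.

(** The right-hand side is the squared modulus of [sum_(m<M) e^(imx)]. It yields positivity, and
    through the geometric sum also the decay away from 0. *)
Lemma fejer_sum M x :
  lsum (fun m => dirichlet m x) (seq 0 M)
  = lsum (fun m => cos (INR m * x)) (seq 0 M) ^ 2 + lsum (fun m => sin (INR m * x)) (seq 0 M) ^ 2.
Proof.
  induction M; [simpl; ring|]. rewrite !lsum_seq_S, IHM. unfold dirichlet.
  rewrite <- lsum_reverse.
  rewrite (lsum_ext (fun m => cos ((INR M - INR m) * x))
    (fun m => cos (INR M * x) * cos (INR m * x) + sin (INR M * x) * sin (INR m * x))).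
  - rewrite lsum_plus, !lsum_scal. pose proof (sin2_cos2 (INR M * x)) as H. unfold Rsqr in H.
    set (c := cos (INR M * x)) in *. set (s := sin (INR M * x)) in *. rewrite <- H. ring.
  - intros m _. rewrite Rmult_minus_distr_r, cos_minus. ring.
Qed.

Lemma fejer_nonneg M x : 0 <= fejer M x.
Proof.
  unfold fejer. rewrite fejer_sum. destruct M as [|M].
  - simpl. rewrite Rinv_0. lra.
  - apply Rmult_le_pos.
    + left. apply Rinv_0_lt_compat, lt_0_INR. lia.
    + apply Rplus_le_le_0_compat; apply pow2_ge_0.
Qed.

(** From [sin a >= a - a^3/6] and [a^2 <= 4]. *)
Lemma sin_ge_third a : 0 <= a <= 2 -> a / 3 <= sin a.
Proof.
  intros Ha. destruct (pre_sin_bound a 0 ltac:(lra) ltac:(lra)) as [H _].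
  unfold sin_approx, sum_f_R0, sin_term in H. simpl in H. nra.
Qed.

Lemma geom_cis M x : ((1 - cis x) * csum (fun m => cis (INR m * x)) M)%C = (1 - cis (INR M * x))%C.
Proof.
  induction M.
  - simpl. unfold cis. rewrite Rmult_0_l, cos_0, sin_0. change ((1, 0) : C) with (RtoC 1). ring.
  - simpl csum. rewrite Cmult_plus_distr_l, IHM, <- !cis_pow, Cpow_S. ring.
Qed.

(** The geometric sum has modulus at most [2 / |1 - e^(ix)|], and
    [|1 - e^(ix)| = 2 |sin(x/2)| >= |x|/3]; squaring gives 36. *)
Lemma fejer_upper M x : (1 <= M)%nat -> 0 < Rabs x <= 4 -> fejer M x <= 36 / (INR M * (x * x)).
Proof.
  intros HM Hx.
  assert (HM' : 1 <= INR M) by (replace 1 with (INR 1) by reflexivity; now apply le_INR).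
  assert (Hx2 : 0 < x * x) by (unfold Rabs in Hx; destruct (Rcase_abs x); nra).
  set (c := csum (fun m => cis (INR m * x)) M).
  assert (Ec : lsum (fun m => cos (INR m * x)) (seq 0 M) ^ 2 + lsum (fun m => sin (INR m * x)) (seq 0 M) ^ 2 = Cmod c ^ 2).
  { rewrite Cmod2_alt. unfold c. rewrite csum_Re, csum_Im. reflexivity. }
  assert (H1 : Cmod (1 - cis x)%C ^ 2 >= x * x / 9).
  { rewrite Cmod2_alt. simpl. pose proof (sin2_cos2 x) as Hs. unfold Rsqr in Hs.
    assert (Hh : sin (Rabs x / 2) * sin (Rabs x / 2) * 2 = 1 - cos x).
    { replace (cos x) with (cos (2 * (Rabs x / 2))).
      - rewrite cos_2a_sin. ring.
      - replace (2 * (Rabs x / 2)) with (Rabs x) by field. unfold Rabs. destruct (Rcase_abs x); [apply cos_neg|reflexivity]. }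
    pose proof (sin_ge_third (Rabs x / 2) ltac:(lra)) as H3.
    assert (Rabs x * Rabs x = x * x) by (rewrite <- Rabs_mult; apply Rabs_pos_eq; lra).
    assert ((Rabs x / 2 / 3) * (Rabs x / 2 / 3) <= sin (Rabs x / 2) * sin (Rabs x / 2)) by (apply Rmult_le_compat; lra).
    apply Rle_ge. nra. }
  assert (H2 : Cmod (1 - cis x)%C * Cmod c <= 2).
  { rewrite <- Cmod_mult. unfold c. rewrite geom_cis.
    eapply Rle_trans; [apply Cmod_triangle|]. rewrite Cmod_1, Cmod_opp, Cmod_cis. lra. }
  unfold fejer. rewrite fejer_sum, Ec.
  pose proof (Cmod_ge_0 c). pose proof (Cmod_ge_0 (1 - cis x)%C).
  assert (H3 : Cmod c ^ 2 * (x * x) <= 36).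
  { assert ((Cmod (1 - cis x)%C * Cmod c) * (Cmod (1 - cis x)%C * Cmod c) <= 2 * 2) by (apply Rmult_le_compat; nra).
    assert (Cmod c ^ 2 * (x * x / 9) <= Cmod c ^ 2 * Cmod (1 - cis x)%C ^ 2) by (apply Rmult_le_compat_l; [apply pow2_ge_0 | lra]).
    simpl in *. lra. }
  apply Rmult_le_reg_r with (INR M * (x * x)); [apply Rmult_lt_0_compat; lra|].
  unfold Rdiv. rewrite (Rmult_assoc 36), Rinv_l by (apply Rgt_not_eq, Rmult_lt_0_compat; lra).
  replace (/ INR M * Cmod c ^ 2 * (INR M * (x * x))) with (Cmod c ^ 2 * (x * x)) by (field; lra). lra.
Qed.

(** For [M x <= 1 < PI/3] every cosine in the sum is at least 1/2, so its square alone contributes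
    [(M/2)^2 / M]. *)
Lemma fejer_lower M x : (1 <= M)%nat -> 0 <= x -> INR M * x <= 1 -> INR M / 4 <= fejer M x.
Proof.
  intros HM Hx HMx.
  assert (HM' : 1 <= INR M) by (replace 1 with (INR 1) by reflexivity; now apply le_INR).
  assert (Hc : INR M / 2 <= lsum (fun m => cos (INR m * x)) (seq 0 M)).
  { replace (INR M / 2) with (lsum (fun _ : nat => 1 / 2) (seq 0 M)) by (rewrite lsum_const, length_seq; field).
    apply lsum_le. intros m Hm. apply in_seq in Hm.
    assert (0 <= INR m <= INR M) by (split; [apply pos_INR | apply le_INR; lia]).
    rewrite <- cos_PI3. pose proof PI2_3_2.
    apply cos_decr_1; try lra; nra. }
  unfold fejer. rewrite fejer_sum.
  set (c := lsum (fun m => cos (INR m * x)) (seq 0 M)) in *.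
  pose proof (pow2_ge_0 (lsum (fun m => sin (INR m * x)) (seq 0 M))).
  apply Rmult_le_reg_l with (INR M); [lra|].
  rewrite <- Rmult_assoc, Rinv_r, Rmult_1_l by lra.
  assert (INR M / 2 * (INR M / 2) <= c * c) by (apply Rmult_le_compat; lra). simpl in *. lra.
Qed.

Lemma fejer_continuous M th V v : continuous (fun v => fejer M (th * (V - v))) v.
Proof.
  unfold fejer. apply (continuous_mult (K := R_AbsRing)); [apply continuous_const|].
  assert (G : forall l (f : nat -> R -> R), (forall n, continuous (f n) v) -> continuous (fun v => lsum (fun n => f n v) l) v).
  { intros l f Hf. induction l; simpl; [apply continuous_const|].
    apply (continuous_plus (V := R_NormedModule)); [apply Hf | apply IHl]. }
  apply (G (seq 0 M) (fun m v => dirichlet m (th * (V - v)))). intros m. unfold dirichlet.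
  apply (continuous_plus (V := R_NormedModule)); [apply continuous_const|].
  apply (continuous_mult (K := R_AbsRing)); [apply continuous_const|].
  apply (G (seq 1 m) (fun j v => cos (INR j * (th * (V - v))))). intros j.
  apply (ex_derive_continuous (V := R_NormedModule)). auto_derive. exact I.
Qed.

(** The kernel need not be normalised: its positivity and a lower bound [W / 4] on its mass
    near [V] suffice. *)
Lemma fejer_desmooth (g : R -> R) (M : nat) (W V d osc B0 I0 : R) :
  (1 <= M)%nat -> 0 < d -> 0 <= V - d -> V + d <= W -> W <= INR M * d -> 0 <= B0 -> 0 <= osc ->
  (forall k, (forall v, continuous k v) -> ex_RInt (fun v => k v * g v) 0 W) ->
  (forall v, 0 <= v <= W -> Rabs (g v) <= B0) ->
  (forall v, V - d <= v <= V + d -> Rabs (g v - g V) <= osc) ->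
  Rabs (RInt (fun v => fejer M (/ W * (V - v)) * g v) 0 W) <= I0 ->
  Rabs (g V) <= osc + 4 / W * (I0 + W * (B0 * (36 * (W * W) / (INR M * (d * d))))).
Proof.
  intros HM Hd HVd HVW HMd HB0 Hosc Hex Hg Hnear HI.
  assert (HM' : 1 <= INR M) by (replace 1 with (INR 1) by reflexivity; now apply le_INR).
  assert (HW : 0 < W) by lra.
  assert (HiW : 0 < / W) by now apply Rinv_0_lt_compat.
  set (k := fun v => fejer M (/ W * (V - v))) in *.
  assert (Hkc : forall v, continuous k v) by (intros; apply fejer_continuous).
  assert (Hkg : ex_RInt (fun v => k v * g v) 0 W) by now apply Hex.
  set (F := 36 * (W * W) / (INR M * (d * d))).
  assert (HF : 0 <= F).
  { apply Rdiv_le_0_compat; [nra|]. apply Rmult_lt_0_compat; [lra|nra]. }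
  assert (Hfar : forall v, 0 <= v <= W -> d <= Rabs (V - v) -> 0 <= k v <= F).
  { intros v Hv Hdv. split; [apply fejer_nonneg|]. unfold k.
    assert (HVv : Rabs (V - v) <= W) by (apply Rabs_le; lra).
    assert (Ex : Rabs (/ W * (V - v)) = / W * Rabs (V - v)) by (rewrite Rabs_mult, (Rabs_pos_eq (/ W)); lra).
    assert (Hle1 : / W * Rabs (V - v) <= 1).
    { apply Rmult_le_reg_l with W; [lra|]. rewrite <- Rmult_assoc, Rinv_r; lra. }
    eapply Rle_trans; [apply fejer_upper; auto|].
    - rewrite Ex. split; [apply Rmult_lt_0_compat; lra|lra].
    - unfold F. replace (36 * (W * W) / (INR M * (d * d))) with (36 / (INR M * (/ W * d * (/ W * d)))) by (field; lra).
      unfold Rdiv. apply Rmult_le_compat_l; [lra|]. apply Rinv_le_contravar.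
      + repeat apply Rmult_lt_0_compat; lra.
      + apply Rmult_le_compat_l; [lra|].
        replace (/ W * (V - v) * (/ W * (V - v))) with (Rabs (/ W * (V - v)) * Rabs (/ W * (V - v)))
          by (rewrite <- Rabs_mult; apply Rabs_pos_eq; apply Rle_0_sqr).
        rewrite Ex. apply Rmult_le_compat; try (apply Rmult_le_pos; lra); apply Rmult_le_compat_l; lra. }
  assert (X1 : ex_RInt (fun v => k v * g v) 0 (V - d)).
  { apply (ex_RInt_Chasles_1 (V := R_CompleteNormedModule)) with W; [lra|assumption]. }
  assert (X2 : ex_RInt (fun v => k v * g v) (V - d) W).
  { apply (ex_RInt_Chasles_2 (V := R_CompleteNormedModule)) with 0; [lra|assumption]. }
  assert (X3 : ex_RInt (fun v => k v * g v) (V - d) (V + d)).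
  { apply (ex_RInt_Chasles_1 (V := R_CompleteNormedModule)) with W; [lra|assumption]. }
  assert (X4 : ex_RInt (fun v => k v * g v) (V + d) W).
  { apply (ex_RInt_Chasles_2 (V := R_CompleteNormedModule)) with (V - d); [lra|assumption]. }
  assert (XK : forall a b, a <= b -> ex_RInt k a b).
  { intros a b Hab. apply ex_RInt_cont_from with (a - 1); auto; lra. }
  assert (Efar : forall a b, 0 <= a <= b -> b <= W -> (b <= V - d \/ V + d <= a) -> ex_RInt (fun v => k v * g v) a b ->
     Rabs (RInt (fun v => k v * g v) a b) <= (b - a) * (F * B0)).
  { intros a b Ha Hb Hab Hx.
    apply (norm_RInt_le_const (V := R_NormedModule) (fun v => k v * g v) a b); [lra| |].
    - intros x Hxx. change (Rabs (k x * g x) <= F * B0). rewrite Rabs_mult.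
      assert (0 <= k x <= F).
      { apply Hfar; [lra|]. destruct Hab; [rewrite Rabs_pos_eq; lra | rewrite Rabs_left1; lra]. }
      apply Rmult_le_compat; try apply Rabs_pos; [rewrite Rabs_pos_eq; lra | apply Hg; lra].
    - now apply (RInt_correct (V := R_CompleteNormedModule)). }
  pose proof (Efar 0 (V - d) ltac:(lra) ltac:(lra) (or_introl (Rle_refl _)) X1) as F1.
  pose proof (Efar (V + d) W ltac:(lra) ltac:(lra) (or_intror (Rle_refl _)) X4) as F2.
  assert (ECh : RInt (fun v => k v * g v) 0 W = RInt (fun v => k v * g v) 0 (V - d)
     + (RInt (fun v => k v * g v) (V - d) (V + d) + RInt (fun v => k v * g v) (V + d) W)).
  { rewrite <- (RInt_Chasles (V := R_CompleteNormedModule) _ 0 (V - d) W X1 X2).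
    rewrite <- (RInt_Chasles (V := R_CompleteNormedModule) _ (V - d) (V + d) W X3 X4). reflexivity. }
  set (Kn := RInt k (V - d) (V + d)).
  assert (Hosc2 : Rabs (RInt (fun v => k v * g v) (V - d) (V + d) - g V * Kn) <= osc * Kn).
  { assert (E1 : is_RInt (fun v => k v * g v - g V * k v) (V - d) (V + d) (RInt (fun v => k v * g v) (V - d) (V + d) - g V * Kn)).
    { apply (is_RInt_minus (V := R_NormedModule) (fun v => k v * g v) (fun v => g V * k v)).
      - now apply (RInt_correct (V := R_CompleteNormedModule)).
      - apply (is_RInt_scal (V := R_NormedModule) k (V - d) (V + d) (g V)).
        apply (RInt_correct (V := R_CompleteNormedModule)). apply XK; lra. }
    assert (E2 : is_RInt (fun v => osc * k v) (V - d) (V + d) (osc * Kn)).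
    { apply (is_RInt_scal (V := R_NormedModule) k (V - d) (V + d) osc).
      apply (RInt_correct (V := R_CompleteNormedModule)). apply XK; lra. }
    apply (norm_RInt_le (V := R_NormedModule) _ _ (V - d) (V + d) _ _ ltac:(lra)) with (2 := E1) (3 := E2).
    intros x Hx. change (Rabs (k x * g x - g V * k x) <= osc * k x).
    replace (k x * g x - g V * k x) with ((g x - g V) * k x) by ring.
    rewrite Rabs_mult, (Rabs_pos_eq (k x)) by apply fejer_nonneg.
    apply Rmult_le_compat_r; [apply fejer_nonneg | now apply Hnear]. }
  assert (HKn : W / 4 <= Kn).
  (* On [[V - e, V]] the kernel is at least [M/4] by [fejer_lower], and [e M / 4 = W / 4]. *)
  { set (e := W / INR M). assert (He : 0 < e <= d).
    { unfold e. split; [apply Rdiv_lt_0_compat; lra|]. apply Rmult_le_reg_r with (INR M); [lra|].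
      unfold Rdiv. rewrite Rmult_assoc, Rinv_l; lra. }
    assert (EK : Kn = RInt k (V - d) (V - e) + (RInt k (V - e) V + RInt k V (V + d))).
    { unfold Kn. rewrite <- (RInt_Chasles (V := R_CompleteNormedModule) k (V - d) (V - e) (V + d)) by (apply XK; lra).
      rewrite <- (RInt_Chasles (V := R_CompleteNormedModule) k (V - e) V (V + d)) by (apply XK; lra). reflexivity. }
    assert (P1 : 0 <= RInt k (V - d) (V - e)) by (apply RInt_ge_0; [lra | apply XK; lra | intros; apply fejer_nonneg]).
    assert (P2 : 0 <= RInt k V (V + d)) by (apply RInt_ge_0; [lra | apply XK; lra | intros; apply fejer_nonneg]).
    assert (P3 : RInt (fun _ => INR M / 4) (V - e) V <= RInt k (V - e) V).
    { apply RInt_le; [lra | apply ex_RInt_const | apply XK; lra |].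
      intros x Hx. apply fejer_lower; auto.
      - apply Rmult_le_pos; lra.
      - rewrite <- Rmult_assoc. apply Rle_trans with (INR M * / W * e).
        + apply Rmult_le_compat_l; [apply Rmult_le_pos; lra|lra].
        + unfold e. right. field. lra. }
    rewrite RInt_const in P3. unfold scal in P3; simpl in P3; unfold mult in P3; simpl in P3.
    assert (E : (V - (V - e)) * (INR M / 4) = W / 4) by (unfold e; field; lra).
    lra. }
  assert (Hmain : Rabs (g V) * Kn <= osc * Kn + (I0 + W * (B0 * F))).
  { rewrite <- (Rabs_pos_eq Kn) at 1 by lra. rewrite <- Rabs_mult.
    set (In := RInt (fun v => k v * g v) (V - d) (V + d)) in *.
    assert (Hin : Rabs In <= I0 + W * (B0 * F)).
    { replace In with (RInt (fun v => k v * g v) 0 W - (RInt (fun v => k v * g v) 0 (V - d) + RInt (fun v => k v * g v) (V + d) W))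
        by (rewrite ECh; ring).
      unfold Rminus at 1. eapply Rle_trans; [apply Rabs_triang|]. rewrite Rabs_Ropp.
      eapply Rle_trans; [apply Rplus_le_compat; [exact HI | apply Rabs_triang]|].
      assert (0 <= F * B0) by (apply Rmult_le_pos; assumption).
      replace (W * (B0 * F)) with (W * (F * B0)) by ring. set (fb := F * B0) in *. clearbody fb.
      assert (0 <= d * fb) by (apply Rmult_le_pos; [lra|assumption]). lra. }
    replace (g V * Kn) with (In - (In - g V * Kn)) by ring.
    unfold Rminus at 1. eapply Rle_trans; [apply Rabs_triang|]. rewrite Rabs_Ropp. lra. }
  fold F. assert (HKn0 : 0 < Kn) by lra.
  assert (HI0 : 0 <= I0) by (eapply Rle_trans; [apply Rabs_pos | exact HI]).
  assert (HX : 0 <= I0 + W * (B0 * F)).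
  { assert (0 <= W * (B0 * F)) by (apply Rmult_le_pos; [lra|]; apply Rmult_le_pos; assumption). lra. }
  set (X := I0 + W * (B0 * F)) in *.
  apply Rmult_le_reg_r with Kn; [assumption|]. rewrite Rmult_plus_distr_r.
  assert (X <= 4 / W * X * Kn).
  { replace X with (4 / W * X * (W / 4)) at 1 by (field; lra).
    apply Rmult_le_compat_l; [|assumption]. apply Rmult_le_pos; [|assumption]. apply Rdiv_le_0_compat; lra. }
  lra.
Qed.

(** * Kernels integrated against the prime-power measure *)

(** The integral of [k] over [[0, W]] against the measure of atoms minus [b(v) dv]. It is linear in
    [k], which lets a trigonometric kernel be treated frequency by frequency. *)
Definition Jf (L : list (R * R)) (b : R -> R) (W : R) (k : R -> R) : R :=
  cum (reweigh k L) (fun x => k x * b x) 0 W.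

Section Functional.
Variables (L : list (R * R)) (b : R -> R) (W : R).
Hypothesis HW : 0 <= W.
Hypothesis Hb : forall v, continuous b v.

Lemma Jf_ex k : (forall v, continuous k v) -> ex_RInt (fun x => k x * b x) 0 W.
Proof.
  intros Hk. apply ex_RInt_cont_from with (-1); auto; try lra. intros v _.
  apply (continuous_mult (K := R_AbsRing)); auto.
Qed.

Lemma Jf_ext k1 k2 : (forall x, k1 x = k2 x) -> Jf L b W k1 = Jf L b W k2.
Proof.
  intros H. unfold Jf, cum. rewrite !step_reweigh.
  rewrite (RInt_ext (fun x => k1 x * b x) (fun x => k2 x * b x)) by (intros; now rewrite H).
  f_equal. apply lsum_ext. intros p _. now rewrite H.
Qed.

Lemma Jf_lin k1 k2 c1 c2 : (forall v, continuous k1 v) -> (forall v, continuous k2 v) ->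
  Jf L b W (fun x => c1 * k1 x + c2 * k2 x) = c1 * Jf L b W k1 + c2 * Jf L b W k2.
Proof.
  intros H1 H2. unfold Jf, cum. rewrite !step_reweigh.
  rewrite (RInt_ext (fun x => (c1 * k1 x + c2 * k2 x) * b x) (fun x => c1 * (k1 x * b x) + c2 * (k2 x * b x))).
  - rewrite RInt_lin by now apply Jf_ex.
    rewrite (lsum_ext (fun a => if Rle_dec (snd a) W then fst a * (c1 * k1 (snd a) + c2 * k2 (snd a)) else 0)
      (fun a => c1 * (if Rle_dec (snd a) W then fst a * k1 (snd a) else 0) + c2 * (if Rle_dec (snd a) W then fst a * k2 (snd a) else 0))).
    + rewrite lsum_plus, !lsum_scal. ring.
    + intros p _. destruct (Rle_dec _ _); ring.
  - intros x _. simpl. ring.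
Qed.

Lemma Jf_scal k c : (forall v, continuous k v) -> Jf L b W (fun x => c * k x) = c * Jf L b W k.
Proof.
  intros H. rewrite (Jf_ext _ (fun x => c * k x + 0 * k x)) by (intros; ring).
  rewrite Jf_lin by auto. ring.
Qed.

Lemma continuous_lsum {T} (f : T -> R -> R) l v : (forall x, continuous (f x) v) -> continuous (fun v => lsum (fun x => f x v) l) v.
Proof.
  intros H. induction l; simpl; [apply continuous_const|].
  apply (continuous_plus (V := R_NormedModule)); auto.
Qed.

Lemma Jf_lsum {T} (f : T -> R -> R) (l : list T) : (forall x v, continuous (f x) v) ->
  Jf L b W (fun v => lsum (fun x => f x v) l) = lsum (fun x => Jf L b W (f x)) l.
Proof.
  intros H. induction l as [|x l IH]; simpl.
  - rewrite (Jf_ext _ (fun x => 0 * 0)) by (intros; ring). rewrite (Jf_scal (fun _ => 0)); [ring|].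
    intros; apply continuous_const.
  - rewrite (Jf_ext _ (fun v => 1 * f x v + 1 * lsum (fun x => f x v) l)) by (intros; ring).
    rewrite Jf_lin, IH; auto; [ring|]. intros v. apply continuous_lsum. auto.
Qed.
End Functional.

(** A real part of [e^(-(s + iy) x)] up to a phase: up to truncation, [Jf] of it is a component of
    [D(s + iy)]. *)
Definition Dk (s y phi x : R) : R := exp (- s * x) * cos (y * x + phi).

Lemma Dk_continuous s y phi v : continuous (Dk s y phi) v.
Proof. apply (ex_derive_continuous (V := R_NormedModule)). unfold Dk. auto_derive. exact I. Qed.

(** The closed form of the integral of [e^(-su) cos(b (V - u))] over [u >= v]. The decay at infinity
    fixes the constant of integration. *)
Definition om_term (s b V v : R) : R :=
  exp (- s * v) * ((s * cos (b * (V - v)) + b * sin (b * (V - v))) / (s * s + b * b)).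
Definition om0 (s v : R) : R := exp (- s * v) / s.
(** The tail from [v] to infinity of the Fejer kernel times [e^(-su)]. It is the weight that Abel
    summation needs to move the kernel from the integral of [Gf] onto the atoms. *)
Definition omega (M : nat) (th s V v : R) : R :=
  / INR M * lsum (fun m => om0 s v + 2 * lsum (fun j => om_term s (INR j * th) V v) (seq 1 m)) (seq 0 M).

Lemma is_derive_lsum {T} (f f' : T -> R -> R) l v : (forall x, is_derive (f x) v (f' x v)) ->
  is_derive (fun v => lsum (fun x => f x v) l) v (lsum (fun x => f' x v) l).
Proof.
  intros H. induction l; simpl; [apply (is_derive_const (V := R_NormedModule))|].
  apply (is_derive_plus (V := R_NormedModule)); auto.
Qed.

Lemma omega_derive M th s V v : 0 < s ->
  is_derive (omega M th s V) v (- (fejer M (th * (V - v)) * exp (- s * v))).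
Proof.
  intros Hs. unfold omega.
  assert (H0 : is_derive (om0 s) v (- exp (- s * v))).
  { unfold om0. auto_derive; [lra|]. field. lra. }
  assert (Hj : forall j : nat, is_derive (om_term s (INR j * th) V) v (- (exp (- s * v) * cos (INR j * (th * (V - v)))))).
  { intros j. unfold om_term. set (b := INR j * th).
    assert (Hsb : 0 < s * s + b * b) by nra.
    auto_derive; [lra|]. replace (INR j * (th * (V - v))) with (b * (V - v)) by (unfold b; ring).
    replace (V + - v) with (V - v) by ring. field. lra. }
  pose proof (is_derive_lsum (fun m v => om0 s v + 2 * lsum (fun j => om_term s (INR j * th) V v) (seq 1 m))
    (fun m v => - exp (- s * v) + 2 * lsum (fun j => - (exp (- s * v) * cos (INR j * (th * (V - v))))) (seq 1 m)) (seq 0 M) v) as HD.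
  assert (HD' : is_derive (fun v => lsum (fun m => om0 s v + 2 * lsum (fun j => om_term s (INR j * th) V v) (seq 1 m)) (seq 0 M)) v
    (lsum (fun m => - exp (- s * v) + 2 * lsum (fun j => - (exp (- s * v) * cos (INR j * (th * (V - v))))) (seq 1 m)) (seq 0 M))).
  { apply HD. intros m. apply (is_derive_plus (V := R_NormedModule)); [exact H0|].
    apply (is_derive_scal (fun v => lsum (fun j => om_term s (INR j * th) V v) (seq 1 m))).
    apply (is_derive_lsum (fun j v => om_term s (INR j * th) V v) (fun j v => - (exp (- s * v) * cos (INR j * (th * (V - v)))))).
    exact Hj. }
  pose proof (is_derive_scal _ v (/ INR M) _ HD') as HS.
  apply (is_derive_eq_R _ _ _ _ HS).
  unfold fejer, dirichlet. rewrite Rmult_assoc, Ropp_mult_distr_r. f_equal.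
  replace (- (lsum (fun m => 1 + 2 * lsum (fun j => cos (INR j * (th * (V - v)))) (seq 1 m)) (seq 0 M) * exp (- s * v)))
    with (- exp (- s * v) * lsum (fun m => 1 + 2 * lsum (fun j => cos (INR j * (th * (V - v)))) (seq 1 m)) (seq 0 M)) by ring.
  rewrite <- lsum_scal. apply lsum_ext. intros m _.
  rewrite (lsum_ext (fun j => - (exp (- s * v) * cos (INR j * (th * (V - v))))) (fun j => - exp (- s * v) * cos (INR j * (th * (V - v))))) by (intros; ring).
  rewrite lsum_scal. ring.
Qed.

Lemma harmonic_bound m M : (m <= M)%nat -> (1 <= M)%nat -> lsum (fun j => / INR j) (seq 1 m) <= 1 + ln (INR M).
Proof.
  intros Hm HM.
  assert (H : lsum (fun j => / INR j) (seq 1 M) <= 1 + ln (INR M)).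
  { clear Hm. induction HM as [|n Hn IH].
    - simpl. rewrite ln_1. lra.
    - rewrite seq_S, lsum_app. cbn [lsum]. replace (1 + n)%nat with (S n) by lia.
      assert (Hn0 : 0 < INR n) by (apply lt_0_INR; lia). rewrite S_INR.
      assert (/ (INR n + 1) <= ln (INR n + 1) - ln (INR n)); [|lra].
      pose proof (ln_le_sub1 (INR n / (INR n + 1)) ltac:(apply Rdiv_lt_0_compat; lra)) as H.
      unfold Rdiv in H. rewrite ln_mult, ln_Rinv in H by (try apply Rinv_0_lt_compat; lra).
      assert (INR n * / (INR n + 1) = 1 - / (INR n + 1)) by (field; lra). lra. }
  apply Rle_trans with (2 := H).
  replace M with (m + (M - m))%nat by lia. rewrite seq_app, lsum_app.
  assert (0 <= lsum (fun j => / INR j) (seq (1 + m) (M - m))); [|lra].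
  apply lsum_nonneg. intros j Hj. apply in_seq in Hj. left. apply Rinv_0_lt_compat, lt_0_INR. lia.
Qed.

Lemma frac_bound s b : 0 < s -> 0 < b -> (s + b) / (s * s + b * b) <= 2 / b.
Proof.
  intros Hs Hb. assert (H : 0 < s * s + b * b) by nra.
  apply Rmult_le_reg_r with (b * (s * s + b * b)); [nra|].
  replace ((s + b) / (s * s + b * b) * (b * (s * s + b * b))) with ((s + b) * b) by (field; lra).
  replace (2 / b * (b * (s * s + b * b))) with (2 * (s * s + b * b)) by (field; lra).
  pose proof (Rle_0_sqr (s - b)) as Hq. unfold Rsqr in Hq. nra.
Qed.

(** Integration has given the frequency [j th] a coefficient of size [1/(j th)], so summing over up
    to [M] frequencies costs only [log M]. *)
Lemma cesaro_bound (a0 : R) (a : nat -> R) (M : nat) (th s BD : R) : (1 <= M)%nat -> 0 < th -> 0 <= BD -> 0 < s ->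
  Rabs a0 <= BD / s -> (forall j, (1 <= j <= M)%nat -> Rabs (a j) <= BD * (2 / (INR j * th))) ->
  Rabs (/ INR M * lsum (fun m => a0 + 2 * lsum a (seq 1 m)) (seq 0 M)) <= BD * (/ s + 4 / th * (1 + ln (INR M))).
Proof.
  intros HM Hth HBD Hs H0 Ha.
  assert (HM0 : 0 < INR M) by (apply lt_0_INR; lia).
  rewrite Rabs_mult, (Rabs_pos_eq (/ INR M)) by (left; now apply Rinv_0_lt_compat).
  apply Rmult_le_reg_l with (INR M); [assumption|]. rewrite <- Rmult_assoc, Rinv_r, Rmult_1_l by lra.
  eapply Rle_trans; [apply lsum_abs|].
  apply Rle_trans with (lsum (fun _ => BD * (/ s + 4 / th * (1 + ln (INR M)))) (seq 0 M)).
  - apply lsum_le. intros m Hm. apply in_seq in Hm.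
    eapply Rle_trans; [apply Rabs_triang|]. rewrite Rmult_plus_distr_l. apply Rplus_le_compat; [exact H0|].
    rewrite Rabs_mult, (Rabs_pos_eq 2) by lra.
    assert (H : Rabs (lsum a (seq 1 m)) <= BD * 2 / th * lsum (fun j => / INR j) (seq 1 m)).
    { eapply Rle_trans; [apply lsum_abs|]. rewrite <- lsum_scal. apply lsum_le. intros j Hj. apply in_seq in Hj.
      eapply Rle_trans; [apply Ha; lia|]. right. assert (0 < INR j) by (apply lt_0_INR; lia). field. lra. }
    pose proof (harmonic_bound m M ltac:(lia) HM) as HH.
    assert (0 <= BD * 2 / th) by (apply Rdiv_le_0_compat; lra).
    assert (BD * 2 / th * lsum (fun j => / INR j) (seq 1 m) <= BD * 2 / th * (1 + ln (INR M))) by (apply Rmult_le_compat_l; assumption).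
    replace (BD * (4 / th * (1 + ln (INR M)))) with (2 * (BD * 2 / th * (1 + ln (INR M)))) by (field; lra). lra.
  - rewrite lsum_const, length_seq. lra.
Qed.

Lemma Rabs_cos_sin_le s b x : 0 <= s -> 0 <= b -> Rabs (s * cos x + b * sin x) <= s + b.
Proof.
  intros Hs Hb. eapply Rle_trans; [apply Rabs_triang|]. rewrite !Rabs_mult, (Rabs_pos_eq s), (Rabs_pos_eq b) by assumption.
  assert (Rabs (cos x) <= 1) by (apply Rabs_le, COS_bound). assert (Rabs (sin x) <= 1) by (apply Rabs_le, SIN_bound). nra.
Qed.

Lemma omega_bound M th s V v : (1 <= M)%nat -> 0 < th -> 0 < s ->
  Rabs (omega M th s V v) <= exp (- s * v) * (/ s + 4 / th * (1 + ln (INR M))).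
Proof.
  intros HM Hth Hs. unfold omega.
  apply (cesaro_bound (om0 s v) (fun j => om_term s (INR j * th) V v)); auto.
  - left; apply exp_pos.
  - unfold om0. rewrite Rabs_pos_eq; [lra|]. apply Rdiv_le_0_compat; [left; apply exp_pos|assumption].
  - intros j Hj. unfold om_term. rewrite Rabs_mult, (Rabs_pos_eq (exp _)) by (left; apply exp_pos).
    apply Rmult_le_compat_l; [left; apply exp_pos|].
    assert (0 < INR j) by (apply lt_0_INR; lia). assert (Hb : 0 < INR j * th) by now apply Rmult_lt_0_compat.
    set (b := INR j * th) in *. assert (Hsb : 0 < s * s + b * b) by nra.
    unfold Rdiv at 1. rewrite Rabs_mult, (Rabs_pos_eq (/ _)) by (left; now apply Rinv_0_lt_compat).
    eapply Rle_trans; [|apply (frac_bound s b Hs Hb)]. unfold Rdiv. apply Rmult_le_compat_r; [left; now apply Rinv_0_lt_compat|].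
    apply Rabs_cos_sin_le; lra.
Qed.

Section FejerBound.
Variables (L : list (R * R)) (b : R -> R) (W : R).
Hypothesis HW : 0 < W.
Hypothesis Hb : forall v, continuous b v.
Hypothesis HL : forall p, In p L -> 0 <= snd p.

(** Multiplied by the twist, each term of [omega] splits into kernels [Dk] at the heights [t - j th]
    and [t + j th], all bounded by [Y]. So a bound for [D] at heights up to [Y] suffices. *)
Lemma Jf_cost_omega M th s V t phi Y BD : (1 <= M)%nat -> 0 < th -> 0 < s -> 0 <= BD ->
  Rabs t + INR M * th <= Y ->
  (forall y psi, Rabs y <= Y -> Rabs (Jf L b W (Dk s y psi)) <= BD) ->
  Rabs (Jf L b W (fun x => cost t phi x * omega M th s V x)) <= BD * (/ s + 4 / th * (1 + ln (INR M))).
Proof.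
  intros HM Hth Hs HBD HY HD. pose proof (Rabs_pos t) as Ht.
  assert (Hc0 : forall v, continuous (fun x => cost t phi x * om0 s x) v).
  { intros v. apply (ex_derive_continuous (V := R_NormedModule)). unfold cost, om0. auto_derive. lra. }
  assert (Hcj : forall (j : nat) v, continuous (fun x => cost t phi x * om_term s (INR j * th) V x) v).
  { intros j v. apply (ex_derive_continuous (V := R_NormedModule)). unfold cost, om_term.
    set (bb := INR j * th). assert (0 < s * s + bb * bb) by nra. auto_derive. lra. }
  assert (HMm : forall m v, continuous (fun x => cost t phi x * om0 s x + 2 * lsum (fun j => cost t phi x * om_term s (INR j * th) V x) (seq 1 m)) v).
  { intros m v. apply (continuous_plus (V := R_NormedModule)); [apply Hc0|].
    apply (continuous_mult (K := R_AbsRing)); [apply continuous_const|].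
    apply (continuous_lsum (fun (j : nat) x => cost t phi x * om_term s (INR j * th) V x)). intros; apply Hcj. }
  rewrite (Jf_ext L b W _ (fun x => / INR M * lsum (fun m => cost t phi x * om0 s x + 2 * lsum (fun j => cost t phi x * om_term s (INR j * th) V x) (seq 1 m)) (seq 0 M))).
  2:{ intros x. unfold omega. rewrite <- Rmult_assoc, (Rmult_comm (cost t phi x)), Rmult_assoc. f_equal.
      rewrite <- lsum_scal. apply lsum_ext. intros m _. rewrite lsum_scal. ring. }
  rewrite (Jf_scal L b W (Rlt_le _ _ HW) Hb (fun x => lsum (fun m => cost t phi x * om0 s x + 2 * lsum (fun j => cost t phi x * om_term s (INR j * th) V x) (seq 1 m)) (seq 0 M))).
  2:{ intros v. apply (continuous_lsum (fun m x => cost t phi x * om0 s x + 2 * lsum (fun j => cost t phi x * om_term s (INR j * th) V x) (seq 1 m))).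
      intros; apply HMm. }
  rewrite (Jf_lsum L b W (Rlt_le _ _ HW) Hb (fun m x => cost t phi x * om0 s x + 2 * lsum (fun j => cost t phi x * om_term s (INR j * th) V x) (seq 1 m))) by apply HMm.
  rewrite (lsum_ext _ (fun m => Jf L b W (fun x => cost t phi x * om0 s x) + 2 * lsum (fun j => Jf L b W (fun x => cost t phi x * om_term s (INR j * th) V x)) (seq 1 m))).
  2:{ intros m _. rewrite <- (Jf_lsum L b W (Rlt_le _ _ HW) Hb (fun (j : nat) x => cost t phi x * om_term s (INR j * th) V x)) by apply Hcj.
      rewrite <- (Rmult_1_l (Jf L b W (fun x => cost t phi x * om0 s x))).
      rewrite <- (Jf_lin L b W (Rlt_le _ _ HW) Hb); [apply Jf_ext; intros; ring | apply Hc0 |].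
      intros v. apply (continuous_lsum (fun (j : nat) x => cost t phi x * om_term s (INR j * th) V x)). intros; apply Hcj. }
  apply cesaro_bound; auto.
  - rewrite (Jf_ext L b W _ (fun x => / s * Dk s t phi x)) by (intros x; unfold cost, om0, Dk, Rdiv; ring).
    rewrite (Jf_scal L b W (Rlt_le _ _ HW) Hb) by apply Dk_continuous.
    rewrite Rabs_mult, (Rabs_pos_eq (/ s)), Rmult_comm by (left; now apply Rinv_0_lt_compat).
    unfold Rdiv. apply Rmult_le_compat_r; [left; now apply Rinv_0_lt_compat|]. apply HD.
    assert (0 <= INR M * th) by (apply Rmult_le_pos; [apply pos_INR|lra]). lra.
  - intros j Hj. assert (Hj0 : 0 < INR j) by (apply lt_0_INR; lia). assert (HjM : INR j <= INR M) by (apply le_INR; lia).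
    assert (Hbb : 0 < INR j * th) by now apply Rmult_lt_0_compat.
    assert (HbM : INR j * th <= INR M * th) by (apply Rmult_le_compat_r; lra).
    set (bb := INR j * th) in *. assert (Hsb : 0 < s * s + bb * bb) by nra.
    (* product-to-sum: each term is a combination of kernels at the heights t - bb and t + bb *)
    rewrite (Jf_ext L b W _ (fun x => / (2 * (s * s + bb * bb)) *
      (1 * (s * Dk s (t - bb) (phi + bb * V) x + s * Dk s (t + bb) (phi - bb * V) x)
       + 1 * (bb * Dk s (t - bb) (phi + bb * V - PI / 2) x + - bb * Dk s (t + bb) (phi - bb * V - PI / 2) x)))).
    2:{ intros x. unfold cost, om_term, Dk.
        replace ((t - bb) * x + (phi + bb * V)) with ((t * x + phi) + bb * (V - x)) by ring.
        replace ((t + bb) * x + (phi - bb * V)) with ((t * x + phi) - bb * (V - x)) by ring.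
        replace ((t - bb) * x + (phi + bb * V - PI / 2)) with ((t * x + phi) + bb * (V - x) - PI / 2) by ring.
        replace ((t + bb) * x + (phi - bb * V - PI / 2)) with ((t * x + phi) - bb * (V - x) - PI / 2) by ring.
        set (z1 := t * x + phi). set (z2 := bb * (V - x)).
        rewrite !(cos_minus _ (PI / 2)), cos_PI2, sin_PI2, !cos_plus, !cos_minus, !sin_plus, !sin_minus. field. lra. }
    assert (Hlc : forall c1 c2 y1 y2 p1 p2 v, continuous (fun x => c1 * Dk s y1 p1 x + c2 * Dk s y2 p2 x) v).
    { intros. apply (continuous_plus (V := R_NormedModule)); apply (continuous_mult (K := R_AbsRing)); try apply continuous_const; apply Dk_continuous. }
    rewrite (Jf_scal L b W (Rlt_le _ _ HW) Hb).
    2:{ intros v. apply (continuous_plus (V := R_NormedModule)); apply (continuous_mult (K := R_AbsRing)); try apply continuous_const; apply Hlc. }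
    rewrite (Jf_lin L b W (Rlt_le _ _ HW) Hb) by apply Hlc.
    rewrite !(Jf_lin L b W (Rlt_le _ _ HW) Hb (Dk _ _ _)) by apply Dk_continuous.
    assert (Hy1 : Rabs (t - bb) <= Y) by (unfold Rabs in *; destruct (Rcase_abs t), (Rcase_abs (t - bb)); lra).
    assert (Hy2 : Rabs (t + bb) <= Y) by (unfold Rabs in *; destruct (Rcase_abs t), (Rcase_abs (t + bb)); lra).
    pose proof (HD (t - bb) (phi + bb * V) Hy1) as B1. pose proof (HD (t + bb) (phi - bb * V) Hy2) as B2.
    pose proof (HD (t - bb) (phi + bb * V - PI / 2) Hy1) as B3. pose proof (HD (t + bb) (phi - bb * V - PI / 2) Hy2) as B4.
    set (x1 := Jf L b W (Dk s (t - bb) (phi + bb * V))) in *. set (x2 := Jf L b W (Dk s (t + bb) (phi - bb * V))) in *.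
    set (x3 := Jf L b W (Dk s (t - bb) (phi + bb * V - PI / 2))) in *. set (x4 := Jf L b W (Dk s (t + bb) (phi - bb * V - PI / 2))) in *.
    rewrite Rabs_mult, (Rabs_pos_eq (/ _)) by (left; apply Rinv_0_lt_compat; lra).
    assert (Hnum : Rabs (1 * (s * x1 + s * x2) + 1 * (bb * x3 + - bb * x4)) <= 2 * BD * (s + bb)).
    { apply Rabs_le_between in B1, B2, B3, B4. apply Rabs_le.
      assert (-(s * BD) <= s * x1 <= s * BD) by (split; nra). assert (-(s * BD) <= s * x2 <= s * BD) by (split; nra).
      assert (-(bb * BD) <= bb * x3 <= bb * BD) by (split; nra). assert (-(bb * BD) <= bb * x4 <= bb * BD) by (split; nra). lra. }
    apply Rle_trans with (/ (2 * (s * s + bb * bb)) * (2 * BD * (s + bb))).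
    + apply Rmult_le_compat_l; [left; apply Rinv_0_lt_compat; lra | exact Hnum].
    + replace (/ (2 * (s * s + bb * bb)) * (2 * BD * (s + bb))) with (BD * ((s + bb) / (s * s + bb * bb))) by (field; lra).
      apply Rmult_le_compat_l; [assumption|]. now apply frac_bound.
Qed.

Definition Gf t phi v := cum (reweigh (cost t phi) L) (fun x => cost t phi x * b x) 0 v.

(** Abel summation with the weight [omega] expresses the smoothed integral as a [Jf] minus a
    boundary term at [W], the second summand in the first factor. *)
Lemma fejer_integral_bound M th s V t phi Y BD : (1 <= M)%nat -> 0 < th -> 0 < s -> 0 <= BD ->
  Rabs t + INR M * th <= Y ->
  (forall y psi, Rabs y <= Y -> Rabs (Jf L b W (Dk s y psi)) <= BD) ->
  Rabs (RInt (fun v => fejer M (th * (V - v)) * (exp (- s * v) * Gf t phi v)) 0 W)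
   <= (BD + exp (- s * W) * Rabs (Gf t phi W)) * (/ s + 4 / th * (1 + ln (INR M))).
Proof.
  intros HM Hth Hs HBD HY HD.
  pose proof (Jf_cost_omega M th s V t phi Y BD HM Hth Hs HBD HY HD) as HJ.
  assert (Hcb : forall v, -1 < v -> continuous (fun x => cost t phi x * b x) v).
  { intros v _. apply (continuous_mult (K := R_AbsRing)); [apply cost_continuous | apply Hb]. }
  assert (HAb : cum (reweigh (omega M th s V) (reweigh (cost t phi) L)) (fun v => omega M th s V v * (cost t phi v * b v)) 0 W
     = omega M th s V W * Gf t phi W - RInt (fun v => - (fejer M (th * (V - v)) * exp (- s * v)) * Gf t phi v) 0 W).
  { apply (cum_abel (omega M th s V) (fun v => - (fejer M (th * (V - v)) * exp (- s * v))) (fun x => cost t phi x * b x) (reweigh (cost t phi) L) (-1)); auto; try lra.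
    - now apply reweigh_loc.
    - intros v _. now apply omega_derive.
    - intros v _. apply (continuous_opp (V := R_NormedModule)). apply (continuous_mult (K := R_AbsRing)); [apply fejer_continuous|].
      apply (ex_derive_continuous (V := R_NormedModule)). auto_derive. exact I. }
  assert (EJ : cum (reweigh (omega M th s V) (reweigh (cost t phi) L)) (fun v => omega M th s V v * (cost t phi v * b v)) 0 W
    = Jf L b W (fun x => cost t phi x * omega M th s V x)).
  { unfold Jf, cum. rewrite reweigh_comp.
    rewrite (RInt_ext (fun v => omega M th s V v * (cost t phi v * b v)) (fun x => cost t phi x * omega M th s V x * b x));
      [reflexivity|]. intros x _. simpl. ring. }
  rewrite EJ in HAb.
  rewrite (RInt_ext (fun v => - (fejer M (th * (V - v)) * exp (- s * v)) * Gf t phi v)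
    (fun v => opp (fejer M (th * (V - v)) * (exp (- s * v) * Gf t phi v)))) in HAb by (intros v _; unfold opp; simpl; ring).
  assert (Hex : ex_RInt (fun v => fejer M (th * (V - v)) * (exp (- s * v) * Gf t phi v)) 0 W).
  { pose proof (abel_cum (omega M th s V) (fun v => - (fejer M (th * (V - v)) * exp (- s * v))) (fun x => cost t phi x * b x) (reweigh (cost t phi) L) (-1) 0 W) as HI.
    assert (HI' : ex_RInt (fun v => - (fejer M (th * (V - v)) * exp (- s * v)) * Gf t phi v) 0 W).
    { eexists. apply HI; auto; try lra.
      - now apply reweigh_loc.
      - intros v _. now apply omega_derive.
      - intros v _. apply (continuous_opp (V := R_NormedModule)). apply (continuous_mult (K := R_AbsRing)); [apply fejer_continuous|].
        apply (ex_derive_continuous (V := R_NormedModule)). auto_derive. exact I. }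
    apply (ex_RInt_opp (V := R_NormedModule)) in HI'. apply ex_RInt_ext with (2 := HI').
    intros v _. unfold opp; simpl. ring. }
  rewrite (RInt_opp (V := R_CompleteNormedModule)) in HAb by exact Hex. unfold opp in HAb; simpl in HAb.
  set (X := RInt (fun v => fejer M (th * (V - v)) * (exp (- s * v) * Gf t phi v)) 0 W) in *.
  replace X with (Jf L b W (fun x => cost t phi x * omega M th s V x) - omega M th s V W * Gf t phi W) by lra.
  unfold Rminus at 1. eapply Rle_trans; [apply Rabs_triang|]. rewrite Rabs_Ropp, Rabs_mult.
  rewrite Rmult_plus_distr_r. apply Rplus_le_compat; [exact HJ|].
  pose proof (omega_bound M th s V W HM Hth Hs) as HO. pose proof (Rabs_pos (Gf t phi W)).
  replace (exp (- s * W) * Rabs (Gf t phi W) * (/ s + 4 / th * (1 + ln (INR M))))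
    with (exp (- s * W) * (/ s + 4 / th * (1 + ln (INR M))) * Rabs (Gf t phi W)) by ring.
  now apply Rmult_le_compat_r.
Qed.

Lemma Gf_ex s t phi k : (forall v, continuous k v) -> ex_RInt (fun v => k v * (exp (- s * v) * Gf t phi v)) 0 W.
Proof.
  intros Hk.
  set (kk := fun v => k v * exp (- s * v)).
  assert (Hkk : forall v, continuous kk v).
  { intros v. apply (continuous_mult (K := R_AbsRing)); [apply Hk|].
    apply (ex_derive_continuous (V := R_NormedModule)). auto_derive. exact I. }
  pose proof (abel_cum (fun x => RInt kk 0 x) kk (fun x => cost t phi x * b x) (reweigh (cost t phi) L) (-1) 0 W) as HI.
  assert (HI' : ex_RInt (fun v => kk v * Gf t phi v) 0 W).
  { eexists. apply HI; auto; try lra.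
    - now apply reweigh_loc.
    - intros v Hv. apply is_derive_primitive with (-1); auto; lra.
    - intros v _. apply (continuous_mult (K := R_AbsRing)); [apply cost_continuous | apply Hb]. }
  apply ex_RInt_ext with (2 := HI'). intros v _. unfold kk. simpl. ring.
Qed.
End FejerBound.

(** * Bounds for the twisted Chebyshev error *)

Definition bpsi (x : R) : R := exp x - 1.

Lemma bpsi_continuous v : continuous bpsi v.
Proof. apply (ex_derive_continuous (V := R_NormedModule)). unfold bpsi. auto_derive. exact I. Qed.

Lemma RInt_bpsi v w : RInt bpsi v w = exp w - exp v - (w - v).
Proof.
  apply is_RInt_unique.
  apply (is_RInt_eq bpsi _ _ _ ((exp w - w) - (exp v - v))); [|reflexivity|ring].
  apply (is_RInt_derive (V := R_CompleteNormedModule) (fun x => exp x - x)).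
  - intros x _. unfold bpsi. auto_derive; [exact I|]. ring.
  - intros x _. apply bpsi_continuous.
Qed.

Lemma exp_neg_diff a b : a <= b -> Rabs (exp (- a) - exp (- b)) <= (b - a) * exp (- a).
Proof.
  intros H. replace (- b) with (- a + (a - b)) by ring. rewrite exp_plus.
  pose proof (exp_pos (- a)). pose proof (exp_ineq1_le (a - b)).
  assert (exp (a - b) <= exp 0) by (apply exp_le; lra). rewrite exp_0 in *.
  replace (exp (- a) - exp (- a) * exp (a - b)) with (exp (- a) * (1 - exp (a - b))) by ring.
  rewrite Rabs_pos_eq by (apply Rmult_le_pos; lra). rewrite (Rmult_comm (b - a)).
  apply Rmult_le_compat_l; lra.
Qed.

Section Psi.
Variables (P : beurling_system) (kap CQ W : R) (J K : nat).
Hypothesis HQ : adm kap CQ (QE P).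
Hypothesis Hkap : 1 / 2 <= kap <= 1.
Hypothesis HW : 0 <= W.
Hypothesis HJ : pcover P W J.
Hypothesis HK : W < INR (S K) * lam P 0.

Let L := atoms_psi P J K.

Lemma cum_QE v : v <= W -> cum L bpsi 0 v = QE P v.
Proof.
  intros Hv. unfold cum, QE, PsiE, L. rewrite (psi_atoms P W J K v HJ HK Hv), RInt_bpsi, exp_0. ring.
Qed.

Lemma cum_kernel k k' v : 0 <= v <= W -> (forall x, is_derive k x (k' x)) -> (forall x, continuous k' x) ->
  cum (reweigh k L) (fun x => k x * bpsi x) 0 v = k v * QE P v - RInt (fun x => k' x * QE P x) 0 v.
Proof.
  intros Hv Hd Hc.
  rewrite (cum_abel k k' bpsi L (-1) 0 v); auto; try lra.
  - rewrite cum_QE by lra. f_equal. apply RInt_ext. intros x. rewrite Rmin_left, Rmax_right by lra.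
    intros Hx. now rewrite cum_QE by lra.
  - apply atoms_psi_loc0.
  - intros x _. apply bpsi_continuous.
Qed.

(** By Abel summation [Jf] is a boundary term minus the integral of [k' Q] over [[0, W]]. Extended
    to infinity, that integral is a combination of [Re D] and [Im D] at [s + iy]; the boundary and
    the extension both cost [e^(-(s - kap) W)]. *)
Lemma Dk_bound s y psi0 : kap < s -> 
  Rabs (Jf L bpsi W (Dk s y psi0)) <= 2 * Cmod (Df P (s, y)) + CQ * (1 + (s + Rabs y) / (s - kap)) * exp (- (s - kap) * W).
Proof.
  intros Hs. set (z := (s, y) : C).
  set (k' := fun x => - (s * cos psi0 + y * sin psi0) * Re (ce (RtoC x * - z))
     + - (s * sin psi0 - y * cos psi0) * Im (ce (RtoC x * - z))).
  assert (Ere : forall v, Re (ce (RtoC v * - z)) = exp (- s * v) * cos (y * v)) by (intros v; exact (f_equal Re (ce_kernel s y v))).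
  assert (Eim : forall v, Im (ce (RtoC v * - z)) = - (exp (- s * v) * sin (y * v))) by (intros v; exact (f_equal Im (ce_kernel s y v))).
  pose proof (ckern_ce z) as Kc.
  assert (K1 : kern s 1 (fun v => Re (ce (RtoC v * - z)))) by exact (ckern_re _ _ _ Kc).
  assert (K2 : kern s 1 (fun v => Im (ce (RtoC v * - z)))) by exact (ckern_im _ _ _ Kc).
  assert (Ek' : forall x, k' x = - s * exp (- s * x) * cos (y * x + psi0) - y * exp (- s * x) * sin (y * x + psi0)).
  { intros x. unfold k'. rewrite Ere, Eim, cos_plus, sin_plus. ring. }
  assert (Kk' : kern s (s + Rabs y) k').
  { split.
    - intros v. apply (continuous_plus (V := R_NormedModule)); apply (continuous_mult (K := R_AbsRing));
       try apply continuous_const; [apply K1 | apply K2].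
    - intros v Hv. rewrite Ek'.
      replace (- s * exp (- s * v) * cos (y * v + psi0) - y * exp (- s * v) * sin (y * v + psi0))
        with ((- (s * cos (y * v + psi0)) + - (y * sin (y * v + psi0))) * exp (- s * v)) by ring.
      rewrite Rabs_mult, (Rabs_pos_eq (exp _)) by (left; apply exp_pos).
      apply Rmult_le_compat_r; [left; apply exp_pos|].
      eapply Rle_trans; [apply Rabs_triang|]. rewrite !Rabs_Ropp, !Rabs_mult, (Rabs_pos_eq s) by lra.
      assert (Rabs (cos (y * v + psi0)) <= 1) by (apply Rabs_le, COS_bound).
      assert (Rabs (sin (y * v + psi0)) <= 1) by (apply Rabs_le, SIN_bound).
      pose proof (Rabs_pos y). assert (s * Rabs (cos (y * v + psi0)) <= s * 1) by (apply Rmult_le_compat_l; lra).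
      assert (Rabs y * Rabs (sin (y * v + psi0)) <= Rabs y * 1) by (apply Rmult_le_compat_l; lra). lra. }
  unfold Jf. rewrite (cum_kernel (Dk s y psi0) k' W).
  - pose proof (LI_trunc _ _ _ _ _ _ W HQ Kk' Hs HW) as HT.
    assert (EL : LI (QE P) k' = - (cos psi0 * Re (Df P z) + sin psi0 * Im (Df P z))).
    { unfold k'. rewrite (LI_plus kap CQ (QE P) s _ _ _ _ HQ (kern_scal _ _ _ _ K1) (kern_scal _ _ _ _ K2) Hs).
      rewrite (LI_scal kap CQ (QE P) s 1 _ _ HQ K1 Hs), (LI_scal kap CQ (QE P) s 1 _ _ HQ K2 Hs).
      unfold Df, Lap, CI. set (X := LI (QE P) (fun v => Re (ce (RtoC v * - z)))).
      set (Y := LI (QE P) (fun v => Im (ce (RtoC v * - z)))). unfold z; simpl. ring. }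
    assert (HL : Rabs (LI (QE P) k') <= 2 * Cmod (Df P z)).
    { rewrite EL, Rabs_Ropp. eapply Rle_trans; [apply Rabs_triang|]. rewrite !Rabs_mult.
      assert (Rabs (cos psi0) <= 1) by (apply Rabs_le, COS_bound).
      assert (Rabs (sin psi0) <= 1) by (apply Rabs_le, SIN_bound).
      pose proof (re_le_Cmod (Df P z)). pose proof (im_le_Cmod (Df P z)).
      pose proof (Rabs_pos (Re (Df P z))). pose proof (Rabs_pos (Im (Df P z))). nra. }
    destruct HQ as [_ HQb].
    assert (HB : Rabs (Dk s y psi0 W * QE P W) <= CQ * exp (- (s - kap) * W)).
    { rewrite Rabs_mult. replace (- (s - kap) * W) with (- s * W + kap * W) by ring. rewrite exp_plus.
      replace (CQ * (exp (- s * W) * exp (kap * W))) with (exp (- s * W) * (CQ * exp (kap * W))) by ring.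
      apply Rmult_le_compat; try apply Rabs_pos; [|now apply HQb].
      unfold Dk. rewrite Rabs_mult, (Rabs_pos_eq (exp _)) by (left; apply exp_pos).
      rewrite <- (Rmult_1_r (exp (- s * W))) at 2. apply Rmult_le_compat_l; [left; apply exp_pos|].
      apply Rabs_le, COS_bound. }
    set (R0 := RInt (fun x => k' x * QE P x) 0 W) in *.
    assert (HR0 : Rabs R0 <= 2 * Cmod (Df P z) + CQ * (s + Rabs y) / (s - kap) * exp (- (s - kap) * W)).
    { replace R0 with (LI (QE P) k' - (LI (QE P) k' - R0)) by ring. unfold Rminus at 1.
      eapply Rle_trans; [apply Rabs_triang|]. rewrite Rabs_Ropp. lra. }
    unfold Rminus at 1. eapply Rle_trans; [apply Rabs_triang|]. rewrite Rabs_Ropp.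
    replace (CQ * (1 + (s + Rabs y) / (s - kap)) * exp (- (s - kap) * W))
      with (CQ * exp (- (s - kap) * W) + CQ * (s + Rabs y) / (s - kap) * exp (- (s - kap) * W)) by (field; lra).
    lra.
  - lra.
  - intros x. unfold Dk. auto_derive; [exact I|]. rewrite Ek'. ring.
  - apply Kk'.
Qed.

(** The trivial bound from partial summation, with its loss of [|t|]. It is used only where an
    exponential or the decay of the kernel compensates. *)
Lemma Gf_bound t phi v : 0 <= v <= W -> Rabs (Gf L bpsi t phi v) <= CQ * (1 + 2 * Rabs t) * exp (kap * v).
Proof.
  intros Hv. unfold Gf. pose proof (adm_nonneg _ _ _ HQ) as HC. pose proof (Rabs_pos t) as Ht.
  rewrite (cum_kernel (cost t phi) (fun x => - t * sin (t * x + phi)) v Hv).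
  - unfold Rminus. eapply Rle_trans; [apply Rabs_triang|]. rewrite Rabs_Ropp.
    destruct HQ as [HQi HQb].
    assert (H1 : Rabs (cost t phi v * QE P v) <= CQ * exp (kap * v)).
    { rewrite Rabs_mult, <- (Rmult_1_l (CQ * _)). apply Rmult_le_compat; try apply Rabs_pos; [apply Rabs_le, COS_bound | apply HQb; lra]. }
    assert (H2 : Rabs (RInt (fun x => - t * sin (t * x + phi) * QE P x) 0 v) <= CQ * Rabs t / kap * (exp (kap * v) - exp (kap * 0))).
    { apply RInt_exp_bound; try lra.
      - apply HQi; [lra|]. intros x. apply (ex_derive_continuous (V := R_NormedModule)). auto_derive. exact I.
      - intros x Hx. rewrite Rabs_mult, Rabs_mult, Rabs_Ropp.
        assert (Rabs (sin (t * x + phi)) <= 1) by (apply Rabs_le, SIN_bound).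
        replace (CQ * Rabs t * exp (kap * x)) with (Rabs t * 1 * (CQ * exp (kap * x))) by ring.
        apply Rmult_le_compat; try apply Rabs_pos; [apply Rmult_le_pos; apply Rabs_pos| |apply HQb; lra].
        apply Rmult_le_compat_l; lra. }
    rewrite Rmult_0_r, exp_0 in H2.
    assert (Hq : CQ * Rabs t / kap <= CQ * Rabs t * 2).
    { unfold Rdiv. apply Rmult_le_compat_l; [apply Rmult_le_pos; lra|].
      replace 2 with (/ (1 / 2)) by field. apply Rinv_le_contravar; lra. }
    pose proof (one_le_exp (kap * v) ltac:(nra)) as He.
    assert (0 <= CQ * Rabs t / kap) by (apply Rdiv_le_0_compat; [apply Rmult_le_pos; lra|lra]).
    assert (CQ * Rabs t / kap * (exp (kap * v) - 1) <= CQ * Rabs t * 2 * exp (kap * v)).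
    { apply Rmult_le_compat; lra. }
    lra.
  - intros x. unfold cost. auto_derive; [exact I|]. ring.
  - intros x. apply (ex_derive_continuous (V := R_NormedModule)). auto_derive. exact I.
Qed.

(** Because the atoms have positive weight, the increment of the twisted sum is at most that of
    [psi], and this is known up to [Q]. Unlike [Gf_bound], no factor [t] is lost. *)
Lemma Gf_osc t phi v w : 0 <= v <= w -> w <= W ->
  Rabs (Gf L bpsi t phi w - Gf L bpsi t phi v) <= 2 * CQ * exp (kap * w) + 2 * ((w - v) * exp w).
Proof.
  intros Hv Hw. pose proof (adm_nonneg _ _ _ HQ) as HC.
  assert (Hcb : forall a b, a <= b -> ex_RInt (fun x => cost t phi x * bpsi x) a b).
  { intros a b Hab. apply ex_RInt_cont_from with (a - 1); auto; try lra. intros x _.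
    apply (continuous_mult (K := R_AbsRing)); [apply cost_continuous | apply bpsi_continuous]. }
  assert (E : Gf L bpsi t phi w - Gf L bpsi t phi v
    = (step (reweigh (cost t phi) L) w - step (reweigh (cost t phi) L) v) - RInt (fun x => cost t phi x * bpsi x) v w).
  { unfold Gf, cum. rewrite <- (RInt_Chasles (V := R_CompleteNormedModule) (fun x => cost t phi x * bpsi x) 0 v w) by (apply Hcb; lra).
    unfold plus; simpl. ring. }
  rewrite E. unfold Rminus at 1. eapply Rle_trans; [apply Rabs_triang|]. rewrite Rabs_Ropp.
  pose proof (step_var (cost t phi) L v w (atoms_psi_wt P J K) (fun x => proj2 (Rabs_le_between _ _) (COS_bound _)) ltac:(lra)) as H1.
  assert (HI : Rabs (RInt (fun x => cost t phi x * bpsi x) v w) <= exp w - exp v - (w - v)).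
  { rewrite <- RInt_bpsi.
    apply (norm_RInt_le (V := R_NormedModule) (fun x => cost t phi x * bpsi x) bpsi v w); [lra| | |].
    - intros x Hx. change (Rabs (cost t phi x * bpsi x) <= bpsi x).
      assert (0 <= bpsi x) by (unfold bpsi; pose proof (one_le_exp x ltac:(lra)); lra).
      rewrite Rabs_mult, (Rabs_pos_eq (bpsi x)) by assumption.
      assert (Rabs (cost t phi x) <= 1) by (apply Rabs_le, COS_bound). nra.
    - apply (RInt_correct (V := R_CompleteNormedModule)), Hcb; lra.
    - apply (RInt_correct (V := R_CompleteNormedModule)). apply ex_RInt_cont_from with (v - 1); try lra.
      intros; apply bpsi_continuous. }
  assert (ES : step L w - step L v = QE P w - QE P v + (exp w - exp v - (w - v))).
  { rewrite <- !cum_QE by lra. unfold cum. rewrite !RInt_bpsi. ring. }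
  destruct HQ as [_ HQb]. pose proof (HQb w ltac:(lra)) as Q1. pose proof (HQb v ltac:(lra)) as Q2.
  assert (exp (kap * v) <= exp (kap * w)) by (apply exp_le; nra).
  assert (CQ * exp (kap * v) <= CQ * exp (kap * w)) by (apply Rmult_le_compat_l; assumption).
  apply Rabs_le_between in Q1, Q2.
  assert (exp w - exp v <= (w - v) * exp w).
  { replace (exp v) with (exp w * exp (v - w)) by (rewrite <- exp_plus; f_equal; ring).
    pose proof (exp_ineq1_le (v - w)). pose proof (exp_pos w). nra. }
  lra.
Qed.

(** [d e^V <= 1] bounds the main term in [Gf_osc], and [d t <= 1] offsets the factor [t] of
    [Gf_bound] in the variation of [e^(-sv)]. The two parts contribute [6 (CQ + 1)] and [27 CQ]. *)
Lemma g_near s t phi V v d : kap < s <= 1 -> 1 <= t -> 0 < d <= 1 -> d * t <= 1 -> d * exp V <= 1 -> 0 <= V - d -> V + d <= W ->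
  V - d <= v <= V + d ->
  Rabs (exp (- s * v) * Gf L bpsi t phi v - exp (- s * V) * Gf L bpsi t phi V) <= 40 * (CQ + 1).
Proof.
  intros Hs Ht Hd Hdt HdV H0 H1 Hv. pose proof (adm_nonneg _ _ _ HQ) as HC.
  set (G := Gf L bpsi t phi).
  pose proof exp_le_3 as He3.
  assert (HG : Rabs (G v - G V) <= 2 * CQ * exp (kap * (V + d)) + 2 * (d * exp (V + d))).
  { assert (Hmono : forall a b, 0 <= a <= b -> b <= V + d -> b - a <= d ->
      Rabs (G b - G a) <= 2 * CQ * exp (kap * (V + d)) + 2 * (d * exp (V + d))).
    { intros a b Hab Hb Hba. eapply Rle_trans; [apply (Gf_osc t phi a b); lra|].
      assert (exp (kap * b) <= exp (kap * (V + d))) by (apply exp_le; nra).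
      assert (exp b <= exp (V + d)) by (apply exp_le; lra). pose proof (exp_pos b).
      assert ((b - a) * exp b <= d * exp (V + d)) by (apply Rmult_le_compat; lra).
      assert (CQ * exp (kap * b) <= CQ * exp (kap * (V + d))) by (apply Rmult_le_compat_l; assumption). lra. }
    destruct (Rle_lt_dec v V) as [h|h].
    - rewrite Rabs_minus_sym. apply Hmono; lra.
    - apply Hmono; lra. }
  replace (exp (- s * v) * G v - exp (- s * V) * G V) with (exp (- s * V) * (G v - G V) + (exp (- s * v) - exp (- s * V)) * G v) by ring.
  eapply Rle_trans; [apply Rabs_triang|]. rewrite !Rabs_mult, (Rabs_pos_eq (exp (- s * V))) by (left; apply exp_pos).
  assert (HA1 : exp (- s * V) * Rabs (G v - G V) <= 6 * (CQ + 1)).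
  { apply Rle_trans with (exp (- s * V) * (2 * CQ * exp (kap * (V + d)) + 2 * (d * exp (V + d)))).
    - apply Rmult_le_compat_l; [left; apply exp_pos | exact HG].
    - rewrite Rmult_plus_distr_l.
      assert (exp (- s * V) * exp (kap * (V + d)) <= 3).
      { rewrite <- exp_plus. eapply Rle_trans; [|exact He3]. apply exp_le. nra. }
      assert (exp (- s * V) * (d * exp (V + d)) <= 3).
      { rewrite (exp_plus V d). replace (exp (- s * V) * (d * (exp V * exp d))) with (exp (- s * V) * exp d * (d * exp V)) by ring.
        assert (exp (- s * V) * exp d <= 3).
        { rewrite <- exp_plus. eapply Rle_trans; [|exact He3]. apply exp_le. nra. }
        assert (0 < exp (- s * V) * exp d) by (apply Rmult_lt_0_compat; apply exp_pos).
        assert (0 <= d * exp V) by (apply Rmult_le_pos; [lra | left; apply exp_pos]). nra. }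
      nra. }
  assert (HA2 : Rabs (exp (- s * v) - exp (- s * V)) * Rabs (G v) <= 27 * CQ).
  { assert (Hdiff : Rabs (exp (- s * v) - exp (- s * V)) <= s * d * exp (- s * (V - d))).
    { assert (Hm : forall a b, V - d <= a <= b -> b - a <= d -> Rabs (exp (- s * a) - exp (- s * b)) <= s * d * exp (- s * (V - d))).
      { intros a b Hab Hba. replace (- s * a) with (- (s * a)) by ring. replace (- s * b) with (- (s * b)) by ring.
        eapply Rle_trans; [apply exp_neg_diff; nra|].
        assert (exp (- (s * a)) <= exp (- s * (V - d))) by (apply exp_le; nra).
        apply Rmult_le_compat; [nra | left; apply exp_pos | nra | assumption]. }
      destruct (Rle_lt_dec v V) as [h|h].
      - apply Hm; lra.
      - rewrite Rabs_minus_sym. apply Hm; lra. }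
    pose proof (Gf_bound t phi v ltac:(lra)) as HGv. fold G in HGv. rewrite (Rabs_pos_eq t) in HGv by lra.
    apply Rle_trans with (s * d * exp (- s * (V - d)) * (CQ * (1 + 2 * t) * exp (kap * (V + d)))).
    - apply Rmult_le_compat; try apply Rabs_pos; [exact Hdiff|]. eapply Rle_trans; [exact HGv|].
      apply Rmult_le_compat_l; [nra|]. apply exp_le. nra.
    - replace (s * d * exp (- s * (V - d)) * (CQ * (1 + 2 * t) * exp (kap * (V + d))))
        with (CQ * ((s * (d * (1 + 2 * t))) * (exp (- s * (V - d)) * exp (kap * (V + d))))) by ring.
      replace (27 * CQ) with (CQ * (3 * 9)) by ring. apply Rmult_le_compat_l; [assumption|].
      rewrite <- exp_plus.
      apply Rmult_le_compat.
      + apply Rmult_le_pos; [lra|]. apply Rmult_le_pos; lra.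
      + left; apply exp_pos.
      + assert (d * (1 + 2 * t) <= 3) by nra. assert (0 <= d * (1 + 2 * t)) by (apply Rmult_le_pos; lra). nra.
      + apply Rle_trans with (exp 2).
        * apply exp_le. nra.
        * replace 2 with (1 + 1) by ring. rewrite exp_plus. pose proof (exp_pos 1). nra. }
  lra.
Qed.
End Psi.

(** All parameters are powers of [t] or multiples of [log t]: the heights stay polynomial, so
    [D << log t] and [log M << log t], and these are the two logarithms. The cutoffs depend on [t]
    but not on [phi] or [V]. *)
Lemma G_main (P : beurling_system) (A : R) : 0 < A ->
  bigO_infty (fun x => N_count P x - A * x) (fun x => sqrt x) -> RHv P ->
  forall eps Bx, 0 < eps < 1 / 2 -> 0 < Bx -> exists Cg, 0 <= Cg /\ forall t, 3 <= t ->
  exists J K W, Bx * ln t <= W /\ pcover P W J /\ W < INR (S K) * lam P 0 /\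
   forall phi V, lam P 0 <= V <= Bx * ln t ->
     Rabs (Gf (atoms_psi P J K) bpsi t phi V) <= Cg * (ln t * ln t) * exp ((1 / 2 + eps) * V).
Proof.
  intros HA hN hRH eps Bx Heps HBx.
  destruct (Df_bound P A HA hN hRH eps ltac:(lra)) as (KD & HKD & HD).
  set (del := eps / 2). assert (Hdel : 0 < del) by (unfold del; lra).
  set (kap := 1 / 2 + del). set (s := 1 / 2 + eps).
  assert (Hkap : 1 / 2 <= kap <= 1) by (unfold kap, del; lra).
  assert (Hs : kap < s <= 1) by (unfold kap, s, del; lra).
  assert (Hsk : s - kap = del) by (unfold s, kap, del; lra).
  destruct (adm_QE P hRH kap ltac:(unfold kap; lra)) as [CQ HQ].
  pose proof (adm_nonneg _ _ _ HQ) as HCQ. pose proof (lam0_pos P) as Hl.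
  (* With [D = t^(Bx+1)] and [d] about [1/D], the choice [M] about [t^p = D^2 t^4] makes [M d^2]
     about [t^4], more than the [t W^2] of the far part of the kernel. *)
  set (p := 2 * Bx + 6). assert (Hp : 6 < p) by (unfold p; lra).
  set (l1 := Rmin (lam P 0) 1). assert (Hl1 : 0 < l1 <= 1) by (unfold l1; split; [apply Rmin_pos; lra | apply Rmin_r]).
  assert (Hl1' : l1 <= lam P 0) by apply Rmin_l.
  (* The summand [p / del] makes [e^(-del W) <= t^(-p)]; the rest keeps [V + d <= W] for all
     [V <= Bx log t]. *)
  set (C4 := p / del + Bx + 2).
  assert (Hpd : 0 < p / del) by (apply Rdiv_lt_0_compat; lra).
  assert (HC4 : 2 < C4) by (unfold C4; lra).
  (* The first summand secures [W <= M d], the second makes the far part of the kernel bounded, the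
     third keeps [C5 >= 1]. *)
  set (C5 := C4 / l1 + 432 * CQ * (C4 * C4) / (l1 * l1) + 1).
  assert (HC5a : 0 <= C4 / l1) by (apply Rdiv_le_0_compat; lra).
  assert (HC5b : 0 <= 432 * CQ * (C4 * C4) / (l1 * l1)).
  { apply Rdiv_le_0_compat; [|nra]. repeat apply Rmult_le_pos; lra. }
  assert (HC5 : 1 <= C5) by (unfold C5; lra).
  set (C8 := 2 * KD * (1 + ln (C5 + 3) + p) + CQ * (1 + (C5 + 3) / del)).
  set (C11 := 1 + ln (C5 + 1) + p).
  assert (Hln3 : 0 <= ln (C5 + 3)) by (rewrite <- ln_1; apply ln_le'; lra).
  assert (Hln1 : 0 <= ln (C5 + 1)) by (rewrite <- ln_1; apply ln_le'; lra).
  assert (HC8 : 0 <= C8).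
  { unfold C8. apply Rplus_le_le_0_compat; apply Rmult_le_pos; try lra.
    assert (0 <= (C5 + 3) / del) by (apply Rdiv_le_0_compat; lra). lra. }
  assert (HC11 : 1 <= C11) by (unfold C11; lra).
  exists (40 * (CQ + 1) + 4 * ((C8 + 3 * CQ) * (2 + 4 * C11)) + 4). split.
  { assert (0 <= (C8 + 3 * CQ) * (2 + 4 * C11)) by (apply Rmult_le_pos; lra). lra. }
  intros t Ht. set (L := ln t).
  assert (HL : 1 <= L).
  { unfold L. rewrite <- (ln_exp 1). apply ln_le'; [apply exp_pos|]. pose proof exp_le_3. lra. }
  assert (Et : exp L = t) by (unfold L; apply exp_ln; lra).
  assert (HLt : L <= t) by (rewrite <- Et; pose proof (exp_ineq1_le L); lra).
  set (W := C4 * L). set (E := exp (p * L)). set (D := exp ((Bx + 1) * L)).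
  assert (HE0 : 0 < E) by apply exp_pos. assert (HD0 : 0 < D) by apply exp_pos.
  assert (HDE : E = D * D * (t * t * t * t)).
  { unfold E, D. rewrite <- Et, <- !exp_plus. f_equal. unfold p. ring. }
  assert (HtE : t <= E) by (unfold E; rewrite <- Et; apply exp_le; nra).
  assert (HD1 : 1 <= D) by (apply one_le_exp; nra).
  assert (HDt : t <= D) by (unfold D; rewrite <- Et; apply exp_le; nra).
  (* Then [d e^V t <= l1 <= 1] for [V <= Bx log t], as [g_near] demands, and [l1 <= log p_1] gives
     [V - d >= 0]. *)
  set (d := l1 / D).
  assert (Hd : 0 < d) by (apply Rdiv_lt_0_compat; lra).
  assert (HdD : d * D = l1) by (unfold d; field; lra).
  assert (Hdl : d <= l1).
  { apply Rmult_le_reg_r with D; [lra|]. rewrite HdD. nra. }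
  destruct (nfloor_ex (C5 * E) ltac:(nra)) as (M0 & HM0a & HM0b).
  set (M := S M0). assert (EM : INR M = INR M0 + 1) by apply S_INR.
  assert (HMlo : C5 * E <= INR M) by lra. assert (HMhi : INR M <= C5 * E + 1) by lra.
  assert (HE1 : 1 <= E) by lra.
  assert (HW1 : 2 <= W) by (unfold W; nra).
  destruct (pcover_ex P W) as [J HJ]. destruct (kcover_ex P W) as [K HK].
  exists J, K, W. split; [unfold W, C4; nra|]. split; [exact HJ|]. split; [exact HK|].
  intros phi V HV.
  assert (HVW : V + d <= W).
  { assert (Bx * L + 1 <= C4 * L) by (unfold C4; nra). fold L in HV. unfold W. lra. }
  set (Latoms := atoms_psi P J K).
  set (g := fun v => exp (- s * v) * Gf Latoms bpsi t phi v).
  (* Truncation errors carry a factor polynomial in [t], either a height up to [Y] or the loss in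
     [Gf_bound]; [1/E] cancels it. *)
  assert (HedW : exp (- del * W) <= / E).
  { unfold E. rewrite <- exp_Ropp. apply exp_le. unfold W, C4.
    assert (del * (p / del * L) = p * L) by (field; lra).
    assert (0 <= del * ((Bx + 2) * L)) by (apply Rmult_le_pos; [lra|]; apply Rmult_le_pos; lra). lra. }
  assert (HEi : 0 < / E) by now apply Rinv_0_lt_compat.
  set (Y := t + INR M * / W).
  assert (HY : Rabs t + INR M * / W <= Y) by (rewrite Rabs_pos_eq by lra; unfold Y; lra).
  assert (HYb : Y <= (C5 + 2) * E).
  { unfold Y. assert (/ W <= 1) by (rewrite <- Rinv_1; apply Rinv_le_contravar; lra).
    assert (0 <= INR M) by apply pos_INR. assert (INR M * / W <= INR M * 1) by (apply Rmult_le_compat_l; assumption). lra. }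
  set (BD := C8 * L).
  assert (HBD0 : 0 <= BD) by (unfold BD; apply Rmult_le_pos; lra).
  assert (HDk : forall y psi0, Rabs y <= Y -> Rabs (Jf Latoms bpsi W (Dk s y psi0)) <= BD).
  { intros y psi0 Hy. pose proof (Rabs_pos y) as Hy0.
    eapply Rle_trans; [apply (Dk_bound P kap CQ W J K HQ Hkap ltac:(lra) HJ HK s y psi0 ltac:(lra))|].
    rewrite Hsk.
    assert (T1 : Cmod (Df P (s, y)) <= KD * (1 + ln (C5 + 3) + p) * L).
    { eapply Rle_trans; [apply HD|]. rewrite Rmult_assoc. apply Rmult_le_compat_l; [assumption|].
      assert (Hlny : ln (1 + Rabs y) <= ln (C5 + 3) + p * L).
      { rewrite <- (ln_exp (p * L)), <- ln_mult by (lra || apply exp_pos). fold E. apply ln_le'; lra. }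
      assert (ln (C5 + 3) <= ln (C5 + 3) * L) by nra. lra. }
    assert (T2 : (1 + (s + Rabs y) / del) * exp (- del * W) <= 1 + (C5 + 3) / del).
    { apply Rle_trans with ((1 + (s + Rabs y) / del) * / E).
      - apply Rmult_le_compat_l; [|assumption].
        assert (0 <= (s + Rabs y) / del) by (apply Rdiv_le_0_compat; lra). lra.
      - apply Rmult_le_reg_r with E; [lra|]. rewrite Rmult_assoc, Rinv_l, Rmult_1_r by lra.
        assert ((s + Rabs y) / del <= (C5 + 3) / del * E).
        { replace ((C5 + 3) / del * E) with ((C5 + 3) * E / del) by (field; lra). unfold Rdiv.
          apply Rmult_le_compat_r; [left; now apply Rinv_0_lt_compat|]. lra. }
        lra. }
    assert (0 <= (C5 + 3) / del) by (apply Rdiv_le_0_compat; lra).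
    rewrite Rmult_assoc. apply Rle_trans with (2 * (KD * (1 + ln (C5 + 3) + p) * L) + CQ * (1 + (C5 + 3) / del)).
    - apply Rplus_le_compat; [lra|]. apply Rmult_le_compat_l; assumption.
    - unfold BD, C8. assert (CQ * (1 + (C5 + 3) / del) * 1 <= CQ * (1 + (C5 + 3) / del) * L).
      { apply Rmult_le_compat_l; [apply Rmult_le_pos; lra | assumption]. }
      lra. }
  assert (HM1 : (1 <= M)%nat) by (unfold M; lia).
  assert (HiW : 0 < / W) by (apply Rinv_0_lt_compat; lra).
  pose proof (fejer_integral_bound Latoms bpsi W ltac:(lra) bpsi_continuous (atoms_psi_loc0 P J K)
     M (/ W) s V t phi Y BD HM1 HiW ltac:(lra) HBD0 HY HDk) as HI.
  set (SM := / s + 4 / / W * (1 + ln (INR M))) in HI.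
  assert (HSM : 0 <= SM <= W * L * (2 + 4 * C11)).
  { unfold SM. replace (4 / / W) with (4 * W) by (field; lra).
    assert (Hsi : 0 < / s <= 2).
    { split; [apply Rinv_0_lt_compat; lra|]. replace 2 with (/ (1 / 2)) by field. apply Rinv_le_contravar; lra. }
    assert (HlnM0 : 0 <= ln (INR M)) by (rewrite <- ln_1; apply ln_le'; lra || nra).
    assert (HlnM : ln (INR M) <= ln (C5 + 1) + p * L).
    { rewrite <- (ln_exp (p * L)), <- ln_mult by (lra || apply exp_pos). fold E. apply ln_le'; nra. }
    assert (H1 : 1 + ln (INR M) <= C11 * L) by (unfold C11; nra).
    assert (1 <= W * L) by nra.
    split; [apply Rplus_le_le_0_compat; [lra|]; apply Rmult_le_pos; lra|].
    assert (4 * W * (1 + ln (INR M)) <= 4 * W * (C11 * L)) by (apply Rmult_le_compat_l; lra). lra. }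
  assert (HGW : exp (- s * W) * Rabs (Gf Latoms bpsi t phi W) <= 3 * CQ).
  { apply Rle_trans with (exp (- s * W) * (CQ * (1 + 2 * t) * exp (kap * W))).
    - apply Rmult_le_compat_l; [left; apply exp_pos|].
      pose proof (Gf_bound P kap CQ W J K HQ Hkap HJ HK t phi W ltac:(lra)) as H. rewrite (Rabs_pos_eq t) in H by lra. exact H.
    - replace (exp (- s * W) * (CQ * (1 + 2 * t) * exp (kap * W))) with (CQ * ((1 + 2 * t) * (exp (- s * W) * exp (kap * W)))) by ring.
      rewrite <- exp_plus. replace (- s * W + kap * W) with (- del * W) by (rewrite <- Hsk; ring).
      rewrite (Rmult_comm 3). apply Rmult_le_compat_l; [assumption|].
      apply Rle_trans with ((1 + 2 * t) * / E); [apply Rmult_le_compat_l; lra|].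
      apply Rmult_le_reg_r with E; [lra|]. rewrite Rmult_assoc, Rinv_l; lra. }
  set (I0 := (C8 * L + 3 * CQ) * (W * L * (2 + 4 * C11))).
  assert (HI0 : Rabs (RInt (fun v => fejer M (/ W * (V - v)) * g v) 0 W) <= I0).
  { eapply Rle_trans; [exact HI|]. unfold I0. fold BD.
    pose proof (exp_pos (- s * W)). pose proof (Rabs_pos (Gf Latoms bpsi t phi W)).
    assert (0 <= exp (- s * W) * Rabs (Gf Latoms bpsi t phi W)) by (apply Rmult_le_pos; lra).
    apply Rmult_le_compat; lra. }
  assert (HdV : d * exp V * t <= 1).
  { assert (exp V * t <= D).
    { unfold D. replace ((Bx + 1) * L) with (Bx * L + L) by ring. rewrite exp_plus, Et.
      apply Rmult_le_compat_r; [lra|]. apply exp_le. apply HV. }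
    rewrite Rmult_assoc. apply Rle_trans with (d * D); [apply Rmult_le_compat_l; lra | lra]. }
  pose proof (one_le_exp V ltac:(lra)) as HeV.
  assert (Hde : 0 < d * exp V) by (apply Rmult_lt_0_compat; lra).
  assert (HWM : W <= INR M * d).
  { assert (C4 / l1 * l1 = C4) by (field; lra).
    assert (HC4' : C4 <= C5 * l1).
    { unfold C5. assert (0 <= 432 * CQ * (C4 * C4) / (l1 * l1) * l1) by (apply Rmult_le_pos; lra). lra. }
    apply Rle_trans with (C5 * E * d); [|apply Rmult_le_compat_r; lra].
    rewrite HDE. replace (C5 * (D * D * (t * t * t * t)) * d) with (C5 * (d * D) * (D * (t * t * t * t))) by ring.
    rewrite HdD. unfold W. apply Rmult_le_compat; try lra.
    assert (1 <= t * t * t) by nra. assert (t * 1 <= t * (t * t * t)) by (apply Rmult_le_compat_l; lra).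
    assert (1 * (t * (t * t * t)) <= D * (t * (t * t * t))) by (apply Rmult_le_compat_r; lra). lra. }
  set (B0 := 3 * CQ * t).
  assert (Hfejer := fejer_desmooth g M W V d (40 * (CQ + 1)) B0 I0 HM1 Hd ltac:(lra) HVW HWM
    ltac:(unfold B0; apply Rmult_le_pos; lra) ltac:(lra)).
  assert (Hres : Rabs (g V) <= 40 * (CQ + 1) + 4 / W * (I0 + W * (B0 * (36 * (W * W) / (INR M * (d * d)))))).
  { apply Hfejer.
    - intros k Hk. unfold g; apply (Gf_ex Latoms bpsi W ltac:(lra) bpsi_continuous (atoms_psi_loc0 P J K)). exact Hk.
    - intros v Hv. unfold g. rewrite Rabs_mult, (Rabs_pos_eq (exp _)) by (left; apply exp_pos).
      pose proof (Gf_bound P kap CQ W J K HQ Hkap HJ HK t phi v Hv) as H. rewrite (Rabs_pos_eq t) in H by lra.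
      apply Rle_trans with (exp (- s * v) * (CQ * (1 + 2 * t) * exp (kap * v))); [apply Rmult_le_compat_l; [left; apply exp_pos | exact H]|].
      replace (exp (- s * v) * (CQ * (1 + 2 * t) * exp (kap * v))) with (CQ * (1 + 2 * t) * (exp (- s * v) * exp (kap * v))) by ring.
      rewrite <- exp_plus.
      assert (exp (- s * v + kap * v) <= exp 0) by (apply exp_le; nra). rewrite exp_0 in *.
      unfold B0. apply Rle_trans with (CQ * (1 + 2 * t) * 1); [apply Rmult_le_compat_l; [apply Rmult_le_pos; lra | assumption]|].
      assert (CQ * 1 <= CQ * t) by (apply Rmult_le_compat_l; lra). lra.
    - intros v Hv. unfold g. apply (g_near P kap CQ W J K HQ Hkap HJ HK s t phi V v d); try lra.
      + assert (d * 1 <= d * exp V) by (apply Rmult_le_compat_l; lra).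
        assert (d * 1 * t <= d * exp V * t) by (apply Rmult_le_compat_r; lra). lra.
      + assert (d * exp V * 1 <= d * exp V * t) by (apply Rmult_le_compat_l; lra). lra.
    - exact HI0. }
  assert (Hfar : 4 / W * (W * (B0 * (36 * (W * W) / (INR M * (d * d))))) <= 4).
  { assert (Hdd : 0 < d * d) by nra. assert (HMp : 0 < INR M) by nra.
    replace (4 / W * (W * (B0 * (36 * (W * W) / (INR M * (d * d)))))) with (4 * (B0 * 36 * (W * W) / (INR M * (d * d)))) by (field; lra).
    assert (B0 * 36 * (W * W) / (INR M * (d * d)) <= 1); [|lra].
    apply Rmult_le_reg_r with (INR M * (d * d)); [nra|]. unfold Rdiv. rewrite Rmult_assoc, Rinv_l by nra.
    rewrite Rmult_1_r, Rmult_1_l.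
    apply Rle_trans with (C5 * E * (d * d)); [|apply Rmult_le_compat_r; lra].
    rewrite HDE. replace (C5 * (D * D * (t * t * t * t)) * (d * d)) with (C5 * ((d * D) * (d * D)) * (t * t * t * t)) by ring.
    rewrite HdD.
    assert (HC5l : 432 * CQ * (C4 * C4) <= C5 * (l1 * l1)).
    { assert (432 * CQ * (C4 * C4) / (l1 * l1) * (l1 * l1) = 432 * CQ * (C4 * C4)) by (field; lra).
      unfold C5. assert (0 <= C4 / l1 * (l1 * l1)) by (apply Rmult_le_pos; nra). nra. }
    unfold B0, W.
    assert (HLL : L * L <= t * t) by (apply Rmult_le_compat; lra).
    assert (Hq : 0 <= CQ * (C4 * C4)) by (apply Rmult_le_pos; nra).
    apply Rle_trans with (108 * (CQ * (C4 * C4)) * (t * (t * t))).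
    - replace (3 * CQ * t * 36 * (C4 * L * (C4 * L))) with (108 * (CQ * (C4 * C4)) * (t * (L * L))) by ring.
      apply Rmult_le_compat_l; [lra|]. apply Rmult_le_compat_l; lra.
    - apply Rmult_le_compat; try lra.
      + apply Rmult_le_pos; nra.
      + assert (1 * (t * t * t) <= t * (t * t * t)) by (apply Rmult_le_compat_r; [nra|lra]). lra. }
  assert (Hmid : 4 / W * I0 <= 4 * ((C8 + 3 * CQ) * (2 + 4 * C11)) * (L * L)).
  { unfold I0. replace (4 / W * ((C8 * L + 3 * CQ) * (W * L * (2 + 4 * C11)))) with (4 * (C8 * L + 3 * CQ) * (2 + 4 * C11) * L) by (field; lra).
    assert (C8 * L + 3 * CQ <= (C8 + 3 * CQ) * L) by nra.
    assert (4 * (C8 * L + 3 * CQ) * (2 + 4 * C11) * L <= 4 * ((C8 + 3 * CQ) * L) * (2 + 4 * C11) * L).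
    { apply Rmult_le_compat_r; [lra|]. apply Rmult_le_compat_r; lra. }
    lra. }
  assert (HLL1 : 1 <= L * L) by nra.
  rewrite Rmult_plus_distr_l in Hres.
  assert (Hg : Rabs (g V) <= (40 * (CQ + 1) + 4 * ((C8 + 3 * CQ) * (2 + 4 * C11)) + 4) * (L * L)) by nra.
  assert (EG : Gf Latoms bpsi t phi V = g V * exp (s * V)).
  { unfold g. rewrite (Rmult_comm (exp _)), Rmult_assoc, <- exp_plus. replace (- s * V + s * V) with 0 by ring. rewrite exp_0. ring. }
  rewrite EG, Rabs_mult, (Rabs_pos_eq (exp (s * V))) by (left; apply exp_pos).
  apply Rmult_le_compat_r; [left; apply exp_pos | exact Hg].
Qed.

(** * From prime powers to primes *)

(** Here [k] starts at 1, so only exponents from 2 on remain. *)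
Definition atoms_powers (P : beurling_system) (J K : nat) : list (R * R) :=
  flat_map (fun j => map (fun k => (lam P j, INR (S k) * lam P j)) (seq 1 K)) (seq 0 J).

Lemma atoms_psi_split P J K (f : R * R -> R) :
  lsum f (atoms_psi P J (S K)) = lsum f (atoms_theta P J) + lsum f (atoms_powers P J K).
Proof.
  unfold atoms_psi, atoms_theta, atoms_powers. rewrite !lsum_flat_map, lsum_map, <- lsum_plus.
  apply lsum_ext. intros j _. change (seq 0 (S K)) with (0%nat :: seq 1 K). cbn [map lsum].
  replace (INR 1 * lam P j) with (lam P j) by (simpl; ring). reflexivity.
Qed.

Lemma atoms_powers_wt P J K p : In p (atoms_powers P J K) -> 0 <= fst p.
Proof.
  unfold atoms_powers. intros H. apply in_flat_map in H. destruct H as (j & _ & H).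
  apply in_map_iff in H. destruct H as (k & <- & _). apply Rlt_le, lam_pos.
Qed.

Lemma step_reweigh_psi_theta P J K h v : (forall x, Rabs (h x) <= 1) ->
  Rabs (step (reweigh h (atoms_psi P J (S K))) v - step (reweigh h (atoms_theta P J)) v)
  <= step (atoms_psi P J (S K)) v - step (atoms_theta P J) v.
Proof.
  intros Hh. rewrite !step_reweigh. unfold step. rewrite !atoms_psi_split.
  match goal with |- Rabs (?a + ?b - ?a) <= ?c + ?d - ?c =>
    replace (a + b - a) with b by ring; replace (c + d - c) with d by ring end.
  eapply Rle_trans; [apply lsum_abs|]. apply lsum_le. intros p Hp.
  apply atoms_powers_wt in Hp. destruct (Rle_dec _ _).
  - rewrite Rabs_mult, (Rabs_pos_eq (fst p)) by assumption.
    rewrite <- (Rmult_1_r (fst p)) at 2. apply Rmult_le_compat_l; [assumption | apply Hh].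
  - rewrite Rabs_R0. lra.
Qed.

Lemma chebyshev_theta P : RHv P -> exists C, 0 <= C /\ forall v J, 0 <= v -> pcover P v J ->
  step (atoms_theta P J) v <= C * exp v.
Proof.
  intros H. destruct (H (1 / 2) ltac:(lra)) as [C HC]. exists (Rmax C 0 + 1).
  pose proof (Rmax_l C 0). pose proof (Rmax_r C 0). split; [lra|]. intros v J Hv HJ.
  destruct (kcover_ex P v) as [K HK]. pose proof (lam0_pos P).
  assert (HK' : v < INR (S (S K)) * lam P 0).
  { rewrite (S_INR (S K)). lra. }
  specialize (HC v Hv). replace ((1 / 2 + 1 / 2) * v) with v in HC by field.
  apply Rabs_le_between in HC. pose proof (exp_pos v).
  rewrite (psi_atoms P v J (S K)) in HC by (assumption || lra).
  assert (Hs : step (atoms_psi P J (S K)) v = step (atoms_theta P J) v + step (atoms_powers P J K) v)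
    by apply atoms_psi_split.
  pose proof (step_nonneg (atoms_powers P J K) v (atoms_powers_wt P J K)).
  assert (C * exp v <= Rmax C 0 * exp v) by (apply Rmult_le_compat_r; lra). lra.
Qed.

(** The weight [1/x] at [x = log p] turns the atoms of [theta] into those of [pi], and the density
    [e^x - 1] into [beta]. *)
Lemma primeE_theta P J t phi V : lam P 0 <= V ->
  primeE P J t phi V
  = cum (reweigh (fun x => / x) (reweigh (cost t phi) (atoms_theta P J)))
      (fun x => / x * (cost t phi x * bpsi x)) (lam P 0) V.
Proof.
  intros HV. pose proof (lam0_pos P). unfold primeE, cum. f_equal.
  - rewrite reweigh_comp, !step_reweigh. unfold atoms_pi, atoms_theta. rewrite !lsum_map.
    apply lsum_ext. intros j _. cbn [fst snd]. pose proof (lam_pos P j).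
    destruct (Rle_dec _ _); [field; lra | reflexivity].
  - apply RInt_ext. intros x. rewrite Rmin_left, Rmax_right by lra. intros Hx.
    change (cost t phi x * beta x = / x * (cost t phi x * bpsi x)).
    unfold beta, bpsi. field. lra.
Qed.

(** Three errors add up: the bound of [G_main], the prime powers (of size [V e^(V/2)] whatever the
    twist), and the piece of the integral between 0 and [log p_1]. *)
Lemma theta_cost_bound (P : beurling_system) (A : R) : 0 < A ->
  bigO_infty (fun x => N_count P x - A * x) (fun x => sqrt x) -> RHv P ->
  forall eps B, 0 < eps < 1 / 2 -> 0 < B -> exists C, 0 <= C /\ forall t, 3 <= t ->
  exists J, pcover P (B * ln t) J /\ forall phi V, lam P 0 <= V <= B * ln t ->
    Rabs (cum (reweigh (cost t phi) (atoms_theta P J)) (fun x => cost t phi x * bpsi x) (lam P 0) V)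
    <= C * (ln t * ln t) * exp ((1 / 2 + eps) * V).
Proof.
  intros HA hN hRH eps B Heps HB. pose proof (lam0_pos P) as Hl.
  destruct (G_main P A HA hN hRH eps B Heps HB) as (Cg & HCg & HG).
  destruct (chebyshev_theta P hRH) as (Ct & HCt & Hth).
  set (c2 := B / lam P 0 * Ct).
  assert (Hc2 : 0 <= c2) by (apply Rmult_le_pos; [apply Rdiv_le_0_compat; lra | assumption]).
  pose proof (exp_pos (lam P 0)) as Hel.
  exists (Cg + c2 + exp (lam P 0)). split; [lra|].
  intros t Ht. destruct (HG t Ht) as (J & K & W & HW & HJ & HK & HGf).
  assert (HJt : pcover P (B * ln t) J) by (apply pcover_le with W; assumption).
  exists J. split; [exact HJt|]. intros phi V HV. specialize (HGf phi V HV).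
  set (L := ln t) in *.
  assert (HL : 1 <= L).
  { unfold L. rewrite <- (ln_exp 1). apply ln_le'; [apply exp_pos|]. pose proof exp_le_3. lra. }
  destruct K as [|K]; [simpl in HK; lra|].
  assert (Hcos : forall x, Rabs (cost t phi x) <= 1) by (intros; apply Rabs_le, COS_bound).
  pose proof (step_reweigh_psi_theta P J K (cost t phi) V Hcos) as H1.
  assert (HJV : pcover P V J) by (apply pcover_le with (B * L); [assumption | lra]).
  assert (H2 := psi_theta_bound P Ct V J ltac:(lra) HCt HJV
     ltac:(intros w Hw; apply Hth; [lra|]; apply pcover_le with V; [assumption | lra])).
  rewrite (psi_atoms P W J (S K) V HJ HK ltac:(lra)) in H2.
  set (b := fun x => cost t phi x * bpsi x).
  assert (Hb : forall x, -1 < x -> continuous b x).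
  { intros x _. apply (continuous_mult (K := R_AbsRing)); [apply cost_continuous | apply bpsi_continuous]. }
  assert (H3 : Rabs (RInt b 0 (lam P 0)) <= exp (lam P 0)).
  { eapply Rle_trans; [apply (RInt_exp_bound b 1 1)|].
    - lra.
    - lra.
    - apply ex_RInt_cont_from with (-1); auto; lra.
    - intros x Hx. unfold b. rewrite Rabs_mult, !Rmult_1_l.
      pose proof (one_le_exp x ltac:(lra)). unfold bpsi. rewrite (Rabs_pos_eq (exp x - 1)) by lra.
      assert (Rabs (cost t phi x) * (exp x - 1) <= 1 * (exp x - 1)) by (apply Rmult_le_compat_r; [lra | apply Hcos]).
      lra.
    - rewrite Rmult_0_r, exp_0, Rmult_1_l. lra. }
  assert (HE : RInt b 0 V = RInt b 0 (lam P 0) + RInt b (lam P 0) V).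
  { symmetry. apply (RInt_Chasles (V := R_CompleteNormedModule)); apply ex_RInt_cont_from with (-1); auto; lra. }
  unfold Gf in HGf. fold b in HGf. unfold cum in *. rewrite HE in HGf.
  set (sp := step (reweigh (cost t phi) (atoms_psi P J (S K))) V) in *.
  set (st := step (reweigh (cost t phi) (atoms_theta P J)) V) in *.
  replace (st - RInt b (lam P 0) V)
    with ((sp - (RInt b 0 (lam P 0) + RInt b (lam P 0) V)) + (RInt b 0 (lam P 0) - (sp - st))) by ring.
  eapply Rle_trans; [apply Rabs_triang|].
  assert (H4 : Rabs (RInt b 0 (lam P 0) - (sp - st)) <= Rabs (RInt b 0 (lam P 0)) + Rabs (sp - st)).
  { unfold Rminus at 1. eapply Rle_trans; [apply Rabs_triang|]. rewrite Rabs_Ropp. lra. }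
  set (e := exp ((1 / 2 + eps) * V)) in *.
  assert (He : 1 <= e) by (apply one_le_exp; apply Rmult_le_pos; lra).
  assert (HLL : 1 <= L * L) by nra.
  assert (HLLe : 1 <= L * L * e) by nra.
  assert (H5 : V / lam P 0 * Ct * exp (V / 2) <= c2 * (L * L * e)).
  { assert (Hev : exp (V / 2) <= e) by (apply exp_le; nra).
    replace (c2 * (L * L * e)) with (B * (L * L) / lam P 0 * Ct * e) by (unfold c2; field; lra).
    apply Rmult_le_compat; [apply Rmult_le_pos; [apply Rdiv_le_0_compat; lra | assumption] | left; apply exp_pos | | assumption].
    apply Rmult_le_compat_r; [assumption|]. unfold Rdiv.
    apply Rmult_le_compat_r; [left; now apply Rinv_0_lt_compat|]. nra. }
  assert (H6 : exp (lam P 0) * 1 <= exp (lam P 0) * (L * L * e)) by (apply Rmult_le_compat_l; lra).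
  lra.
Qed.

(** Partial summation with [1/x], which is at most [i] on the range: the boundary term gives [i],
    and the integral gives [2 i^2] because [1/s <= 2]. *)
Lemma primeE_bound (P : beurling_system) (A : R) : 0 < A ->
  bigO_infty (fun x => N_count P x - A * x) (fun x => sqrt x) -> RHv P ->
  forall eps B, 0 < eps < 1 / 2 -> 0 < B -> exists C, 0 <= C /\ forall t, 3 <= t ->
  exists J, pcover P (B * ln t) J /\ forall phi V, lam P 0 <= V <= B * ln t ->
    Rabs (primeE P J t phi V) <= C * (ln t * ln t) * exp ((1 / 2 + eps) * V).
Proof.
  intros HA hN hRH eps B Heps HB. pose proof (lam0_pos P) as Hl.
  destruct (theta_cost_bound P A HA hN hRH eps B Heps HB) as (C & HC & HG).
  set (i := / lam P 0). assert (Hi : 0 < i) by now apply Rinv_0_lt_compat.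
  set (s := 1 / 2 + eps). assert (Hs : 1 / 2 < s) by (unfold s; lra).
  exists (C * (i + 2 * (i * i))). split; [apply Rmult_le_pos; nra|].
  intros t Ht. destruct (HG t Ht) as (J & HJ & HF). exists J. split; [exact HJ|].
  intros phi V HV. rewrite primeE_theta by lra.
  set (D := C * (ln t * ln t)) in *.
  assert (HD : 0 <= D) by (apply Rmult_le_pos; [assumption | apply Rle_0_sqr]).
  set (Lt := reweigh (cost t phi) (atoms_theta P J)).
  set (b := fun x => cost t phi x * bpsi x).
  set (k' := fun x => - (/ x * / x)).
  assert (HLt : forall p, In p Lt -> lam P 0 <= snd p) by apply reweigh_loc, atoms_theta_loc.
  assert (Hd : forall x, 0 < x -> is_derive (fun x => / x) x (k' x)).
  { intros x Hx. unfold k'. auto_derive; [lra|]. field. lra. }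
  assert (Hk' : forall x, 0 < x -> continuous k' x).
  { intros x Hx. apply (ex_derive_continuous (V := R_NormedModule)). unfold k'. auto_derive. lra. }
  assert (Hb : forall x, 0 < x -> continuous b x).
  { intros x _. apply (continuous_mult (K := R_AbsRing)); [apply cost_continuous | apply bpsi_continuous]. }
  pose proof (abel_cum (fun x => / x) k' b Lt 0 (lam P 0) V Hl (proj1 HV) HLt Hd Hk' Hb) as HI.
  change (Rabs (cum (reweigh (fun x => / x) Lt) (fun x => / x * b x) (lam P 0) V) <= C * (i + 2 * (i * i)) * (ln t * ln t) * exp (s * V)).
  rewrite (cum_abel (fun x => / x) k' b Lt 0 (lam P 0) V Hl (proj1 HV) HLt Hd Hk' Hb).
  assert (Hinv : forall x, lam P 0 <= x -> 0 < / x <= i).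
  { intros x Hx. split; [apply Rinv_0_lt_compat; lra | apply Rinv_le_contravar; lra]. }
  assert (H1 : Rabs (/ V * cum Lt b (lam P 0) V) <= i * (D * exp (s * V))).
  { rewrite Rabs_mult. destruct (Hinv V (proj1 HV)).
    apply Rmult_le_compat; try apply Rabs_pos; [rewrite Rabs_pos_eq; lra | apply HF; assumption]. }
  assert (H2 : Rabs (RInt (fun v => k' v * cum Lt b (lam P 0) v) (lam P 0) V)
     <= i * i * D / s * (exp (s * V) - exp (s * lam P 0))).
  { apply RInt_exp_bound; [lra | apply HV | eexists; exact HI |].
    intros x Hx. rewrite Rabs_mult, (Rmult_assoc (i * i)). destruct (Hinv x (proj1 Hx)).
    apply Rmult_le_compat; try apply Rabs_pos; [|apply HF; lra].
    unfold k'. rewrite Rabs_Ropp, Rabs_pos_eq by (apply Rmult_le_pos; lra).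
    apply Rmult_le_compat; lra. }
  assert (H3 : i * i * D / s * (exp (s * V) - exp (s * lam P 0)) <= 2 * (i * i) * D * exp (s * V)).
  { pose proof (exp_pos (s * lam P 0)). pose proof (exp_pos (s * V)).
    assert (0 <= i * i * D) by (apply Rmult_le_pos; nra).
    assert (Hsi : 0 < / s <= 2).
    { split; [apply Rinv_0_lt_compat; lra|]. replace 2 with (/ (1 / 2)) by field. apply Rinv_le_contravar; lra. }
    apply Rle_trans with (i * i * D / s * exp (s * V)).
    - apply Rmult_le_compat_l; [apply Rmult_le_pos; lra | lra].
    - apply Rmult_le_compat_r; [lra|]. unfold Rdiv.
      assert (i * i * D * / s <= i * i * D * 2) by (apply Rmult_le_compat_l; lra). lra. }
  unfold Rminus at 1. eapply Rle_trans; [apply Rabs_triang|]. rewrite Rabs_Ropp.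
  replace (C * (i + 2 * (i * i)) * (ln t * ln t) * exp (s * V))
    with (i * (D * exp (s * V)) + 2 * (i * i) * D * exp (s * V)) by (unfold D; ring).
  lra.
Qed.

(** * Assembly of LH: signs of the height, small heights and the size of Li *)

Lemma primeE_neg P J t phi V : primeE P J (- t) phi V = primeE P J t (- phi) V.
Proof.
  assert (E : forall x, cost (- t) phi x = cost t (- phi) x).
  { intros x. unfold cost. rewrite <- cos_neg. f_equal. ring. }
  unfold primeE, cum. f_equal.
  - rewrite !step_reweigh. apply lsum_ext. intros p _. now rewrite E.
  - apply RInt_ext. intros x _. now rewrite E.
Qed.

Lemma primeE_trivial P J t phi V W : lam P 0 <= V <= W ->
  Rabs (primeE P J t phi V) <= INR J + / lam P 0 * exp W.
Proof.
  intros HV. pose proof (lam0_pos P) as Hl.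
  assert (Hi : 0 < / lam P 0) by now apply Rinv_0_lt_compat.
  assert (Hcos : forall x, Rabs (cost t phi x) <= 1) by (intros; apply Rabs_le, COS_bound).
  unfold primeE, cum, Rminus. eapply Rle_trans; [apply Rabs_triang|]. rewrite Rabs_Ropp.
  apply Rplus_le_compat.
  - rewrite step_reweigh. eapply Rle_trans; [apply lsum_abs|].
    unfold atoms_pi. rewrite lsum_map. cbn [fst snd].
    replace (INR J) with (lsum (fun _ : nat => 1) (seq 0 J)) by (rewrite lsum_const, length_seq; ring).
    apply lsum_le. intros j _. destruct (Rle_dec _ _); [rewrite Rmult_1_l; apply Hcos | rewrite Rabs_R0; lra].
  - eapply Rle_trans; [apply (RInt_exp_bound _ (/ lam P 0) 1)|].
    + lra.
    + lra.
    + apply ex_RInt_cont_from with 0; try lra. intros x Hx.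
      apply (continuous_mult (K := R_AbsRing)); [apply cost_continuous | now apply beta_continuous].
    + intros x Hx. rewrite Rabs_mult, Rmult_1_l.
      pose proof (one_le_exp x ltac:(lra)).
      assert (0 < / x <= / lam P 0) by (split; [apply Rinv_0_lt_compat | apply Rinv_le_contravar]; lra).
      assert (0 <= beta x <= / lam P 0 * exp x).
      { unfold beta, Rdiv. split; [apply Rmult_le_pos; lra|]. rewrite Rmult_comm. apply Rmult_le_compat; lra. }
      rewrite (Rabs_pos_eq (beta x)) by lra.
      assert (Rabs (cost t phi x) * beta x <= 1 * beta x) by (apply Rmult_le_compat_r; [lra | apply Hcos]).
      lra.
    + rewrite !Rmult_1_l. unfold Rdiv. rewrite Rinv_1, Rmult_1_r.
      apply Rmult_le_compat_l; [lra|]. pose proof (exp_pos (lam P 0)).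
      pose proof (exp_le V W ltac:(lra)). lra.
Qed.

(** LH asks for [sqrt (Li x)] rather than [sqrt x], so a lower bound for [Li] is required. The
    constant comes from [1 - (1 + v) e^(-v)], which increases with [v] and is positive at [l]. *)
Lemma Li_exp_ge l : 0 < l -> exists c, 0 < c /\ forall v, l <= v -> c * exp v / v <= Li (exp v).
Proof.
  intros Hl. set (c := 1 - (1 + l) * exp (- l)). exists c.
  pose proof (exp_pos l). pose proof (exp_pos (- l)).
  assert (E1 : exp l * exp (- l) = 1) by (rewrite <- exp_plus, Rplus_opp_r; apply exp_0).
  split.
  - unfold c. pose proof (exp_ineq1 l ltac:(lra)).
    assert ((1 + l) * exp (- l) < exp l * exp (- l)) by (apply Rmult_lt_compat_r; lra). lra.
  - intros v Hv.
    assert (H1 : 1 < exp v) by (rewrite <- exp_0; apply exp_increasing; lra).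
    pose proof (Li_ge (exp v) H1) as H2. rewrite ln_exp in H2.
    eapply Rle_trans; [|exact H2]. apply Rmult_le_compat_r; [left; apply Rinv_0_lt_compat; lra|].
    assert (H3 : exp v = exp l * exp (v - l)) by (rewrite <- exp_plus; f_equal; ring).
    assert (H4 : exp (- l) * exp v = exp (v - l)) by (rewrite <- exp_plus; f_equal; ring).
    unfold c. pose proof (exp_ineq1_le (v - l)).
    assert ((1 + l) * (1 + (v - l)) <= (1 + l) * exp (v - l)) by (apply Rmult_le_compat_l; lra).
    assert (0 <= l * (v - l)) by (apply Rmult_le_pos; lra). nra.
Qed.

Lemma le_sqrt a b : 0 <= a -> a * a <= b -> a <= sqrt b.
Proof. intros Ha Hab. rewrite <- (sqrt_square a Ha). now apply sqrt_le_1_alt. Qed.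

(** The range [1 < p_1 <= x <= |t|^B] forces [|t| > 1]. A negative height is reflected into the
    phase, which is why the hypothesis covers all [phi]; real and imaginary parts account for the
    factor 2. *)
Lemma LH_of_bound P : (forall eps B, 0 < eps -> 0 < B -> exists K, 0 <= K /\ forall t, 1 < t -> forall V,
    lam P 0 <= V <= B * ln t -> exists J, pcover P V J /\ forall phi,
    Rabs (primeE P J t phi V) <= K * (sqrt (Li (exp V)) * exp (eps * ln t))) ->
  LH (gprime P) Li.
Proof.
  intros H eps B Heps HB. destruct (H eps B Heps HB) as (K & HK & Hb). exists (2 * K).
  intros t x Ht Hx. pose proof (gprime_gt1 P) as Hp. pose proof (Rabs_pos_lt t Ht) as Ht0.
  assert (Hxl : lam P 0 <= ln x) by (apply ln_le'; lra).
  assert (HxB : ln x <= B * ln (Rabs t)).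
  { rewrite <- (ln_exp (B * ln (Rabs t))). apply ln_le'; [lra | apply Hx]. }
  pose proof (lam0_pos P) as Hl.
  assert (Ht1 : 1 < Rabs t).
  { apply Rnot_le_lt. intros h. apply ln_le' in h; [|assumption]. rewrite ln_1 in h. nra. }
  destruct (Hb (Rabs t) Ht1 (ln x) (conj Hxl HxB)) as (J & HJ & HE).
  rewrite exp_ln in HE by lra. fold (Rpower (Rabs t) eps) in HE.
  rewrite (LH_form P t x J) by (assumption || lra).
  eapply Rle_trans; [apply Cmod_le_abs|]. cbn [Re Im fst snd].
  assert (HE' : forall phi, Rabs (primeE P J t phi (ln x)) <= K * (sqrt (Li x) * Rpower (Rabs t) eps)).
  { intros phi. destruct (Rle_dec 0 t) as [h|h].
    - rewrite <- (Rabs_pos_eq t h) at 1. apply HE.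
    - rewrite <- (Ropp_involutive t) at 1. rewrite primeE_neg.
      rewrite <- (Rabs_left t) at 1 by lra. apply HE. }
  pose proof (HE' 0). pose proof (HE' (PI / 2)). lra.
Qed.

Lemma LH_of_RH (P : beurling_system) (A : R) : 0 < A ->
  bigO_infty (fun x => N_count P x - A * x) (fun x => sqrt x) ->
  riemann_hypothesis P -> LH (gprime P) Li.
Proof.
  intros HA hN hRH. apply RH_to_RHv in hRH. apply LH_of_bound. intros eps B Heps HB.
  pose proof (lam0_pos P) as Hl.
  destruct (Li_exp_ge (lam P 0) Hl) as (c & Hc & HLi).
  (* With [V <= B log t] this gives [e^(dV) <= t^(eps/2)], and half of [eps] is left for the
     logarithms. *)
  set (d := Rmin (1 / 4) (eps / (2 * B))).
  assert (Hd0 : 0 < d) by (apply Rmin_pos; [lra | apply Rdiv_lt_0_compat; lra]).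
  assert (Hd1 : d <= 1 / 4) by apply Rmin_l.
  assert (Hd2 : d * B <= eps / 2).
  { replace (eps / 2) with (eps / (2 * B) * B) by (field; lra).
    apply Rmult_le_compat_r; [lra | apply Rmin_r]. }
  destruct (primeE_bound P A HA hN hRH d B ltac:(lra) HB) as (C & HC & HM).
  destruct (pcover_ex P (B * ln 3)) as [J0 HJ0].
  set (M0 := INR J0 + / lam P 0 * exp (B * ln 3)).
  assert (HM0 : 0 <= M0).
  { unfold M0. pose proof (pos_INR J0). pose proof (exp_pos (B * ln 3)).
    assert (0 < / lam P 0) by now apply Rinv_0_lt_compat.
    assert (0 <= / lam P 0 * exp (B * ln 3)) by (apply Rmult_le_pos; lra). lra. }
  assert (Hsc : 0 < sqrt c) by now apply sqrt_lt_R0.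
  set (cB := sqrt (c / B)).
  assert (HcB : 0 < cB) by (apply sqrt_lt_R0, Rdiv_lt_0_compat; lra).
  assert (HcB2 : cB * cB = c / B) by (apply sqrt_sqrt, Rdiv_le_0_compat; lra).
  (* The other half of [eps] is split in three, as [log t <= a t^(eps/6)]: two logarithms come from
     [primeE_bound], one from the lower bound for [sqrt (Li x)]. *)
  set (a := / (eps / 6)). assert (Ha : 0 < a) by (apply Rinv_0_lt_compat; lra).
  set (K1 := M0 / sqrt c). set (K2 := C * (a * a * a) / cB).
  assert (Ha3 : 0 <= a * a * a) by (repeat apply Rmult_le_pos; lra).
  assert (HK1 : 0 <= K1) by (apply Rdiv_le_0_compat; lra).
  assert (HK2 : 0 <= K2) by (apply Rdiv_le_0_compat; [apply Rmult_le_pos|]; lra).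
  exists (K1 + K2). split; [lra|]. intros t Ht V HV.
  assert (HX : 0 <= sqrt (Li (exp V)) * exp (eps * ln t))
    by (apply Rmult_le_pos; [apply sqrt_pos | left; apply exp_pos]).
  set (X := sqrt (Li (exp V)) * exp (eps * ln t)) in *.
  assert (Hlt : 0 < ln t) by (rewrite <- ln_1; apply ln_increasing; lra).
  pose proof (exp_ineq1_le V) as HVe. pose proof (exp_pos V) as HV0.
  specialize (HLi V (proj1 HV)).
  assert (HcV : c <= c * exp V / V).
  { apply Rmult_le_reg_r with V; [lra|]. unfold Rdiv. rewrite Rmult_assoc, Rinv_l, Rmult_1_r by lra.
    apply Rmult_le_compat_l; lra. }
  destruct (Rle_lt_dec 3 t) as [h|h].
  - destruct (HM t h) as (J & HJ & HB'). exists J. split; [apply pcover_le with (B * ln t); [assumption|lra]|].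
    intros phi. eapply Rle_trans; [apply HB'; assumption|].
    apply Rle_trans with (K2 * X); [|apply Rmult_le_compat_r; lra].
    set (L := ln t) in *.
    assert (HL : 1 <= L).
    { unfold L. rewrite <- (ln_exp 1). apply ln_le'; [apply exp_pos|]. pose proof exp_le_3. lra. }
    assert (Hsq : cB * exp (V / 2) / L <= sqrt (Li (exp V))).
    { apply le_sqrt.
      - apply Rdiv_le_0_compat; [|lra]. apply Rmult_le_pos; [lra | left; apply exp_pos].
      - eapply Rle_trans; [|exact HLi].
        replace (cB * exp (V / 2) / L * (cB * exp (V / 2) / L))
          with (cB * cB * (exp (V / 2) * exp (V / 2)) * / (L * L)) by (field; lra).
        rewrite HcB2, <- exp_plus. replace (V / 2 + V / 2) with V by field.
        replace (c / B * exp V * / (L * L)) with (c * exp V * / (B * (L * L))) by (field; lra).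
        apply Rmult_le_compat_l; [apply Rmult_le_pos; lra|]. apply Rinv_le_contravar; [lra|].
        assert (B * L * 1 <= B * L * L) by (apply Rmult_le_compat_l; nra). lra. }
    set (g := exp (eps / 6 * L)).
    assert (Hg : 0 < g) by apply exp_pos.
    assert (HLg : L <= a * g) by (apply lin_le_exp; lra).
    assert (HL3 : L * L * L <= a * a * a * (g * g * g)).
    { replace (a * a * a * (g * g * g)) with ((a * g) * (a * g) * (a * g)) by ring.
      apply Rmult_le_compat; try lra; [nra|]. apply Rmult_le_compat; lra. }
    assert (Hg3 : g * g * g * exp (d * V) <= exp (eps * L)).
    { unfold g. rewrite <- !exp_plus. apply exp_le.
      assert (d * V <= d * (B * L)) by (apply Rmult_le_compat_l; lra).
      assert (d * B * L <= eps / 2 * L) by (apply Rmult_le_compat_r; lra). lra. }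
    apply Rle_trans with (K2 * (cB * exp (V / 2) / L * exp (eps * L))).
    2:{ apply Rmult_le_compat_l; [assumption|]. apply Rmult_le_compat_r; [left; apply exp_pos | assumption]. }
    replace (K2 * (cB * exp (V / 2) / L * exp (eps * L)))
      with (C * exp (V / 2) * (a * a * a * exp (eps * L) / L)) by (unfold K2; field; lra).
    replace ((1 / 2 + d) * V) with (V / 2 + d * V) by field. rewrite exp_plus.
    replace (C * (L * L) * (exp (V / 2) * exp (d * V))) with (C * exp (V / 2) * (L * L * exp (d * V))) by ring.
    apply Rmult_le_compat_l; [apply Rmult_le_pos; [assumption | left; apply exp_pos]|].
    apply Rmult_le_reg_r with L; [lra|]. unfold Rdiv. rewrite (Rmult_assoc _ (/ L)), Rinv_l, Rmult_1_r by lra.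
    pose proof (exp_pos (d * V)).
    apply Rle_trans with (a * a * a * (g * g * g) * exp (d * V)).
    + replace (L * L * exp (d * V) * L) with (L * L * L * exp (d * V)) by ring. apply Rmult_le_compat_r; lra.
    + rewrite Rmult_assoc. apply Rmult_le_compat_l; assumption.
  (* For [t < 3] the left side is bounded by the constant [M0], and the right side is bounded below
     since [Li >= c] on the range and [t^eps >= 1]. *)
  - assert (HV3 : V <= B * ln 3).
    { assert (ln t <= ln 3) by (apply ln_le'; lra).
      assert (B * ln t <= B * ln 3) by (apply Rmult_le_compat_l; lra). lra. }
    exists J0. split; [apply pcover_le with (B * ln 3); assumption|]. intros phi.
    eapply Rle_trans; [apply (primeE_trivial P J0 t phi V (B * ln 3)); lra|]. fold M0.
    apply Rle_trans with (K1 * X); [|apply Rmult_le_compat_r; lra].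
    assert (HsX : sqrt c <= X).
    { unfold X. rewrite <- (Rmult_1_r (sqrt c)). apply Rmult_le_compat; try lra.
      - apply sqrt_le_1_alt. lra.
      - apply one_le_exp. apply Rmult_le_pos; lra. }
    replace M0 with (K1 * sqrt c) at 1 by (unfold K1; field; lra).
    apply Rmult_le_compat_l; assumption.
Qed.

Theorem theorem1p5 (P : beurling_system) (A : R) (hA : 0 < A)
    (hN : bigO_infty (fun x => N_count P x - A * x) (fun x => sqrt x)) :
  LH (gprime P) Li <-> riemann_hypothesis P.
Proof.
  split; [apply RH_of_LH | exact (LH_of_RH P A hA hN)].
Qed.
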